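(* Let $d\ge1$. Suppose that either (i) $\frac{d}{d+1} <p< 1$ and $p\le q\leq \infty$, or (ii) $p=1$ and $q=\infty$. Then for large $N$ $$\|\mathbb{E}_N\|_{B^1_{p,q}\to B^1_{p,q}} \approx N^{\frac 1p-\frac 1q}.$$ Moreover, for cubes $Q$ of side length $\ge 1/2$ (and large $N$), $$\mathrm{Op}\big(\mathbb{E}_N, B_{p,q}^1(\mathbb{R}^d), Q\big) \approx N^{\frac 1p-\frac 1q}.$$ Here $\approx$ means two-sided inequalities with positive constants independent of $N$ and $Q$.
   Context: $B^s_{p,q}=B^s_{p,q}(\mathbb{R}^d)$ is the usual inhomogeneous Besov space. With $I_{N,\mu}=2^{-N}(\mu+[0,1)^d)$, the dyadic averaging operator is $$\mathbb{E}_Nf(x)=\sum_{\mu\in\mathbb{Z}^d}\mathbf{1}_{I_{N,\mu}}(x)\,2^{Nd}\int_{I_{N,\mu}}f(y)\,dy,\qquad f\in L^1_{loc}(\mathbb{R}^d).$$ For an open dyadic cube $Q\subset\mathbb{R}^d$ of side length $\ge1/2$, a (quasi-)Banach space $X$ of tempered distributions on $\mathbb{R}^d$ and a linear operator $T$ defined on those $f\in X$ supported in $Q$, put $$\mathrm{Op}(T,X,Q)=\sup\big\{\|Tf\|_X:\ \|f\|_X\le1,\ \mathrm{supp}(f)\subset Q\big\}.$$ *)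

(* Defs.v *)
From HB Require Import structures.
From mathcomp Require Import all_boot all_order all_algebra.
From mathcomp Require Import complex.
From mathcomp Require Import all_classical all_reals all_analysis.

Set Implicit Arguments.
Unset Strict Implicit.
Unset Printing Implicit Defensive.

Import Order.TTheory GRing.Theory Num.Theory.
Import numFieldNormedType.Exports.
Import Normc.

Local Open Scope classical_set_scope.
Local Open Scope complex_scope.
Local Open Scope ring_scope.

Section measurable_rV.
Variables (R : realType) (n : nat).

Let coors : 'I_n -> 'rV[R]_n -> measurableTypeR R := fun i x => x 0 i.

Let rV_set0 : g_sigma_preimage coors set0.
Proof. exact: sigma_algebra0. Qed.

Let rV_setC A : g_sigma_preimage coors A -> g_sigma_preimage coors (~` A).
Proof. exact: sigma_algebraC. Qed.

Let rV_bigcup (F : _^nat) : (forall i, g_sigma_preimage coors (F i)) ->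
  g_sigma_preimage coors (\bigcup_i (F i)).
Proof. exact: sigma_algebra_bigcup. Qed.

HB.instance Definition _ := @isMeasurable.Build default_measure_display
  'rV[R]_n (g_sigma_preimage coors) rV_set0 rV_setC rV_bigcup.

Lemma measurable_coord (i : 'I_n) :
  measurable_fun setT (fun x : 'rV[R]_n => x 0 i : measurableTypeR R).
Proof.
move=> _ Y mY; rewrite setTI; apply: sub_sigma_algebra => /=.
rewrite -bigcup_seq/=; exists i => /=; first by rewrite mem_index_enum.
by exists Y => //; rewrite setTI.
Qed.

Lemma measurable_fun_rVP d (T : measurableType d) (f : T -> 'rV[R]_n) :
  (forall i, measurable_fun setT (fun t => f t 0 i : measurableTypeR R)) ->
  measurable_fun setT f.
Proof.
move=> mf _ A mA; rewrite setTI; move: A mA.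
apply: (@smallest_sub _ _ _ [set A | measurable (f @^-1` A)]).
  split=> /=.
  - by rewrite preimage_set0.
  - by move=> A mA; rewrite setTD preimage_setC; exact: measurableC.
  - by move=> F mF; rewrite preimage_bigcup; exact: bigcup_measurable.
move=> A; rewrite -bigcup_seq => -[i _ [B mB <-]] /=.
by rewrite setTI; have := mf i measurableT B mB; rewrite setTI.
Qed.

End measurable_rV.

Section lebesgue_rV.
Variable R : realType.

Definition cons_rV n (p : 'rV[R]_n * measurableTypeR R) : 'rV[R]_n.+1 :=
  row_mx (p.2 : R)%:M p.1.

Lemma measurable_cons_rV n : measurable_fun setT (@cons_rV n).
Proof.
apply: measurable_fun_rVP => i.
rewrite (_ : (fun _ => _) = fun p : 'rV[R]_n * measurableTypeR R =>
    match fintype.split (i : 'I_(1 + n)) with inl _ => p.2 | inr j => p.1 0 j end).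
  case: fintype.split => [_|j]; first exact: measurable_snd.
  exact: (measurableT_comp (measurable_coord j) measurable_fst).
apply/funext => p; rewrite /cons_rV mxE.
by case: fintype.split => j //; rewrite mxE ord1 eqxx mulr1n.
Qed.

Section succ.
Variables (n : nat) (mu : {measure set 'rV[R]_n -> \bar R}).

Definition lebesgue_rV_succ : set 'rV[R]_n.+1 -> \bar R :=
  pushforward (mu \x @lebesgue_measure R)%E (@cons_rV n).

Let mcons A : measurable A -> measurable (@cons_rV n @^-1` A).
Proof. by move=> mA; rewrite -[_ @^-1` _]setTI; exact: measurable_cons_rV. Qed.

Let succ0 : lebesgue_rV_succ set0 = 0%E.
Proof. by rewrite /lebesgue_rV_succ/pushforward preimage_set0 measure0. Qed.

Let succ_ge0 A : (0 <= lebesgue_rV_succ A)%E.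
Proof. by rewrite /lebesgue_rV_succ/pushforward; exact: measure_ge0. Qed.

Let succ_sigma_additive : semi_sigma_additive lebesgue_rV_succ.
Proof.
move=> F mF tF mUF; rewrite /lebesgue_rV_succ /pushforward preimage_bigcup.
apply: measure_semi_sigma_additive.
- by move=> k; exact: mcons.
- apply/trivIsetP => /= i j _ _ ij; rewrite -preimage_setI.
  by move/trivIsetP : tF => /(_ _ _ _ _ ij) ->//; rewrite preimage_set0.
- by rewrite -preimage_bigcup; exact: mcons.
Qed.

HB.instance Definition _ := isMeasure.Build _ _ _ lebesgue_rV_succ
  succ0 succ_ge0 succ_sigma_additive.

End succ.

Fixpoint lebesgue_rV n : {measure set 'rV[R]_n -> \bar R} :=
  match n with
  | 0 => @dirac _ _ (0 : 'rV[R]_0) R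
  | k.+1 => lebesgue_rV_succ (lebesgue_rV k)
  end.

Lemma lebesgue_rV_box n (a b : 'I_n -> R) : (forall i, a i <= b i) ->
  lebesgue_rV n [set x : 'rV[R]_n | forall i, x 0 i \in `[a i, b i[] =
  (\prod_i (b i - a i))%:E.
Proof.
elim: n a b => [|n IH] a b ab.
  by rewrite big_ord0 /= diracE mem_set// => -[].
pose B : set 'rV[R]_n :=
  [set x | forall i : 'I_n, x 0 i \in `[a (lift ord0 i), b (lift ord0 i)[].
have consE : @cons_rV n @^-1` [set x | forall i, x 0 i \in `[a i, b i[] =
    B `*` [set` `[a ord0, b ord0[].
  have E0 (p : 'rV[R]_n * measurableTypeR R) : cons_rV p 0 ord0 = p.2.
    rewrite /cons_rV (_ : ord0 = @lshift 1 n ord0); last exact/val_inj.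
    by apply: (etrans (row_mxEl _ _ _ _)); rewrite mxE.
  have ES (p : 'rV[R]_n * measurableTypeR R) i :
      cons_rV p 0 (lift ord0 i) = p.1 0 i.
    rewrite /cons_rV (_ : lift ord0 i = @rshift 1 n i); last exact/val_inj.
    exact: row_mxEr.
  apply/seteqP; split => [p /= h|p /= [h1 h2] i].
    split=> [i|]; first by have := h (lift ord0 i); rewrite ES.
    by have := h ord0; rewrite E0.
  case: (unliftP ord0 i) => [j ->|->]; rewrite ?ES ?E0//; exact: h1.
have mB : measurable B.
  rewrite (_ : B = \bigcap_(i in [set: 'I_n])
      [set x | x 0 i \in `[a (lift ord0 i), b (lift ord0 i)[]).
    apply: fin_bigcap_measurable => // i _.
    rewrite -[X in measurable X]setTI.
    exact: (measurable_coord i measurableT (measurable_itv _)).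
  by apply/seteqP; split => x /= h i; [move=> _; exact: h|exact: h].
rewrite big_ord_recl -[LHS]/((lebesgue_rV n \x @lebesgue_measure R)%E
  (@cons_rV n @^-1` [set x | forall i, x 0 i \in `[a i, b i[])) consE.
rewrite product_measure1E//.
rewrite IH; last by move=> i; exact: ab.
rewrite [X in (_ * X)%E](lebesgue_measure_itv `[a ord0, b ord0[)/= lte_fin.
have [_|ba] := ltP (a ord0) (b ord0); first by rewrite -EFinB -EFinM mulrC.
by rewrite mule0 (@le_anti _ _ (a ord0) (b ord0)) ?ab// subrr mul0r.
Qed.

End lebesgue_rV.

Section euclidean_space.
Variables (R : realType) (d : nat).
Local Notation Re := (@complex.Re R).
Local Notation Im := (@complex.Im R).
Local Notation C := R[i].
Local Notation E := 'rV[R]_d.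
Local Notation mu := (lebesgue_rV R d).
Implicit Types (f phi : E -> C) (x y : E) (D K U : set E).

Definition dotp x y : R := \sum_(i < d) x 0 i * y 0 i.

(* the canonical norm of 'rV[R]_d is the maximum norm *)
Definition eucl_norm x : R := Num.sqrt (dotp x x).

Definition cis (t : R) : C := cos t +i* sin t.

Definition cintegral D f : C :=
  (\int[mu]_(x in D) Re (f x)) +i* (\int[mu]_(x in D) Im (f x)).

Definition partial (i : 'I_d) f : E -> C := fun x =>
  ('D_(delta_mx 0 i) (Re \o f) x) +i* ('D_(delta_mx 0 i) (Im \o f) x).

(* A multi-index is given by the list of the successive directions. *)
Definition iter_partial (s : seq 'I_d) f : E -> C := foldr partial f s.

Definition smooth f : Prop := forall s : seq 'I_d,
  [/\ continuous (Re \o iter_partial s f),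
      continuous (Im \o iter_partial s f) &
      forall i x, derivable (Re \o iter_partial s f) x (delta_mx 0 i) /\
                  derivable (Im \o iter_partial s f) x (delta_mx 0 i)].

Definition schwartz_seminorm (k : nat) (s : seq 'I_d) f : \bar R :=
  ereal_sup (range (fun x =>
    ((1 + eucl_norm x) ^+ k * normc (iter_partial s f x))%:E)).

Definition schwartz f : Prop :=
  smooth f /\ forall k s, (schwartz_seminorm k s f < +oo)%E.

Definition test_function U f : Prop :=
  [/\ smooth f, compact (closure [set x : E | f x != 0]) &
      closure [set x : E | f x != 0] `<=` U].

(* Only the values at Schwartz functions are relevant. *)
Definition raw_distribution := (E -> C) -> C.
Implicit Types u v : raw_distribution.

Definition tempered u : Prop :=
  (forall (a : C) phi psi, schwartz phi -> schwartz psi ->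
     u (fun x => a * phi x + psi x) = a * u phi + u psi) /\
  (exists (M : R) (k : nat), forall phi, schwartz phi ->
     ((normc (u phi))%:E <=
      M%:E * \sum_(n < k.+1) \sum_(s : n.-tuple 'I_d)
                schwartz_seminorm k s phi)%E).

Definition supp u : set E :=
  ~` \bigcup_(U in [set U | open U /\
                            forall phi, test_function U phi -> u phi = 0]) U.

Definition locally_L1 f : Prop :=
  [/\ measurable_fun setT (Re \o f), measurable_fun setT (Im \o f) &
      forall K, compact K -> (\int[mu]_(x in K) (normc (f x))%:E < +oo)%E].

Definition represents f u : Prop :=
  locally_L1 f /\
  forall phi, test_function setT phi ->
    u phi = cintegral setT (fun x => f x * phi x).

Definition inverse_fourier f : E -> C := fun x =>
  ((2 * pi) ^- d)%:C * cintegral setT (fun xi => f xi * cis (dotp x xi)).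

Definition lp_cutoff phi0 : Prop :=
  [/\ schwartz phi0,
      forall xi, eucl_norm xi <= 1 -> phi0 xi = 1 &
      forall xi, 3 / 2 <= eucl_norm xi -> phi0 xi = 0].

(* phi_j(xi) = phi_0(2^-j xi) - phi_0(2^(-j+1) xi) for j >= 1 *)
Definition lp_resolution phi0 (j : nat) : E -> C := fun xi =>
  if j is k.+1 then phi0 (2 ^- k.+1 *: xi) - phi0 (2 ^- k *: xi) else phi0 xi.

(* the smooth function F^-1(phi_j F u) = F^-1(phi_j) * u *)
Definition lp_piece phi0 u (j : nat) : E -> C := fun x =>
  u (fun y => inverse_fourier (lp_resolution phi0 j) (x - y)).

Definition besov_norm phi0 (s : R) (p q : \bar R) u : \bar R :=
  Lnorm counting q (fun j : nat =>
    (2 `^ (j%:R * s))%:E *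
    Lnorm mu p (fun x => (normc (lp_piece phi0 u j x))%:E))%E.

Definition dyadic_cube (N : int) (m : 'rV[int]_d) : set E :=
  [set x : E | forall i, 2 ^ (- N) * (m 0 i)%:~R <= x 0 i
                     < 2 ^ (- N) * ((m 0 i)%:~R + 1)].

Definition open_dyadic_cube (N : int) (m : 'rV[int]_d) : set E :=
  [set x : E | forall i, 2 ^ (- N) * (m 0 i)%:~R < x 0 i
                     < 2 ^ (- N) * ((m 0 i)%:~R + 1)].

Definition dyadic_avg (N : nat) f : E -> C := fun x =>
  \sum_(m \in [set: 'rV[int]_d])
    (\1_(dyadic_cube N m) x)%:C *
    ((2 ^+ (N * d))%:C * cintegral (dyadic_cube N m) f).

(* An operator with values in the tempered distributions is given by its
   graph, T u being empty where the operator is not defined. *)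
Definition operator := raw_distribution -> set raw_distribution.

Definition avg_operator (N : nat) : operator := fun u =>
  [set v | tempered v /\
    exists f, represents f u /\ represents (dyadic_avg N f) v].

(* ereal_inf of the empty set is +oo: the norm of T u counts as infinite at the
   points u where T is not defined; elsewhere T u has one value up to equality
   on Schwartz functions. *)
Definition op_value (nrm : raw_distribution -> \bar R) (T : operator) u :
    \bar R :=
  ereal_inf (nrm @` T u).

Definition Op (T : operator) (nrm : raw_distribution -> \bar R) (Q : set E) :
    \bar R :=
  ereal_sup (op_value nrm T @`
    [set u | [/\ tempered u, (nrm u <= 1)%E & supp u `<=` Q]]).

Definition operator_norm (T : operator) (nrm : raw_distribution -> \bar R) :
    \bar R :=
  ereal_sup (op_value nrm T @` [set u | tempered u /\ (nrm u <= 1)%E]).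

End euclidean_space.

(* Main.v *)
From HB Require Import structures.
Require Import Defs.
From mathcomp Require Import all_boot all_order all_algebra.
From mathcomp Require Import complex.
From mathcomp Require Import all_classical all_reals all_analysis.
From mathcomp Require Import measurable_realfun ess_sup_inf.
From mathcomp Require Import zify ring lra.

(** The argument is driven by the exponent gamma = p - d(1 - p), positive because
p > d/(d+1).  Write f_j for the j-th Littlewood-Paley piece of f and
A_j = 2^{jp} ||f_j||_p^p, so that the Besov norm of f is the l^q norm of the
sequence A_j^{1/p}; since p <= 1, p-th powers of L^p norms are subadditive.

Upper bound.  A band-limited piece f_j satisfies a Peetre maximal estimate, so
its oscillation on the dyadic cubes of side 2^{-N} and the increments of its
average E_N f_j are both bounded by one function S_j constant on these cubes.
For j <= N the mean value theorem gives int S_j <= C 2^{-Np} A_j; for j >= N one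
only has the size of f_j, at the price of a volume factor, and
int S_j <= C 2^{-Np} 2^{-(j-N)gamma} A_j ([controls_piece]).  Let
S = sum_j S_j.  For k > N the piece K_k * E_N f sees the step function E_N f
only within 2^{-k} of the boundaries of the N-cubes, which yields the factor
2^{N-k} ([cnv_high]); for k <= N one compares with f_k, and
K_k * (E_N f - f) is small because the averages of E_N f - f vanish, so that the
kernel may be replaced by its own oscillation ([cnv_low]).  Altogether the
sequence D_k of E_N f satisfies
D_k <= A_k 1_{k <= N} + C (1 + sum_{j <= N} A_j) rho^{|k - N|}  ([upper_density]),
with rho = max (2^{p-1}, 2^{-p-gamma}), which is less than 1 when p < 1.  Hoelder's
inequality bounds sum_{j <= N} A_j by N^{1-p/q}, hence the norm by N^{1/p-1/q}.
For p = 1 one has rho = 1, which is harmless for the supremum norm q = infinity.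

Lower bound.  Let eta(y) = y_1 phi0(y), linear near the origin, and let f be the
sum over 5 <= j <= N of the bumps 2^{-j+jd/p} eta(2^j(x - z)), with z the centre of
a cube of side 1/2 contained in Q.  The bumps are almost orthogonal with respect
to the pieces ([cnv_bump]), so the norm of f is at most C N^{1/q}
([density_block]).  For each j there is a box of side comparable to 2^{-j} at
distance comparable to 2^{-j} from z on which f is linear with slope at least
2^{jd/p}.  There E_N f - f is a sawtooth of period 2^{-N}; its first Fourier mode
has frequency 2 pi 2^N, where the symbol of the piece N + 3 equals 1
([symbol_wave]).  Hence K_{N+3} * (E_N f - f) has p-th power integral at least
c 2^{-Np} on the box ([box_mass]).  The boxes are disjoint and about N in number,
whereas the piece N + 3 of f itself is bounded independently of N, so
D_{N+3}^{1/p} >= c N^{1/p}.  Dividing by the norm of f gives N^{1/p-1/q}.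

Distributions.  The operator is defined on a distribution through any locally
integrable function representing it.  A distribution with A_j <= 1 for all j is
represented by the integrable sum of its pieces ([represent], which rests on
Fourier inversion and on the exchange of a distribution with an integral,
[tempered_cint]); averages do not depend on the representative because a
half-open cube is a bounded pointwise limit of test functions
([averages_determined]); and a tempered distribution represented by an integrable
function is given by integration against every Schwartz function
([represents_unique]). *)

Set Implicit Arguments.
Unset Strict Implicit.
Unset Printing Implicit Defensive.
Import Order.TTheory GRing.Theory Num.Theory.
Import numFieldNormedType.Exports.
Import Normc.
Local Open Scope classical_set_scope.
Local Open Scope complex_scope.
Local Open Scope ring_scope.

Local Notation Re := complex.Re.
Local Notation Im := complex.Im.
Local Notation meas := (measurable_fun setT).

Tactic Notation "via" uconstr(t) := refine (@le_trans _ _ t _ _ _ _).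
Tactic Notation "ext" ident(x) := apply/funext; intro x.

(** Discharges nonnegativity, positivity, measurability and integrability side conditions by a
structural search. The hooks below are filled in as the corresponding lemmas become available.
*)
Ltac side_complex := fail.
Ltac side_vector := fail.
Ltac side_schwartz := fail.
Ltac side_integral := fail.
Ltac side_dyadic := fail.
Ltac side_kernel := fail.
Ltac side_step := match goal with
  | |- is_true (0 <= _)%R => first
    [ assumption | solve [apply: ltW; assumption] | exact: ler0n | exact: ler01 | exact: normr_ge0
    | exact: powR_ge0 | exact: sqr_ge0 | exact: pi_ge0 | exact: expR_ge0 | side_complex
    | side_integral | side_dyadic | apply: mulr_ge0 | apply: addr_ge0 | apply: exprn_ge0
    | rewrite invr_ge0 | apply: sumr_ge0 | rewrite subr_ge0; assumption ]
  | |- is_true (0 < _)%R => first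
    [ assumption | exact: ltr0Sn | exact: ltr01 | exact: pi_gt0 | exact: expR_gt0 | side_complex
    | side_integral | apply: powR_gt0 | apply: mulr_gt0 | apply: exprn_gt0 | rewrite invr_gt0
    | apply: ltr_pwDl ]
  | |- is_true (_ != 0)%R => first [ assumption | apply: lt0r_neq0 ]
  | |- (_ == 0)%R = false => apply: gt_eqF
  | |- is_true (_ \is Num.nneg) => rewrite nnegrE
  | |- is_true (_ \is Num.pos) => rewrite posrE
  | |- is_true (0 <= _)%E => first [ rewrite lee_fin | apply: integral_ge0 | side_complex ]
  | |- measurable_fun _ _ => first
    [ assumption | exact: measurable_cst | exact: measurable_id | exact: measurable_fst
    | exact: measurable_snd | side_complex | side_vector | side_integral | side_dyadic
    | apply: measurable_funD | apply: measurable_funB | apply: measurable_funM ]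
  | |- _ => first
    [ assumption | side_complex | side_schwartz | side_integral | side_dyadic | side_kernel ]
  end.
Ltac side := by intros; repeat side_step.
(** Makes the intro pattern and rewrite switch [/1/] a variant of [//] that also tries [side].
*)
Ltac ssrdone1 := first [ done | side ].
Ltac mull := apply: ler_wpM2l => /1/.
Ltac mulr := apply: ler_wpM2r => /1/.

(** * Lebesgue measure on R^d and dyadic cubes *)

Section lebesgue_rV_theory.
Variable R : realType.
Local Notation leb1 := (@lebesgue_measure R).

Definition leb n : set 'rV[R]_n -> \bar R := lebesgue_rV R n.
HB.instance Definition _ n := Measure.on (@leb n).

Lemma cons_rV_ord0 n (p : 'rV[R]_n * measurableTypeR R) : cons_rV p 0 ord0 = p.2.
Proof.
rewrite /cons_rV (_ : ord0 = @lshift 1 n ord0); last exact/val_inj.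
by apply: (etrans (row_mxEl _ _ _ _)); rewrite mxE.
Qed.

Lemma cons_rV_lift n (p : 'rV[R]_n * measurableTypeR R) i :
  cons_rV p 0 (lift ord0 i) = p.1 0 i.
Proof.
rewrite /cons_rV (_ : lift ord0 i = @rshift 1 n i); last exact/val_inj.
exact: row_mxEr.
Qed.

Lemma leb_box n (a b : 'I_n -> R) : (forall i, a i <= b i) ->
  @leb n [set x : 'rV[R]_n | forall i, x 0 i \in `[a i, b i[] =
  (\prod_i (b i - a i))%:E.
Proof. exact: lebesgue_rV_box. Qed.

Lemma measurable_box n (F : 'I_n -> set R) : (forall i, measurable (F i)) ->
  measurable [set x : 'rV[R]_n | forall i, F i (x 0 i)].
Proof.
move=> mF; rewrite (_ : [set x : 'rV[R]_n | _] = \bigcap_(i in [set: 'I_n]) [set x : 'rV[R]_n | F i (x 0 i)]).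
  apply: fin_bigcap_measurable => // i _. rewrite -[X in measurable X]setTI.
  exact: (measurable_coord i measurableT (mF i)).
by apply/seteqP; split => x /= h i; [move=> _; exact: h|exact: h].
Qed.

Lemma coord_le_norm n (x : 'rV[R]_n) i : `|x 0 i| <= `|x|.
Proof.
rewrite [leRHS]/Num.norm/= mx_normrE.
exact: (le_bigmax _ (fun ij : 'I_1 * 'I_n => `|x ij.1 ij.2|) (0, i)).
Qed.

Lemma norm_rV_le n (x : 'rV[R]_n) (M : R) : 0 <= M ->
  (forall i, `|x 0 i| <= M) -> `|x| <= M.
Proof.
move=> M0 h; rewrite [leLHS]/Num.norm/= mx_normrE.
by apply/bigmax_leP; split => // -[i j] _ /=; rewrite ord1.
Qed.

Lemma sigma_finite_leb n : sigma_finite setT (@leb n).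
Proof.
exists (fun k => [set x : 'rV[R]_n | forall i, x 0 i \in `[- k%:R, k%:R[]).
  apply/seteqP; split => // x _. exists (Num.bound `|x|) => //= i; rewrite in_itv/=.
  have h : `|x 0 i| < (Num.bound `|x|)%:R.
    apply: le_lt_trans (archi_boundP (normr_ge0 x)). exact: coord_le_norm.
  by move: h; rewrite ltr_norml => /andP[/ltW -> ->].
move=> k; split.
  exact: (@measurable_box n (fun=> [set` `[- k%:R, k%:R[])).
by rewrite leb_box ?ltry// => i; rewrite ge0_cp.
Qed.

HB.instance Definition _ n := Measure_isSigmaFinite.Build _ _ _ (@leb n) (@sigma_finite_leb n).

Lemma ge0_integral_leb_succ n (f : 'rV[R]_n.+1 -> \bar R) :
  meas f -> (forall x, 0 <= f x)%E ->
  (\int[@leb n.+1]_x f x = \int[leb1]_t \int[@leb n]_x f (cons_rV (x, t)))%E.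
Proof.
move=> mf f0.
transitivity (\int[pushforward (@leb n \x leb1) (@cons_rV R n)]_x f x)%E => //.
rewrite ge0_integral_pushforward//=; last exact: measurable_cons_rV.
rewrite preimage_setT (fubini_tonelli2 (f \o @cons_rV R n))//.
  by apply: measurableT_comp => //; exact: measurable_cons_rV.
by move=> x /=.
Qed.

Lemma leb1_affine (a b : R) (g : R -> \bar R) : a != 0 ->
  meas g -> (forall x, 0 <= g x)%E ->
  (\int[leb1]_t g (a * t + b)%R = `|a|^-1%:E * \int[leb1]_t g t)%E.
Proof.
move=> a0 mg g0.
pose T : measurableTypeR R -> measurableTypeR R := fun t => (a * t + b)%R.
have mT : meas T.
  by apply: measurable_funD => //; exact: measurable_funM.
pose nu := mscale (NngNum (normr_ge0 a)) (pushforward leb1 T).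
have E A : measurable A -> leb1 A = nu mT A.
  apply: lebesgue_measure_unique => _ [[x y] _ <-].
  rewrite [RHS](_ : _ = `|a|%:E * leb1 (T @^-1` [set` `]x, y]]))%E//.
  have [ap|an|a0'] := ltgtP 0 a; last by rewrite -a0' eqxx in a0.
    rewrite (_ : T @^-1` _ = `](x - b) / a, (y - b) / a]%classic); last first.
      by apply/seteqP; split => t /=; rewrite !in_itv/= /T ltr_pdivrMr// ler_pdivlMr// ltrBlDr lerBrDr mulrC.
    rewrite !lebesgue_measure_itv/= !lte_fin ltr_pM2r ?invr_gt0// ltrD2r. case: ifPn; rewrite ?mule0// => _.
    by rewrite -!EFinD -EFinM gtr0_norm//; congr EFin; field.
  rewrite (_ : T @^-1` _ = `[(y - b) / a, (x - b) / a[%classic); last first.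
    apply/seteqP; split => t /=; rewrite !in_itv/= /T ltr_ndivlMr//
        ler_ndivrMr// ltrBlDr lerBrDr mulrC => /andP[-> ->]//.
  rewrite !lebesgue_measure_itv/= !lte_fin ltr_nM2r ?invr_lt0// ltrD2r. case: ifPn; rewrite ?mule0// => _.
  by rewrite -!EFinD -EFinM ltr0_norm//; congr EFin; field.
rewrite [in RHS](eq_measure_integral (nu mT)); last by move=> A mA _; exact: E.
rewrite ge0_integral_mscale//= ge0_integral_pushforward//= muleA -EFinM.
by rewrite mulVf ?mul1e ?normr_eq0// preimage_setT.
Qed.

Lemma measurable_affine n (a : R) (b : 'rV[R]_n) :
  meas (fun x : 'rV[R]_n => a *: x + b).
Proof.
apply: measurable_fun_rVP => i.
under eq_fun do rewrite !mxE.
apply: measurable_funD => //; apply: measurable_funM => //.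
exact: measurable_coord.
Qed.

(** Peeling off one coordinate at a time reduces the homothety to the one-dimensional change of
variables. *)
Lemma ge0_integral_affine n (a : R) (b : 'rV[R]_n) (f : 'rV[R]_n -> \bar R) :
  a != 0 -> meas f -> (forall x, 0 <= f x)%E ->
  (\int[@leb n]_x f (a *: x + b)%R = (`|a| ^- n)%:E * \int[@leb n]_x f x)%E.
Proof.
move=> a0; elim: n b f => [|n IH] b f mf f0.
  rewrite expr0 invr1 mul1e. by apply: eq_integral => x _; congr f; apply/rowP => -[].
rewrite ge0_integral_leb_succ//; last first.
  by apply: measurableT_comp => //; exact: measurable_affine.
rewrite [in RHS]ge0_integral_leb_succ//.
pose b' := \row_i b 0 (lift ord0 i).
have mfc t : meas (fun x => f (cons_rV (x, t))).
  apply: measurableT_comp => //; apply: measurableT_comp; first exact: measurable_cons_rV. exact: measurable_fun_pair.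
transitivity (\int[leb1]_t ((`|a| ^- n)%:E * \int[@leb n]_x f (cons_rV (x, (a * t + b 0 ord0)%R))))%E.
  apply: eq_integral => t _. rewrite -(IH b')//; apply: eq_integral => x _; congr f.
  apply/rowP => i; case: (unliftP ord0 i) => [j ->|->].
    by rewrite 2!mxE !cons_rV_lift !mxE.
  by rewrite 2!mxE !cons_rV_ord0/=.
have mF : meas (fun t => \int[@leb n]_x f (cons_rV (x, t)))%E.
  apply: (measurable_fun_fubini_tonelli_G (f \o @cons_rV R n)) => //.
    by apply: measurableT_comp => //; exact: measurable_cons_rV.
  by move=> x /=.
pose G t := (\int[@leb n]_x f (cons_rV (x, t)))%E.
have G0 t : (0 <= G t)%E by exact: integral_ge0.
rewrite -[LHS]/(\int[leb1]_t ((`|a| ^- n)%:E * G (a * t + b 0 ord0)%R))%E.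
rewrite -[X in _ = (_ * X)%E]/(\int[leb1]_t G t)%E.
have mG : meas G by exact: mF.
move: G G0 mG => G G0 mG.
have mG' : meas (fun t : R => G (a * t + b 0 ord0)).
  apply: (measurableT_comp mG). by apply: measurable_funD => //; exact: measurable_funM.
rewrite (@ge0_integralZl_EFin _ _ _ leb1 setT measurableT _ _ mG')//.
rewrite (leb1_affine (b 0 ord0) a0 mG)//.
by rewrite muleA -EFinM -invfM mulrC -exprS.
Qed.

Lemma ge0_integral_prod n (h : 'I_n -> R -> R) :
  (forall i, meas (h i)) -> (forall i t, 0 <= h i t) ->
  (\int[@leb n]_x (\prod_i h i (x 0 i))%:E = \prod_i \int[leb1]_t (h i t)%:E)%E.
Proof.
elim: n h => [|n IH] h mh h0.
  rewrite big_ord0; under eq_integral do rewrite big_ord0. by rewrite integral_cst// mul1e; exact: diracT.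
rewrite ge0_integral_leb_succ//; last 2 first.
- apply/measurable_EFinP; apply: measurable_prod => i _. by apply: measurableT_comp => //; exact: measurable_coord.
- by move=> x; rewrite lee_fin prodr_ge0.
rewrite big_ord_recl -(IH (fun i => h (lift ord0 i)))//.
have H0 : (0 <= \int[@leb n]_x (\prod_i h (lift ord0 i) (x 0 i))%:E)%E.
  by apply: integral_ge0 => x _; rewrite lee_fin prodr_ge0.
rewrite -ge0_integralZr//=; last 2 first.
- by apply/measurable_EFinP; exact: (mh ord0).
- by move=> t _; rewrite lee_fin.
apply: eq_integral => t _; rewrite -ge0_integralZl//; last 3 first.
- apply/measurable_EFinP; apply: measurable_prod => i _. by apply: measurableT_comp => //; exact: measurable_coord.
- by move=> x _; rewrite lee_fin prodr_ge0.
- by rewrite lee_fin.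
apply: eq_integral => x _; rewrite -EFinM big_ord_recl cons_rV_ord0.
by congr (_ * _)%:E; apply: eq_bigr => i _; rewrite cons_rV_lift.
Qed.

(** The index of the dyadic cube of side 2^-N containing x, so that two points share a cube
exactly when their indices agree. *)
Definition dyfloor n (N : nat) (x : 'rV[R]_n) : 'rV[int]_n :=
  \row_i Num.floor (2 ^+ N * x 0 i).

Lemma dyadic_cubeE n (N : nat) (m : 'rV[int]_n) (x : 'rV[R]_n) :
  dyadic_cube N m x <-> dyfloor N x = m.
Proof.
have h0 : 0 < 2 ^+ N :> R by rewrite exprn_gt0.
have E (i : 'I_n) : (2 ^ (- N%:Z) * (m 0 i)%:~R <= x 0 i < 2 ^ (- N%:Z) * ((m 0 i)%:~R + 1)) =
    (Num.floor (2 ^+ N * x 0 i) == m 0 i).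
  rewrite -invr_expz -exprnP floor_eq. by rewrite ler_pdivrMl// ltr_pdivlMl// intrD.
split => [h|mE i]; last by rewrite E -mE mxE.
by apply/rowP => i; rewrite mxE; apply/eqP; rewrite -E.
Qed.

Lemma measurable_dyadic_cube n (N : int) (m : 'rV[int]_n) :
  measurable (@dyadic_cube R n N m).
Proof.
have -> : @dyadic_cube R n N m = [set x : 'rV[R]_n | forall i,
   [set` `[2 ^ (- N) * (m 0 i)%:~R, 2 ^ (- N) * ((m 0 i)%:~R + 1)[ ] (x 0 i)].
  by apply/seteqP; split => x /= h i; have := h i; rewrite in_itv.
exact: (@measurable_box n (fun i => [set` `[2 ^ (- N) * (m 0 i)%:~R, 2 ^ (- N) * ((m 0 i)%:~R + 1)[ ])).
Qed.

Lemma leb_dyadic_cube n (N : nat) (m : 'rV[int]_n) :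
  @leb n (dyadic_cube N m) = (2 ^- (N * n))%:E.
Proof.
have -> : @dyadic_cube R n N m = [set x : 'rV[R]_n | forall i,
   x 0 i \in `[2 ^ (- N%:Z) * (m 0 i)%:~R, 2 ^ (- N%:Z) * ((m 0 i)%:~R + 1)[ ].
  by apply/seteqP; split => x /= h i; have := h i; rewrite in_itv.
rewrite leb_box; last by move=> i; rewrite ler_pM2l ?exprz_gt0// lerDl.
under eq_bigr do rewrite -mulrBr addrC addKr mulr1.
by rewrite prodr_const card_ord -invr_expz -exprnP exprVn exprM.
Qed.

(** An open set is the countable union of the dyadic cubes that it contains. *)
Lemma measurable_open n (U : set 'rV[R]_n) : open U -> measurable U.
Proof.
move=> oU.
rewrite (_ : U = \bigcup_(N in [set: nat])
   \bigcup_(m in [set m : 'rV[int]_n | dyadic_cube N m `<=` U]) dyadic_cube N m).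
  apply: bigcup_measurable => N _. rewrite bigcup_mkcond; apply: countable_bigcupT_measurable.
    exact: countableP.
  by move=> m; case: ifPn => _ //; exact: measurable_dyadic_cube.
apply/seteqP; split; last first.
  by move=> x [N _ [m /= mU]]; exact: mU.
move=> x Ux.
have /nbhs_ballP[e /= e0 eU] : nbhs x U by apply: open_nbhs_nbhs.
have [N Ne] : exists N, 2 ^- N < e.
  exists (Num.bound e^-1); rewrite invf_plt ?posrE ?exprn_gt0//.
  apply: lt_trans (archi_boundP _) _; first by rewrite invr_ge0 ltW. by rewrite -natrX ltr_nat ltn_expl.
exists N => //; exists (dyfloor N x); last exact/dyadic_cubeE.
move=> y hy; apply: eU.
rewrite -ball_normE/=.
apply: le_lt_trans Ne; apply: norm_rV_le; first by rewrite invr_ge0 exprn_ge0.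
have hx : dyadic_cube N (dyfloor N x) x by exact/dyadic_cubeE.
move=> i; have := hy i; have := hx i.
rewrite -invr_expz -exprnP !mxE mulrDr mulr1.
set A := _ * _; set B := _ ^- _ => /andP[? ?] /andP[? ?].
by rewrite ler_norml; apply/andP; split; lra.
Qed.

Lemma continuous_measurable_rV n (f : 'rV[R]_n -> R) :
  continuous f -> meas f.
Proof.
move=> cf; apply: (measurability _ (RGenOpens.measurableE R)).
move=> _ [_ [a [b ->] <-]]; rewrite setTI; apply: measurable_open.
by move/continuousP: cf; apply; exact: interval_open.
Qed.

End lebesgue_rV_theory.

(** * The modulus of a complex number *)

Section normc_theory.
Variable R : realType.
Implicit Types z w : R[i].

Lemma normc_ge0 z : 0 <= normc z.
Proof. by case: z => a b; exact: sqrtr_ge0. Qed.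

Lemma normc_triangle z w : normc (z + w) <= normc z + normc w.
Proof. exact: le_normcD. Qed.

Lemma normc_opp z : normc (- z) = normc z.
Proof. exact: normcN. Qed.

Lemma normc_distC z w : normc (z - w) = normc (w - z).
Proof. by rewrite -normc_opp opprB. Qed.

Lemma normc_triangleB z w : normc (z - w) <= normc z + normc w.
Proof. by rewrite -(normc_opp w); exact: normc_triangle. Qed.

Lemma normc_dist_ge z w : normc z - normc w <= normc (z - w).
Proof. by rewrite lerBlDr -{1}(subrK w z); exact: normc_triangle. Qed.

Lemma normc_sum (I : Type) (r : seq I) (P : pred I) (F : I -> R[i]) :
  normc (\sum_(i <- r | P i) F i) <= \sum_(i <- r | P i) normc (F i).
Proof.
elim/big_ind2 : _ => //; first by rewrite normc0.
by move=> z x w y hx hy; apply: le_trans (normc_triangle _ _) (lerD hx hy).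
Qed.

Lemma normcr (r : R) : normc (r%:C) = `|r|.
Proof. by rewrite /normc/= expr0n addr0 sqrtr_sqr. Qed.

Lemma Re_le_normc z : `|Re z| <= normc z.
Proof.
by case: z => a b; rewrite -sqrtr_sqr ler_sqrt/1/ lerDl sqr_ge0.
Qed.

Lemma Im_le_normc z : `|Im z| <= normc z.
Proof.
by case: z => a b; rewrite -sqrtr_sqr ler_sqrt/1/ lerDr sqr_ge0.
Qed.

Lemma normc_le_ReIm z : normc z <= `|Re z| + `|Im z|.
Proof.
case: z => a b /=; rewrite -[leRHS]ger0_norm// -sqrtr_sqr.
rewrite ler_sqrt// sqrrD !real_normK ?num_real//.
by rewrite addrAC lerDl mulrn_wge0// mulr_ge0.
Qed.

Lemma normc_cis (t : R) : normc (cis t) = 1.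
Proof. by rewrite /normc/cis cos2Dsin2 sqrtr1. Qed.

Lemma cisD (s t : R) : cis (s + t) = cis s * cis t.
Proof.
by rewrite /cis cosD sinD; apply/eqP; rewrite eq_complex eqxx [X in _ == X]addrC mulrC eqxx.
Qed.

Lemma cis0 : cis 0 = 1 :> R[i].
Proof. by rewrite /cis cos0 sin0. Qed.

Lemma ReM z w : Re (z * w) =
  Re z * Re w - Im z * Im w.
Proof. by case: z w => a b [c e]. Qed.

Lemma ImM z w : Im (z * w) =
  Re z * Im w + Im z * Re w.
Proof. by case: z w => a b [c e]. Qed.

Lemma ReD z w : Re (z + w) = Re z + Re w.
Proof. by case: z w => a b [c e]. Qed.

Lemma ImD z w : Im (z + w) = Im z + Im w.
Proof. by case: z w => a b [c e]. Qed.

Lemma ReN z : Re (- z) = - Re z.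
Proof. by case: z => a b. Qed.

Lemma ImN z : Im (- z) = - Im z.
Proof. by case: z => a b. Qed.

Lemma complexP z w : Re z = Re w -> Im z = Im w -> z = w.
Proof. by case: z w => a b [c e]/= -> ->. Qed.

End normc_theory.

(** * Polynomial weights *)

Section weights.
Variables (R : realType) (d : nat).
Local Notation E := 'rV[R]_d.
Local Notation mu := (@leb R d).
Implicit Types (x y : E) (s t : R).

Definition wt s x : R := (1 + `|x|) `^ (- s).

Lemma measurable_normx : meas (fun x : E => `|x|).
Proof. by apply: continuous_measurable_rV => x; exact: norm_continuous. Qed.

Lemma base_gt0 x : 0 < 1 + `|x|.
Proof. side. Qed.

Lemma base_ge0 x : 0 <= 1 + `|x|.
Proof. side. Qed.

Lemma wt_gt0 s x : 0 < wt s x.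
Proof. side. Qed.

Lemma wt_ge0 s x : 0 <= wt s x.
Proof. side. Qed.

Lemma wtD s t x : wt (s + t) x = wt s x * wt t x.
Proof. rewrite /wt opprD powRD//; apply/implyP => _.
side. Qed.

Lemma wt_le s t x : s <= t -> wt t x <= wt s x.
Proof. by move=> st; rewrite ler_powR ?lerDl// lerN2. Qed.

Lemma wt_le1 s x : 0 <= s -> wt s x <= 1.
Proof.
by move=> s0; rewrite -[leRHS](powRr0 (1 + `|x|)) ler_powR ?lerDl// oppr_le0.
Qed.

Lemma wt0 s : wt s 0 = 1.
Proof. by rewrite /wt normr0 addr0 powR1. Qed.

Lemma wtN s x : wt s (- x) = wt s x.
Proof. by rewrite /wt normrN. Qed.

Lemma wt_norm_le s x y : 0 <= s -> `|x| <= `|y| -> wt s y <= wt s x.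
Proof.
move=> s0 xy; rewrite /wt !powRN lef_pV2/1/.
by apply: ge0_ler_powR; rewrite/1/ lerD2l.
Qed.

Lemma wt_submul s x y : 0 <= s -> wt s x * wt s y <= wt s (x + y).
Proof.
move=> s0; rewrite /wt !powRN -invfM lef_pV2/1/.
rewrite -powRM//.
apply: ge0_ler_powR => /1/.
rewrite mulrDl mul1r mulrDr mulr1 -!addrA lerD2l.
apply: le_trans (ler_normD _ _) _.
by rewrite addrA (addrC `|x|) lerDl mulr_ge0.
Qed.

Lemma wtX (n : nat) x : wt n%:R x = (1 + `|x|) ^- n.
Proof. by rewrite /wt powR_invn// ltW. Qed.

Lemma wt_powR s t x : wt s x `^ t = wt (s * t) x.
Proof. by rewrite /wt -powRrM mulNr. Qed.

Lemma measurable_wt s : meas (wt s).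
Proof.
apply: (measurableT_comp (f := fun r => r `^ (- s))).
  side.
by apply: measurable_funD => //; exact: measurable_normx.
Qed.

Lemma integral_oneDsqrV :
  (\int[@lebesgue_measure R]_t ((1 + t ^+ 2)^-1)%:E = pi%:E)%E.
Proof.
have c1 : continuous (fun t : R => (1 + t ^+ 2)^-1) := continuous_oneDsqrV.
have g0 (t : R) : 0 <= (1 + t ^+ 2)^-1 => /1/.
rewrite ge0_symfun_integralT//; last by move=> t /=; rewrite sqrrN.
rewrite (_ : [set t | (0 <= t)%R] = `[0, +oo[%classic); last first.
  by apply/seteqP; split => t /=; rewrite in_itv andbT.
rewrite (@ge0_continuous_FTC2y _ _ atan 0 (pi / 2))//.
- by rewrite atan0 sube0 -EFinM mulrC divfK.
- exact: continuous_subspaceT.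
- exact: cvgy_atan.
- exact: cvg_at_right_filter (@continuous_atan _ 0).
- by move=> t _; rewrite derive1_atan.
Qed.

Lemma integral_wt_prod : (\int[mu]_x (\prod_i (1 + (x 0 i) ^+ 2)^-1)%:E = (pi ^+ d)%:E)%E.
Proof.
rewrite (@ge0_integral_prod _ _ (fun=> fun t => (1 + t ^+ 2)^-1)).
- under eq_bigr do rewrite integral_oneDsqrV. by rewrite -(big_morph EFin EFinM erefl) prodr_const card_ord.
- by move=> _; apply: continuous_measurable_fun; exact: continuous_oneDsqrV.
- side.
Qed.

(** One factor of (1 + |x|)^-2 is spent on each coordinate. *)
Lemma wt_le_prod x : wt (2 * d)%:R x <= \prod_i (1 + (x 0 i) ^+ 2)^-1.
Proof.
rewrite wtX exprM -exprVn -[X in _ ^+ X]card_ord -prodr_const.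
apply: ler_prod => i _; rewrite invr_ge0 sqr_ge0/=.
rewrite lef_pV2/1/.
rewrite sqrrD expr1n mul1r -addrA lerD2l -[leLHS]real_normK ?num_real//.
via (`|x| ^+ 2).
  by rewrite lerXn2r/1/; exact: coord_le_norm.
by rewrite lerDr mulrn_wge0.
Qed.

Lemma integral_wt s : (2 * d)%:R <= s -> (\int[mu]_x (wt s x)%:E <= (pi ^+ d)%:E)%E.
Proof.
move=> ds; rewrite -integral_wt_prod; apply: ge0_le_integral => //.
- by move=> x _; rewrite lee_fin wt_ge0.
- by apply/measurable_EFinP; exact: measurable_wt.
- apply/measurable_EFinP; apply: measurable_prod => i _.
  apply: (measurableT_comp (f := fun t : R => (1 + t ^+ 2)^-1)).
    by apply: continuous_measurable_fun; exact: continuous_oneDsqrV.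
  exact: measurable_coord.
- by move=> x _/1/; apply: le_trans (wt_le_prod x); exact: wt_le.
Qed.

End weights.

(** * Integrals of nonnegative functions *)

Section nonneg_integral.
Variables (R : realType) (d : nat).
Local Notation E := 'rV[R]_d.
Local Notation mu := (@leb R d).
Implicit Types (f g : E -> R).

Definition nint f : \bar R := (\int[mu]_x (f x)%:E)%E.

Lemma nint_ge0 f : (forall x, 0 <= f x) -> (0 <= nint f)%E.
Proof. by move=> f0; apply: integral_ge0 => x _; rewrite lee_fin. Qed.

Lemma nint_le f g : meas f -> meas g ->
  (forall x, 0 <= f x) -> (forall x, f x <= g x) -> (nint f <= nint g)%E.
Proof.
move=> mf mg f0 fg; apply: ge0_le_integral => //.
- by move=> x _; rewrite lee_fin.
- exact/measurable_EFinP.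
- exact/measurable_EFinP.
- by move=> x _; rewrite lee_fin.
Qed.

Lemma nintZ (c : R) f : meas f -> (forall x, 0 <= f x) -> 0 <= c ->
  nint (fun x => c * f x) = (c%:E * nint f)%E.
Proof.
move=> mf f0 c0; rewrite /nint.
under eq_integral do rewrite EFinM.
apply: ge0_integralZl => //; first exact/measurable_EFinP.
by move=> x _; rewrite lee_fin.
Qed.

Lemma nintD f g : meas f -> meas g ->
  (forall x, 0 <= f x) -> (forall x, 0 <= g x) ->
  nint (fun x => f x + g x) = (nint f + nint g)%E.
Proof.
move=> mf mg f0 g0; rewrite /nint.
under eq_integral do rewrite EFinD.
apply: ge0_integralD => //; try exact/measurable_EFinP.
- by move=> x _; rewrite lee_fin.
- by move=> x _; rewrite lee_fin.
Qed.

Lemma nint_affine (a : R) (b : E) f : a != 0 -> meas f ->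
  (forall x, 0 <= f x) ->
  nint (fun x => f (a *: x + b)) = ((`|a| ^- d)%:E * nint f)%E.
Proof.
move=> a0 mf f0; rewrite /nint.
rewrite -(@ge0_integral_affine _ _ a b (fun x => (f x)%:E))//.
exact/measurable_EFinP.
Qed.

Lemma nint_tonelli (F : E -> E -> \bar R) :
  meas (fun z : E * E => F z.1 z.2) ->
  (forall x y, 0 <= F x y)%E ->
  (\int[mu]_x \int[mu]_y F x y = \int[mu]_y \int[mu]_x F x y)%E.
Proof.
by move=> mF F0; exact: (fubini_tonelli (m1 := mu) (m2 := mu) (fun z => F z.1 z.2) mF).
Qed.

Lemma integrable_nint f : meas f ->
  mu.-integrable setT (EFin \o f) <-> (nint (fun x => `|f x|%R) < +oo)%E.
Proof.
move=> mf; split => [/integrableP[_]//|fy]; apply/integrableP; split => //.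
exact/measurable_EFinP.
Qed.

End nonneg_integral.

Lemma cvg0_nnegP (R : realType) (u : nat -> R) : (forall n, 0 <= u n) ->
  u n @[n --> \oo] --> (0:R) <-> forall e, 0 < e -> exists N, forall n, (N <= n)%N -> u n < e.
Proof.
move=> u0; split => [/cvgrPdist_lt uc e e0|h].
  have [N _ hN] := uc e e0; exists N => n Nn; have := hN n Nn. by rewrite sub0r normrN ger0_norm.
apply/cvgrPdist_lt => e e0; have [N hN] := h e e0.
by exists N => // n Nn; rewrite sub0r normrN ger0_norm//; exact: hN.
Qed.

Lemma cvg0_squeeze (R : realType) (u v : nat -> R) : (forall n, 0 <= u n) ->
  (forall n, u n <= v n) -> v n @[n --> \oo] --> (0:R) -> u n @[n --> \oo] --> (0:R).
Proof.
move=> u0 uv v0; apply: (@squeeze_cvgr _ _ _ _ (fun=> 0) v) => //; last exact: cvg_cst.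
by apply: nearW => n; rewrite u0 uv.
Qed.

(** * Complex-valued integrals *)

Section complex_integral.
Variables (R : realType) (d : nat).
Local Notation E := 'rV[R]_d.
Local Notation mu := (@leb R d).
Local Notation C := R[i].
Implicit Types (f g : E -> C) (a : C).

Definition cmeas d' (T : measurableType d') (f : T -> C) :=
  meas (@Re R \o f) /\ meas (@Im R \o f).

Lemma cmeasD d' (T : measurableType d') (f g : T -> C) :
  cmeas f -> cmeas g -> cmeas (fun x => f x + g x).
Proof.
move=> [f1 f2] [g1 g2]; split.
- rewrite (_ : _ \o _ = (@Re R \o f) \+ (@Re R \o g)).
    side.
  by apply/funext => x /=; rewrite ReD.
- rewrite (_ : _ \o _ = (@Im R \o f) \+ (@Im R \o g)).
    side.
  by apply/funext => x /=; rewrite ImD.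
Qed.

Lemma cmeasM d' (T : measurableType d') (f g : T -> C) :
  cmeas f -> cmeas g -> cmeas (fun x => f x * g x).
Proof.
move=> [f1 f2] [g1 g2]; split.
- rewrite (_ : _ \o _ = fun x => (@Re R \o f) x * (@Re R \o g) x - (@Im R \o f) x * (@Im R \o g) x).
    by apply: measurable_funB; side.
  by apply/funext => x /=; rewrite ReM.
- rewrite (_ : _ \o _ = fun x => (@Re R \o f) x * (@Im R \o g) x + (@Im R \o f) x * (@Re R \o g) x).
    side.
  by apply/funext => x /=; rewrite ImM.
Qed.

Lemma cmeas_cst d' (T : measurableType d') a : cmeas (fun _ : T => a).
Proof. by split; side. Qed.

Lemma cmeasN d' (T : measurableType d') (f : T -> C) : cmeas f -> cmeas (fun x => - f x).
Proof.
move=> mf; rewrite (_ : (fun _ => _) = fun x => (-1) * f x).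
  by apply: cmeasM => //; exact: cmeas_cst.
by ext x; rewrite mulN1r.
Qed.

Lemma cmeasB d' (T : measurableType d') (f g : T -> C) :
  cmeas f -> cmeas g -> cmeas (fun x => f x - g x).
Proof. by move=> mf mg; apply: cmeasD => //; exact: cmeasN. Qed.

Lemma cmeas_real d' (T : measurableType d') (h : T -> R) :
  meas h -> cmeas (fun x => (h x)%:C).
Proof. by move=> mh; split =>  /1/. Qed.

Lemma cmeas_comp d' (T : measurableType d') d2 (T2 : measurableType d2)
  (f : T -> C) (h : T2 -> T) : cmeas f -> meas h -> cmeas (f \o h).
Proof. by move=> [f1 f2] mh; split; [exact: (measurableT_comp f1)|exact: (measurableT_comp f2)]. Qed.

Lemma cmeas_normc d' (T : measurableType d') (f : T -> C) :
  cmeas f -> meas (fun x => normc (f x)).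
Proof.
move=> [f1 f2].
rewrite (_ : (fun _ => _) = fun x => Num.sqrt ((@Re R \o f) x ^+ 2 + (@Im R \o f) x ^+ 2)).
  apply: (measurableT_comp (f := Num.sqrt : R -> R)).
    by apply: continuous_measurable_fun; exact: sqrt_continuous.
  side.
by apply/funext => x /=; case: (f x).
Qed.

Lemma cmeas_cis d' (T : measurableType d') (h : T -> R) :
  meas h -> cmeas (fun x => cis (h x)).
Proof.
move=> mh; split.
- apply: (measurableT_comp (f := cos)) => //. by apply: continuous_measurable_fun; exact: continuous_cos.
- apply: (measurableT_comp (f := sin)) => //. by apply: continuous_measurable_fun; exact: continuous_sin.
Qed.

Definition cint f : C := cintegral setT f.

(** Absolute integrability, stated through the modulus rather than through the two components.
*)
Definition cintble f := cmeas f /\ (nint (fun x => normc (f x)) < +oo)%E.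

Lemma cintble_dom f (g : E -> R) : cmeas f -> meas g ->
  (forall x, normc (f x) <= g x) -> (nint g < +oo)%E -> cintble f.
Proof.
move=> mf mg fg gy; split => //; apply: le_lt_trans gy.
by apply: nint_le => // [|x]; [exact: cmeas_normc|exact: normc_ge0].
Qed.

Lemma cintble_Re f : cintble f -> mu.-integrable setT (EFin \o (@Re R \o f)).
Proof.
move=> [mf fy]; apply/integrable_nint; first exact: mf.1.
apply: le_lt_trans fy; apply: nint_le => //.
- by apply: measurableT_comp => //; exact: mf.1.
- exact: cmeas_normc.
- by move=> x; exact: Re_le_normc.
Qed.

Lemma cintble_Im f : cintble f -> mu.-integrable setT (EFin \o (@Im R \o f)).
Proof.
move=> [mf fy]; apply/integrable_nint; first exact: mf.2.
apply: le_lt_trans fy; apply: nint_le => //.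
- by apply: measurableT_comp => //; exact: mf.2.
- exact: cmeas_normc.
- by move=> x; exact: Im_le_normc.
Qed.

Lemma cintbleD f g : cintble f -> cintble g -> cintble (fun x => f x + g x).
Proof.
move=> [mf fy] [mg gy]; apply: (@cintble_dom _ (fun x => normc (f x) + normc (g x))).
- exact: cmeasD.
- by apply: measurable_funD; exact: cmeas_normc.
- by move=> x; exact: normc_triangle.
- rewrite nintD; [exact: lte_add_pinfty| | | |]; by [exact: cmeas_normc|move=> x; exact: normc_ge0].
Qed.

Lemma cintbleZ a f : cintble f -> cintble (fun x => a * f x).
Proof.
move=> [mf fy]; split; first by apply: cmeasM => //; exact: cmeas_cst.
rewrite (_ : (fun _ => _) = fun x => normc a * normc (f x)); last first.
  by ext x; rewrite normcM.
rewrite nintZ; [|exact: cmeas_normc|by move=> x; exact: normc_ge0|exact: normc_ge0].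
by rewrite lte_mul_pinfty// lee_fin normc_ge0.
Qed.

Lemma cintbleB f g : cintble f -> cintble g -> cintble (fun x => f x - g x).
Proof.
move=> mf mg; rewrite (_ : (fun _ => _) = fun x => f x + (-1) * g x).
  by apply: cintbleD => //; exact: cintbleZ.
by ext x; rewrite mulN1r.
Qed.

Lemma cintD f g : cintble f -> cintble g ->
  cint (fun x => f x + g x) = cint f + cint g.
Proof.
move=> fi gi; apply: complexP.
  rewrite ReD/= -RintegralD//; [|exact: cintble_Re|exact: cintble_Re]. by apply: eq_Rintegral => x _; rewrite ReD.
rewrite ImD/= -RintegralD//; [|exact: cintble_Im|exact: cintble_Im].
by apply: eq_Rintegral => x _; rewrite ImD.
Qed.

Lemma cintZ a f : cintble f -> cint (fun x => a * f x) = a * cint f.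
Proof.
move=> fi; have [fR fI] := (cintble_Re fi, cintble_Im fi).
have zr (r : R) (h : E -> R) : mu.-integrable setT (EFin \o h) -> mu.-integrable setT (EFin \o (fun x => r * h x)).
  move=> hi; rewrite (_ : EFin \o _ = fun x => (r%:E * (h x)%:E)%E).
    exact: integrableZl.
  side.
apply: complexP.
  rewrite ReM/= -!RintegralZl// -RintegralB//; [|exact: zr|exact: zr]. by apply: eq_Rintegral => x _; rewrite ReM.
rewrite ImM/= -!RintegralZl// -RintegralD//; [|exact: zr|exact: zr].
by apply: eq_Rintegral => x _; rewrite ImM.
Qed.

Lemma cintB f g : cintble f -> cintble g ->
  cint (fun x => f x - g x) = cint f - cint g.
Proof.
move=> fi gi; rewrite (_ : (fun _ => _) = fun x => f x + (-1) * g x).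
  by rewrite cintD ?cintZ ?mulN1r//; exact: cintbleZ.
by ext x; rewrite mulN1r.
Qed.

Lemma cintble0 : cintble (fun=> 0).
Proof.
apply: (@cintble_dom _ (fun=> 0)) => //; first exact: cmeas_cst.
  by move=> x; rewrite normc0.
by rewrite /nint integral_cst// mul0e ltry.
Qed.

Lemma cint0 : cint (fun=> 0) = 0.
Proof. by rewrite -[0 as X in cint (fun=> X)](mul0r 0) cintZ ?mul0r//; exact: cintble0. Qed.

Lemma cintble_sum (I : Type) (r : seq I) (F : I -> E -> C) :
  (forall i, cintble (F i)) -> cintble (fun x => \sum_(i <- r) F i x).
Proof.
move=> Fi; elim: r => [|i r IH].
  by under eq_fun do rewrite big_nil; exact: cintble0.
by under eq_fun do rewrite big_cons; exact: cintbleD.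
Qed.

Lemma cint_sum (I : Type) (r : seq I) (F : I -> E -> C) :
  (forall i, cintble (F i)) ->
  cint (fun x => \sum_(i <- r) F i x) = \sum_(i <- r) cint (F i).
Proof.
move=> Fi; elim: r => [|i r IH].
  by under eq_fun do rewrite big_nil; rewrite big_nil cint0.
under eq_fun do rewrite big_cons.
by rewrite big_cons cintD ?IH//; exact: cintble_sum.
Qed.

(** The constant 2 comes from estimating the two components separately; it saves the rotation
argument and is harmless throughout. *)
Lemma normc_cint_le f : cintble f ->
  ((normc (cint f))%:E <= 2%:E * nint (fun x => normc (f x)))%E.
Proof.
move=> fi; have [fR fI] := (cintble_Re fi, cintble_Im fi).
have main (h : E -> R) : mu.-integrable setT (EFin \o h) -> (forall x, `|h x| <= normc (f x)) ->
    (`|\int[mu]_x h x|%:E <= nint (fun x => normc (f x)))%E.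
  move=> hi hf; rewrite EFin_normr_Rintegral//. have mh : meas h by apply/measurable_EFinP; case/integrableP : hi.
  apply: le_trans (le_abse_integral mu measurableT (measurable_int _ hi)) _.
  by apply: nint_le => //; [exact: measurableT_comp|apply: cmeas_normc; exact: fi.1].
rewrite mule_natl mule2n.
apply: (@le_trans _ _ (`|Re (cint f)| + `|Im (cint f)|)%:E).
  by rewrite lee_fin normc_le_ReIm.
rewrite EFinD; apply: leeD.
  by apply: main => // x; exact: Re_le_normc.
by apply: main => // x; exact: Im_le_normc.
Qed.

Lemma normc_cint_bound f (g : E -> R) (B : R) : cmeas f -> meas g ->
  (forall x, normc (f x) <= g x) -> (nint g <= B%:E)%E -> normc (cint f) <= 2 * B.
Proof.
move=> mf mg fg gB.
have fi : cintble f by apply: (cintble_dom mf mg fg); apply: le_lt_trans gB _; rewrite ltry.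
rewrite -lee_fin; apply: le_trans (normc_cint_le fi) _; rewrite EFinM.
apply: lee_wpmul2l => /1/.
apply: le_trans gB; apply: nint_le => // [|x]; [exact: cmeas_normc|exact: normc_ge0].
Qed.

Lemma Rint_affine (a : R) (b : E) (h : E -> R) : a != 0 ->
  mu.-integrable setT (EFin \o h) ->
  (\int[mu]_x h (a *: x + b) = `|a| ^- d * \int[mu]_x h x)%R.
Proof.
move=> a0 hi; have mh : meas h by apply/measurable_EFinP; case/integrableP : hi.
have cf : (0 <= `|a| ^- d)%R by [].
rewrite /Rintegral integralE [in RHS]integralE.
have P := @ge0_integral_affine R d a b _ a0 (measurable_funepos (measurable_int _ hi)) (funepos_ge0 _).
have N := @ge0_integral_affine R d a b _ a0 (measurable_funeneg (measurable_int _ hi)) (funeneg_ge0 _).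
have -> : (\int[mu]_x ((fun x => (h (a *: x + b))%:E) ^\+ x) = (`|a| ^- d)%:E * \int[mu]_x ((EFin \o h)^\+ x))%E.
  by rewrite -P (funepos_comp (EFin \o h) (fun x => a *: x + b)).
have -> : (\int[mu]_x ((fun x => (h (a *: x + b))%:E) ^\- x) = (`|a| ^- d)%:E * \int[mu]_x ((EFin \o h)^\- x))%E.
  by rewrite -N (funeneg_comp (EFin \o h) (fun x => a *: x + b)).
have := integrable_pos_fin_num measurableT hi; have := integrable_neg_fin_num measurableT hi.
rewrite /= => h1 h2.
have -> : (fun x => (h x)%:E) = EFin \o h by [].
by rewrite -(fineK h2) -(fineK h1) -!EFinM -!EFinB mulrBr.
Qed.

Lemma cint_affine (a : R) (b : E) f : a != 0 -> cintble f ->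
  cint (fun x => f (a *: x + b)) = (`|a| ^- d)%:C * cint f.
Proof.
move=> a0 fi; have [fR fI] := (cintble_Re fi, cintble_Im fi).
apply: complexP.
  by rewrite ReM mul0r subr0 -(Rint_affine b a0 fR).
by rewrite ImM mul0r addr0 -(Rint_affine b a0 fI).
Qed.

Lemma cint_shift (b : E) f : cintble f -> cint (fun x => f (x + b)) = cint f.
Proof.
move=> fi; have := cint_affine b (oner_neq0 _) fi.
rewrite normr1 expr1n invr1 mul1r => <-.
by congr cint; ext x; rewrite scale1r.
Qed.

Lemma cint_refl (b : E) f : cintble f -> cint (fun x => f (b - x)) = cint f.
Proof.
move=> fi; have := @cint_affine (-1) b f _ fi.
rewrite normrN1 expr1n invr1 mul1r => <- /1/.
by congr cint; ext x; rewrite scaleN1r addrC.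
Qed.

Lemma cintble_affine (a : R) (b : E) f : a != 0 -> cintble f ->
  cintble (fun x => f (a *: x + b)).
Proof.
move=> a0 [mf fy]; split; first by apply: (cmeas_comp mf); exact: measurable_affine.
rewrite (@nint_affine _ _ a b (fun x => normc (f x)))//; last 2 first.
- exact: cmeas_normc.
- by move=> x; exact: normc_ge0.
by rewrite lte_mul_pinfty// lee_fin invr_ge0 exprn_ge0.
Qed.

Lemma cintble_refl (b : E) f : cintble f -> cintble (fun x => f (b - x)).
Proof.
move=> fi; have := @cintble_affine (-1) b f _ fi.
rewrite oppr_eq0 oner_neq0 => /(_ isT); congr cintble.
by ext x; rewrite scaleN1r addrC.
Qed.

Lemma cintble_shift (b : E) f : cintble f -> cintble (fun x => f (x + b)).
Proof.
move=> fi; have := @cintble_affine 1 b f (oner_neq0 _) fi; congr cintble.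
by ext x; rewrite scale1r.
Qed.

Lemma cfubini (F : E -> E -> C) : cmeas (fun z : E * E => F z.1 z.2) ->
  (\int[mu]_x \int[mu]_y (normc (F x y))%:E < +oo)%E ->
  cint (fun x => cint (F x)) = cint (fun y => cint (fun x => F x y)).
Proof.
move=> mF Fy.
have main (h : E -> E -> R) : meas (fun z : E * E => h z.1 z.2) -> (forall x y, `|h x y| <= normc (F x y)) ->
    (\int[mu]_x \int[mu]_y h x y = \int[mu]_y \int[mu]_x h x y)%R.
  move=> mh hF. have mh' : meas (fun z : E * E => (h z.1 z.2)%:E) by exact/measurable_EFinP.
  have hi : (mu \x mu)%E.-integrable setT (fun z : E * E => (h z.1 z.2)%:E).
    apply: (integrable12ltyP mu mu mh').2; apply: le_lt_trans Fy. apply: ge0_le_integral => //.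
    - by move=> x _; apply: integral_ge0.
    - apply: (measurable_fun_fubini_tonelli_F (m2 := mu) (fun z : E * E => `|(h z.1 z.2)%:E|%E)) => //.
      exact: measurableT_comp.
    - apply: (measurable_fun_fubini_tonelli_F (m2 := mu) (fun z : E * E => (normc (F z.1 z.2))%:E)) => //.
        by apply/measurable_EFinP; exact: cmeas_normc.
      by move=> z; rewrite lee_fin normc_ge0.
    - move=> x _; apply: ge0_le_integral => //.
      + apply: measurableT_comp => //.
        exact: (@measurable_fun_pair2 _ _ _ _ _ _ (fun z : E * E => (h z.1 z.2)%:E) x mh').
      + apply/measurable_EFinP.
        exact: (@measurable_fun_pair2 _ _ _ _ _ _ (fun z : E * E => normc (F z.1 z.2)) x (cmeas_normc mF)).
      + by move=> y _; rewrite lee_fin.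
  rewrite /Rintegral. have := Fubini hi. rewrite /fubini_F /fubini_G/= => HF.
  have ae1 := ae_integrable1 hi; have ae2 := ae_integrable2 hi.
  transitivity (fine (\int[mu]_x \int[mu]_y (h x y)%:E)%E).
    congr fine; apply: ae_eq_integral => //.
    - apply/measurable_EFinP; apply: measurableT_comp => //. exact: (measurable_fubini_F hi).
    - exact: (measurable_fubini_F hi).
    - by apply: filterS ae1 => x hx _; rewrite fineK//; exact: integrable_fin_num.
  rewrite HF; congr fine; apply: ae_eq_integral => //.
  - exact: (measurable_fubini_G hi).
  - apply/measurable_EFinP; apply: measurableT_comp => //. exact: (measurable_fubini_G hi).
  - by apply: filterS ae2 => x hx _; rewrite fineK//; exact: integrable_fin_num.
apply: complexP => /=.
  by apply: main => [|x y]; [exact: mF.1|exact: Re_le_normc].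
by apply: main => [|x y]; [exact: mF.2|exact: Im_le_normc].
Qed.

Lemma cint_dct (F : nat -> E -> C) f (g : E -> R) :
  (forall n, cmeas (F n)) -> cmeas f -> meas g -> (nint g < +oo)%E ->
  (forall n x, normc (F n x) <= g x) ->
  (forall x, normc (F n x - f x) @[n --> \oo] --> (0:R)) ->
  normc (cint (F n) - cint f) @[n --> \oo] --> (0:R).
Proof.
move=> mF mf mg gy Fg Ff.
have g0 x : 0 <= g x by apply: le_trans (Fg 0%N x); exact: normc_ge0.
have fg x : normc (f x) <= g x.
  apply/ler_addgt0Pr => e e0.
  have [N /(_ _ (leqnn N)) hN] := (cvg0_nnegP (fun n => normc_ge0 (F n x - f x))).1 (Ff x) e e0.
  rewrite -(subKr (F N x) (f x)); apply: le_trans (normc_triangleB _ _) _. by apply: lerD => //; exact: ltW.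
have Fi n : cintble (F n) by apply: (cintble_dom (mF n) mg (Fg n)).
have fi : cintble f by apply: (cintble_dom mf mg fg).
pose h n x := normc (F n x - f x).
have mh n : meas (h n) by apply: cmeas_normc; exact: cmeasB.
have h2 n x : h n x <= 2 * g x.
  by rewrite mulr2n mulrDl mul1r; apply: le_trans (normc_triangleB _ _) _; exact: lerD.
have h0 n x : 0 <= h n x by exact: normc_ge0.
have g2 : (nint (fun x => 2 * g x)%R < +oo)%E.
  by rewrite nintZ// lte_mul_pinfty// lee_fin.
have [|||||_ _ dc] := @dominated_convergence _ _ _ mu setT measurableT
  (fun n x => (h n x)%:E) (fun=> 0%E) (fun x => (2 * g x)%:E).
- by move=> n; exact/measurable_EFinP.
- side.
- by apply: aeW => x _; apply: cvg_EFin; [exact: nearW|exact: Ff].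
- apply/integrable_nint => /1/. rewrite (_ : (fun x => _) = fun x => 2 * g x)//.
  by ext x; rewrite ger0_norm// mulr_ge0.
- by apply: aeW => x n _; rewrite lee_fin ger0_norm.
move: dc; rewrite integral_cst// mul0e => dc.
have fin n : nint (h n) \is a fin_num.
  rewrite ge0_fin_numE ?nint_ge0//; apply: le_lt_trans g2; apply: nint_le => //. side.
have L : fine (nint (h n)) @[n --> \oo] --> (0:R) by apply: fine_cvg; side.
apply: (@cvg0_squeeze _ _ (fun n => 2 * fine (nint (h n)))).
- by move=> n; exact: normc_ge0.
- move=> n; rewrite -cintB// -lee_fin EFinM fineK//. by apply: normc_cint_le; exact: cintbleB.
- by rewrite -[0 in X in _ --> X](mulr0 2); exact: cvgMr.
Qed.

End complex_integral.

Ltac side_complex ::= match goal with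
  | |- is_true (0 <= _)%R => first [ exact: normc_ge0 | exact: wt_ge0 | exact: base_ge0 ]
  | |- is_true (0 < _)%R => first [ exact: wt_gt0 | exact: base_gt0 ]
  | |- is_true (0 <= _)%E => apply: nint_ge0
  | H : cintble ?f |- cmeas ?f => exact: (proj1 H)
  | |- cmeas _ => first
    [ exact: cmeas_cst | apply: cmeasM | apply: cmeasD | apply: cmeasB | apply: cmeasN
    | apply: cmeas_real ]
  | |- cintble _ => first [ apply: cintbleB | apply: cintbleZ | apply: cintbleD ]
  | |- measurable_fun _ _ => first
    [ exact: measurable_wt | exact: measurable_normx | apply: cmeas_normc ]
  end.

(** * Smooth functions *)

Section smooth_calculus.
Variables (R : realType) (d : nat).
Local Notation E := 'rV[R]_d.
Local Notation C := R[i].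
Local Notation Re := (@complex.Re R).
Local Notation Im := (@complex.Im R).
Implicit Types (f g : E -> C) (x y : E) (s : seq 'I_d).

Definition ev (i : 'I_d) : E := delta_mx 0 i.

Definition cder f (i : 'I_d) g := forall x,
  is_derive x (ev i) (Re \o f) (Re (g x)) /\ is_derive x (ev i) (Im \o f) (Im (g x)).

Definition ccont f := continuous (Re \o f) /\ continuous (Im \o f).

Lemma ccont_cmeas f : ccont f -> cmeas f.
Proof. by move=> [h1 h2]; split; exact: continuous_measurable_rV. Qed.

Lemma cder_partial f i g : cder f i g -> partial i f = g.
Proof.
move=> fg; ext x; have [h1 h2] := fg x.
by apply: complexP => /1/; exact: derive_val.
Qed.

Lemma smooth_cder f s i : smooth f ->
  cder (iter_partial s f) i (iter_partial (i :: s) f).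
Proof.
move=> fs x; have [_ _ h] := fs s; have [h1 h2] := h i x.
side.
Qed.

Lemma smooth_ccont f s : smooth f -> ccont (iter_partial s f).
Proof. by move=> fs; have [h1 h2 _] := fs s. Qed.

(** Smoothness is always proved by exhibiting all iterated derivatives at once: a family indexed
by sequences of directions that is closed under differentiation. *)
Lemma smooth_of_family f (D : seq 'I_d -> E -> C) : D [::] = f ->
  (forall s, ccont (D s)) -> (forall s i, cder (D s) i (D (i :: s))) ->
  smooth f /\ forall s, iter_partial s f = D s.
Proof.
move=> D0 Dc DD.
have E1 s : iter_partial s f = D s.
  elim: s => [//|i s IH] /=. by rewrite IH; exact: cder_partial (DD s i).
split =>  s; rewrite E1; have [c1 c2] := Dc s; split => // i x.
have [h1 h2] := DD s i x; split.
  side.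
side.
Qed.

Lemma smooth_iter f s : smooth f -> smooth (iter_partial s f) /\
  forall t, iter_partial t (iter_partial s f) = iter_partial (t ++ s) f.
Proof.
move=> fs; apply: (@smooth_of_family _ (fun t => iter_partial (t ++ s) f)) => //.
  by move=> t; exact: smooth_ccont.
by move=> t i; exact: smooth_cder.
Qed.

Lemma is_derive_line (f : E -> R) x i (t c : R) :
  is_derive (x + t *: ev i) (ev i) f c <->
  is_derive t (1:R) (fun r => f (x + r *: ev i)) c.
Proof.
have e1 : (fun h : R => h^-1 *: ((f \o shift (x + t *: ev i)) (h *: ev i) - f (x + t *: ev i))) =
   (fun h : R => h^-1 *: (((fun r => f (x + r *: ev i)) \o shift t) (h *: (1:R)) - f (x + t *: ev i))).
  ext h; congr (_ *: (_ - _)) => /=; congr f. by rewrite addrCA scaler1 scalerDl.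
split => -[dr dv]; apply: DeriveDef.
- by move: dr; rewrite /derivable e1.
- by rewrite -dv /derive e1.
- by move: dr; rewrite /derivable e1.
- by rewrite -dv /derive -e1.
Qed.

Lemma ccontD f g : ccont f -> ccont g -> ccont (fun x => f x + g x).
Proof.
move=> [f1 f2] [g1 g2]; split => x.
  rewrite (_ : Re \o _ = fun x => (Re \o f) x + (Re \o g) x); first exact: cvgD (f1 x) (g1 x).
  by apply/funext => z /=; rewrite ReD.
rewrite (_ : Im \o _ = fun x => (Im \o f) x + (Im \o g) x); first exact: cvgD (f2 x) (g2 x).
by apply/funext => z /=; rewrite ImD.
Qed.

Lemma ccontM f g : ccont f -> ccont g -> ccont (fun x => f x * g x).
Proof.
move=> [f1 f2] [g1 g2]; split => x.
  rewrite (_ : Re \o _ = fun x => (Re \o f) x * (Re \o g) x - (Im \o f) x * (Im \o g) x).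
    exact: cvgB (cvgM (f1 x) (g1 x)) (cvgM (f2 x) (g2 x)).
  by apply/funext => z /=; rewrite ReM.
rewrite (_ : Im \o _ = fun x => (Re \o f) x * (Im \o g) x + (Im \o f) x * (Re \o g) x).
  exact: cvgD (cvgM (f1 x) (g2 x)) (cvgM (f2 x) (g1 x)).
by apply/funext => z /=; rewrite ImM.
Qed.

Lemma ccont_cst (a : C) : ccont (fun=> a).
Proof. by split; exact: cst_continuous. Qed.

Lemma ccont_comp f (h : E -> E) : continuous h -> ccont f -> ccont (f \o h).
Proof.
by move=> ch [f1 f2]; split => x; [exact: (continuous_comp (ch x) (f1 (h x)))|
  exact: (continuous_comp (ch x) (f2 (h x)))].
Qed.

Lemma ccont_sum (I : Type) (r : seq I) (F : I -> E -> C) :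
  (forall i, ccont (F i)) -> ccont (fun x => \sum_(i <- r) F i x).
Proof.
move=> Fc; elim: r => [|i r IH].
  by under eq_fun do rewrite big_nil; exact: ccont_cst.
by under eq_fun do rewrite big_cons; exact: ccontD.
Qed.

Lemma cderD f g i f' g' : cder f i f' -> cder g i g' ->
  cder (fun x => f x + g x) i (fun x => f' x + g' x).
Proof.
move=> h1 h2 x; have [a1 a2] := h1 x; have [b1 b2] := h2 x; split.
  rewrite (_ : Re \o _ = (Re \o f) + (Re \o g)) ?ReD; first exact: is_deriveD. by apply/funext => z /=; rewrite ReD.
rewrite (_ : Im \o _ = (Im \o f) + (Im \o g)) ?ImD; first exact: is_deriveD.
by apply/funext => z /=; rewrite ImD.
Qed.

Lemma cderM f g i f' g' : cder f i f' -> cder g i g' ->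
  cder (fun x => f x * g x) i (fun x => f' x * g x + f x * g' x).
Proof.
move=> h1 h2 x; have [a1 a2] := h1 x; have [b1 b2] := h2 x; split.
  rewrite (_ : Re \o _ = (Re \o f) * (Re \o g) - (Im \o f) * (Im \o g)).
    apply: is_derive_eq (is_deriveB (is_deriveM a1 b1) (is_deriveM a2 b2)) _.
    by rewrite ReD !ReM /GRing.scale/=; ring.
  by apply/funext => z /=; rewrite ReM.
rewrite (_ : Im \o _ = (Re \o f) * (Im \o g) + (Im \o f) * (Re \o g)).
  apply: is_derive_eq (is_deriveD (is_deriveM a1 b2) (is_deriveM a2 b1)) _. by rewrite ImD !ImM /GRing.scale/=; ring.
by apply/funext => z /=; rewrite ImM.
Qed.

Lemma cder_cst (a : C) i : cder (fun=> a) i (fun=> 0).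
Proof.
move=> x; split => /=.
  by rewrite (_ : Re \o _ = cst (Re a))//; exact: is_derive_cst.
by rewrite (_ : Im \o _ = cst (Im a))//; exact: is_derive_cst.
Qed.

Lemma cder_sum (I : Type) (r : seq I) (F G : I -> E -> C) i :
  (forall k, cder (F k) i (G k)) ->
  cder (fun x => \sum_(k <- r) F k x) i (fun x => \sum_(k <- r) G k x).
Proof.
move=> Fc; elim: r => [|k r IH].
  have E0 (H : I -> E -> C) : (fun x => \sum_(k <- [::]) H k x) = fun=> 0.
    by ext x; rewrite big_nil.
  by rewrite !E0; exact: cder_cst.
have E1 (H : I -> E -> C) : (fun x => \sum_(j <- k :: r) H j x) = fun x => H k x + \sum_(j <- r) H j x.
  by ext x; rewrite big_cons.
by rewrite !E1; exact: cderD.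
Qed.

Lemma cder_affine f i g (c : R) (b : E) : cder f i g ->
  cder (fun x => f (c *: x + b)) i (fun x => (c%:C) * g (c *: x + b)).
Proof.
move=> fg x.
have main (h : E -> R) (l : R) : is_derive (c *: x + b) (ev i) h l ->
    is_derive x (ev i) (fun x => h (c *: x + b)) (c * l).
  move=> hd; rewrite -[x]addr0 -[0](scale0r (ev i)); apply/is_derive_line.
  have h1 : is_derive (c * 0) (1:R) (fun r => h (c *: x + b + r *: ev i)) l.
    by apply/is_derive_line; rewrite mulr0 scale0r addr0.
  have h2 : is_derive (0:R) (1:R) (fun r => c * r) c.
    have := @is_deriveZ _ _ _ id c (0:R) (1:R) 1 (is_derive_id _ _). by rewrite /GRing.scale/= mulr1.
  rewrite (_ : (fun r => _) = (fun r => h (c *: x + b + r *: ev i)) \o (fun r => c * r)).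
    by rewrite mulrC; exact: (is_derive1_comp h1 h2).
  by ext r; rewrite scalerDr scalerA addrAC.
have [h1 h2] := fg (c *: x + b); split.
  by rewrite ReM mul0r subr0; exact: main.
by rewrite ImM mul0r addr0; exact: main.
Qed.

Lemma cder_coord_lip f i g x (t M : R) : cder f i g ->
  (forall r, `|r| <= `|t| -> normc (g (x + r *: ev i)) <= M) ->
  normc (f (x + t *: ev i) - f x) <= 2 * (M * `|t|).
Proof.
move=> fg gM.
have main (h dh : E -> R) : (forall z, is_derive z (ev i) h (dh z)) ->
    (forall z, `|dh z| <= normc (g z)) -> `|h (x + t *: ev i) - h x| <= M * `|t|.
  move=> hd dhg. pose u r := h (x + r *: ev i).
  have ud r : is_derive r (1:R) u (dh (x + r *: ev i)) by apply/is_derive_line.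
  have cu (a b : R) : {within `[a, b], continuous u}.
    apply: derivable_within_continuous => r _. side.
  have -> : h (x + t *: ev i) - h x = u t - u 0 by rewrite /u scale0r addr0. have [t0|t0] := leP 0 t.
    have [c cI ->] := MVT_segment t0 (fun r _ => ud r) (cu _ _).
    rewrite subr0 normrM ler_wpM2r//; apply: le_trans (dhg _) _; apply: gM.
    by move: cI; rewrite in_itv => /andP[c0 ct]; rewrite !ger0_norm.
  have [c cI h1] := MVT_segment (ltW t0) (fun r _ => ud r) (cu _ _).
  rewrite distrC h1 sub0r normrM normrN ler_wpM2r//; apply: le_trans (dhg _) _; apply: gM.
  by move: cI; rewrite in_itv => /andP[c0 ct]; rewrite !ler0_norm ?lerN2// ltW.
apply: le_trans (normc_le_ReIm _) _.
rewrite mulr2n mulrDl mul1r ReD ReN ImD ImN; apply: lerD.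
  by apply: (main (Re \o f) (Re \o g)) => z; [exact: (fg z).1|exact: Re_le_normc].
by apply: (main (Im \o f) (Im \o g)) => z; [exact: (fg z).2|exact: Im_le_normc].
Qed.

Lemma cder_lip f (g : 'I_d -> E -> C) x (h : E) (M : R) :
  (forall i, cder f i (g i)) ->
  (forall i z, `|z| <= `|h| -> normc (g i (x + z)) <= M) ->
  normc (f (x + h) - f x) <= 2 * d%:R * M * `|h|.
Proof.
move=> fg gM.
pose z (k : nat) : E := \row_i (if (i < k)%N then h 0 i else 0).
have z0 : z 0%N = 0 by apply/rowP => i; rewrite !mxE.
have zd : z d = h by apply/rowP => i; rewrite !mxE ltn_ord.
have step (k : 'I_d) : normc (f (x + z k.+1) - f (x + z k)) <= 2 * (M * `|h|).
  have -> : x + z k.+1 = x + z k + h 0 k *: ev k.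
    rewrite -addrA; congr (_ + _); apply/rowP => i; rewrite !mxE eqxx/= ltnS. case: ltngtP => ik.
    - by case: eqP ik => [->|_]; rewrite ?ltnn// mulr0 addr0.
    - by case: eqP ik => [->|_]; rewrite ?ltnn// mulr0 addr0.
    - have -> : i = k by exact/val_inj. by rewrite eqxx mulr1 add0r.
  have hk : `|h 0 k| <= `|h| by exact: coord_le_norm.
  have M0 : 0 <= M by apply: le_trans (gM k 0 _); rewrite/1/ normr0.
  apply: le_trans (@cder_coord_lip f k (g k) (x + z k) (h 0 k) M (fg k) _) _.
    move=> r rh; rewrite -addrA; apply: gM; apply: norm_rV_le => // i. rewrite !mxE eqxx/=; case: ltnP => ik.
      case: eqP ik => [->|_ _]; first by rewrite ltnn. by rewrite mulr0 addr0; exact: coord_le_norm.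
    rewrite add0r; case: eqP => _; rewrite ?mulr1 ?mulr0 ?normr0//. exact: le_trans rh hk.
  by rewrite ler_pM2l// ler_wpM2l.
have -> : f (x + h) - f x = \sum_(k < d) (f (x + z k.+1) - f (x + z k)).
  rewrite -(big_mkord xpredT (fun k => f (x + z k.+1) - f (x + z k))). by rewrite telescope_sumr// zd z0 addr0.
apply: le_trans (normc_sum _ _ _) _.
apply: le_trans (ler_sum _ (fun k _ => step k)) _.
rewrite sumr_const card_ord -mulr_natr le_eqVlt; apply/orP; left; apply/eqP; ring.
Qed.

Lemma cder_bounded_ccont f (g : 'I_d -> E -> C) (M : R) :
  (forall i, cder f i (g i)) -> (forall i x, normc (g i x) <= M) -> ccont f.
Proof.
move=> fg gM.
have main (p : C -> R) : (forall z w, `|p z - p w| <= normc (z - w)) -> continuous (p \o f).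
  move=> pl x; have Fx := nbhs_filter (x : E); apply/cvgrPdist_lt => e e0. have M1 : 0 < 2 * d%:R * `|M| + 1 by [].
  apply/(@nbhs_ballP R E); exists ((2 * d%:R * `|M| + 1)^-1 * e) => /=.
    side.
  move=> y; rewrite -ball_normE/= distrC => xy. apply: le_lt_trans (pl _ _) _; rewrite normc_distC.
  have -> : y = x + (y - x) by rewrite addrC subrK. apply: le_lt_trans (@cder_lip f g x (y - x) `|M| fg _) _.
    by move=> i z _; apply: le_trans (gM _ _) (ler_norm _).
  apply: (@le_lt_trans _ _ ((2 * d%:R * `|M| + 1) * `|y - x|)).
    by rewrite ler_wpM2r// lerDl.
  by rewrite -ltr_pdivlMl.
split; apply: main => z w; [rewrite -ReN -ReD|rewrite -ImN -ImD].
  exact: Re_le_normc.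
exact: Im_le_normc.
Qed.

Fixpoint leibniz s : seq (seq 'I_d * seq 'I_d) :=
  if s is i :: s' then
    [seq (i :: p.1, p.2) | p <- leibniz s'] ++ [seq (p.1, i :: p.2) | p <- leibniz s']
  else [:: ([::], [::])].

Lemma size_leibniz s : size (leibniz s) = (2 ^ size s)%N.
Proof. by elim: s => // i s IH; rewrite size_cat !size_map IH expnS mul2n addnn. Qed.

Lemma leibniz_size s p : p \in leibniz s -> (size p.1 <= size s)%N /\ (size p.2 <= size s)%N.
Proof.
elim: s p => [|i s IH] p /=; first by rewrite inE => /eqP ->.
rewrite mem_cat => /orP[] /mapP[[a b] /IH [h1 h2] ->]; split => //; exact: leqW.
Qed.

Lemma smoothM f g : smooth f -> smooth g -> smooth (fun x => f x * g x) /\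
  forall s, iter_partial s (fun x => f x * g x) =
    fun x => \sum_(p <- leibniz s) iter_partial p.1 f x * iter_partial p.2 g x.
Proof.
move=> fs gs; apply: smooth_of_family.
- by ext x; rewrite big_seq1.
- by move=> s; apply: ccont_sum => p; apply: ccontM; exact: smooth_ccont.
- move=> s i /=. have := @cder_sum _ (leibniz s) (fun p x => iter_partial p.1 f x * iter_partial p.2 g x) _ i
    (fun p => cderM (@smooth_cder f p.1 i fs) (@smooth_cder g p.2 i gs)).
  congr (cder _ _ _); ext x. by rewrite big_cat !big_map big_split.
Qed.

Lemma smoothM_bound f g s x (A B : R) : smooth f -> smooth g ->
  (forall t, (size t <= size s)%N -> normc (iter_partial t f x) <= A) ->
  (forall t, (size t <= size s)%N -> normc (iter_partial t g x) <= B) ->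
  normc (iter_partial s (fun x => f x * g x) x) <= 2 ^+ size s * (A * B).
Proof.
move=> fs gs fA gB; have [_ ->] := smoothM fs gs.
apply: le_trans (normc_sum _ _ _) _.
have : \sum_(p <- leibniz s) normc (iter_partial p.1 f x * iter_partial p.2 g x) <= \sum_(p <- leibniz s) A * B.
  rewrite !big_seq; apply: ler_sum => p /leibniz_size[h1 h2].
  by rewrite normcM; apply: ler_pM => /1/; [exact: fA|exact: gB].
move/le_trans; apply.
by rewrite big_const_seq count_predT size_leibniz iter_addr_0 -(mulr_natl (A * B) (2 ^ size s)) natrX.
Qed.

Lemma smooth_lin (a : C) f g : smooth f -> smooth g ->
  smooth (fun x => a * f x + g x) /\
  forall s, iter_partial s (fun x => a * f x + g x) =
    fun x => a * iter_partial s f x + iter_partial s g x.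
Proof.
move=> fs gs.
apply: (@smooth_of_family _ (fun s x => a * iter_partial s f x + iter_partial s g x)) => //.
- by move=> s; apply: ccontD; [apply: ccontM; [exact: ccont_cst|]|]; exact: smooth_ccont.
- move=> s i; apply: cderD; last exact: smooth_cder. have := cderM (@cder_cst a i) (@smooth_cder f s i fs).
  by congr cder; ext x; rewrite mul0r add0r.
Qed.

Lemma smooth_cst (a : C) : smooth (fun _ : E => a) /\
  forall s, iter_partial s (fun=> a) = fun=> if s is [::] then a else 0.
Proof.
apply: (@smooth_of_family _ (fun s _ => if s is [::] then a else 0)) => //.
- by move=> s; exact: ccont_cst.
- by move=> [|? ?] i; exact: cder_cst.
Qed.

Lemma continuous_affine (c : R) (b : E) : continuous (fun x : E => c *: x + b).
Proof.
move=> x; have Fx := nbhs_filter (x : E).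
by apply: cvgD; [apply: cvgZr; side|exact: cvg_cst].
Qed.

Lemma smooth_affine f (c : R) (b : E) : smooth f ->
  smooth (fun x => f (c *: x + b)) /\
  forall s, iter_partial s (fun x => f (c *: x + b)) =
    fun x => (c ^+ size s)%:C * iter_partial s f (c *: x + b).
Proof.
move=> fs.
apply: (@smooth_of_family _ (fun s x => (c ^+ size s)%:C * iter_partial s f (c *: x + b))).
- by ext x; rewrite expr0 mul1r.
- move=> s; apply: ccontM; first exact: ccont_cst.
  by apply: (@ccont_comp (iter_partial s f) (fun x => c *: x + b)); [exact: continuous_affine|exact: smooth_ccont].
- move=> s i. have := cderM (@cder_cst (c ^+ size s)%:C i) (cder_affine c b (@smooth_cder f s i fs)).
  congr cder; ext x; rewrite mul0r add0r mulrA; congr (_ * _).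
  by apply: complexP; rewrite/= ?mulr0 ?mul0r ?subr0 ?addr0// exprS mulrC.
Qed.

Lemma cder_cint (G G' : E -> E -> C) i :
  (forall y, cintble (fun x => G x y)) -> (forall x, cder (G x) i (G' x)) ->
  (forall y, exists w : E -> R, [/\ meas w, (nint w < +oo)%E &
     forall x r, `|r| <= 1 -> normc (G' x (y + r *: ev i)) <= w x]) ->
  cder (fun y => cint (fun x => G x y)) i (fun y => cint (fun x => G' x y)).
Proof.
move=> Gi GG' hw y; have [w [mw wy Gw]] := hw y.
have w0 x : 0 <= w x.
  by apply: le_trans (Gw x 0 _); rewrite ?normr0 ?normc_ge0.
have main (p : C -> R) (H H' : E -> E -> R) : (forall y, (@leb R d).-integrable setT (EFin \o (fun x => H x y))) ->
    (forall x y, is_derive y (ev i) (H x) (H' x y)) -> (forall x r, `|r| <= 1 -> `|H' x (y + r *: ev i)| <= w x) ->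
    is_derive y (ev i) (fun y => \int[@leb R d]_x H x y)%R (\int[@leb R d]_x H' x y)%R.
  move=> Hi HH' Hw. rewrite -[X in is_derive X](_ : y + 0 *: ev i = y); last by rewrite scale0r addr0.
  apply/is_derive_line. pose f (r : R) (x : E) := H x (y + r *: ev i).
  have fd r x : is_derive r (1:R) (f ^~ x) (H' x (y + r *: ev i)) by apply/is_derive_line.
  have I0 : `](-1 : R), 1[%classic 0 by rewrite /= in_itv/= oppr_lt0 ltr01.
  have wi : (@leb R d).-integrable setT (EFin \o w).
    apply/integrable_nint => //; rewrite (_ : (fun x => _) = w)//. by ext x; rewrite ger0_norm.
  have fi r : `](-1 : R), 1[%classic r -> (@leb R d).-integrable setT (EFin \o f r).
    by move=> _; exact: Hi.
  have fdr r x : `](-1 : R), 1[%classic r -> [set: E] x -> derivable (f ^~ x) r 1.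
    side.
  have fub r x : `](-1 : R), 1[%classic r -> [set: E] x -> `|partial1of2 f r x| <= w x.
    rewrite /= in_itv/= => /andP[r1 r2] _; rewrite partial1of2E (@derive_val _ _ _ _ _ _ _ (fd r x)).
    by apply: Hw; rewrite ler_norml !ltW.
  apply: DeriveDef.
    exact: (derivable_under_integral measurableT I0 fi fdr w0 wi fub).
  rewrite -derive1E (differentiation_under_integral measurableT I0 fi fdr w0 wi fub).
  apply: eq_Rintegral => x _; rewrite partial1of2E (@derive_val _ _ _ _ _ _ _ (fd 0 x)). by rewrite scale0r addr0.
split.
  apply: (main Re (fun x y => Re (G x y)) (fun x y => Re (G' x y))).
  - by move=> z; exact: (cintble_Re (Gi z)).
  - by move=> x z; exact: (GG' x z).1.
  - by move=> x z z1; apply: le_trans (Re_le_normc _) (Gw _ _ z1).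
apply: (main Im (fun x y => Im (G x y)) (fun x y => Im (G' x y))).
- by move=> z; exact: (cintble_Im (Gi z)).
- by move=> x z; exact: (GG' x z).2.
- by move=> x z z1; apply: le_trans (Im_le_normc _) (Gw _ _ z1).
Qed.

Lemma cder_vanish f i g (rho : R) : cder f i g ->
  (forall x, rho < `|x| -> f x = 0) -> forall x, rho < `|x| -> g x = 0.
Proof.
move=> fg f0 x xr.
have main (h : E -> R) (l : R) : (forall x, rho < `|x| -> h x = 0) -> is_derive x (ev i) h l -> l = 0.
  move=> h0 hd. have nz : \forall r \near (0 : R), h (x + r *: ev i) = 0.
    have c : (fun r : R => `|x + r *: ev i|) @ (0:R) --> `|x|.
      rewrite -[in X in _ --> X](addr0 x) -(scale0r (ev i)).
      apply: (continuous_comp (f := fun r : R => x + r *: ev i)); last exact: norm_continuous.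
      by apply: cvgD; [exact: cvg_cst|apply: cvgZl; side].
    apply: (@filterS _ _ (nbhs_filter (0:R)) _ _ _ (cvgr_gt _ c _ xr)) => r; exact: h0.
  have h1 : is_derive (0:R) (1:R) (fun r => h (x + r *: ev i)) l.
    by apply/is_derive_line; rewrite scale0r addr0.
  rewrite -(@derive_val _ _ _ _ _ _ _ h1) (near_eq_derive _ (g := cst 0))//.
    by rewrite derive_cst.
apply: complexP.
  apply: (main (Re \o f)); last exact: (fg x).1. by move=> z zr /=; rewrite f0.
apply: (main (Im \o f)); last exact: (fg x).2.
by move=> z zr /=; rewrite f0.
Qed.

End smooth_calculus.

(** * Schwartz functions and tempered distributions *)

Section schwartz_theory.
Variables (R : realType) (d : nat).
Local Notation E := 'rV[R]_d.
Local Notation C := R[i].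
Implicit Types (f g : E -> C) (x y : E) (s : seq 'I_d).

Lemma nint_wt (sigma : R) : (2 * d)%:R <= sigma ->
  (nint (@wt R d sigma) <= (pi ^+ d)%:E)%E.
Proof. exact: integral_wt. Qed.

(** A bound on a Schwartz seminorm formed with the maximum norm; the equivalence of norms makes
these interchangeable with the Euclidean seminorms. *)
Definition sbd (k : nat) s f (B : R) :=
  forall x, (1 + `|x|) ^+ k * normc (iter_partial s f x) <= B.

Lemma eucl_norm_ge (x : E) : `|x| <= eucl_norm x.
Proof.
apply: norm_rV_le; first exact: sqrtr_ge0.
move=> i; rewrite /eucl_norm -sqrtr_sqr; apply: ler_wsqrtr.
rewrite /dotp (bigD1 i)//= -expr2 lerDl sumr_ge0// => j _.
side.
Qed.

Lemma eucl_norm_le (x : E) : eucl_norm x <= d%:R * `|x|.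
Proof.
rewrite -[leRHS]ger0_norm// -sqrtr_sqr; apply: ler_wsqrtr.
via (d%:R * `|x| ^+ 2).
  have -> : d%:R * `|x| ^+ 2 = \sum_(i < d) `|x| ^+ 2.
    by rewrite sumr_const card_ord mulr_natl.
  apply: ler_sum => i _. by rewrite -expr2 -real_normK ?num_real// lerXn2r/1/; exact: coord_le_norm.
rewrite exprMn ler_wpM2r// -natrX ler_nat.
by case: d => // n; rewrite -{1}[n.+1]expn1 leq_pexp2l.
Qed.

Lemma schwartz_seminorm_le k s f (B : R) : sbd k s f B ->
  (schwartz_seminorm k s f <= ((1 + d%:R) ^+ k * B)%:E)%E.
Proof.
move=> h; apply: ge_ereal_sup => _ [x _ <-]; rewrite lee_fin.
apply: le_trans (ler_wpM2l _ (h x)) => /1/.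
rewrite mulrA ler_wpM2r/1/ -exprMn lerXn2r ?nnegrE//.
- by rewrite addr_ge0// sqrtr_ge0.
- via (1 + d%:R * `|x|); first by rewrite lerD2l eucl_norm_le.
  have t0 : 0 <= `|x| := normr_ge0 x; have n0 : 0 <= d%:R :> R := ler0n _ _. nra.
Qed.

Lemma schwartzP f : schwartz f <-> smooth f /\ forall k s, exists B, sbd k s f B.
Proof.
split => -[fs h]; split => // k s.
  have := h k s; case E0 : (schwartz_seminorm k s f) => [B| |] // _.
    exists B => x; rewrite -lee_fin -E0; apply: (@le_trans _ _ ((1 + eucl_norm x) ^+ k * normc (iter_partial s f x))%:E).
      rewrite lee_fin ler_wpM2r/1/ lerXn2r ?nnegrE ?addr_ge0 ?sqrtr_ge0//. by rewrite lerD2l eucl_norm_ge.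
    by apply: ereal_sup_ubound => /1/.
  exfalso; have : (-oo < schwartz_seminorm k s f)%E.
    apply: (@lt_le_trans _ _ ((1 + eucl_norm (0:E)) ^+ k * normc (iter_partial s f 0))%:E).
      by rewrite ltNyr.
    by apply: ereal_sup_ubound => /1/.
  by rewrite E0.
have [B hB] := h k s; apply: le_lt_trans (schwartz_seminorm_le hB) _.
by rewrite ltry.
Qed.

Lemma schwartz_smooth f : schwartz f -> smooth f.
Proof. by case. Qed.

Lemma schwartz_bd f k s : schwartz f -> exists2 B, 0 <= B & sbd k s f B.
Proof.
move=> /schwartzP[_ /(_ k s)[B hB]]; exists B => //.
by apply: le_trans (hB 0) => /1/.
Qed.

Lemma seq_bounded_choice (P : seq 'I_d -> R -> Prop) (n : nat) :
  (forall s, exists2 B, 0 <= B & P s B) ->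
  (forall s B B', B <= B' -> P s B -> P s B') ->
  exists2 B, 0 <= B & forall s, (size s <= n)%N -> P s B.
Proof.
move=> h mono; elim: n => [|n [B B0 hB]].
  have [B B0 hB] := h [::]; exists B => // s; rewrite leqn0 => /nilP -> /1/.
have /choice[b hb] : forall t : n.+1.-tuple 'I_d, exists B, 0 <= B /\ P t B.
  by move=> t; have [B' h1 h2] := h t; exists B'.
exists (B + \sum_t b t); first by rewrite addr_ge0// sumr_ge0// => t _; exact: (hb t).1.
move=> s; rewrite leq_eqVlt ltnS => /orP[/eqP sn|sn].
  have := (hb (tcast sn (in_tuple s))).2; rewrite val_tcast; apply: mono.
  rewrite (bigD1 (tcast sn (in_tuple s)))//= addrCA lerDl addr_ge0// sumr_ge0// => t _. exact: (hb t).1.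
apply: mono (hB s sn).
by rewrite lerDl sumr_ge0// => t _; exact: (hb t).1.
Qed.

Lemma schwartz_bd_le f k n : schwartz f ->
  exists2 B, 0 <= B & forall s, (size s <= n)%N -> sbd k s f B.
Proof.
move=> fs; apply: (seq_bounded_choice (P := fun s B => sbd k s f B)).
  by move=> s; exact: schwartz_bd.
by move=> s B B' BB h x; exact: le_trans (h x) BB.
Qed.

Lemma sbd_wt k s f B x : sbd k s f B -> normc (iter_partial s f x) <= B * wt k%:R x.
Proof.
by move=> h; rewrite wtX ler_pdivlMr// mulrC/1/.
Qed.

(** The decay in weights of arbitrary real exponent, the form in which Schwartz functions enter
all kernel estimates. *)
Lemma schwartz_decay f n (sigma : R) : schwartz f ->
  exists2 B, 0 <= B & forall s, (size s <= n)%N ->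
    forall x, normc (iter_partial s f x) <= B * wt sigma x.
Proof.
move=> fs; have [B B0 hB] := schwartz_bd_le (Num.bound `|sigma|) n fs.
exists B => // s sn x; apply: le_trans (sbd_wt x (hB s sn)) _.
rewrite ler_wpM2l// wt_le//.
by apply: le_trans (ler_norm _) _; rewrite ltW// archi_boundP.
Qed.

Lemma schwartz_ccont f s : schwartz f -> ccont (iter_partial s f).
Proof. by move=> fs; exact: smooth_ccont (schwartz_smooth fs). Qed.

Lemma schwartz_lin (a : C) f g : schwartz f -> schwartz g -> schwartz (fun x => a * f x + g x).
Proof.
move=> fs gs; have [h1 h2] := smooth_lin a (schwartz_smooth fs) (schwartz_smooth gs).
apply/schwartzP; split => // k s.
have [B B0 hB] := schwartz_bd k s fs; have [B' B0' hB'] := schwartz_bd k s gs.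
exists (normc a * B + B') => x; rewrite h2.
via ((1 + `|x|) ^+ k * (normc a * normc (iter_partial s f x) + normc (iter_partial s g x))).
  rewrite ler_wpM2l//; apply: le_trans (normc_triangle _ _) _. by rewrite normcM.
rewrite mulrDr; apply: lerD => //; rewrite mulrCA ler_wpM2l/1/.
Qed.

Lemma schwartz_cst0 : schwartz (fun _ : E => 0 : C).
Proof.
have [h1 h2] := @smooth_cst R d 0; apply/schwartzP; split => // k s.
by exists 0 => x; rewrite h2 -(_ : 0 = if s is [::] then 0 else 0 :> C) ?normc0; case: s.
Qed.

Lemma schwartzZ (a : C) f : schwartz f -> schwartz (fun x => a * f x).
Proof.
move=> fs; have := schwartz_lin a fs schwartz_cst0; congr schwartz.
by ext x; rewrite addr0.
Qed.

Lemma schwartzD f g : schwartz f -> schwartz g -> schwartz (fun x => f x + g x).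
Proof.
move=> fs gs; have := schwartz_lin 1 fs gs; congr schwartz.
by ext x; rewrite mul1r.
Qed.

Lemma schwartzB f g : schwartz f -> schwartz g -> schwartz (fun x => f x - g x).
Proof.
move=> fs gs; have := schwartz_lin (-1) gs fs; congr schwartz.
by ext x; rewrite mulN1r addrC.
Qed.

Lemma schwartz_sum (I : Type) (r : seq I) (F : I -> E -> C) :
  (forall i, schwartz (F i)) -> schwartz (fun x => \sum_(i <- r) F i x).
Proof.
move=> Fs; elim: r => [|i r IH].
  by under eq_fun do rewrite big_nil; exact: schwartz_cst0.
by under eq_fun do rewrite big_cons; exact: schwartzD.
Qed.

Lemma schwartz_affine f (c : R) (b : E) : c != 0 -> schwartz f -> schwartz (fun x => f (c *: x + b)).
Proof.
move=> c0 fs; have [h1 h2] := smooth_affine c b (schwartz_smooth fs).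
apply/schwartzP; split => // k s.
have [B B0 hB] := schwartz_bd k s fs.
pose m := 1 + `|c|^-1 * (1 + `|b|).
exists (`|c| ^+ size s * (m ^+ k * B)) => x; rewrite h2 normcM normcr normrX mulrCA.
rewrite ler_wpM2l//.
via (m ^+ k * ((1 + `|c *: x + b|) ^+ k * normc (iter_partial s f (c *: x + b)))).
  rewrite mulrA ler_wpM2r/1/ -exprMn lerXn2r ?nnegrE//.
    side.
  have c1 : 0 < `|c| by rewrite normr_gt0. have xe : `|x| <= `|c|^-1 * (`|c *: x + b| + `|b|).
    rewrite ler_pdivlMl// -normrZ. by apply: le_trans (ler_normB _ _); rewrite addrK.
  rewrite /m; set u := `|c *: x + b| in xe *; set v := `|b| in xe *; set w := `|c|^-1 in xe *.
  have u0 : 0 <= u := normr_ge0 _. have v0 : 0 <= v := normr_ge0 _. have w0 : 0 <= w => /1/.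
  have wu : 0 <= w * u => /1/. have wv : 0 <= w * v => /1/. have wvu : 0 <= w * v * u => /1/. nra.
by rewrite ler_wpM2l// exprn_ge0// addr_ge0// mulr_ge0.
Qed.

Lemma schwartz_iter f s : schwartz f -> schwartz (iter_partial s f).
Proof.
move=> fs; have [h1 h2] := smooth_iter s (schwartz_smooth fs).
apply/schwartzP; split => // k t; have [B _ hB] := schwartz_bd k (t ++ s) fs.
by exists B => x; rewrite h2.
Qed.

Lemma schwartz_mulp f g : schwartz f -> smooth g ->
  (forall n, exists B (m : nat), forall s x, (size s <= n)%N ->
     normc (iter_partial s g x) <= B * (1 + `|x|) ^+ m) ->
  schwartz (fun x => f x * g x).
Proof.
move=> fs gs gB; apply/schwartzP; split.
  by have [] := smoothM (schwartz_smooth fs) gs.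
move=> k s; have [B [m hB]] := gB (size s).
have [A A0 hA] := schwartz_bd_le (k + m) (size s) fs.
exists (2 ^+ size s * (A * B)) => x.
have bk n : 0 < (1 + `|x|) ^+ n by [].
have bk' n : (1 + `|x|) ^+ n != 0 by [].
rewrite mulrC -ler_pdivlMr//.
apply: le_trans (@smoothM_bound _ _ f g s x (A * (1 + `|x|) ^- (k + m))
  (B * (1 + `|x|) ^+ m) (schwartz_smooth fs) gs _ _) _.
- by move=> t ts; rewrite ler_pdivlMr// mulrC; exact: hA.
- by move=> t ts; exact: hB.
- by rewrite exprD le_eqVlt; apply/orP; left; apply/eqP; field; rewrite !bk'.
Qed.

Lemma ev_norm (i : 'I_d) : `|ev R i| <= 1.
Proof.
apply: norm_rV_le => // j; rewrite mxE eqxx/=.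
by case: eqP => _; rewrite ?normr1 ?normr0.
Qed.

Lemma wt_shift_le (sigma : R) x z : 0 <= sigma ->
  wt sigma (x + z) <= (1 + `|z|) `^ sigma * wt sigma x.
Proof.
move=> s0; have h1 := wt_submul (x + z) (- z) s0; rewrite addrK wtN in h1.
have h3 : (1 + `|z|) `^ sigma * wt sigma z = 1.
  by rewrite /wt powRN divff// gt_eqF powR_gt0.
via ((1 + `|z|) `^ sigma * wt sigma z * wt sigma (x + z)).
  by rewrite h3 mul1r.
by rewrite -mulrA ler_wpM2l// mulrC.
Qed.

(** The derivative at x + h is bounded by the weight at x, at the price of a power of 1 + |h|.
*)
Lemma schwartz_lip f n (sigma : R) : 0 <= sigma -> schwartz f ->
  exists2 B, 0 <= B & forall s, (size s <= n)%N -> forall x h, 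
    normc (iter_partial s f (x + h) - iter_partial s f x) <=
      B * `|h| * (1 + `|h|) `^ sigma * wt sigma x.
Proof.
move=> s0 fs; have [B B0 hB] := schwartz_decay n.+1 sigma fs.
exists (2 * d%:R * B) => /1/.
move=> s sn x h.
apply: le_trans (@cder_lip R d _ (fun i => iter_partial (i :: s) f) x h
  (B * ((1 + `|h|) `^ sigma * wt sigma x)) _ _) _.
- by move=> i; exact: smooth_cder (schwartz_smooth fs).
- move=> i z zh; apply: le_trans (hB (i :: s) _ _) _ => //. rewrite ler_wpM2l//.
  have h1 := wt_submul (x + z) (- z) s0; rewrite addrK wtN in h1.
  have h2 : wt sigma h <= wt sigma z by exact: wt_norm_le. have h3 : (1 + `|h|) `^ sigma * wt sigma h = 1.
    by rewrite /wt powRN divff// gt_eqF powR_gt0.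
  via ((1 + `|h|) `^ sigma * wt sigma h * wt sigma (x + z)).
    by rewrite h3 mul1r.
  rewrite -mulrA ler_wpM2l//. rewrite mulrC; apply: le_trans h1. by rewrite ler_wpM2l ?wt_ge0.
- by rewrite le_eqVlt; apply/orP; left; apply/eqP; ring.
Qed.

Lemma schwartz_cintble f s : schwartz f -> cintble (iter_partial s f).
Proof.
move=> fs; have [B B0 hB] := schwartz_decay (size s) (2 * d)%:R fs.
apply: (@cintble_dom _ _ _ (fun x => B * wt (2 * d)%:R x)).
- by apply: ccont_cmeas; exact: schwartz_ccont.
- side.
- by move=> x; exact: hB.
- rewrite nintZ//; last 2 first.
  + side.
  + side.
  apply: lte_mul_pinfty => /1/. by apply: le_lt_trans (nint_wt (lexx _)) _; rewrite ltry.
Qed.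

Lemma tempered_bound (u : raw_distribution R d) : tempered u ->
  exists M (k : nat), 0 <= M /\ forall f B, schwartz f ->
    (forall s, (size s <= k)%N -> sbd k s f B) -> normc (u f) <= M * B.
Proof.
move=> [_ [M [k hM]]].
exists (`|M| * \sum_(n < k.+1) \sum_(s : n.-tuple 'I_d) (1 + d%:R) ^+ k), k; split.
  by rewrite mulr_ge0// sumr_ge0// => n _/1/.
move=> f B fs fB; rewrite -lee_fin; apply: le_trans (hM f fs) _.
have S0 (n : nat) (s : n.-tuple 'I_d) : (0 <= schwartz_seminorm k s f)%E.
  apply: (@le_trans _ _ ((1 + eucl_norm (0:E)) ^+ k * normc (iter_partial s f 0))%:E).
    by rewrite lee_fin mulr_ge0/1/ exprn_ge0// addr_ge0// sqrtr_ge0.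
  by apply: ereal_sup_ubound => /1/.
apply: (@le_trans _ _ (`|M|%:E * \sum_(n < k.+1) \sum_(s : n.-tuple 'I_d) schwartz_seminorm k s f)%E).
  apply: lee_wpmul2r; last by rewrite lee_fin ler_norm. by apply: sume_ge0 => n _; apply: sume_ge0.
rewrite -mulrA EFinM; apply: lee_wpmul2l => /1/.
rewrite mulr_suml -sumEFin; apply: lee_sum => n _.
rewrite mulr_suml -sumEFin; apply: lee_sum => s _.
apply: schwartz_seminorm_le; apply: fB; rewrite size_tuple -ltnS/1/.
Qed.

Lemma tempered_lin (u : raw_distribution R d) (a : C) f g : tempered u ->
  schwartz f -> schwartz g -> u (fun x => a * f x + g x) = a * u f + u g.
Proof. by move=> [h _]; exact: h. Qed.

Lemma tempered0 (u : raw_distribution R d) : tempered u -> u (fun=> 0) = 0.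
Proof.
move=> ut; have := tempered_lin 1 ut schwartz_cst0 schwartz_cst0.
rewrite (_ : (fun x => 1 * 0 + 0) = fun=> 0); last by ext x; rewrite mul1r addr0.
by rewrite mul1r => /eqP; rewrite -subr_eq0 opprD addrA subrr sub0r oppr_eq0 => /eqP.
Qed.

Lemma temperedZ (u : raw_distribution R d) (a : C) f : tempered u ->
  schwartz f -> u (fun x => a * f x) = a * u f.
Proof.
move=> ut fs; have := tempered_lin a ut fs schwartz_cst0; rewrite tempered0// addr0 => <-.
by congr u; ext x; rewrite addr0.
Qed.

Lemma temperedD (u : raw_distribution R d) f g : tempered u ->
  schwartz f -> schwartz g -> u (fun x => f x + g x) = u f + u g.
Proof.
move=> ut fs gs; have := tempered_lin 1 ut fs gs; rewrite mul1r => <-.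
by congr u; ext x; rewrite mul1r.
Qed.

Lemma temperedB (u : raw_distribution R d) f g : tempered u ->
  schwartz f -> schwartz g -> u (fun x => f x - g x) = u f - u g.
Proof.
move=> ut fs gs; have := tempered_lin (-1) ut gs fs; rewrite mulN1r addrC => <-.
by congr u; ext x; rewrite mulN1r addrC.
Qed.

Lemma tempered_sum (u : raw_distribution R d) (I : Type) (r : seq I) (F : I -> E -> C) :
  tempered u -> (forall i, schwartz (F i)) ->
  u (fun x => \sum_(i <- r) F i x) = \sum_(i <- r) u (F i).
Proof.
move=> ut Fs; elim: r => [|i r IH].
  by under eq_fun do rewrite big_nil; rewrite big_nil tempered0.
under eq_fun do rewrite big_cons.
by rewrite big_cons temperedD ?IH//; exact: schwartz_sum.
Qed.

End schwartz_theory.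

(** * Joint measurability *)

Section joint_measurability.
Variables (R : realType) (d : nat).
Local Notation E := 'rV[R]_d.
Local Notation C := R[i].

Lemma measurable_rV_comp d' (T : measurableType d') (h : T -> E) i :
  meas h -> meas (fun t => h t 0 i).
Proof. by move=> mh; exact: (measurableT_comp (@measurable_coord R d i) mh). Qed.

Lemma measurable_rVD d' (T : measurableType d') (h k : T -> E) :
  meas h -> meas k -> meas (fun t => h t + k t).
Proof.
move=> mh mk; apply: measurable_fun_rVP => i.
under eq_fun do rewrite !mxE.
by apply: measurable_funD; exact: measurable_rV_comp.
Qed.

Lemma measurable_rVZ d' (T : measurableType d') (h : T -> E) (c : R) :
  meas h -> meas (fun t => c *: h t).
Proof.
move=> mh; apply: measurable_fun_rVP => i.
under eq_fun do rewrite !mxE.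
by apply: measurable_funM => //; exact: measurable_rV_comp.
Qed.

Lemma measurable_rVB d' (T : measurableType d') (h k : T -> E) :
  meas h -> meas k -> meas (fun t => h t - k t).
Proof.
move=> mh mk; apply: measurable_rVD => //.
rewrite (_ : (fun _ => _) = fun t => (-1) *: k t); first exact: measurable_rVZ.
by ext t; rewrite scaleN1r.
Qed.

Lemma measurable_dotp d' (T : measurableType d') (h k : T -> E) :
  meas h -> meas k -> meas (fun t => dotp (h t) (k t)).
Proof.
move=> mh mk; apply: measurable_sum => i.
by apply: measurable_funM; exact: measurable_rV_comp.
Qed.

Lemma cfubini_dom (F : E -> E -> C) (f g : E -> R) :
  cmeas (fun z : E * E => F z.1 z.2) ->
  meas f -> meas g ->
  (forall x, 0 <= f x) -> (forall x, 0 <= g x) ->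
  (nint f < +oo)%E -> (nint g < +oo)%E ->
  (forall x y, normc (F x y) <= f x * g y) ->
  cint (fun x => cint (F x)) = cint (fun y => cint (fun x => F x y)).
Proof.
move=> mF mf mg f0 g0 fy gy Fb; apply: cfubini => //.
apply: (@le_lt_trans _ _ (\int[@leb R d]_x ((f x)%:E * nint g))%E).
  have mnF : meas (fun z : E * E => (normc (F z.1 z.2))%:E).
    by apply/measurable_EFinP; side.
  apply: ge0_le_integral => //.
  - by move=> x _; apply: integral_ge0 => y _; rewrite lee_fin normc_ge0.
  - apply: (measurable_fun_fubini_tonelli_F (m2 := @leb R d) (fun z : E * E => (normc (F z.1 z.2))%:E)) => //.
    by move=> z; rewrite lee_fin normc_ge0.
  - by apply: emeasurable_funM => /1/; exact/measurable_EFinP.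
  - move=> x _; rewrite -nintZ//; apply: ge0_le_integral => //.
    + by move=> y _; rewrite lee_fin normc_ge0.
    + exact: (@measurable_fun_pair2 _ _ _ _ _ _ (fun z : E * E => (normc (F z.1 z.2))%:E) x mnF).
    + by apply/measurable_EFinP; side.
    + by move=> y _; rewrite lee_fin.
rewrite ge0_integralZr//.
- by apply: lte_mul_pinfty => //; [exact: nint_ge0|rewrite ge0_fin_numE ?nint_ge0].
- exact/measurable_EFinP.
- by move=> x _; rewrite lee_fin.
- exact: nint_ge0.
Qed.

End joint_measurability.

(** * The Fourier transform of exp(-|t|) *)

Section cauchy_kernel.
Variable R : realType.
Local Notation leb1 := (@lebesgue_measure R).
Local Notation C := R[i].

Lemma integral_expabs_cos (s : R) :
  (\int[leb1]_t (expR (- `|t|) * (1 + cos (s * t)))%:E = (2 + 2 / (1 + s ^+ 2))%:E)%E.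
Proof.
have D0 : 1 + s ^+ 2 != 0 => /1/.
pose f (t : R) := expR (- `|t|) * (1 + cos (s * t)).
have f0 t : 0 <= f t.
  by rewrite mulr_ge0// -lerBlDl sub0r cos_geN1.
have cst1 : continuous (fun t : R => s * t) by move=> t; apply: cvgMr; side.
have cf : continuous f.
  move=> t; apply: cvgM.
    apply: (continuous_comp (f := fun t : R => - `|t|)); last exact: continuous_expR.
    by apply: cvgN; exact: norm_continuous.
  apply: cvgD; first exact: cvg_cst.
  by apply: (continuous_comp (f := fun t : R => s * t)); [exact: cst1|exact: continuous_cos].
rewrite (ge0_symfun_integralT f0 cf); last first.
  by move=> t; rewrite /f/= normrN mulrN cosN.
rewrite (_ : [set t | (0 <= t)%R] = `[0, +oo[%classic); last first.
  by apply/seteqP; split => t /=; rewrite in_itv andbT.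
pose F (t : R) := expR (- t) * ((s * sin (s * t) - cos (s * t)) / (1 + s ^+ 2) - 1).
have dF t : is_derive t (1:R) F (expR (- t) * (1 + cos (s * t))).
  have h1 : is_derive t (1:R) (fun t => s * t) s.
    have := @is_deriveZ _ _ _ id s t (1:R) 1 (is_derive_id _ _). by rewrite /GRing.scale/= mulr1.
  have h2 := is_derive1_comp (is_derive_sin (s * t)) h1. have h3 := is_derive1_comp (is_derive_cos (s * t)) h1.
  have h4 : is_derive t (1:R) (fun t => - t) (-1) by exact: is_deriveN.
  have h5 := is_derive1_comp (is_derive_expR (- t)) h4.
  have h6 := is_deriveB (is_deriveZ (1 + s ^+ 2)^-1 (is_deriveB (is_deriveZ s h2) h3))
    (is_derive_cst (1 : R) t (1:R)).
  have := is_deriveM h5 h6. rewrite (_ : _ * _ = F); last first.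
    by ext r; rewrite /F !fctE/= /GRing.scale/= mulrC [_^-1 * _]mulrC mulrC.
  move=> h; apply: (is_derive_eq h). by rewrite !fctE/= /GRing.scale/=; field.
rewrite (@ge0_continuous_FTC2y _ _ F 0 0)//.
- rewrite /F oppr0 expR0 mulr0 sin0 cos0 mulr0 sub0e -EFinN -EFinM; congr EFin; field. by [].
- exact: continuous_subspaceT.
- pose M : R := (`|s| + 1) / (1 + s ^+ 2) + 1. have FM t : `|F t| <= expR (- t) * M.
    rewrite /F normrM ger0_norm// ler_wpM2l//. apply: le_trans (ler_normB _ _) _; rewrite normr1 lerD2r normrM.
    rewrite (ger0_norm (x := (1 + s ^+ 2)^-1))/1/. rewrite ler_wpM2r/1/.
    apply: le_trans (ler_normB _ _) _; apply: lerD; last by rewrite ler_norml cos_geN1 cos_le1.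
    by rewrite normrM ler_piMr// ler_norml sin_geN1 sin_le1.
  have e0 : (fun t => expR (- t) * M) @ +oo%R --> (0:R).
    rewrite -[in X in _ --> X](mul0r M); apply: cvgMl; exact: cvgr_expR.
  apply/cvgrPdist_le => e epos. move/cvgrPdist_le : e0 => /(_ e epos); apply: filterS => t.
  rewrite !sub0r !normrN => h; apply: le_trans (FM t) _. exact: le_trans (ler_norm _) h.
- apply: cvg_at_right_filter; apply: differentiable_continuous; apply/derivable1_diffP. side.
- move=> t; rewrite in_itv/= andbT => t0. by rewrite derive1E (@derive_val _ _ _ _ _ _ _ (dF t)) /f gtr0_norm.
Qed.

Lemma integral_expabs : (\int[leb1]_t (expR (- `|t|))%:E = 2%:E)%E.
Proof.
have mexp : meas (fun t : R => expR (- `|t|)).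
  apply: continuous_measurable_fun => t.
  apply: (continuous_comp (f := fun t : R => - `|t|)); last exact: continuous_expR.
  by apply: cvgN; exact: norm_continuous.
have h := integral_expabs_cos 0.
have h2 : (\int[leb1]_t (expR (- `|t|) * (1 + cos (0 * t)))%:E = 2%:E * \int[leb1]_t (expR (- `|t|))%:E)%E.
  rewrite -ge0_integralZl//.
  - by apply: eq_integral => t _; rewrite mul0r cos0 -EFinM; congr EFin; ring.
  - exact/measurable_EFinP.
move: h; rewrite h2 => h3.
have fin : (\int[leb1]_t (expR (- `|t|))%:E)%E \is a fin_num.
  rewrite ge0_fin_numE/1/; last by apply: integral_ge0 => t _. rewrite ltey; apply/eqP => hy; move: h3; rewrite hy.
  by rewrite mulry gtr0_sg// mul1e.
move: h3; rewrite -(fineK fin) -EFinM => -[]; rewrite expr0n addr0 divr1 => h3.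
by congr EFin; apply: (@mulfI _ 2) => //; rewrite h3; ring.
Qed.

Lemma measurable_expabs_trig (s : R) (b : bool) (c : R) :
  meas (fun t : R => expR (- `|t|) * (c + (if b then cos (s * t) else sin (s * t)))).
Proof.
apply: continuous_measurable_fun => t; apply: cvgM.
  apply: (continuous_comp (f := fun t : R => - `|t|)); last exact: continuous_expR.
  by apply: cvgN; exact: norm_continuous.
apply: cvgD; first exact: cvg_cst.
have cst1 : {for t, continuous (fun t : R => s * t)} by apply: cvgMr; side.
by case: b; apply: (continuous_comp (f := fun t : R => s * t)) => //; [exact: continuous_cos|exact: continuous_sin].
Qed.

Lemma integrable_expabs_trig (s : R) (b : bool) :
  leb1.-integrable setT (EFin \o (fun t : R => expR (- `|t|) * (if b then cos (s * t) else sin (s * t)))).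
Proof.
have m0 := measurable_expabs_trig s b 0.
have m1 : meas (fun t : R => expR (- `|t|) * (if b then cos (s * t) else sin (s * t))).
  by move: m0; congr measurable_fun; ext t; rewrite add0r.
apply/integrableP; split; first exact/measurable_EFinP.
apply: (@le_lt_trans _ _ 2%:E); last by rewrite ltry.
rewrite -integral_expabs; apply: ge0_le_integral => //.
- by apply: measurableT_comp => //; exact/measurable_EFinP.
- have := measurable_expabs_trig 0 true 0; rewrite /= => h.
  apply/measurable_EFinP; move: h; congr measurable_fun; ext t. by rewrite mul0r cos0 add0r mulr1.
- move=> t _; rewrite lee_fin normrM ger0_norm// ler_piMr//.
  by case: b {m0 m1}; rewrite ler_norml ?cos_geN1 ?cos_le1 ?sin_geN1 ?sin_le1.
Qed.

Lemma Rint_expabs_cos (s : R) :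
  (\int[leb1]_t (expR (- `|t|) * cos (s * t)) = 2 / (1 + s ^+ 2))%R.
Proof.
have i1 := integrable_expabs_trig s true; have i0 := integrable_expabs_trig 0 true.
have := RintegralD measurableT i1 i0 => /1/.
have -> : (\int[leb1]_t (expR (- `|t|) * cos (0 * t)) = 2)%R.
  rewrite /Rintegral -[RHS]/(fine 2%:E) -integral_expabs; congr fine.
  by apply: eq_integral => t _; rewrite mul0r cos0 mulr1.
have -> : (\int[leb1]_t (expR (- `|t|) * cos (s * t) + expR (- `|t|) * cos (0 * t)) = 2 + 2 / (1 + s ^+ 2))%R.
  rewrite /Rintegral -[RHS]/(fine (2 + 2 / (1 + s ^+ 2))%:E) -integral_expabs_cos; congr fine.
  by apply: eq_integral => t _; rewrite mul0r cos0; congr EFin; ring.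
by move=> h; apply: (@addIr _ 2); rewrite -h addrC.
Qed.

Lemma Rint_expabs_sin (s : R) : (\int[leb1]_t (expR (- `|t|) * sin (s * t)) = 0)%R.
Proof.
have i1 := integrable_expabs_trig s false; have i0 := integrable_expabs_trig 0 true.
have e1 := RintegralD measurableT i0 i1; have e2 := RintegralB measurableT i0 i1.
pose g (t : R) := (expR (- `|t|) * (1 + sin (s * t)))%:E.
have g0 t : (0 <= g t)%E.
  by rewrite lee_fin mulr_ge0// -lerBlDl sub0r sin_geN1.
have mg : meas g.
  by apply/measurable_EFinP; exact: (measurable_expabs_trig s false 1).
have := leb1_affine 0 (_ : -1 != 0 :> R) mg g0.
rewrite oppr_eq0 oner_neq0 normrN1 invr1 mul1e => /(_ isT) h.
have hf : (\int[leb1]_t (expR (- `|t|) * cos (0 * t) + expR (- `|t|) * sin (s * t)) =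
   \int[leb1]_t (expR (- `|t|) * cos (0 * t) - expR (- `|t|) * sin (s * t)))%R.
  rewrite /Rintegral; congr fine. transitivity (\int[leb1]_t g t)%E.
    by apply: eq_integral => t _; rewrite /g mul0r cos0; congr EFin; ring.
  rewrite -h; apply: eq_integral => t _. rewrite /g mul0r cos0 mulN1r addr0 normrN mulrN sinN; congr EFin; ring.
rewrite /= in e1 e2; move: hf; rewrite e1 e2 => /addrI/eqP.
by rewrite -subr_eq0 opprK -mulr2n mulrn_eq0 => /eqP.
Qed.

Definition tail n (z : 'rV[R]_n.+1) : 'rV[R]_n := \row_i z 0 (lift ord0 i).

Lemma measurable_tail n : meas (@tail n).
Proof.
apply: measurable_fun_rVP => i; under eq_fun do rewrite mxE.
exact: measurable_coord.
Qed.

Lemma Rint_succ_prod n (a : R -> R) (b : 'rV[R]_n -> R) :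
  leb1.-integrable setT (EFin \o a) -> (@leb R n).-integrable setT (EFin \o b) ->
  (@leb R n.+1).-integrable setT
     (EFin \o (fun z : 'rV[R]_n.+1 => a (z 0 ord0) * b (tail z))) /\
  (\int[@leb R n.+1]_z (a (z 0 ord0) * b (tail z)) =
   \int[leb1]_t a t * \int[@leb R n]_x b x)%R.
Proof.
move=> ai bi.
have ma : meas a by apply/measurable_EFinP; case/integrableP : ai.
have mb : meas b by apply/measurable_EFinP; case/integrableP : bi.
pose f (z : 'rV[R]_n.+1) := (a (z 0 ord0) * b (tail z))%:E.
have fE x t : f (cons_rV (x, t)) = (a t * b x)%:E.
  rewrite /f cons_rV_ord0; congr (_ * b _)%:E. by apply/rowP => i; rewrite mxE cons_rV_lift.
have mf : meas f.
  apply/measurable_EFinP; apply: measurable_funM.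
    by apply: (measurableT_comp ma); exact: measurable_coord.
  by apply: (measurableT_comp mb); exact: measurable_tail.
pose fp (p : 'rV[R]_n * measurableTypeR R) := (a p.2 * b p.1)%:E.
have mfp : meas fp.
  by apply/measurable_EFinP; apply: measurable_funM; [exact: (measurableT_comp ma)|exact: (measurableT_comp mb)].
have fpi : (@leb R n \x leb1)%E.-integrable setT fp.
  apply: (integrable21ltyP (@leb R n) leb1 mfp).2. have -> : (\int[leb1]_t \int[@leb R n]_x `|fp (x, t)| =
      \int[leb1]_t (`|(a t)%:E| * \int[@leb R n]_x `|(b x)%:E|))%E.
    apply: eq_integral => t _; rewrite -ge0_integralZl//.
    - by apply: eq_integral => x _; rewrite /fp/= -EFinM normrM.
    - by apply: measurableT_comp => //; exact/measurable_EFinP.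
  have hb : (\int[@leb R n]_x `|(b x)%:E| < +oo)%E by case/integrableP : bi.
  have hb0 : (0 <= \int[@leb R n]_x `|(b x)%:E|)%E by apply: integral_ge0.
  rewrite ge0_integralZr//; last by apply: measurableT_comp => //; exact/measurable_EFinP.
  apply: lte_mul_pinfty => /1/.
    exact: integral_ge0.
  by rewrite ge0_fin_numE; [case/integrableP : ai|exact: integral_ge0].
have mc := @measurable_cons_rV R n.
have fcE : f \o @cons_rV R n = fp by apply/funext => -[x t]; exact: fE.
have ip : (pushforward (@leb R n \x leb1)%E (@cons_rV R n)).-integrable setT f.
  by apply: integrable_pushforward => //; rewrite preimage_setT fcE.
split => /1/.
rewrite /Rintegral.
transitivity (fine (\int[pushforward (@leb R n \x leb1)%E (@cons_rV R n)]_z f z)%E) => //.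
rewrite integral_pushforward// preimage_setT.
have -> : (\int[@leb R n \x leb1]_p (f \o @cons_rV R n) p = \int[@leb R n \x leb1]_p fp p)%E.
  by rewrite fcE.
rewrite -(integral21_prod_meas1 fpi) /fubini_G.
have fb : (\int[@leb R n]_x (b x)%:E)%E \is a fin_num by exact: integrable_fin_num.
have fa : (\int[leb1]_t (a t)%:E)%E \is a fin_num by exact: integrable_fin_num.
rewrite -fineM//; congr fine.
rewrite -(fineK fb).
transitivity (\int[leb1]_t ((a t)%:E * (fine (\int[@leb R n]_x (b x)%:E))%:E))%E.
  by apply: eq_integral => t _; rewrite (fineK fb) -integralZl.
exact: integralZr.
by rewrite fcE.
Qed.

End cauchy_kernel.

Section poisson.
Variable R : realType.
Local Notation leb1 := (@lebesgue_measure R).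
Local Notation C := R[i].

(** This kernel regularizes the inversion integral. Its transform [cauchyker] is a product of
Cauchy densities, whose total mass is elementary. *)
Definition expker d (y : 'rV[R]_d) : R := \prod_i expR (- `|y 0 i|).
Definition cauchyker d (z : 'rV[R]_d) : R := \prod_i (2 / (1 + (z 0 i) ^+ 2)).

Lemma dotp_succ n (y z : 'rV[R]_n.+1) :
  dotp y z = y 0 ord0 * z 0 ord0 + dotp (tail y) (tail z).
Proof. by rewrite /dotp big_ord_recl; congr (_ + _); apply: eq_bigr => i _; rewrite !mxE. Qed.

Lemma expker_succ n (y : 'rV[R]_n.+1) : expker y = expR (- `|y 0 ord0|) * expker (tail y).
Proof. by rewrite /expker big_ord_recl; congr (_ * _); apply: eq_bigr => i _; rewrite mxE. Qed.

Lemma expker_ge0 d (y : 'rV[R]_d) : 0 <= expker y.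
Proof. by apply: prodr_ge0 => i _/1/. Qed.

Lemma expker_le1 d (y : 'rV[R]_d) : expker y <= 1.
Proof.
rewrite [leRHS](_ : 1 = \prod_(i < d) (1:R)); last by rewrite big1.
by apply: ler_prod => i _; rewrite expR_ge0/= -[leRHS]expR0 ler_expR oppr_le0.
Qed.

Lemma measurable_expker d : meas (@expker d).
Proof.
apply: measurable_prod => i _.
apply: (measurableT_comp (f := fun t : R => expR (- `|t|))); last exact: measurable_coord.
apply: continuous_measurable_fun => t.
apply: (continuous_comp (f := fun t : R => - `|t|)); last exact: continuous_expR.
by apply: cvgN; exact: norm_continuous.
Qed.

Lemma cauchyker_ge0 d (z : 'rV[R]_d) : 0 <= cauchyker z.
Proof. by apply: prodr_ge0 => i _/1/. Qed.

Lemma measurable_cauchy1 : meas (fun t : R => 2 / (1 + t ^+ 2)).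
Proof.
apply: measurable_funM => //.
by apply: continuous_measurable_fun; exact: continuous_oneDsqrV.
Qed.

Lemma measurable_cauchyker d : meas (@cauchyker d).
Proof.
apply: measurable_prod => i _.
by apply: (measurableT_comp measurable_cauchy1); exact: measurable_coord.
Qed.

Lemma nint_expker d : (nint (@expker d) < +oo)%E.
Proof.
rewrite /nint (@ge0_integral_prod R d (fun _ t => expR (- `|t|))).
- under eq_bigr do rewrite integral_expabs. by rewrite -(big_morph EFin EFinM erefl) ltry.
- move=> _; apply: continuous_measurable_fun => t.
  apply: (continuous_comp (f := fun t : R => - `|t|)); last exact: continuous_expR.
  by apply: cvgN; exact: norm_continuous.
- side.
Qed.

Lemma nint_cauchyker d : nint (@cauchyker d) = ((2 * pi) ^+ d)%:E.
Proof.
rewrite /nint (@ge0_integral_prod R d (fun _ t => 2 / (1 + t ^+ 2))).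
- have -> : (\int[leb1]_t (2 / (1 + t ^+ 2))%:E = (2 * pi)%:E)%E.
    under eq_integral do rewrite EFinM. rewrite ge0_integralZl//.
    + by rewrite integral_oneDsqrV.
    + apply/measurable_EFinP; apply: continuous_measurable_fun; exact: continuous_oneDsqrV.
    + by move=> t _; rewrite lee_fin invr_ge0 addr_ge0/1/.
  by rewrite -(big_morph EFin EFinM erefl) prodr_const card_ord.
- by move=> _; exact: measurable_cauchy1.
- side.
Qed.

Lemma cauchy_transform d (z : 'rV[R]_d) :
  cintble (fun y => (expker y)%:C * cis (dotp y z)) /\
  cint (fun y => (expker y)%:C * cis (dotp y z)) = (cauchyker z)%:C.
Proof.
have key n (z' : 'rV[R]_n) : cintble (fun y => (expker y)%:C * cis (dotp y z')).
  apply: (@cintble_dom _ _ _ (@expker n)).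
  - apply: cmeasM; first by apply: cmeas_real; exact: measurable_expker. by apply: cmeas_cis; apply: measurable_dotp.
  - exact: measurable_expker.
  - by move=> y; rewrite normcM normcr normc_cis mulr1 ger0_norm ?expker_ge0.
  - exact: nint_expker.
split => /1/.
elim: d z => [|n IH] z.
  have E1 (y : 'rV[R]_0) : (expker y)%:C * cis (dotp y z) = 1.
    by rewrite /expker /dotp !big_ord0 cis0 mulr1.
  under eq_fun do rewrite E1. rewrite /cauchyker big_ord0. have h1 : (\int[@leb R 0]__ 1 = 1)%R.
    rewrite /Rintegral integral_cst// mul1e. by rewrite [X in fine X](_ : _ = 1%E)//; exact: diracT.
  by apply: complexP => //=; rewrite /Rintegral integral_cst// mul0e.
have ki := key n (tail z).
have := IH (tail z).
pose t0 := z 0 ord0.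
pose A t := expR (- `|t|) * cos (t0 * t); pose B t := expR (- `|t|) * sin (t0 * t).
have Ai : leb1.-integrable setT (EFin \o A) := integrable_expabs_trig t0 true.
have Bi : leb1.-integrable setT (EFin \o B) := integrable_expabs_trig t0 false.
set H := (fun y : 'rV[R]_n => _) in ki *.
have HR := cintble_Re ki; have HI := cintble_Im ki.
move=> IHz.
have [hR hI] : Re (cint H) = cauchyker (tail z) /\ Im (cint H) = 0 by rewrite IHz.
have [i1 e1] := Rint_succ_prod Ai HR; have [i2 e2] := Rint_succ_prod Bi HI.
have [i3 e3] := Rint_succ_prod Ai HI; have [i4 e4] := Rint_succ_prod Bi HR.
have FE y : (expker y)%:C * cis (dotp y z) = (A (y 0 ord0) +i* B (y 0 ord0))%C * H (tail y).
  rewrite /H expker_succ dotp_succ cisD /A /B (mulrC t0) -/(cis _).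
  rewrite (_ : (_ +i* _)%C = (expR (- `|y 0 ord0|))%:C * cis (y 0 ord0 * t0)); last first.
    by apply: complexP; rewrite/= ?mul0r ?subr0 ?addr0.
  by rewrite rmorphM mulrACA.
apply: complexP.
  transitivity (Rintegral (@leb R n.+1) setT (fun y : 'rV[R]_n.+1 => A (y 0 ord0) * (@Re R \o H) (tail y) -
     B (y 0 ord0) * (@Im R \o H) (tail y))).
    by apply: eq_Rintegral => y _; rewrite FE ReM.
  rewrite RintegralB// e1 e2. rewrite -[X in _ * X - _]/(Re (cint H)) -[X in _ - _ * X]/(Im (cint H)) hR hI.
  rewrite mulr0 subr0 /A Rint_expabs_cos /cauchyker big_ord_recl; congr (_ * _).
  by apply: eq_bigr => i _; rewrite mxE.
transitivity (Rintegral (@leb R n.+1) setT (fun y : 'rV[R]_n.+1 => A (y 0 ord0) * (@Im R \o H) (tail y) +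
     B (y 0 ord0) * (@Re R \o H) (tail y))).
  by apply: eq_Rintegral => y _; rewrite FE ImM.
rewrite RintegralD// e3 e4.
rewrite -[X in _ * X + _]/(Im (cint H)) -[X in _ + _ * X]/(Re (cint H)) hR hI.
by rewrite mulr0 add0r /B Rint_expabs_sin mul0r.
Qed.

End poisson.

Ltac side_vector ::= first
  [ apply: measurable_rVB | apply: measurable_rVD | apply: measurable_rVZ ].
Ltac side_schwartz ::= match goal with
  | H : schwartz ?f |- smooth ?f => exact: schwartz_smooth H
  | H : schwartz ?f |- ccont ?f => exact: schwartz_ccont [::] H
  | H : schwartz ?f |- cmeas ?f => exact: ccont_cmeas (schwartz_ccont [::] H)
  | H : schwartz ?f |- cintble ?f => exact: schwartz_cintble [::] H
  end.

(** * Fourier inversion for Schwartz functions *)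

Section fourier.
Variables (R : realType) (d : nat).
Local Notation E := 'rV[R]_d.
Local Notation C := R[i].
Local Notation ift := (@inverse_fourier R d).
Implicit Types (f g phi psi : E -> C) (x y xi : E) (s : seq 'I_d).

Definition ii : C := Complex 0 1.

Lemma normc_ii : normc ii = 1.
Proof. by rewrite /normc/= expr0n expr1n add0r sqrtr1. Qed.

Definition xc (i : 'I_d) : E -> C := fun x => (x 0 i)%:C.

Lemma cder_xc i j : cder (xc i) j (fun=> (i == j)%:R).
Proof.
move=> x; split => /=; last first.
  have -> : Im ((i == j)%:R : C) = 0 by case: eqP. by rewrite (_ : _ \o _ = cst 0)//; exact: is_derive_cst.
rewrite -[X in is_derive X](_ : x + 0 *: ev R j = x); last by rewrite scale0r addr0.
apply/is_derive_line.
have -> : (fun r : R => (@Re R \o xc i) (x + r *: ev R j)) = cst (x 0 i) + (fun r => (i == j)%:R *: r).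
  by ext r; rewrite /= !mxE eqxx fctE mulrC.
have := is_deriveD (is_derive_cst (x 0 i) (0:R) (1:R)) (is_deriveZ ((i == j)%:R : R) (is_derive_id (0:R) (1:R))).
rewrite add0r [_ *: 1]mulr1 => h; apply: (is_derive_eq h).
by case: eqP.
Qed.

Lemma ccont_xc i : ccont (xc i).
Proof.
apply: (@cder_bounded_ccont R d (xc i) (fun j => fun=> (i == j)%:R) 1).
  by move=> j; exact: cder_xc.
by move=> j x; case: eqP; rewrite ?normc1 ?normc0.
Qed.

Lemma smooth_xc i : smooth (xc i) /\ forall s, iter_partial s (xc i) =
  match s with [::] => xc i | [:: j] => fun=> (i == j)%:R | _ => fun=> 0 end.
Proof.
apply: (@smooth_of_family _ _ _ (fun s => match s with [::] => xc i | [:: j] => fun=> (i == j)%:R | _ => fun=> 0 end)) => //.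
  by move=> [|j [|? ?]]; [exact: ccont_xc|exact: ccont_cst|exact: ccont_cst].
by move=> [|j [|? ?]] k; [exact: cder_xc|exact: cder_cst|exact: cder_cst].
Qed.

Lemma normc_xc i x : normc (xc i x) <= `|x|.
Proof. by rewrite normcr coord_le_norm. Qed.

Lemma schwartz_mulxc f i : schwartz f -> schwartz (fun x => f x * xc i x).
Proof.
have [h1 h2] := smooth_xc i.
move=> fs; apply: schwartz_mulp => // n; exists 1, 1%N => s x _; rewrite h2 mul1r expr1.
have x1 : 1 <= 1 + `|x| by rewrite lerDl.
case: s => [|j [|k s]].
- by apply: le_trans (normc_xc _ _) _; rewrite lerDr.
- by apply: le_trans x1; case: eqP; rewrite ?normc1 ?normc0.
- by rewrite normc0 base_ge0.
Qed.

Definition chi x : E -> C := fun xi => cis (dotp x xi).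

Lemma dotpC x y : dotp x y = dotp y x.
Proof. by apply: eq_bigr => i _; rewrite mulrC. Qed.

Lemma dotpDr x y z : dotp x (y + z) = dotp x y + dotp x z.
Proof. by rewrite /dotp -big_split; apply: eq_bigr => i _; rewrite mxE mulrDr. Qed.

Lemma dotpZr (a : R) x y : dotp x (a *: y) = a * dotp x y.
Proof. by rewrite /dotp mulr_sumr; apply: eq_bigr => i _; rewrite mxE mulrCA. Qed.

Lemma dotpDl x y z : dotp (x + y) z = dotp x z + dotp y z.
Proof. by rewrite dotpC dotpDr !(dotpC z). Qed.

Lemma dotpNr x y : dotp x (- y) = - dotp x y.
Proof. by rewrite -scaleN1r dotpZr mulN1r. Qed.

Lemma dotpNl x y : dotp (- x) y = - dotp x y.
Proof. by rewrite dotpC dotpNr dotpC. Qed.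

Lemma dotpZl (a : R) x y : dotp (a *: x) y = a * dotp x y.
Proof. by rewrite dotpC dotpZr dotpC. Qed.

Lemma dotp_ev x i : dotp x (ev R i) = x 0 i.
Proof.
rewrite /dotp (bigD1 i)//= mxE !eqxx mulr1 big1 ?addr0// => j ji.
by rewrite mxE eqxx (negbTE ji) mulr0.
Qed.

Lemma normc_chi x xi : normc (chi x xi) = 1.
Proof. exact: normc_cis. Qed.

Lemma chiD x xi eta : chi x (xi + eta) = chi x xi * chi x eta.
Proof. by rewrite /chi dotpDr cisD. Qed.

Lemma cmeas_chi d' (T : measurableType d') (h k : T -> E) :
  meas h -> meas k -> cmeas (fun t => chi (h t) (k t)).
Proof. by move=> mh mk; apply: cmeas_cis; exact: measurable_dotp. Qed.

Lemma cder_chi x i : cder (chi x) i (fun xi => (ii * (x 0 i)%:C) * chi x xi).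
Proof.
move=> xi.
have h1 : is_derive (0:R) (1:R) (fun r => dotp x xi + r * x 0 i) (x 0 i).
  have := is_deriveD (is_derive_cst (dotp x xi) (0:R) (1:R)) (is_deriveZ (x 0 i) (is_derive_id (0:R) (1:R))).
  rewrite add0r [_ *: 1]mulr1; congr is_derive. by ext r; rewrite fctE /GRing.scale mulrC.
have E0 : dotp x xi + 0 * x 0 i = dotp x xi by rewrite mul0r addr0.
rewrite -[X in is_derive X](_ : xi + 0 *: ev R i = xi); last by rewrite scale0r addr0.
split; apply/is_derive_line.
  have h := @is_derive1_comp R cos (fun r => dotp x xi + r * x 0 i) 0 _ _ (is_derive_cos _) h1.
  rewrite (_ : (fun r : R => _) = cos \o (fun r => dotp x xi + r * x 0 i)); last first.
    by apply/funext => r /=; rewrite dotpDr dotpZr dotp_ev.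
  apply: (is_derive_eq h); rewrite E0. by rewrite ReM ReM ImM/=; ring.
have h := @is_derive1_comp R sin (fun r => dotp x xi + r * x 0 i) 0 _ _ (is_derive_sin _) h1.
rewrite (_ : (fun r : R => _) = sin \o (fun r => dotp x xi + r * x 0 i)); last first.
  by apply/funext => r /=; rewrite dotpDr dotpZr dotp_ev.
apply: (is_derive_eq h); rewrite E0.
by rewrite ImM ReM ImM/=; ring.
Qed.

Lemma smooth_chi x : smooth (chi x) /\ forall s, iter_partial s (chi x) =
  fun xi => (\prod_(i <- s) (ii * (x 0 i)%:C)) * chi x xi.
Proof.
have cchi : ccont (chi x).
  apply: (@cder_bounded_ccont R d (chi x) (fun i xi => (ii * (x 0 i)%:C) * chi x xi) `|x|).
    by move=> i; exact: cder_chi.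
  by move=> i xi; rewrite !normcM normc_ii mul1r normc_chi mulr1; exact: normc_xc.
apply: (@smooth_of_family _ _ _ (fun s xi => (\prod_(i <- s) (ii * (x 0 i)%:C)) * chi x xi)).
- by ext xi; rewrite big_nil mul1r.
- by move=> s; apply: ccontM => //; exact: ccont_cst.
- move=> s i; have := cderM (@cder_cst R d (\prod_(i <- s) (ii * (x 0 i)%:C)) i) (cder_chi x i). congr cder; ext xi.
  by rewrite mul0r add0r big_cons mulrA [X in X * _]mulrC.
Qed.

Lemma schwartz_mulchi f x : schwartz f -> schwartz (fun xi => f xi * chi x xi).
Proof.
have [h1 h2] := smooth_chi x.
move=> fs; apply: schwartz_mulp => // n; exists ((1 + `|x|) ^+ n), 0%N => s xi sn.
rewrite h2 expr0 mulr1 normcM normc_chi mulr1.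
via ((1 + `|x|) ^+ size s); last by rewrite ler_weXn2l// lerDl.
elim: s {sn} => [|i s IH]; first by rewrite big_nil normc1.
rewrite big_cons normcM exprS ler_pM/1/.
by rewrite normcM normc_ii mul1r; apply: le_trans (normc_xc _ _) _; rewrite lerDr.
Qed.

Lemma cint_partial f i : schwartz f -> cint (partial i f) = 0.
Proof.
move=> fs.
have fd : cder f i (partial i f) := @smooth_cder _ _ f [::] i (schwartz_smooth fs).
have fi : cintble f := schwartz_cintble [::] fs.
have [B B0 hB] := schwartz_decay 1 (2 * d)%:R fs.
have fdi : cintble (partial i f) := schwartz_cintble [:: i] fs.
have h := @cder_cint R d (fun x y => f (1 *: y + x)) (fun x y => (1:R)%:C * partial i f (1 *: y + x)) i.
have /(_ _ _ _ 0)[|||h1 h2] := h.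
- move=> y; have := cintble_shift (1 *: y) fi; congr cintble. by ext x; rewrite addrC.
- by move=> x; exact: cder_affine.
- move=> y; exists (fun x => B * (2 + `|y|) `^ (2 * d)%:R * wt (2 * d)%:R x); split.
  + side.
  + rewrite nintZ/1/. apply: lte_mul_pinfty; rewrite ?lee_fin/1/.
    by apply: le_lt_trans (nint_wt (lexx _)) _; rewrite ltry.
  + move=> x r r1; rewrite mul1r scale1r addrC. apply: le_trans (hB [:: i] _ _) _ => //; rewrite -mulrA ler_wpM2l//.
    apply: le_trans (wt_shift_le _ _ _) _ => //; rewrite ler_wpM2r/1/. apply: ge0_ler_powR => /1/.
    rewrite -[2]/(1 + 1) -addrA lerD2l addrC. apply: le_trans (ler_normD _ _) _; rewrite lerD2l normrZ.
    by rewrite -[leRHS]mulr1; apply: ler_pM => //; exact: ev_norm.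
have cE : (fun y => cint (fun x => f (1 *: y + x))) = fun=> cint f.
  ext y; rewrite -(cint_shift (1 *: y) fi). by congr cint; ext x; rewrite addrC.
have cE' : cint (fun x => (1:R)%:C * partial i f (1 *: 0 + x)) = cint (partial i f).
  by congr cint; ext x; rewrite mul1r scaler0 add0r.
rewrite cE cE' in h1 h2.
apply: complexP.
  have := @derive_val _ _ _ _ _ _ _ h1. by rewrite (_ : _ \o _ = cst (Re (cint f)))// derive_cst.
have := @derive_val _ _ _ _ _ _ _ h2.
by rewrite (_ : _ \o _ = cst (Im (cint f)))// derive_cst.
Qed.

Lemma cintble_mulchi f x : cintble f -> cintble (fun xi => f xi * chi x xi).
Proof.
move=> [mf fy]; split; first by apply: cmeasM => //; exact: cmeas_chi.
by under eq_fun do rewrite normcM normc_chi mulr1.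
Qed.

Lemma iftE f x : ift f x = ((2 * pi) ^- d)%:C * cint (fun xi => f xi * chi x xi).
Proof. by []. Qed.
Local Opaque inverse_fourier.

Lemma pi2d_gt0 : 0 < (2 * pi) ^- d :> R.
Proof. side. Qed.

Lemma ift_bound phi : cintble phi -> exists2 B, 0 <= B & forall x, normc (ift phi x) <= B.
Proof.
move=> phii; pose n := fine (nint (fun xi => normc (phi xi))).
have n0 : 0 <= n by apply/fine_ge0/nint_ge0 => x/1/.
have nE : nint (fun xi => normc (phi xi)) = n%:E.
  by rewrite fineK// ge0_fin_numE; [exact: phii.2|apply: nint_ge0 => x; side].
exists ((2 * pi) ^- d * (2 * n)) => /1/.
move=> x; rewrite iftE normcM normcr ger0_norm/1/ ler_wpM2l/1/.
apply: (@normc_cint_bound _ _ _ (fun xi => normc (phi xi))).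
- by apply: cmeasM => /1/; exact: cmeas_chi.
- side.
- by move=> xi; rewrite normcM normc_chi mulr1.
- by rewrite nE.
Qed.

Lemma cder_ift phi i : schwartz phi ->
  cder (ift phi) i (ift (fun xi => ii * (phi xi * xc i xi))).
Proof.
move=> phis.
have phii : cintble phi := schwartz_cintble [::] phis.
have xs := schwartz_mulxc i phis.
have xii : cintble (fun xi => phi xi * xc i xi) := schwartz_cintble [::] xs.
have h := @cder_cint R d (fun xi y => phi xi * chi xi y) (fun xi y => phi xi * (ii * (xi 0 i)%:C * chi xi y)) i.
have hc : cder (fun y => cint (fun xi => phi xi * chi xi y)) i
    (fun y => cint (fun xi => phi xi * (ii * (xi 0 i)%:C * chi xi y))).
  apply: h.
  - move=> y; have := cintble_mulchi y phii; congr cintble. by ext xi; rewrite /chi dotpC.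
  - move=> xi; have := cderM (@cder_cst R d (phi xi) i) (cder_chi xi i). by congr cder; ext y; rewrite mul0r add0r.
  - move=> y; exists (fun xi => normc (phi xi * xc i xi)); split.
    + side.
    + exact: xii.2.
    + by move=> xi r _; rewrite !normcM normc_ii mul1r normc_chi mulr1.
have := cderM (@cder_cst R d ((2 * pi) ^- d)%:C i) hc.
congr cder.
  by ext x; rewrite iftE; congr (_ * cint _); ext xi; rewrite /chi dotpC.
ext x; rewrite mul0r add0r iftE; congr (_ * cint _); ext xi.
by rewrite /xc /chi dotpC; ring.
Qed.

Lemma ift_partial phi i x : schwartz phi ->
  ift (partial i phi) x = - (ii * (x 0 i)%:C * ift phi x).
Proof.
move=> phis.
have gs := schwartz_mulchi x phis.
have h := cint_partial i gs.
have phid : cder phi i (partial i phi) := @smooth_cder _ _ phi [::] i (schwartz_smooth phis).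
have pE : partial i (fun xi => phi xi * chi x xi) =
   fun xi => partial i phi xi * chi x xi + (ii * (x 0 i)%:C) * (phi xi * chi x xi).
  rewrite (cder_partial (cderM phid (cder_chi x i))); ext xi; ring.
move: h; rewrite pE cintD.
- rewrite cintZ/1/. move=> /eqP; rewrite addr_eq0 => /eqP e1; rewrite !iftE e1; ring.
- by apply: cintble_mulchi; exact: (schwartz_cintble [:: i] phis).
- side.
Qed.

Lemma xc_ift phi i x : schwartz phi ->
  (x 0 i)%:C * ift phi x = ift (fun xi => ii * partial i phi xi) x.
Proof.
move=> phis; have pi1 : cintble (partial i phi) := schwartz_cintble [:: i] phis.
rewrite [RHS](_ : _ = ii * ift (partial i phi) x); last first.
  rewrite !iftE [in RHS]mulrCA; congr (_ * _); rewrite -cintZ; last exact: cintble_mulchi.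
  by congr cint; ext xi; rewrite mulrA.
rewrite ift_partial// mulrN !mulrA.
have -> : ii * ii = -1 by apply: complexP => /=; rewrite ?mulr0 ?mulr1 ?sub0r ?addr0// oppr0.
by rewrite !mulN1r !mulNr opprK.
Qed.

(** Multiplication by a coordinate is turned into differentiation of phi, whose derivatives are
again Schwartz. *)
Lemma ift_decay phi k : schwartz phi ->
  exists2 B, 0 <= B & forall x, (1 + `|x|) ^+ k * normc (ift phi x) <= B.
Proof.
move=> phis.
have hi (i : 'I_d) : exists2 B, 0 <= B & forall x, `|x 0 i| ^+ k * normc (ift phi x) <= B.
  elim: k phi phis => [|k IH] phi phis.
    have [B B0 hB] := ift_bound (schwartz_cintble [::] phis). by exists B => // x; rewrite expr0 mul1r.
  have ps : schwartz (fun xi => ii * partial i phi xi).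
    by apply: schwartzZ; exact: (@schwartz_iter _ _ phi [:: i]).
  have [B B0 hB] := IH _ ps; exists B => // x. by have := hB x; rewrite -xc_ift// normcM normcr mulrA exprSr.
have [B B0 hB] := ift_bound (schwartz_cintble [::] phis).
have /choice[b hb] : forall i : 'I_d, exists B, 0 <= B /\ forall x, `|x 0 i| ^+ k * normc (ift phi x) <= B.
  by move=> i; have [B' h1 h2] := hi i; exists B'.
exists (2 ^+ k * (B + \sum_i b i)).
  by rewrite mulr_ge0// addr_ge0// sumr_ge0// => i _; exact: (hb i).1.
move=> x.
have xk : `|x| ^+ k * normc (ift phi x) <= B + \sum_i b i.
  have [x0|[i xi]] : `|x| = 0 \/ exists i, `|x| = `|x 0 i|.
    have [->|x0] := eqVneq x 0; first by left; rewrite normr0. right; have /mx_norm_neq0[[i0 i] hh] : mx_norm x != 0.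
      by apply: contra_neq x0; exact: mx_norm_eq0.
    by exists i; rewrite -(ord1 i0).
  - apply: (@le_trans _ _ B); last by rewrite lerDl sumr_ge0// => i _; exact: (hb i).1.
    apply: le_trans (hB x); rewrite x0 ler_piMl/1/. by case: (k) => [|n]; rewrite expr0n.
  - rewrite xi; apply: le_trans ((hb i).2 x) _.
    rewrite (bigD1 i)// addrCA lerDl addr_ge0// sumr_ge0// => j _; exact: (hb j).1.
have [x1|x1] := leP `|x| 1.
  rewrite ler_pM/1/.
    by rewrite lerXn2r/1/ -[2]/(1 + 1) lerD2l.
  by apply: le_trans (hB x) _; rewrite lerDl sumr_ge0// => i _; exact: (hb i).1.
via (2 ^+ k * (`|x| ^+ k * normc (ift phi x))).
  rewrite mulrA ler_wpM2r/1/ -exprMn lerXn2r/1/. by rewrite mulrDl !mul1r lerD2r ltW.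
by rewrite ler_wpM2l.
Qed.

Definition mulxi s phi : E -> C :=
  foldr (fun i g => fun xi => ii * (g xi * xc i xi)) phi s.

Lemma schwartz_mulxi s phi : schwartz phi -> schwartz (mulxi s phi).
Proof.
by move=> phis; elim: s => [//|i s IH]; apply: schwartzZ; exact: schwartz_mulxc.
Qed.

Lemma schwartz_ift phi : schwartz phi -> schwartz (ift phi) /\
  forall s, iter_partial s (ift phi) = ift (mulxi s phi).
Proof.
move=> phis.
have [h1 h2] : smooth (ift phi) /\ forall s, iter_partial s (ift phi) = ift (mulxi s phi).
  apply: (@smooth_of_family _ _ _ (fun s => ift (mulxi s phi))) => // s.
    have /choice[b hb] : forall i : 'I_d, exists B, 0 <= B /\ forall x, normc (ift (mulxi (i :: s) phi) x) <= B.
      move=> i; have [B B0 hB] := ift_bound (schwartz_cintble [::] (schwartz_mulxi (i :: s) phis)). by exists B.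
    apply: (@cder_bounded_ccont _ _ _ (fun i => ift (mulxi (i :: s) phi)) (\sum_i b i)).
      by move=> i; apply: cder_ift; exact: schwartz_mulxi.
    move=> i x; apply: le_trans ((hb i).2 x) _. by rewrite (bigD1 i)// lerDl sumr_ge0// => j _; exact: (hb j).1.
  by move=> i; apply: cder_ift; exact: schwartz_mulxi.
split => //; apply/schwartzP; split => // k s.
have [B _ hB] := ift_decay k (schwartz_mulxi s phis).
by exists B => x; rewrite h2.
Qed.

(** Insert exp(-h|y|) into the inversion integral. By Fubini this turns into an average of
phi(xi + h z) against the Cauchy kernel, which tends to phi(xi) as h tends to 0; both limits are
dominated. *)
Lemma fourier_inversion phi xi : schwartz phi ->
  cint (fun y => ift phi y * chi (- xi) y) = phi xi.
Proof.
move=> phis.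
have phii : cintble phi := schwartz_cintble [::] phis.
have [Ks _] := schwartz_ift phis.
have Ki : cintble (ift phi) := schwartz_cintble [::] Ks.
have mK := Ki.1.
pose h (n : nat) : R := n.+1%:R^-1.
have h0 n : 0 < h n => /1/.
have hc : h n @[n --> \oo] --> (0:R) := cvg_harmonic.
pose L n := cint (fun y => (expker (h n *: y))%:C * (ift phi y * chi (- xi) y)).
have mL : cmeas (fun y => ift phi y * chi (- xi) y) by apply: cmeasM => //; exact: cmeas_chi.
have mexp n : meas (fun y : E => expker (h n *: y)).
  by apply: (measurableT_comp (@measurable_expker R d)); side.
have Lc1 : normc (L n - cint (fun y => ift phi y * chi (- xi) y)) @[n --> \oo] --> (0:R).
  apply: (@cint_dct _ _ _ _ (fun y => normc (ift phi y))).
  - side.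
  - by [].
  - side.
  - exact: Ki.2.
  - move=> n y; rewrite normcM normcr normcM normc_chi mulr1 ger0_norm ?expker_ge0//.
    by rewrite ler_piMl/1/ expker_le1.
  - move=> y. have ce : expker (h n *: y) @[n --> \oo] --> (1:R).
      have hs : \sum_i `|(h n *: y) 0 i| @[n --> \oo] --> (0:R).
        rewrite (_ : (fun n => _) = fun n => h n * \sum_i `|y 0 i|).
          by rewrite -[X in _ --> X](mul0r (\sum_i `|y 0 i|)); exact: cvgMl.
        ext n; rewrite mulr_sumr; apply: eq_bigr => i _. by rewrite mxE normrM gtr0_norm.
      have -> : (fun n => expker (h n *: y)) = (fun n => expR (- \sum_i `|(h n *: y) 0 i|)).
        ext n; rewrite /expker -sumrN. by rewrite (big_morph expR (@expRD R) (@expR0 R)).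
      rewrite -[X in _ --> X](@expR0 R) -[X in expR X]oppr0.
      by apply: continuous_cvg; [exact: continuous_expR|exact: cvgN].
    apply: (@cvg0_squeeze _ _ (fun n => `|expker (h n *: y) - 1| * normc (ift phi y))).
    + side.
    + move=> n; rewrite -[X in _ - X]mul1r -mulrBl normcM.
      rewrite (_ : (expker (h n *: y))%:C - 1 = (expker (h n *: y) - 1)%:C); last first.
        by apply: complexP => /=; rewrite ?subr0.
      by rewrite normcr [X in _ * X]normcM normc_chi mulr1.
    + rewrite -[X in _ --> X](mul0r (normc (ift phi y))); apply: cvgMl.
      rewrite -(@normr0 _ R) -(subrr 1); apply: cvg_norm; apply: cvgB => //; exact: cvg_cst.
have LE n : L n = ((2 * pi) ^- d)%:C * cint (fun z : E => phi (h n *: z + xi) * (cauchyker z)%:C).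
  have E1 : L n = cint (fun y => cint (fun eta => ((2 * pi) ^- d)%:C * (phi eta * ((expker (h n *: y))%:C *
       chi (eta - xi) y)))).
    congr cint; ext y; rewrite iftE. set e := (expker _)%:C; set c := (_ ^- d)%:C; set I := cint _; set w := chi _ _.
    have -> : e * (c * I * w) = c * ((e * w) * I) by ring. rewrite -cintZ; last exact: cintble_mulchi.
    rewrite -cintZ; last by apply: cintbleZ; exact: cintble_mulchi. congr cint; ext eta.
    by rewrite /w /chi dotpDl cisD (dotpC eta); ring.
  rewrite E1 (@cfubini_dom _ _ _ (fun y => (2 * pi) ^- d * expker (h n *: y)) (fun eta => normc (phi eta))).
  - transitivity (cint (fun eta => ((2 * pi) ^- d)%:C * (phi eta * ((h n ^- d)%:C * (cauchyker ((h n)^-1 *: (eta - xi)))%:C)))).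
      congr cint; ext eta. have [ci cE] := cauchy_transform ((h n)^-1 *: (eta - xi)).
      have ci2 := cintble_affine (0 : E) (lt0r_neq0 (h0 n)) ci. have cE2 := cint_affine (0 : E) (lt0r_neq0 (h0 n)) ci.
      rewrite gtr0_norm// cE in cE2. rewrite -cE2 -cintZ// -cintZ; last side.
      congr cint; ext y; rewrite addr0; congr (_ * (_ * (_ * cis _))).
      by rewrite dotpZl dotpZr mulrA mulfV ?mul1r/1/ dotpC.
    have ci3 : cintble (fun z => phi (h n *: z + xi) * (cauchyker z)%:C).
      have [B B0 hB] := schwartz_decay 0 0 phis. apply: (@cintble_dom _ _ _ (fun z => B * cauchyker z)).
      + apply: cmeasM; last by apply: cmeas_real; exact: measurable_cauchyker. by apply: (cmeas_comp phii.1); side.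
      + by apply: measurable_funM => //; exact: measurable_cauchyker.
      + move=> z; rewrite normcM normcr (ger0_norm (cauchyker_ge0 _)) ler_wpM2r ?cauchyker_ge0//.
        have := hB [::] isT (h n *: z + xi); rewrite /wt oppr0 powRr0 mulr1/1/.
      + rewrite nintZ//; [|exact: measurable_cauchyker|exact: cauchyker_ge0]. by rewrite nint_cauchyker -EFinM ltry.
    rewrite -cintZ//. have ci4 := cintbleZ ((2 * pi) ^- d)%:C ci3.
    have a0 : (h n)^-1 != 0 by rewrite invr_eq0 (lt0r_neq0 (h0 n)). have := cint_affine (- ((h n)^-1 *: xi)) a0 ci4.
    rewrite gtr0_norm/1/ exprVn invrK => e2. have hd : ((h n ^- d)%:C * (h n ^+ d)%:C = 1 :> C).
      by rewrite -rmorphM mulVf/1/.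
    rewrite -[RHS]mul1r -hd -mulrA -e2 -cintZ; last exact: (cintble_affine (- ((h n)^-1 *: xi)) a0 ci4).
    congr cint; ext eta. have -> : h n *: ((h n)^-1 *: eta - (h n)^-1 *: xi) + xi = eta.
      by rewrite scalerBr !scalerA mulfV/1/ !scale1r subrK.
    rewrite -scalerBr; ring.
  - apply: cmeasM; first side. apply: cmeasM; first exact: (cmeas_comp phii.1 measurable_snd).
    apply: cmeasM; first by apply: cmeas_real; exact: (measurableT_comp (mexp n) measurable_fst).
    by apply: cmeas_chi => /1/.
  - side.
  - side.
  - by move=> y; rewrite mulr_ge0 ?expker_ge0// ltW// pi2d_gt0.
  - side.
  - rewrite nintZ//; [|by move=> y; exact: expker_ge0|side].
    have := @nint_affine R d (h n) 0 (@expker R d) (lt0r_neq0 (h0 n)) (@measurable_expker R d) (@expker_ge0 R d).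
    under eq_fun do rewrite addr0. move=> ->; rewrite muleA -EFinM; apply: lte_mul_pinfty; last exact: nint_expker.
      by rewrite lee_fin mulr_ge0/1/ invr_ge0 exprn_ge0.
    by [].
  - exact: phii.2.
  - move=> y eta; rewrite !normcM !normcr normc_chi mulr1. rewrite !ger0_norm ?expker_ge0/1/.
    by rewrite le_eqVlt; apply/orP; left; apply/eqP; ring.
have Lc2 : normc (cint (fun z : E => phi (h n *: z + xi) * (cauchyker z)%:C) -
    cint (fun z : E => phi xi * (cauchyker z)%:C)) @[n --> \oo] --> (0:R).
  have [B B0 hB] := schwartz_decay 0 0 phis. have hB' z : normc (phi z) <= B.
    by have := hB [::] isT z; rewrite /wt oppr0 powRr0 mulr1.
  apply: (@cint_dct _ _ _ _ (fun z => B * cauchyker z)).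
  - move=> n; apply: cmeasM; last by apply: cmeas_real; exact: measurable_cauchyker.
    by apply: (cmeas_comp phii.1); side.
  - apply: cmeasM => /1/. by apply: cmeas_real; exact: measurable_cauchyker.
  - by apply: measurable_funM => //; exact: measurable_cauchyker.
  - rewrite nintZ//; [|exact: measurable_cauchyker|exact: cauchyker_ge0]. by rewrite nint_cauchyker -EFinM ltry.
  - move=> n z; rewrite normcM normcr (ger0_norm (cauchyker_ge0 _)) ler_wpM2r ?cauchyker_ge0//.
  - move=> z; have [M M0 hM] := schwartz_lip 0 (lexx 0) phis.
    apply: (@cvg0_squeeze _ _ (fun n => h n * (M * `|z| * cauchyker z))).
    + side.
    + move=> n; rewrite -mulrBl normcM normcr (ger0_norm (cauchyker_ge0 _)) mulrA.
      rewrite ler_wpM2r ?cauchyker_ge0// (addrC (h n *: z)). apply: le_trans (hM [::] isT _ _) _.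
      by rewrite /wt oppr0 !powRr0 !mulr1 normrZ gtr0_norm// mulrCA.
    + by rewrite -[X in _ --> X](mul0r (M * `|z| * cauchyker z)); exact: cvgMl.
have cE : cint (fun z : E => phi xi * (cauchyker z)%:C) = phi xi * ((2 * pi) ^+ d)%:C.
  rewrite cintZ; last first.
    apply: (@cintble_dom _ _ _ (@cauchyker R d)).
    - by apply: cmeas_real; exact: measurable_cauchyker.
    - exact: measurable_cauchyker.
    - by move=> z; rewrite normcr ger0_norm ?cauchyker_ge0.
    - by rewrite nint_cauchyker ltry.
  congr (_ * _); apply: complexP => /=.
    by rewrite /Rintegral [X in fine X](_ : _ = nint (@cauchyker R d))// nint_cauchyker.
  by rewrite /Rintegral integral_cst// mul0e.
pose c : C := ((2 * pi) ^- d)%:C.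
have Lc3 : normc (L n - phi xi) @[n --> \oo] --> (0:R).
  apply: (@cvg0_squeeze _ _ (fun n => normc c * normc (cint (fun z : E => phi (h n *: z + xi) * (cauchyker z)%:C) -
    cint (fun z : E => phi xi * (cauchyker z)%:C)))).
  - side.
  - move=> n; rewrite LE cE -normcM mulrBr mulrCA -rmorphM/=.
    by rewrite mulVf ?mulr1// expf_neq0// mulf_neq0// gt_eqF// pi_gt0.
  - by rewrite -[X in _ --> X](mulr0 (normc c)); exact: cvgMr.
have : normc (cint (fun y => ift phi y * chi (- xi) y) - phi xi) <= 0.
  apply/ler_addgt0Pr => e e0. have e2 : 0 < e / 2 => /1/.
  have [N1 hN1] := (cvg0_nnegP (fun n => normc_ge0 _)).1 Lc1 _ e2.
  have [N2 hN2] := (cvg0_nnegP (fun n => normc_ge0 _)).1 Lc3 _ e2. pose N := maxn N1 N2.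
  have l1 := hN1 N (leq_maxl _ _); have l2 := hN2 N (leq_maxr _ _).
  rewrite add0r [leRHS]splitr; set X := cint _ in l1 *.
  rewrite -(subrK (L N) X) -addrA; apply: le_trans (normc_triangle _ _) _.
  by apply: lerD; [rewrite normc_distC ltW|rewrite ltW].
move=> h00; apply/eqP; rewrite -subr_eq0; apply/eqP/eq0_normc/le_anti.
by rewrite h00 normc_ge0.
Qed.

Lemma fourier_at0 phi : schwartz phi -> cint (ift phi) = phi 0.
Proof.
move=> phis; rewrite -fourier_inversion//; congr cint; ext y.
by rewrite oppr0 /chi /dotp big1 ?cis0 ?mulr1// => i _; rewrite mxE mul0r.
Qed.

Lemma ift_conv phi psi x : schwartz phi -> schwartz psi ->
  cint (fun y => ift phi (x - y) * ift psi y) = ift (fun xi => phi xi * psi xi) x.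
Proof.
move=> phis psis; have [Ks _] := schwartz_ift phis.
have Ki : cintble (ift phi) := schwartz_cintble [::] Ks.
have psii : cintble psi := schwartz_cintble [::] psis.
rewrite iftE; set c := (_%:C).
transitivity (cint (fun y => cint (fun xi => c * (ift phi (x - y) * (psi xi * chi y xi))))).
  congr cint; ext y; rewrite [ift psi y]iftE mulrCA -cintZ; last exact: cintble_mulchi.
  by rewrite -cintZ//; apply: cintbleZ; exact: cintble_mulchi.
rewrite (@cfubini_dom _ _ _ (fun y => normc c * normc (ift phi (x - y))) (fun xi => normc (psi xi))).
- rewrite -cintZ; last first.
    apply: cintble_mulchi; apply: (@schwartz_cintble R d (fun xi => phi xi * psi xi) [::]).
    apply: schwartz_mulp => /1/. move=> n; have [B B0 hB] := schwartz_decay n 0 psis.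
    exists B, 0%N => s z sn; rewrite expr0 mulr1. by have := hB s sn z; rewrite /wt oppr0 powRr0 mulr1.
  congr cint; ext xi. have gi : cintble (fun w => ift phi w * chi (- xi) w) by exact: cintble_mulchi.
  have := cint_refl x gi; rewrite fourier_inversion// => e1. rewrite -e1.
  transitivity (cint (fun y => (c * psi xi * chi x xi) * (ift phi (x - y) * chi (- xi) (x - y)))).
    congr cint; ext y. have -> : chi y xi = chi x xi * chi (- xi) (x - y).
      rewrite /chi -cisD; congr cis; rewrite dotpNl dotpDr dotpNr (dotpC xi) (dotpC xi); ring.
    ring.
  rewrite cintZ; [ring|exact: (cintble_refl x gi)].
- apply: cmeasM; first side. apply: cmeasM.
    apply: (cmeas_comp Ki.1); side; side.
  apply: cmeasM; first exact: (cmeas_comp psii.1 measurable_snd). by apply: cmeas_chi => /1/.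
- apply: measurable_funM => //; apply: cmeas_normc. by apply: (cmeas_comp Ki.1); side.
- side.
- side.
- side.
- have := cintble_refl x (cintbleZ c Ki); case=> _. by congr (nint _ < _)%E; ext y; rewrite normcM.
- exact: psii.2.
- by move=> y xi; rewrite normcM [X in _ * X]normcM [X in _ * (_ * X)]normcM normc_chi mulr1 mulrA.
Qed.

Lemma ift_scale phi (a : R) x : 0 < a -> schwartz phi ->
  ift (fun xi => phi (a *: xi)) x = (a ^- d)%:C * ift phi (a^-1 *: x).
Proof.
move=> a0 phis; rewrite !iftE mulrCA; congr (_ * _).
have phii : cintble phi := schwartz_cintble [::] phis.
have a1 : a != 0 => /1/.
have := cint_affine (0:E) a1 (cintble_mulchi (a^-1 *: x) phii).
rewrite gtr0_norm// => <-; congr cint; ext xi; rewrite addr0.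
by rewrite /chi dotpZl dotpZr mulrA mulVf// mul1r.
Qed.

End fourier.

Ltac le_ring := rewrite le_eqVlt; apply/orP; left; apply/eqP; ring.

(** * Convolution and the exchange of distributions with integrals *)

Section convolution.
Variables (R : realType) (d : nat).
Local Notation E := 'rV[R]_d.
Local Notation C := R[i].
Local Notation mu := (@leb R d).
Implicit Types (f g h psi K F : E -> C) (x y z : E) (s : seq 'I_d).

Lemma cvg_half : (2 ^- n : R) @[n --> \oo] --> (0:R).
Proof.
rewrite (_ : (fun n => _) = geometric 1 (2^-1)).
  by apply: cvg_geometric; rewrite ger0_norm// invf_lt1// ltr1n.
by ext n; rewrite /geometric/= mul1r exprVn.
Qed.

Lemma iter_partialB f g s : smooth f -> smooth g ->
  iter_partial s (fun x => f x - g x) = fun x => iter_partial s f x - iter_partial s g x.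
Proof.
move=> fs gs; have [_ h] := smooth_lin (-1) gs fs.
rewrite (_ : (fun x => f x - g x) = fun x => -1 * g x + f x).
  by rewrite h; ext x; rewrite mulN1r addrC.
by ext x; rewrite mulN1r addrC.
Qed.

Lemma smooth_sum (I : Type) (r : seq I) (F : I -> E -> C) : (forall i, smooth (F i)) ->
  smooth (fun x => \sum_(i <- r) F i x) /\
  forall s, iter_partial s (fun x => \sum_(i <- r) F i x) =
    fun x => \sum_(i <- r) iter_partial s (F i) x.
Proof.
move=> Fs; apply: (@smooth_of_family _ _ _ (fun s x => \sum_(i <- r) iter_partial s (F i) x)) => //.
- by move=> s; apply: ccont_sum => i; exact: smooth_ccont.
- by move=> s i; apply: (@cder_sum R d I r (fun k => iter_partial s (F k))) => k; exact: smooth_cder.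
Qed.

Lemma cintble_mul_bounded g h (B : R) : cintble g -> cmeas h ->
  (forall x, normc (h x) <= B) -> cintble (fun x => g x * h x).
Proof.
move=> [mg gy] mh hB; have B0 : 0 <= B by apply: le_trans (hB 0); side.
apply: (@cintble_dom _ _ _ (fun x => B * normc (g x))).
- side.
- side.
- by move=> x; rewrite normcM mulrC ler_wpM2r/1/.
- rewrite nintZ/1/. by apply: lte_mul_pinfty => /1/.
Qed.

Lemma schwartz_bounded h s : schwartz h -> exists2 B, 0 <= B & forall x, normc (iter_partial s h x) <= B.
Proof.
move=> hs; have [B B0 hB] := schwartz_decay (size s) 0 hs.
by exists B => // x; have := hB s (leqnn _) x; rewrite /wt oppr0 powRr0 mulr1.
Qed.

Lemma continuous_shiftr (b : E) : continuous (fun x : E => x + b).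
Proof.
have := @continuous_affine R d 1 b; rewrite (_ : (fun x => 1 *: x + b) = fun x => x + b)//.
by ext x; rewrite scale1r.
Qed.

Lemma conv_smooth g h (c : R) : cintble g -> schwartz h ->
  smooth (fun y => cint (fun x => g x * h (y + c *: x))) /\
  forall s, iter_partial s (fun y => cint (fun x => g x * h (y + c *: x))) =
    fun y => cint (fun x => g x * iter_partial s h (y + c *: x)).
Proof.
move=> gi hs.
have mh s y : cmeas (fun x => iter_partial s h (y + c *: x)).
  apply: (cmeas_comp (ccont_cmeas (schwartz_ccont s hs))). side.
have ghi s y : cintble (fun x => g x * iter_partial s h (y + c *: x)).
  by have [B B0 hB] := schwartz_bounded s hs; apply: (cintble_mul_bounded gi (mh s y) (B := B)).
have D s i : cder (fun y => cint (fun x => g x * iter_partial s h (y + c *: x))) i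
     (fun y => cint (fun x => g x * iter_partial (i :: s) h (y + c *: x))).
  apply: (@cder_cint R d (fun x y => g x * iter_partial s h (y + c *: x))
     (fun x y => g x * iter_partial (i :: s) h (y + c *: x))) => [y|x|y]/1/.
    have := cderM (@cder_cst R d (g x) i) (cder_affine 1 (c *: x) (@smooth_cder R d h s i (schwartz_smooth hs))).
    congr cder; ext y; rewrite ?scale1r//. by rewrite mul0r add0r mul1r.
  have [B B0 hB] := schwartz_bounded (i :: s) hs. exists (fun x => B * normc (g x)); split.
  - side.
  - rewrite nintZ/1/. by apply: lte_mul_pinfty => /1/; exact: gi.2.
  - by move=> x r _; rewrite normcM mulrC ler_wpM2r/1/.
apply: (@smooth_of_family _ _ _ (fun s y => cint (fun x => g x * iter_partial s h (y + c *: x)))) => // s.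
pose n := fine (nint (fun x => normc (g x))).
have nE : nint (fun x => normc (g x)) = n%:E.
  rewrite fineK// ge0_fin_numE; first exact: gi.2. by apply: nint_ge0 => x/1/.
have n0 : 0 <= n by rewrite -lee_fin -nE; apply: nint_ge0 => x/1/.
have /choice[b hb] : forall i : 'I_d, exists B, 0 <= B /\ forall x, normc (iter_partial (i :: s) h x) <= B.
  by move=> i; have [B B0 hB] := schwartz_bounded (i :: s) hs; exists B.
apply: (@cder_bounded_ccont _ _ _ _ (2 * ((\sum_i b i) * n)) (fun i => D s i)) => i y.
apply: (@normc_cint_bound _ _ _ (fun x => (\sum_i b i) * normc (g x))).
- side.
- side.
- move=> x; rewrite normcM mulrC ler_wpM2r/1/; apply: le_trans ((hb i).2 _) _.
  by rewrite (bigD1 i)// lerDl sumr_ge0// => j _; exact: (hb j).1.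
- rewrite nintZ; last by apply: sumr_ge0 => j _; exact: (hb j).1.
  + by rewrite nE -EFinM.
  + side.
  + side.
Qed.

Lemma base_mul_le x z (k : nat) : (1 + `|x + z|) ^+ k <= (1 + `|x|) ^+ k * (1 + `|z|) ^+ k.
Proof.
rewrite -exprMn lerXn2r/1/.
rewrite mulrDl mul1r mulrDr mulr1; have := ler_normD x z.
have x0 := normr_ge0 x; have z0 := normr_ge0 z; nra.
Qed.

Lemma schwartz_moment g (k : nat) (c : R) : schwartz g -> 0 <= c ->
  exists2 B : R, 0 <= B & (nint (fun x => (1 + `|c *: x|) ^+ k * normc (g x))%R <= B%:E)%E.
Proof.
move=> gs c0; have [A A0 hA] := schwartz_decay 0 (k + 2 * d)%:R gs.
exists ((1 + c) ^+ k * A * pi ^+ d).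
  apply: mulr_ge0; last side. side.
via (nint (fun x => (1 + c) ^+ k * A * wt (2 * d)%:R x)%R).
  apply: nint_le.
  - apply: measurable_funM => /1/. apply: measurable_funX; apply: measurable_funD => //.
    by apply: (measurableT_comp (@measurable_normx R d)); side.
  - side.
  - side.
  - move=> x; rewrite -mulrA; via ((1 + c) ^+ k * (1 + `|x|) ^+ k * (A * wt (k + 2 * d)%:R x)).
      apply: ler_pM => /1/; last exact: (hA [::] isT x). rewrite -exprMn lerXn2r/1/.
      rewrite normrZ (ger0_norm c0) mulrDl mul1r mulrDr mulr1; have := normr_ge0 x; nra.
    rewrite natrD wtD -[wt k%:R x]mulr1 -mulrA ler_wpM2l/1/.
    rewrite wtX mulr1 mulrCA (mulrA (_ ^+ k)) mulfV ?mul1r// gt_eqF exprn_gt0 base_gt0.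
rewrite nintZ/1/.
rewrite [leRHS]EFinM; apply: lee_wpmul2l; last exact: nint_wt.
by rewrite lee_fin mulr_ge0/1/.
Qed.

(** Peetre type inequality (1 + |y|) <= (1 + |y - x|)(1 + |x|): one factor is absorbed by each
function. *)
Lemma conv_schwartz g h (c : R) : schwartz g -> schwartz h ->
  schwartz (fun y => cint (fun x => g x * h (y + c *: x))).
Proof.
move=> gs hs; have gi : cintble g := schwartz_cintble [::] gs.
have [h1 h2] := conv_smooth c gi hs; apply/schwartzP; split => // k s.
have [B B0 hB] := schwartz_bd k s hs.
have [M M0 hM] := schwartz_moment k gs (normr_ge0 c).
exists (2 * (B * M)) => y; rewrite h2.
have -> : (1 + `|y|) ^+ k * normc (cint (fun x => g x * iter_partial s h (y + c *: x))) =
    normc (cint (fun x => ((1 + `|y|) ^+ k)%:C * (g x * iter_partial s h (y + c *: x)))).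
  rewrite cintZ; first by rewrite normcM normcr ger0_norm.
  have [B' B0' hB'] := schwartz_bounded s hs; apply: (cintble_mul_bounded gi _ (B := B')) => //.
  apply: (cmeas_comp (ccont_cmeas (schwartz_ccont s hs))). side.
have mm : meas (fun x => (1 + `| `|c| *: x|) ^+ k * normc (g x)).
  apply: measurable_funM => /1/. apply: measurable_funX; apply: measurable_funD => //.
  by apply: (measurableT_comp (@measurable_normx R d)); side.
apply: (@normc_cint_bound _ _ _ (fun x => B * ((1 + `| `|c| *: x|) ^+ k * normc (g x)))).
- apply: cmeasM => /1/. apply: cmeasM => /1/. apply: (cmeas_comp (ccont_cmeas (schwartz_ccont s hs))). side.
- side.
- move=> x; rewrite !normcM normcr ger0_norm//. have := base_mul_le (y + c *: x) (- (c *: x)) k; rewrite addrK normrN.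
  have -> : `|c *: x| = `| `|c| *: x| by rewrite !normrZ normr_id. have := hB (y + c *: x).
  set u := (1 + `|y + _|) ^+ k; set v := (1 + `| _ *: _|) ^+ k; set a := (1 + _) ^+ k.
  set H := normc (iter_partial _ _ _); set G := normc (g x) => h3 h4.
  have G0 : 0 <= G := normc_ge0 _; have H0 : 0 <= H := normc_ge0 _. have v0 : 0 <= v => /1/.
  via (u * v * (G * H)); first by rewrite ler_wpM2r// mulr_ge0.
  rewrite [leLHS](_ : _ = u * H * (v * G)); last by ring. by rewrite ler_wpM2r// mulr_ge0.
- rewrite nintZ//; first by rewrite EFinM; apply: lee_wpmul2l => /1/. side.
Qed.

Lemma loc_lip_ccont F : (forall x, exists L, forall h : E, `|h| <= 1 ->
   normc (F (x + h) - F x) <= L * `|h|) -> ccont F.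
Proof.
move=> FL.
have main (p : C -> R) : (forall z w : C, `|p z - p w| <= normc (z - w)) -> continuous (p \o F).
  move=> pl x; have Fx := nbhs_filter (x : E); have [L hL] := FL x. apply/cvgrPdist_lt => e e0.
  have L1 : 0 < `|L| + 1 by []. apply/(@nbhs_ballP R E); exists (Num.min 1 ((`|L| + 1)^-1 * e)) => /=.
    by rewrite lt_min ltr01 mulr_gt0// invr_gt0.
  move=> y; rewrite -ball_normE/= distrC lt_min => /andP[xy1 xy2]. apply: le_lt_trans (pl _ _) _; rewrite normc_distC.
  have -> : y = x + (y - x) by rewrite addrC subrK. apply: le_lt_trans (hL _ (ltW xy1)) _.
  apply: (@le_lt_trans _ _ ((`|L| + 1) * `|y - x|)).
    by rewrite ler_wpM2r//; apply: le_trans (ler_norm _) _; rewrite lerDl.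
  by rewrite -ltr_pdivlMl.
split; apply: main => z w; [rewrite -ReN -ReD|rewrite -ImN -ImD].
  exact: Re_le_normc.
exact: Im_le_normc.
Qed.

Definition tconv (u : raw_distribution R d) K : E -> C := fun x => u (fun y => K (x - y)).

Lemma schwartz_refl K x : schwartz K -> schwartz (fun y => K (x - y)).
Proof.
move=> Ks; have := schwartz_affine x (_ : -1 != 0 :> R) Ks.
rewrite oppr_eq0 oner_neq0 => /(_ isT); congr schwartz.
by ext y; rewrite scaleN1r addrC.
Qed.

Lemma iter_refl K x s : schwartz K ->
  iter_partial s (fun y => K (x - y)) = fun y => ((-1) ^+ size s)%:C * iter_partial s K (x - y).
Proof.
move=> Ks; have [_ h] := smooth_affine (-1) x (schwartz_smooth Ks).
rewrite (_ : (fun y => K (x - y)) = fun y => K (-1 *: y + x)).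
  by rewrite h; ext y; rewrite scaleN1r addrC.
by ext y; rewrite scaleN1r addrC.
Qed.

Lemma normc_sign (n : nat) : normc ((-1) ^+ n)%:C = 1 :> R.
Proof. by rewrite normcr normrX normrN1 expr1n. Qed.

(** The reflected translates x |-> K(x - .) grow and vary polynomially in x in every seminorm,
which is what makes u(K(x - .)) slowly growing and locally Lipschitz. *)
Lemma refl_growth K (k : nat) : schwartz K -> exists2 B, 0 <= B &
  forall s, (size s <= k)%N -> 
   (forall x y, (1 + `|y|) ^+ k * normc (iter_partial s K (x - y)) <= B * (1 + `|x|) ^+ k) /\
   (forall x (h : E) y, `|h| <= 1 -> (1 + `|y|) ^+ k *
      normc (iter_partial s K (x + h - y) - iter_partial s K (x - y)) <= B * `|h| * (1 + `|x|) ^+ k).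
Proof.
move=> Ks.
have [B1 B10 hB1] := schwartz_bd_le k k Ks.
have [B2 B20 hB2] := schwartz_lip k (ler0n R k) Ks.
have yle x y : (1 + `|y|) ^+ k <= (1 + `|x - y|) ^+ k * (1 + `|x|) ^+ k.
  have := base_mul_le (- (x - y)) x k; rewrite normrN. by rewrite opprB addrNK.
exists (B1 + B2 * 2 ^+ k) => /1/.
move=> s sk; split => [x y|x h y h1].
  via (B1 * (1 + `|x|) ^+ k); last first.
    by rewrite ler_wpM2r// lerDl mulr_ge0// exprn_ge0.
  apply: le_trans (ler_wpM2r (normc_ge0 _) (yle x y)) _. by rewrite mulrAC ler_wpM2r//; exact: hB1.
rewrite addrAC; via (B2 * 2 ^+ k * `|h| * (1 + `|x|) ^+ k); last first.
  by rewrite ler_wpM2r// ler_wpM2r// lerDr.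
apply: le_trans (ler_wpM2r (normc_ge0 _) (yle x y)) _.
rewrite mulrAC ler_wpM2r//.
via ((1 + `|x - y|) ^+ k * (B2 * `|h| * (1 + `|h|) `^ k%:R * wt k%:R (x - y))).
  by rewrite ler_wpM2l//; exact: hB2.
rewrite wtX powR_mulrn// mulrCA mulfV ?mulr1; last first.
  side.
rewrite mulrAC ler_wpM2r// ler_wpM2l// lerXn2r/1/.
by rewrite -[2]/(1 + 1) lerD2l.
Qed.

Lemma tconv_growth u K : tempered u -> schwartz K -> exists A (k : nat), [/\ 0 <= A,
   (forall x, normc (tconv u K x) <= A * (1 + `|x|) ^+ k) &
   forall x (h : E), `|h| <= 1 -> normc (tconv u K (x + h) - tconv u K x) <= A * `|h| * (1 + `|x|) ^+ k].
Proof.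
move=> ut Ks; have [M [k [M0 hM]]] := tempered_bound ut.
have [B B0 hB] := refl_growth k Ks.
exists (M * B), k; split => /1/.
  move=> x; rewrite -mulrA; apply: hM; first exact: schwartz_refl.
  by move=> s sk y; rewrite iter_refl// normcM normc_sign mul1r; exact: (hB s sk).1.
move=> x h h1; rewrite /tconv -temperedB//; [|exact: schwartz_refl|exact: schwartz_refl].
rewrite -2!mulrA; apply: hM; first by apply: schwartzB; exact: schwartz_refl.
move=> s sk y; rewrite iter_partialB; [|exact/schwartz_smooth/schwartz_refl|exact/schwartz_smooth/schwartz_refl].
rewrite !iter_refl// -mulrBr normcM normc_sign mul1r mulrA; exact: (hB s sk).2.
Qed.

Lemma tconv_ccont u K : tempered u -> schwartz K -> ccont (tconv u K).
Proof.
move=> ut Ks; have [A [k [A0 _ h]]] := tconv_growth ut Ks.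
apply: loc_lip_ccont => x; exists (A * (1 + `|x|) ^+ k) => z z1.
by apply: le_trans (h x z z1) _; rewrite mulrAC.
Qed.

Definition corner (n : nat) (m : 'rV[int]_d) : E := \row_i (2 ^- n * (m 0 i)%:~R).

Definition lat (n : nat) (t : 'rV['I_(2 * 4 ^ n)]_d) : 'rV[int]_d :=
  \row_i ((t 0 i)%:Z - (4 ^ n)%:Z).

Definition rsum n F : C := \sum_t (2 ^- (n * d))%:C * F (corner n (@lat n t)).

Lemma corner_dist n x : `|corner n (dyfloor n x) - x| <= 2 ^- n.
Proof.
have h0 : 0 < 2 ^+ n :> R by [].
apply: norm_rV_le => /1/.
move=> i; rewrite !mxE distrC.
have /andP[h1 h2] := floor_itv (2 ^+ n * x 0 i).
have -> : x 0 i - 2 ^- n * (Num.floor (2 ^+ n * x 0 i))%:~R =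
    2 ^- n * (2 ^+ n * x 0 i - (Num.floor (2 ^+ n * x 0 i))%:~R).
  by rewrite mulrBr mulrA mulVf ?mul1r// gt_eqF.
rewrite normrM ger0_norm// ler_piMr//.
rewrite ger0_norm ?subr_ge0// lerBlDl; apply: le_trans (ltW h2) _.
by rewrite intrD.
Qed.

Lemma cint_indic (A : set E) (r : R) : measurable A -> mu A = r%:E ->
  cintble (fun x => (\1_A x)%:C) /\ cint (fun x => (\1_A x)%:C) = (r%:C).
Proof.
move=> mA muA.
have e1 : nint (fun x => \1_A x) = r%:E by rewrite /nint integral_indic// setIT.
split.
  apply: (@cintble_dom _ _ _ (fun x => \1_A x)).
  - side.
  - exact: measurable_indic.
  - by move=> x; rewrite normcr ger0_norm.
  - by rewrite e1 ltry.
apply: complexP => /=.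
  by rewrite /Rintegral [X in fine X](_ : _ = r%:E)/1/.
by rewrite /Rintegral integral_cst// mul0e.
Qed.

Lemma lat_inj n : injective (@lat n).
Proof.
move=> s t /rowP st; apply/rowP => i; have := st i; rewrite !mxE => /addIr[] e.
exact: val_inj.
Qed.

Lemma lat_cover n x : `|x| < 2 ^+ n -> exists t, dyfloor n x = lat (n := n) t.
Proof.
move=> xn.
have hi (i : 'I_d) : (0 <= Num.floor (2 ^+ n * x 0 i) + (4 ^ n)%:Z < (2 * 4 ^ n)%:Z).
  have /andP[h1 h2] : - 2 ^+ n < x 0 i < 2 ^+ n.
    by rewrite -ltr_norml; apply: le_lt_trans xn; exact: coord_le_norm.
  have e4 : (4 ^ n)%:R = 2 ^+ n * 2 ^+ n :> R by rewrite -exprMn natrX -natrM. have h0 : 0 < 2 ^+ n :> R by [].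
  have /andP[h3 h4] := floor_itv (2 ^+ n * x 0 i). have h5 : - (4 ^ n)%:Z < Num.floor (2 ^+ n * x 0 i) + 1.
    rewrite -(ltr_int R); apply: le_lt_trans h4. by rewrite rmorphN/= -pmulrn e4 -mulrN ler_pM2l// ltW.
  have h6 : Num.floor (2 ^+ n * x 0 i) < (4 ^ n)%:Z.
    rewrite -(ltr_int R); apply: le_lt_trans h3 _. by rewrite -pmulrn e4 ltr_pM2l.
  move: h5 h6; set f := Num.floor _; set N4 := (4 ^ n)%N; lia.
have ht (i : 'I_d) : (absz (Num.floor (2 ^+ n * x 0 i) + (4 ^ n)%:Z)%R < 2 * 4 ^ n)%N.
  by have /andP[h1 h2] := hi i; rewrite -ltz_nat gez0_abs.
exists (\row_i Ordinal (ht i)); apply/rowP => i; rewrite !mxE/=.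
by have /andP[h1 h2] := hi i; rewrite gez0_abs// addrK.
Qed.

Lemma rsum_step n F : exists S : E -> C, [/\ cintble S, cint S = rsum n F &
  forall x, S x = F (corner n (dyfloor n x)) \/ (S x = 0 /\ 2 ^+ n <= `|x|)].
Proof.
have hc (t : 'rV['I_(2 * 4 ^ n)]_d) : cintble (fun x => (\1_(dyadic_cube n%:Z (lat t)) x)%:C) /\
    cint (fun x => (\1_(dyadic_cube n%:Z (lat t)) x)%:C) = (2 ^- (n * d))%:C.
  by apply: cint_indic; [exact: measurable_dyadic_cube|exact: leb_dyadic_cube].
pose S x := \sum_t (F (corner n (lat (n := n) t)) * (\1_(dyadic_cube n%:Z (lat t)) x)%:C).
have hi t : cintble (fun x => F (corner n (lat (n := n) t)) * (\1_(dyadic_cube n%:Z (lat t)) x)%:C).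
  by apply: cintbleZ; exact: (hc t).1.
exists S; split; first exact: cintble_sum.
  rewrite /S cint_sum//; apply: eq_bigr => t _. by rewrite cintZ; [rewrite (hc t).2 mulrC|exact: (hc t).1].
move=> x.
have [[t ht]|nt] := pselect (exists t, dyfloor n x = lat (n := n) t).
  left; rewrite /S (bigD1 t)//= big1 ?addr0.
    rewrite indicE mem_set ?mulr1 ?ht//; exact/dyadic_cubeE.
  move=> t' tt'; rewrite indicE memNset ?mulr0// => /dyadic_cubeE e.
  by move: tt'; rewrite -(inj_eq (@lat_inj n)) -e ht eqxx.
right; split; last first.
  by rewrite leNgt; apply/negP => /lat_cover/1/.
rewrite /S big1// => t _; rewrite indicE memNset ?mulr0// => /dyadic_cubeE e.
by apply: nt; exists t.
Qed.

(** The error on each cube is the variation of F there; outside the large box the decay of F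
gives a factor 2^-n. *)
Lemma riemann_err F (A : R) n : cmeas F -> 0 <= A ->
  (forall x, normc (F x) <= A * wt (2 * d).+1%:R x) ->
  (forall x (h : E), `|h| <= 1 -> normc (F (x + h) - F x) <= A * `|h| * wt (2 * d)%:R x) ->
  normc (cint F - rsum n F) <= 2 * pi ^+ d * (A * 2 ^- n).
Proof.
move=> mF A0 h1 h2.
have [S [Si <- hS]] := rsum_step n F.
have pn : 0 < 2 ^+ n :> R by [].
have wi : cintble F.
  apply: (@cintble_dom _ _ _ (fun x => A * wt (2 * d)%:R x)) => //.
  - side.
  - by move=> x; apply: le_trans (h1 x) _; rewrite ler_wpM2l// wt_le// ler_nat.
  - rewrite nintZ/1/. apply: lte_mul_pinfty => /1/. by apply: le_lt_trans (nint_wt (lexx _)) _; rewrite ltry.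
rewrite -cintB// -mulrA.
apply: (@normc_cint_bound _ _ _ (fun x => A * 2 ^- n * wt (2 * d)%:R x)).
- side.
- side.
- move=> x; have [->|[-> xn]] := hS x.
    have hd := corner_dist n x.
    have := h2 x (corner n (dyfloor n x) - x); rewrite addrCA subrr addr0 normc_distC => h. apply: le_trans (h _) _.
      by apply: le_trans hd _; rewrite invf_le1// exprn_ege1// ler1n.
    by rewrite ler_wpM2r/1/ ler_wpM2l.
  rewrite subr0; apply: le_trans (h1 x) _. rewrite -mulrA ler_wpM2l// -addn1 natrD wtD mulrC ler_wpM2r/1/.
  rewrite [leLHS](_ : _ = (1 + `|x|)^-1); last by rewrite (wtX 1) expr1.
  rewrite lef_pV2/1/; apply: le_trans xn _; by rewrite lerDr.
- rewrite nintZ/1/. rewrite [pi ^+ d * _]mulrC [leRHS]EFinM; apply: lee_wpmul2l; last exact: nint_wt.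
  by rewrite lee_fin mulr_ge0// invr_ge0 ltW.
Qed.

Lemma riemann_prod psi (k : nat) : schwartz psi -> exists2 Cp, 0 <= Cp &
  forall F (a : R) n, cmeas F -> 0 <= a ->
   (forall x, normc (F x) <= a * (1 + `|x|) ^+ k) ->
   (forall x (h : E), `|h| <= 1 -> normc (F (x + h) - F x) <= a * `|h| * (1 + `|x|) ^+ k) ->
   cintble (fun x => psi x * F x) /\
   normc (cint (fun x => psi x * F x) - rsum n (fun x => psi x * F x)) <= Cp * (a * 2 ^- n).
Proof.
move=> ps.
have [B1 B10 hB1] := schwartz_decay 0 (k + (2 * d).+1)%:R ps.
have [B2 B20 hB2] := schwartz_lip 0 (ler0n R (k + (2 * d)))  ps.
have p1 x : normc (psi x) * (1 + `|x|) ^+ k <= B1 * wt (2 * d).+1%:R x.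
  apply: le_trans (ler_wpM2r _ (hB1 [::] isT x)) _ => /1/.
  rewrite natrD wtD wtX mulrAC mulrA -(mulrA B1) [X in B1 * X]mulrC.
  by rewrite mulVf ?mulr1// gt_eqF exprn_gt0 base_gt0.
have p2 x (h : E) : `|h| <= 1 -> normc (psi (x + h) - psi x) * (1 + `|x|) ^+ k <=
    B2 * 2 ^+ (k + 2 * d) * `|h| * wt (2 * d)%:R x.
  move=> h1; apply: le_trans (ler_wpM2r _ (hB2 [::] isT x h)) _ => /1/. rewrite powR_mulrn// natrD wtD (wtX k).
  have -> : B2 * `|h| * (1 + `|h|) ^+ (k + 2 * d) * ((1 + `|x|) ^- k * wt (2 * d)%:R x) * (1 + `|x|) ^+ k =
     B2 * (1 + `|h|) ^+ (k + 2 * d) * `|h| * wt (2 * d)%:R x * ((1 + `|x|) ^- k * (1 + `|x|) ^+ k) by ring.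
  rewrite mulVf ?mulr1/1/. rewrite ler_wpM2r/1/ ler_wpM2r// ler_wpM2l// lerXn2r/1/. by rewrite -[2]/(1 + 1) lerD2l.
pose D : R := B1 + (B2 * 2 ^+ (k + 2 * d) * 2 ^+ k + B1).
have D0 : 0 <= D => /1/.
exists (2 * pi ^+ d * D) => /1/.
move=> F a n mF a0 f1 f2.
have mG : cmeas (fun x => psi x * F x).
  side.
have g1 x : normc (psi x * F x) <= D * a * wt (2 * d).+1%:R x.
  rewrite normcM; via (a * (normc (psi x) * (1 + `|x|) ^+ k)).
    by rewrite mulrCA ler_wpM2l/1/.
  rewrite [D * a]mulrC -mulrA ler_wpM2l//; apply: le_trans (p1 x) _.
  by rewrite ler_wpM2r/1/ lerDl addr_ge0// !mulr_ge0// exprn_ge0.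
split.
  apply: (@cintble_dom _ _ _ (fun x => D * a * wt (2 * d).+1%:R x)) => //.
  - side.
  - rewrite nintZ/1/. apply: lte_mul_pinfty; rewrite ?lee_fin/1/.
    by apply: le_lt_trans (nint_wt _) _; rewrite ?ltry// ler_nat.
have := @riemann_err (fun x => psi x * F x) (D * a) n mG (mulr_ge0 D0 a0) g1.
rewrite -!mulrA; apply => x h h1.
have -> : psi (x + h) * F (x + h) - psi x * F x =
   (psi (x + h) - psi x) * F (x + h) + psi x * (F (x + h) - F x) by ring.
apply: le_trans (normc_triangle _ _) _; rewrite !normcM.
have t1 : normc (psi (x + h) - psi x) * normc (F (x + h)) <=
   a * (B2 * 2 ^+ (k + 2 * d) * 2 ^+ k) * (`|h| * wt (2 * d)%:R x).
  via (normc (psi (x + h) - psi x) * (a * (2 ^+ k * (1 + `|x|) ^+ k))).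
    rewrite ler_wpM2l/1/; apply: le_trans (f1 _) _; rewrite ler_wpM2l//.
    apply: le_trans (base_mul_le x h k) _; rewrite mulrC ler_wpM2r//. by rewrite lerXn2r/1/ -[2]/(1 + 1) lerD2l.
  have h3 := ler_wpM2l (mulr_ge0 a0 (exprn_ge0 k (ler0n R 2))) (p2 x h h1).
  rewrite [leRHS](_ : _ = a * 2 ^+ k * (B2 * 2 ^+ (k + 2 * d) * `|h| * wt (2 * d)%:R x)); last by ring.
  by apply: le_trans h3; le_ring.
have t2 : normc (psi x) * normc (F (x + h) - F x) <= a * B1 * (`|h| * wt (2 * d)%:R x).
  via (normc (psi x) * (a * `|h| * (1 + `|x|) ^+ k)).
    by rewrite ler_wpM2l/1/; exact: f2.
  have := ler_wpM2l (mulr_ge0 a0 (normr_ge0 h)) (p1 x). move=> h3; via (a * `|h| * (B1 * wt (2 * d).+1%:R x)).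
    by apply: le_trans h3; le_ring.
  rewrite -!mulrA ler_wpM2l// mulrCA ler_wpM2l// ler_wpM2l//. by rewrite wt_le// ler_nat.
apply: le_trans (lerD t1 t2) _.
set W := wt _ x; have W0 : 0 <= W := wt_ge0 _ _.
rewrite -subr_ge0 (_ : _ - _ = a * `|h| * W * B1); last by rewrite /D; ring.
side.
Qed.

(** A distribution commutes with Riemann sums by linearity; the sums converge to the integral in
all Schwartz seminorms by [riemann_prod], at the same rate 2^-n. *)
Lemma tempered_cint u psi K : tempered u -> schwartz psi -> schwartz K ->
  cintble (fun x => psi x * tconv u K x) /\
  cint (fun x => psi x * tconv u K x) = u (fun y => cint (fun x => psi x * K (x - y))).
Proof.
move=> ut ps Ks.
have [M [k [M0 hM]]] := tempered_bound ut.
have [A [k1 [A0 g1 g2]]] := tconv_growth ut Ks.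
have [Cp1 Cp10 hC1] := riemann_prod k1 ps.
have [Cp2 Cp20 hC2] := riemann_prod k ps.
have [B B0 hB] := refl_growth k Ks.
have mF : cmeas (tconv u K) by apply: ccont_cmeas; exact: tconv_ccont.
have h1 n := hC1 _ A n mF A0 g1 g2.
split; first exact: (h1 0%N).1.
pose Th (y : E) := cint (fun x => psi x * K (x - y)).
pose S n (y : E) := rsum n (fun x => psi x * K (x - y)).
have KN : schwartz (fun z => K (- z)).
  by have := schwartz_refl 0 Ks; congr schwartz; ext z; rewrite sub0r.
have ThE : Th = fun y => cint (fun x => psi x * (fun z => K (- z)) (y + (-1) *: x)).
  by ext y; congr cint; ext x; rewrite opprD scaleN1r opprK addrC.
have Ths : schwartz Th by rewrite ThE; exact: (@conv_schwartz psi (fun z => K (- z)) (-1) ps KN).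
have iterTh s y : iter_partial s Th y = cint (fun x => psi x * (((-1) ^+ size s)%:C * iter_partial s K (x - y))).
  rewrite ThE (@conv_smooth psi (fun z => K (- z)) (-1) (schwartz_cintble [::] ps) KN).2.
  congr cint; ext x; congr (_ * _). have -> : (fun z => K (- z)) = fun z => K (0 - z) by ext z; rewrite sub0r.
  by rewrite iter_refl// sub0r opprD scaleN1r opprK addrC.
have Ssm n (t : 'rV['I_(2 * 4 ^ n)]_d) : schwartz (fun y => (2 ^- (n * d))%:C *
    (psi (corner n (lat t)) * K (corner n (lat t) - y))).
  by apply: schwartzZ; apply: schwartzZ; exact: schwartz_refl.
have Ss n : schwartz (S n) by apply: schwartz_sum => t/1/.
have iterS n s y : iter_partial s (S n) y =
    rsum n (fun x => psi x * (((-1) ^+ size s)%:C * iter_partial s K (x - y))).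
  have [_ ->] := smooth_sum (index_enum _) (fun t => schwartz_smooth (Ssm n t)). apply: eq_bigr => t _.
  set a := psi (corner _ _). have sK := schwartz_smooth (schwartz_refl (corner n (lat t)) Ks).
  have sK2 := schwartz_smooth (schwartzZ a (schwartz_refl (corner n (lat t)) Ks)). have [s0 i0] := @smooth_cst R d 0.
  have iz (b : C) f : smooth f -> iter_partial s (fun x => b * f x) = fun x => b * iter_partial s f x.
    move=> fs; have [_ e] := smooth_lin b fs s0. rewrite (_ : (fun x => b * f x) = fun x => b * f x + 0).
      by rewrite e i0; ext x; case: (s); rewrite ?addr0// => ? ?; rewrite addr0.
    by ext x; rewrite addr0.
  by rewrite iz// iz// iter_refl.
have uS n : u (S n) = rsum n (fun x => psi x * tconv u K x).
  rewrite /S /rsum tempered_sum//; apply: eq_bigr => t _.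
  rewrite temperedZ//; last by apply: schwartzZ; exact: schwartz_refl. by rewrite temperedZ//; exact: schwartz_refl.
have h2 n : normc (u Th - u (S n)) <= M * (Cp2 * (B * 2 ^- n)).
  rewrite -temperedB//; apply: hM; first exact: schwartzB.
  move=> s sk y; rewrite iter_partialB; [|side|exact: schwartz_smooth]. rewrite iterTh iterS.
  pose F x := ((1 + `|y|) ^+ k)%:C * (((-1) ^+ size s)%:C * iter_partial s K (x - y)). have mFy : cmeas F.
    apply: cmeasM; first side. apply: cmeasM; first side. apply: (cmeas_comp (ccont_cmeas (schwartz_ccont s Ks))).
    side.
  have yk : 0 <= (1 + `|y|) ^+ k by []. have [||Fi hF] := hC2 F B n mFy B0.
  - by move=> x; rewrite /F normcM normcr ger0_norm// normcM normc_sign mul1r; exact: (hB s sk).1.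
  - move=> x h h1'; rewrite /F -mulrBr -mulrBr normcM normcr ger0_norm// normcM normc_sign mul1r. exact: (hB s sk).2.
  have -> : (1 + `|y|) ^+ k = normc ((1 + `|y|) ^+ k)%:C by rewrite normcr ger0_norm. rewrite -normcM mulrBr.
  have -> : ((1 + `|y|) ^+ k)%:C * cint (fun x => psi x * (((-1) ^+ size s)%:C * iter_partial s K (x - y))) =
     cint (fun x => psi x * F x).
    rewrite -cintZ; first by congr cint; ext x; rewrite mulrCA. have [Bs Bs0 hBs] := schwartz_bounded s Ks.
    apply: (cintble_mul_bounded (schwartz_cintble [::] ps) _ (B := Bs)).
      apply: cmeasM; first side. apply: (cmeas_comp (ccont_cmeas (schwartz_ccont s Ks))). side.
    by move=> x; rewrite normcM normc_sign mul1r.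
  have -> : ((1 + `|y|) ^+ k)%:C * rsum n (fun x => psi x * (((-1) ^+ size s)%:C * iter_partial s K (x - y))) =
     rsum n (fun x => psi x * F x).
    by rewrite /rsum mulr_sumr; apply: eq_bigr => t _; rewrite /F; ring.
  side.
apply/eqP; rewrite -subr_eq0; apply/eqP/eq0_normc/le_anti; rewrite normc_ge0 andbT.
apply/ler_addgt0Pr => e e0; rewrite add0r.
pose D := Cp1 * A + M * (Cp2 * B).
have D0 : 0 <= D => /1/.
have cD : (D * 2 ^- n) @[n --> \oo] --> (0:R).
  by rewrite -[X in _ --> X](mulr0 D); apply: cvgMr; exact: cvg_half.
have Dn0 n : 0 <= D * 2 ^- n => /1/.
have [N /(_ _ (leqnn N)) hN] := (cvg0_nnegP Dn0).1 cD e e0.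
apply: le_trans (ltW hN).
rewrite -(subrK (u (S N)) (cint _)) -addrA; apply: le_trans (normc_triangle _ _) _.
rewrite [leRHS]mulrDl -!mulrA; apply: lerD.
  by rewrite uS; exact: (h1 N).2.
by rewrite normc_distC/1/.
Qed.

Lemma approx_identity u K psi : tempered u -> schwartz K -> cint K = 1 -> schwartz psi ->
  normc (u (fun y => cint (fun z => K z * psi (y + 2 ^- n *: z))) - u psi) @[n --> \oo] --> (0:R).
Proof.
move=> ut Ks K1 ps.
have [M [k [M0 hM]]] := tempered_bound ut.
have [B B0 hB] := schwartz_lip k (ler0n R k) ps.
have Ki : cintble K := schwartz_cintble [::] Ks.
have [Q Q0 hQ] := schwartz_moment k.+1 Ks ler01.
have p0 n : 0 <= 2 ^- n :> R by [].
have p1 n : 2 ^- n <= 1 :> R by rewrite invf_le1// exprn_ege1// ler1n.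
pose Th n (y : E) := cint (fun z => K z * psi (y + 2 ^- n *: z)).
have Ths n : schwartz (Th n) by exact: conv_schwartz.
apply: (@cvg0_squeeze _ _ (fun n => 2 ^- n * (M * (2 * (B * Q))))).
- side.
- move=> n; rewrite -/(Th n) -(@temperedB R d u (Th n) psi)//.
  rewrite [2 ^- n * _]mulrCA; apply: hM; first exact: schwartzB.
  move=> s sk y; rewrite iter_partialB; [|exact: schwartz_smooth|side]. rewrite (conv_smooth _ Ki ps).2.
  have yk : 0 <= (1 + `|y|) ^+ k by []. have -> : iter_partial s psi y = cint (fun z => K z * iter_partial s psi y).
    have -> : (fun z => K z * iter_partial s psi y) = (fun z => iter_partial s psi y * K z).
      by ext z; rewrite mulrC.
    by rewrite cintZ// K1 mulr1.
  have [Bs Bs0 hBs] := schwartz_bounded s ps. have i1 : cintble (fun x => K x * iter_partial s psi (y + 2 ^- n *: x)).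
    apply: (cintble_mul_bounded Ki _ (B := Bs)) => //. apply: (cmeas_comp (ccont_cmeas (schwartz_ccont s ps))). side.
  have i2 : cintble (fun z => K z * iter_partial s psi y).
    by apply: (cintble_mul_bounded Ki _ (B := Bs)) => /1/.
  rewrite -cintB// -[X in X * _]ger0_norm// -normcr -normcM -cintZ; last side. rewrite mulrCA.
  have mm : meas (fun x : E => (1 + `|1 *: x|) ^+ k.+1 * normc (K x)).
    apply: measurable_funM => /1/. apply: measurable_funX; apply: measurable_funD => //.
    by apply: (measurableT_comp (@measurable_normx R d)); side.
  apply: (@normc_cint_bound _ _ _ (fun z => 2 ^- n * B * ((1 + `|1 *: z|) ^+ k.+1 * normc (K z)))).
  + by apply: cmeasM; [side|exact: (cintbleB i1 i2).1].
  + side.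
  + move=> z; rewrite -mulrBr normcM normcr ger0_norm// normcM. rewrite [leRHS]mulrA [leRHS]mulrC mulrCA ler_wpM2l/1/.
    apply: le_trans (ler_wpM2l yk (hB s sk y _)) _. rewrite powR_mulrn// wtX scale1r normrZ (ger0_norm (p0 n)).
    rewrite mulrCA mulfV ?mulr1/1/. have z0 := normr_ge0 z. have h1 : 2 ^- n * `|z| <= `|z| by rewrite ler_piMl.
    have h2 : (1 + 2 ^- n * `|z|) ^+ k <= (1 + `|z|) ^+ k.
      by rewrite lerXn2r ?nnegrE ?lerD2l// addr_ge0 mulr_ge0.
    rewrite exprS [leLHS](_ : _ = 2 ^- n * B * (`|z| * (1 + 2 ^- n * `|z|) ^+ k)); last by ring.
    rewrite ler_wpM2l/1/; apply: ler_pM => //; last by rewrite lerDr.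
  + rewrite nintZ/1/. by rewrite mulrA [leRHS]EFinM; apply: lee_wpmul2l; rewrite ?lee_fin ?mulr_ge0.
- by rewrite -[X in _ --> X](mul0r (M * (2 * (B * Q)))); apply: cvgMl; exact: cvg_half.
Qed.

End convolution.

(** * Littlewood-Paley kernels *)

Section littlewood_paley.
Variables (R : realType) (d : nat).
Local Notation E := 'rV[R]_d.
Local Notation C := R[i].
Local Notation ift := (@inverse_fourier R d).
Variable phi0 : E -> C.
Hypothesis phi0P : lp_cutoff phi0.
Implicit Types (x y z xi : E) (u : raw_distribution R d) (j n : nat).
Local Opaque inverse_fourier.

Lemma phi0_schwartz : schwartz phi0. Proof. by case: phi0P. Qed.

Lemma two_gt0 n : 0 < 2 ^+ n :> R. Proof. side. Qed.
Lemma two_ge0 n : 0 <= 2 ^+ n :> R. Proof. side. Qed.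
Lemma two_neq0 n : 2 ^+ n != 0 :> R. Proof. side. Qed.
Lemma twoV_gt0 n : 0 < 2 ^- n :> R. Proof. side. Qed.

Lemma eucl_normZ (a : R) x : 0 <= a -> eucl_norm (a *: x) = a * eucl_norm x.
Proof. by move=> a0; rewrite /eucl_norm dotpZl dotpZr mulrA -expr2 sqrtrM/1/ sqrtr_sqr ger0_norm. Qed.

Fact kernel_key : unit. Proof. side. Qed.

(** The low-pass kernel of frequency 2^n; [Kd] below is the kernel of the j-th piece. *)
Definition KL : nat -> E -> C := locked_with kernel_key
  (fun n x => (2 ^+ (n * d))%:C * ift phi0 (2 ^+ n *: x)).

Lemma KL_def n x : KL n x = (2 ^+ (n * d))%:C * ift phi0 (2 ^+ n *: x).
Proof. by rewrite /KL unlock. Qed.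

Definition Kd : nat -> E -> C := locked_with kernel_key (fun j => ift (lp_resolution phi0 j)).

Lemma Kd_def j : Kd j = ift (lp_resolution phi0 j).
Proof. by rewrite /Kd unlock. Qed.

Lemma lp_pieceE u j : lp_piece phi0 u j = tconv u (Kd j).
Proof. by rewrite Kd_def. Qed.

Lemma phi0_scaled n : schwartz (fun xi => phi0 (2 ^- n *: xi)).
Proof.
have := @schwartz_affine R d phi0 (2 ^- n) 0 _ phi0_schwartz.
rewrite gt_eqF// => /(_ isT); congr schwartz; ext x; by rewrite addr0.
Qed.

Lemma KLE n : KL n = ift (fun xi => phi0 (2 ^- n *: xi)).
Proof.
ext x; rewrite KL_def ift_scale; [|side|exact: phi0_schwartz].
rewrite (_ : ((2 ^- n) ^- d : R) = 2 ^+ (n * d)); last by rewrite -exprVn (invrK (2 ^+ n)) exprM.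
by rewrite (invrK (2 ^+ n : R)).
Qed.

Lemma schwartz_KL n : schwartz (KL n).
Proof. by rewrite KLE; exact: (schwartz_ift (phi0_scaled n)).1. Qed.

Lemma ift_sub f g x : schwartz f -> schwartz g ->
  ift (fun xi => f xi - g xi) x = ift f x - ift g x.
Proof.
move=> fs gs; rewrite !iftE -mulrBr -cintB.
- by congr (_ * cint _); ext z; rewrite mulrBl.
- exact: cintble_mulchi (schwartz_cintble [::] fs).
- exact: cintble_mulchi (schwartz_cintble [::] gs).
Qed.

Lemma Kd0 : Kd 0 = KL 0.
Proof.
rewrite KLE Kd_def; congr inverse_fourier; ext x.
by rewrite expr0 invr1 scale1r.
Qed.

Lemma KdS j : Kd j.+1 = fun x => KL j.+1 x - KL j x.
Proof.
ext x; rewrite Kd_def !KLE -ift_sub//; exact: phi0_scaled.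
Qed.

Lemma schwartz_res j : schwartz (lp_resolution phi0 j).
Proof.
case: j => [|j]; first exact: phi0_schwartz.
by apply: schwartzB; exact: phi0_scaled.
Qed.

Lemma schwartz_Kd j : schwartz (Kd j).
Proof. by rewrite Kd_def; exact: (schwartz_ift (schwartz_res j)).1. Qed.

Lemma phi0_one n xi : eucl_norm xi <= 2 ^+ n -> phi0 (2 ^- n *: xi) = 1.
Proof.
case: phi0P => _ h _ xn; apply: h; rewrite eucl_normZ//.
by rewrite mulrC ler_pdivrMr// mul1r.
Qed.

Lemma phi0_zero n xi : 3 / 2 * 2 ^+ n <= eucl_norm xi -> phi0 (2 ^- n *: xi) = 0.
Proof.
case: phi0P => _ _ h xn; apply: h; rewrite eucl_normZ//.
by rewrite [leRHS]mulrC ler_pdivlMr.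
Qed.

Lemma res_mul j xi : phi0 (2 ^- j.+1 *: xi) * lp_resolution phi0 j xi = lp_resolution phi0 j xi.
Proof.
have [h|h] := leP (eucl_norm xi) (2 ^+ j.+1); first by rewrite phi0_one ?mul1r.
suff -> : lp_resolution phi0 j xi = 0 by rewrite mulr0.
have h1 n : (n <= j)%N -> phi0 (2 ^- n *: xi) = 0.
  move=> nj; apply: phi0_zero; apply: le_trans (ltW h). rewrite exprS ler_pM//.
    by rewrite ler_pdivrMr// -natrM ler_nat.
  by rewrite ler_eXn2l// ltr1n.
case: j h h1 => [|j] h h1 /=; first by have := h1 0%N (leqnn _); rewrite expr0 invr1 scale1r.
by rewrite !h1 ?subrr.
Qed.

Lemma Kd_conv j x y : cint (fun z => KL j.+1 (x - z) * Kd j (z - y)) = Kd j (x - y).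
Proof.
have e : Kd j (x - y) = cint (fun z => KL j.+1 ((x - y) - z) * Kd j z).
  rewrite KLE Kd_def ift_conv; [|exact: phi0_scaled|exact: schwartz_res].
  have -> : (fun xi => phi0 (2 ^- j.+1 *: xi) * lp_resolution phi0 j xi) = lp_resolution phi0 j.
    by ext xi; exact: res_mul.
  by [].
rewrite e; set F := fun z => KL j.+1 ((x - y) - z) * Kd j z.
have Fi : cintble F.
  have [B B0 hB] := schwartz_bounded [::] (schwartz_KL j.+1).
  have -> : F = fun z => Kd j z * KL j.+1 ((x - y) - z) by ext z; rewrite mulrC.
  apply: (cintble_mul_bounded (schwartz_cintble [::] (schwartz_Kd j)) _ (B := B)) => [|z]; last exact: hB.
  apply: (cmeas_comp (ccont_cmeas (schwartz_ccont [::] (schwartz_KL j.+1)))). side.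
have -> : (fun z => KL j.+1 (x - z) * Kd j (z - y)) = (fun z => F (z + - y)).
  by ext z; rewrite /F opprB addrA subrK.
exact: cint_shift.
Qed.

(** A frequency piece is reproduced by the next low-pass filter. This identity is the only form
in which the frequency localization of the pieces is used in the upper bound. *)
Lemma lp_reproduce u j x : tempered u ->
  cintble (fun z => KL j.+1 (x - z) * lp_piece phi0 u j z) /\
  lp_piece phi0 u j x = cint (fun z => KL j.+1 (x - z) * lp_piece phi0 u j z).
Proof.
move=> ut; rewrite lp_pieceE; have := tempered_cint ut (schwartz_refl x (schwartz_KL j.+1)) (schwartz_Kd j).
case=> h1 h2; split => /1/.
rewrite h2 /tconv; congr u; ext y; by rewrite Kd_conv.
Qed.

Lemma lp_piece_ccont u j : tempered u -> ccont (lp_piece phi0 u j).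
Proof. by move=> ut; rewrite lp_pieceE; apply: tconv_ccont => //; exact: schwartz_Kd. Qed.

Lemma lp_piece_growth u j : tempered u -> exists A (k : nat), 0 <= A /\
   forall x, normc (lp_piece phi0 u j x) <= A * (1 + `|x|) ^+ k.
Proof.
move=> ut; rewrite lp_pieceE; have [A [k [A0 h _]]] := tconv_growth ut (schwartz_Kd j).
by exists A, k.
Qed.

Lemma lp_piece_sum u J x : tempered u ->
  \sum_(j < J.+1) lp_piece phi0 u j x = tconv u (KL J) x.
Proof.
move=> ut; elim: J => [|J IH]; first by rewrite big_ord1 lp_pieceE Kd0.
rewrite big_ord_recr/= IH lp_pieceE KdS /tconv -temperedD//.
- by congr u; ext y; rewrite addrC subrK.
- exact: schwartz_refl (schwartz_KL J).
- by apply: schwartzB; apply: schwartz_refl; exact: schwartz_KL.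
Qed.

Lemma cint_K0 : cint (ift phi0) = 1.
Proof.
rewrite (fourier_at0 phi0_schwartz).
have := @phi0_one 0 0; rewrite expr0 invr1 scale1r; apply.
by rewrite /eucl_norm /dotp big1 ?sqrtr0// => i _; rewrite mxE mul0r.
Qed.

Lemma lp_converge u psi : tempered u -> schwartz psi ->
  normc (cint (fun x => psi x * \sum_(j < J.+1) lp_piece phi0 u j x) - u psi) @[J --> \oo] --> (0:R).
Proof.
move=> ut ps.
rewrite (_ : (fun J => _) = fun n => normc (u (fun y => cint (fun z => ift phi0 z * psi (y + 2 ^- n *: z))) - u psi)).
  exact: approx_identity ut (schwartz_ift phi0_schwartz).1 cint_K0 ps.
ext J; congr (normc (_ - _)).
have -> : (fun x => psi x * \sum_(j < J.+1) lp_piece phi0 u j x) = fun x => psi x * tconv u (KL J) x.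
  by ext x; rewrite lp_piece_sum.
have [_ ->] := tempered_cint ut ps (schwartz_KL J).
congr u; ext y.
have Gi : cintble (fun z => ift phi0 z * psi (y + 2 ^- J *: z)).
  have [B B0 hB] := schwartz_bounded [::] ps.
  apply: (cintble_mul_bounded (schwartz_cintble [::] (schwartz_ift phi0_schwartz).1) _ (B := B)) => [|z]/1/.
  apply: (cmeas_comp (ccont_cmeas (schwartz_ccont [::] ps))). side.
have := cint_affine (- (2 ^+ J *: y)) (two_neq0 J) Gi.
set c := (_ ^- d)%:C => h.
have -> : cint (fun z => ift phi0 z * psi (y + 2 ^- J *: z)) =
    (2 ^+ (J * d))%:C * (c * cint (fun z => ift phi0 z * psi (y + 2 ^- J *: z))).
  rewrite mulrA -rmorphM/= ger0_norm// -exprM mulfV//. by rewrite mul1r.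
rewrite -h -cintZ.
  congr cint; ext x; rewrite KL_def scalerBr scalerBr.
  rewrite [X in y + (X - _)]scalerA [X in y + (_ - X)]scalerA mulVf// !scale1r.
  have -> : y + (x - y) = x by rewrite addrC subrK. by rewrite mulrCA [psi x * _]mulrC.
exact: (cintble_affine _ (two_neq0 J) Gi).
Qed.

Lemma cint_KL n : cint (KL n) = 1.
Proof.
rewrite KLE (fourier_at0 (phi0_scaled n)); apply: phi0_one.
rewrite /eucl_norm /dotp big1 ?sqrtr0// => i _; by rewrite mxE mul0r.
Qed.

Lemma cint_Kd j : cint (Kd j.+1) = 0.
Proof.
rewrite KdS cintB ?cint_KL ?subrr//; exact: schwartz_cintble [::] (schwartz_KL _).
Qed.

(** The symbol is constant near the origin, where phi0 is 1, so its gradient vanishes there. *)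
Lemma Kd_moment j i : cint (fun y => (y 0 i)%:C * Kd j.+1 y) = 0.
Proof.
have rs := schwartz_res j.+1.
have -> : (fun y => (y 0 i)%:C * Kd j.+1 y) = ift (fun xi => ii R * partial i (lp_resolution phi0 j.+1) xi).
  by ext y; rewrite Kd_def xc_ift.
have := fourier_at0 (schwartzZ (ii R) (schwartz_iter [:: i] rs)).
rewrite /= => ->.
suff -> : partial i (lp_resolution phi0 j.+1) 0 = 0 by rewrite mulr0.
have dr := @smooth_cder R d _ [::] i (schwartz_smooth rs).
have hz x : `|x| < (2 * (d%:R + 1))^-1 -> lp_resolution phi0 j.+1 x = 0.
  move=> xs; have x1 : eucl_norm x <= 1.
    apply: le_trans (eucl_norm_le x) _. via (d%:R * (2 * (d%:R + 1))^-1); first by rewrite ler_wpM2l// ltW.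
    by rewrite ler_pdivrMr// mul1r; have := ler0n R d; lra.
  rewrite /lp_resolution !phi0_one ?subrr//; apply: le_trans x1 _; apply: exprn_ege1; by rewrite ler1n.
have [d1 d2] := dr 0.
have e1 (q : E -> R) (c : R) : is_derive (0:E) (ev R i) q c ->
   (forall x, `|x| < (2 * (d%:R + 1))^-1 -> q x = 0) -> c = 0.
  move=> [dq <-] hq. have dq0 : is_derive (0:E) (ev R i) (fun _ : E => 0 : R) 0 by exact: is_derive_cst.
  rewrite -[RHS](@derive_val _ _ _ _ _ _ _ dq0); apply: near_eq_derive. have b0 : 0 < (2 * (d%:R + 1) : R)^-1 by [].
  apply/(@nbhs_ballP R E); exists (2 * (d%:R + 1))^-1 => // x. rewrite -ball_normE/= sub0r normrN; exact: hq.
apply: complexP; [apply: (e1 _ _ d1)|apply: (e1 _ _ d2)] => x /hz; by rewrite /= => ->.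
Qed.

End littlewood_paley.

(** * Powers with exponent at most one *)

Section powers.
Variable R : realType.
Implicit Types (a b p m : R).

Lemma powR_le p a b : 0 <= p -> 0 <= a -> a <= b -> a `^ p <= b `^ p.
Proof. by move=> p0 a0 ab; apply: ge0_ler_powR => /1/; exact: le_trans ab. Qed.

(** Trading a power of a for its upper bound m: the substitute for Hoelder and Minkowski below
exponent one. *)
Lemma powR_interp p a m : 0 < p <= 1 -> 0 <= a -> a <= m -> a <= a `^ p * m `^ (1 - p).
Proof.
move=> /andP[p0 p1]; rewrite le_eqVlt => /orP[/eqP<- _|a0 am].
  side.
rewrite -[leLHS]powRr1/1/ -[X in a `^ X](subrK p) addrC powRD; last by rewrite (gt_eqF a0) implybT.
rewrite ler_wpM2l/1/; apply: powR_le => /1/; by rewrite subr_ge0.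
Qed.

(** Solves the self-improving inequality a <= b a^(1-p), which is how the Peetre estimate is
closed. *)
Lemma powR_root p a b : 0 < p <= 1 -> 0 <= a -> 0 <= b -> a <= b * a `^ (1 - p) -> a `^ p <= b.
Proof.
move=> /andP[p0 p1]; rewrite le_eqVlt => /orP[/eqP<- b0 _|a0 b0].
  by rewrite powR0/1/.
rewrite -{1}[a]powRr1/1/ -{1}(subrK p 1) addrC powRD; last by rewrite (gt_eqF a0) implybT.
by rewrite ler_pM2r// powR_gt0.
Qed.

Lemma powR_subadd p a b : 0 < p <= 1 -> 0 <= a -> 0 <= b -> (a + b) `^ p <= a `^ p + b `^ p.
Proof.
move=> pp a0 b0; have s0 : 0 <= a + b by side.
apply: powR_root => /1/.
rewrite mulrDl; apply: lerD; apply: powR_interp => //; [by rewrite lerDl|by rewrite lerDr].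
Qed.

Lemma powR_sum_le p (I : Type) (r : seq I) (F : I -> R) : 0 < p <= 1 -> (forall i, 0 <= F i) ->
  (\sum_(i <- r) F i) `^ p <= \sum_(i <- r) F i `^ p.
Proof.
move=> pp F0; elim: r => [|i r IH].
  by rewrite !big_nil powR0// gt_eqF; case/andP: pp.
rewrite !big_cons; apply: le_trans (powR_subadd pp (F0 i) _) _ => /1/.
by rewrite lerD2l.
Qed.

Lemma powRV p a : 0 < p -> 0 <= a -> (a `^ p^-1) `^ p = a.
Proof. by move=> p0 a0; rewrite -powRrM mulVf/1/ powRr1. Qed.

Lemma powR_leV p a b : 0 < p -> 0 <= a -> 0 <= b -> a `^ p <= b -> a <= b `^ p^-1.
Proof.
move=> p0 a0 b0 h; rewrite -[leLHS]powRr1// -(mulfV (lt0r_neq0 p0)) powRrM.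
by apply: powR_le => /1/.
Qed.

Lemma measurable_powR_fun d (T : measurableType d) (f : T -> R) p :
  meas f -> meas (fun x => f x `^ p).
Proof. by move=> mf; exact: (measurableT_comp (measurable_powR p) mf). Qed.

End powers.

(** * Real-valued integrals of nonnegative functions *)

Section real_integral.
Variables (R : realType) (d : nat).
Local Notation E := 'rV[R]_d.
Local Notation C := R[i].
Local Notation mu := (@leb R d).
Implicit Types (f g : E -> R).

Definition L1p f := [/\ meas f, (forall x, 0 <= f x) & (nint f < +oo)%E].

Fact rint_key : unit. Proof. side. Qed.

Definition rint : (E -> R) -> R := locked_with rint_key (fun f => fine (nint f)).

Lemma rint_def f : rint f = fine (nint f).
Proof. by rewrite /rint unlock. Qed.

Lemma rintE f : L1p f -> nint f = (rint f)%:E.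
Proof.
by case=> mf f0 fy; rewrite rint_def fineK// ge0_fin_numE//; exact: nint_ge0.
Qed.

Lemma rint_ge0 f : (forall x, 0 <= f x) -> 0 <= rint f.
Proof. by move=> f0; rewrite rint_def; apply: fine_ge0; exact: nint_ge0. Qed.

Lemma L1p_le f g : L1p g -> meas f -> (forall x, 0 <= f x) ->
  (forall x, f x <= g x) -> L1p f /\ rint f <= rint g.
Proof.
move=> Lg mf f0 fg; have [mg g0 gy] := Lg.
have h : (nint f <= nint g)%E by exact: nint_le.
have Lf : L1p f by split => //; exact: le_lt_trans h gy.
by split => //; rewrite -lee_fin -!rintE.
Qed.

Lemma rint_le f g : L1p f -> L1p g -> (forall x, f x <= g x) -> rint f <= rint g.
Proof. by move=> [mf f0 _] Lg fg; have [] := L1p_le Lg mf f0 fg. Qed.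

Lemma L1pZ (c : R) f : 0 <= c -> L1p f ->
  L1p (fun x => c * f x) /\ rint (fun x => c * f x) = c * rint f.
Proof.
move=> c0 Lf; have [mf f0 fy] := Lf.
have e : nint (fun x => c * f x) = (c * rint f)%:E by rewrite nintZ// rintE.
split; last by rewrite rint_def e.
by split => /1/; rewrite e ltry.
Qed.

Lemma L1pD f g : L1p f -> L1p g ->
  L1p (fun x => f x + g x) /\ rint (fun x => f x + g x) = rint f + rint g.
Proof.
move=> Lf Lg; have [mf f0 fy] := Lf; have [mg g0 gy] := Lg.
have e : nint (fun x => f x + g x) = (rint f + rint g)%:E by rewrite nintD// !rintE.
split; last by rewrite rint_def e.
by split => /1/; rewrite e ltry.
Qed.

Lemma L1p0 : L1p (fun=> 0) /\ rint (fun=> 0) = 0.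
Proof.
have e : nint (fun _ : E => 0 : R) = 0%E by rewrite /nint integral_cst// mul0e.
by split; [split => //; rewrite e ltry|rewrite rint_def e].
Qed.

Lemma L1p_sum (I : Type) (r : seq I) (F : I -> E -> R) : (forall i, L1p (F i)) ->
  L1p (fun x => \sum_(i <- r) F i x) /\
  rint (fun x => \sum_(i <- r) F i x) = \sum_(i <- r) rint (F i).
Proof.
move=> LF; elim: r => [|i r IH].
  rewrite big_nil (_ : (fun x => _) = fun=> 0); first exact: L1p0. by ext x; rewrite big_nil.
rewrite big_cons (_ : (fun x => _) = fun x => F i x + \sum_(j <- r) F j x).
  by have [h1 h2] := L1pD (LF i) IH.1 => /1/; rewrite h2 IH.2.
by ext x; rewrite big_cons.
Qed.

Lemma L1p_affine (a : R) (b : E) f : a != 0 -> L1p f ->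
  L1p (fun x => f (a *: x + b)) /\ rint (fun x => f (a *: x + b)) = `|a| ^- d * rint f.
Proof.
move=> a0 Lf; have [mf f0 fy] := Lf.
have e : nint (fun x => f (a *: x + b)) = (`|a| ^- d * rint f)%:E.
  by rewrite nint_affine// rintE.
split; last by rewrite rint_def e.
split; [|side|by rewrite e ltry].
exact: (measurableT_comp mf (measurable_affine a b)).
Qed.

Lemma L1p_shift (b : E) f : L1p f ->
  L1p (fun x => f (x + b)) /\ rint (fun x => f (x + b)) = rint f.
Proof.
move=> Lf; have := L1p_affine b (oner_neq0 R) Lf.
rewrite normr1 expr1n invr1 mul1r (_ : (fun x => f (1 *: x + b)) = fun x => f (x + b))//.
by ext x; rewrite scale1r.
Qed.

Lemma L1p_refl (b : E) f : L1p f ->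
  L1p (fun x => f (b - x)) /\ rint (fun x => f (b - x)) = rint f.
Proof.
have n0 : (-1 : R) != 0 by [].
move=> Lf; have := L1p_affine b n0 Lf.
rewrite normrN1 expr1n invr1 mul1r (_ : (fun x => f (-1 *: x + b)) = fun x => f (b - x))//.
by ext x; rewrite scaleN1r addrC.
Qed.

Lemma L1p_bounded f g (B : R) : L1p f -> meas g -> (forall x, 0 <= g x <= B) ->
  L1p (fun x => g x * f x) /\ rint (fun x => g x * f x) <= B * rint f.
Proof.
move=> Lf mg gB; have [mf f0 _] := Lf.
have B0 : 0 <= B by have /andP[h1 h2] := gB 0; exact: le_trans h2.
have [h1 h2] := L1pZ B0 Lf.
have [||h3 h4] := @L1p_le (fun x => g x * f x) _ h1 (measurable_funM mg mf).
- by move=> x; rewrite mulr_ge0; case/andP: (gB x).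
- by move=> x; rewrite ler_wpM2r; case/andP: (gB x).
by split => //; rewrite -h2.
Qed.

Lemma measurable_rint (F : E -> E -> R) :
  meas (fun z : E * E => F z.1 z.2) -> (forall x y, 0 <= F x y) ->
  meas (fun x => rint (F x)).
Proof.
move=> mF F0; under eq_fun do rewrite rint_def.
apply: (measurableT_comp (fine_measurable measurableT)).
apply: (@measurable_fun_fubini_tonelli_F _ _ E E R mu (fun z => (F z.1 z.2)%:E)).
  exact/measurable_EFinP.
by move=> z; rewrite lee_fin.
Qed.

Lemma measurable_slice2 (F : E -> E -> R) y :
  meas (fun z : E * E => F z.1 z.2) -> meas (F ^~ y).
Proof. by move=> mF; exact: (measurableT_comp mF (pair2_measurable y)). Qed.

Lemma measurable_exch (F : E -> E -> R) :
  meas (fun z : E * E => F z.1 z.2) ->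
  meas (fun z : E * E => F z.2 z.1).
Proof. by move=> mF; exact: (measurableT_comp mF (@measurable_swap _ _ E E)). Qed.

Lemma rint_tonelli (F : E -> E -> R) :
  meas (fun z : E * E => F z.1 z.2) -> (forall x y, 0 <= F x y) ->
  (forall x, L1p (F x)) -> (forall y, L1p (F ^~ y)) -> L1p (fun x => rint (F x)) ->
  L1p (fun y => rint (F ^~ y)) /\ rint (fun y => rint (F ^~ y)) = rint (fun x => rint (F x)).
Proof.
move=> mF F0 F1 F2 Lr.
have e : nint (fun y => rint (F ^~ y)) = (rint (fun x => rint (F x)))%:E.
  rewrite -(rintE Lr) /nint. transitivity (\int[mu]_y \int[mu]_x (F x y)%:E)%E.
    by apply: eq_integral => y _; rewrite -rintE.
  rewrite -(@nint_tonelli R d (fun x y => (F x y)%:E)).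
  - by apply: eq_integral => x _; rewrite -rintE.
  - exact/measurable_EFinP.
  - by [].
split; last by rewrite rint_def e.
split; last by rewrite e ltry.
- apply: (measurable_rint (F := fun y x => F x y)) => //. exact: measurable_exch.
- by move=> y; exact: rint_ge0.
Qed.

Lemma normc_cint_rint (f : E -> C) (g : E -> R) : cmeas f -> L1p g ->
  (forall x, normc (f x) <= g x) -> normc (cint f) <= 2 * rint g.
Proof.
by move=> mf Lg fg; apply: normc_cint_bound fg _ => //; [case: Lg|rewrite rintE].
Qed.

Lemma cintble_L1p (f : E -> C) : cintble f <-> cmeas f /\ L1p (fun x => normc (f x)).
Proof.
split; first by case=> mf fy; split => //; split => // [|x]/1/.
by case=> mf [].
Qed.

Lemma nint_fatou (F : nat -> E -> R) (f : E -> R) (B : R) :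
  (forall n, L1p (F n)) -> (forall x, 0 <= f x) -> meas f ->
  (forall x, F n x @[n --> \oo] --> f x) -> (forall n, rint (F n) <= B) ->
  L1p f /\ rint f <= B.
Proof.
move=> LF f0 mf Ff FB.
have h : (nint f <= B%:E)%E.
  have := @fatou _ _ _ mu setT measurableT (fun n x => (F n x)%:E). move=> /(_ (fun n => _) (fun n x _ => _)) h.
  have e : (fun x => limn_einf (fun n => (F n x)%:E)) = (fun x => (f x)%:E).
    by ext x; apply: (cvg_limn_einf_sup _).1; apply: cvg_EFin; [exact: nearW|exact: Ff].
  rewrite e in h; apply: le_trans (h _ _) _.
  - by move=> n; apply/measurable_EFinP; case: (LF n).
  - by move=> n x; rewrite lee_fin; case: (LF n).
  - rewrite limn_einf_lim; apply: lime_le; first exact: is_cvg_einfs. apply: nearW => n; via (nint (F n)).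
      by apply: ereal_inf_lbound; exists n => /=.
    by rewrite rintE// lee_fin.
have Lf : L1p f by split => //; exact: le_lt_trans h (ltry _).
by split => //; rewrite -lee_fin -rintE.
Qed.

End real_integral.

Ltac side_integral ::= match goal with
  | |- is_true (0 <= _)%R => apply: rint_ge0
  | |- is_true (0 < _)%R => first [ exact: two_gt0 | exact: twoV_gt0 ]
  | H : L1p ?f |- is_true (0 <= ?f _)%R => (by case: H)
  | H : L1p ?f |- measurable_fun _ ?f => (case: H => ? _ _; assumption)
  | |- measurable_fun _ _ => apply: measurable_powR_fun
  | |- schwartz _ => first [ exact: schwartz_KL | exact: schwartz_Kd ]
  end.

Ltac vring := apply/rowP => ?; rewrite !mxE; ring.

(** * Dilated weights and kernel bounds *)

Section dilated_weights.
Variables (R : realType) (d : nat).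
Local Notation E := 'rV[R]_d.
Implicit Types (x y z : E) (j k : nat) (s : R) (f : E -> R).

Fact dwt_key : unit. Proof. side. Qed.

Definition dwt : R -> nat -> E -> R :=
  locked_with dwt_key (fun s j x => 2 ^+ (j * d) * wt s (2 ^+ j *: x)).

Lemma dwtE s j x : dwt s j x = 2 ^+ (j * d) * wt s (2 ^+ j *: x).
Proof. by rewrite /dwt unlock. Qed.

Lemma dwt_ge0 s j x : 0 <= dwt s j x.
Proof. by rewrite dwtE mulr_ge0/1/. Qed.

Lemma dwt_le s j x : 0 <= s -> dwt s j x <= 2 ^+ (j * d).
Proof. by move=> s0; rewrite dwtE ler_piMr// wt_le1. Qed.

Lemma dwtN s j x : dwt s j (- x) = dwt s j x.
Proof. by rewrite !dwtE scalerN wtN. Qed.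

Lemma dwt_mono s t j x : s <= t -> dwt t j x <= dwt s j x.
Proof. by move=> st; rewrite !dwtE ler_wpM2l// wt_le. Qed.

Lemma measurable_dwt s j d' (T : measurableType d') (h : T -> E) : meas h ->
  meas (fun t => dwt s j (h t)).
Proof.
move=> mh; under eq_fun do rewrite dwtE; apply: measurable_funM => //.
exact: (measurableT_comp (@measurable_wt R d s) (measurable_rVZ _ mh)).
Qed.

Lemma L1p_wt s : (2 * d)%:R <= s -> L1p (@wt R d s) /\ rint (@wt R d s) <= pi ^+ d.
Proof.
move=> ds; have h := nint_wt ds.
have L : L1p (@wt R d s).
  split => /1/; exact: le_lt_trans h (ltry _).
by split => //; rewrite -lee_fin -rintE.
Qed.

Lemma L1p_dwt s j x : (2 * d)%:R <= s ->
  L1p (fun y => dwt s j (x - y)) /\ rint (fun y => dwt s j (x - y)) <= pi ^+ d.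
Proof.
move=> ds; have [L1 L2] := L1p_wt ds.
have [L3 L4] := L1p_affine 0 (two_neq0 R j) L1.
have [L5 L6] := L1pZ (two_ge0 R (j * d)) L3.
have [L7 L8] := L1p_refl x L5.
have e : (fun y => dwt s j (x - y)) = fun y => 2 ^+ (j * d) * wt s (2 ^+ j *: (x - y) + 0).
  by ext y; rewrite dwtE addr0.
rewrite e; split; first side.
suff -> : rint (fun y => 2 ^+ (j * d) * wt s (2 ^+ j *: (x - y) + 0)) = rint (@wt R d s) by [].
apply: etrans L8 _; apply: etrans L6 _; apply: etrans (congr1 _ L4) _.
rewrite (ger0_norm (two_ge0 R j)) mulrA -exprM mulfV/1/.
by rewrite mul1r.
Qed.

Lemma L1p_dwt_conv s j (S : E -> R) : (2 * d)%:R <= s -> L1p S ->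
  [/\ forall x, L1p (fun y => dwt s j (x - y) * S y),
      L1p (fun x => rint (fun y => dwt s j (x - y) * S y)) &
      rint (fun x => rint (fun y => dwt s j (x - y) * S y)) <= pi ^+ d * rint S].
Proof.
move=> ds LS; have s0 : 0 <= s by apply: le_trans ds.
have [mS S0 _] := LS.
pose F y x := dwt s j (x - y) * S y.
have mF : meas (fun z : E * E => F z.1 z.2).
  apply: measurable_funM; last exact: (measurableT_comp mS measurable_fst). by apply: measurable_dwt; side.
have F0 x y : 0 <= F x y by rewrite mulr_ge0 ?dwt_ge0.
have h1 y : L1p (F y) /\ rint (F y) <= S y * pi ^+ d.
  have [h2 h3] := L1p_dwt j y ds. have [h4 h5] := L1pZ (S0 y) h2. have -> : F y = fun x => S y * dwt s j (y - x).
    by ext x; rewrite mulrC -dwtN opprB.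
  by split => //; rewrite h5; apply: ler_wpM2l.
have h2 x : L1p (fun y => dwt s j (x - y) * S y).
  apply: (L1p_bounded (B := 2 ^+ (j * d)) LS _ _).1.
    by apply: measurable_dwt; side.
  by move=> y; rewrite dwt_ge0 dwt_le.
have [h6 h7] := L1pZ (exprn_ge0 d (pi_ge0 R)) LS.
have [|||h8 h9] := @L1p_le R d (fun y => rint (F y)) _ h6.
- exact: measurable_rint.
- side.
- by move=> y; rewrite mulrC; exact: (h1 y).2.
have [||h10 h11] := rint_tonelli mF F0 _ _ h8.
- by move=> y; exact: (h1 y).1.
- by [].
split => /1/.
rewrite [leLHS](_ : _ = rint (fun x => rint (F x))); last by [].
by rewrite -h7.
Qed.

Lemma wt_dil_le s j x : 0 <= s -> wt s (2 ^+ j *: x) <= 2 `^ s * wt s (2 ^+ j.+1 *: x).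
Proof.
move=> s0; rewrite /wt !powRN -ler_pdivrMr//.
rewrite invrK mulrC ler_pdivrMr// -powRM//.
apply: powR_le; rewrite// !normrZ !ger0_norm// exprS.
rewrite mulrDr mulr1 mulrA lerD2r; by rewrite ler1n.
Qed.

Lemma wt_submul2 s x y z : 0 <= s -> wt s (x - y) * wt s (x - z) <= wt s (z - y).
Proof.
move=> s0; have := wt_submul (x - y) (- (x - z)) s0; rewrite wtN.
have -> : x - y - (x - z) = z - y by vring.
by [].
Qed.

End dilated_weights.

Section kernel_bounds.
Variables (R : realType) (d : nat).
Local Notation E := 'rV[R]_d.
Local Notation C := R[i].
Variable phi0 : E -> C.
Hypothesis phi0P : lp_cutoff phi0.
Implicit Types (x y z h : E) (j k : nat) (s : R).
Local Notation KL := (KL phi0).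
Local Notation Kd := (Kd phi0).
Local Opaque inverse_fourier wt dwt.

Lemma KL_bounds s : 0 <= s -> exists2 B, 0 <= B & forall j,
  (forall x, normc (KL j x) <= B * dwt s j x) /\
  (forall x h, normc (KL j (x + h) - KL j x) <=
     B * (2 ^+ j * `|h|) * (1 + 2 ^+ j * `|h|) `^ s * dwt s j x).
Proof.
move=> s0; have K0s := (schwartz_ift (phi0_schwartz phi0P)).1.
have [B1 B10 h1] := schwartz_decay 0 s K0s.
have [B2 B20 h2] := schwartz_lip 0 s0 K0s.
exists (B1 + B2) => /1/.
move=> j; have t0 := two_ge0 R (j * d); split => x.
  rewrite KL_def dwtE normcM normcr ger0_norm// mulrCA ler_wpM2l//.
  apply: le_trans (h1 [::] isT _) _; rewrite ler_wpM2r/1/ lerDl//.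
move=> h; rewrite !KL_def -mulrBr normcM normcr ger0_norm// !dwtE [leRHS]mulrCA ler_wpM2l//.
rewrite scalerDr; apply: le_trans (h2 [::] isT _ _) _.
rewrite ler_wpM2r/1/ normrZ ger0_norm// ler_wpM2r//.
by rewrite ler_wpM2r// lerDr.
Qed.

Lemma dwt_dil_le s j x : 0 <= s -> dwt s j x <= 2 `^ s * dwt s j.+1 x.
Proof.
move=> s0; rewrite !dwtE [leRHS]mulrCA; apply: ler_pM => /1/.
  by rewrite ler_eXn2l ?ltr1n// mulSn leq_addl.
exact: wt_dil_le.
Qed.

Lemma Kd_bounds s : 0 <= s -> exists2 B, 0 <= B & forall j,
  (forall x, normc (Kd j x) <= B * dwt s j x) /\
  (forall x h, normc (Kd j (x + h) - Kd j x) <=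
     B * (2 ^+ j * `|h|) * (1 + 2 ^+ j * `|h|) `^ s * dwt s j x).
Proof.
move=> s0; have [B B0 hB] := KL_bounds s0.
have p0 : 0 <= 2 `^ s :> R := powR_ge0 _ _.
exists (B + B * 2 `^ s) => /1/.
move=> j; case: j => [|j].
  rewrite (Kd0 phi0P); have [h1 h2] := hB 0%N; split => x.
    by apply: le_trans (h1 x) _; rewrite ler_wpM2r ?dwt_ge0// lerDl mulr_ge0.
  move=> h; apply: le_trans (h2 x h) _; rewrite ler_wpM2r ?dwt_ge0// ler_wpM2r//.
  by rewrite ler_wpM2r// lerDl mulr_ge0.
have [h1 h2] := hB j.+1; have [h3 h4] := hB j.
rewrite (KdS phi0P); split => x.
  apply: le_trans (normc_triangleB _ _) _; rewrite mulrDl; apply: lerD => //.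
  apply: le_trans (h3 x) _; rewrite -mulrA ler_wpM2l//; exact: dwt_dil_le.
move=> h.
have -> : KL j.+1 (x + h) - KL j (x + h) - (KL j.+1 x - KL j x) = (KL j.+1 (x + h) - KL j.+1 x) - (KL j (x + h) - KL j x) by ring.
apply: le_trans (normc_triangleB _ _) _; rewrite !mulrDl; apply: lerD => //.
apply: le_trans (h4 x h) _.
have tj : 2 ^+ j * `|h| <= 2 ^+ j.+1 * `|h|.
  by rewrite ler_wpM2r// ler_eXn2l// ltr1n.
rewrite [leRHS](_ : _ = B * ((2 ^+ j.+1 * `|h|) * ((1 + 2 ^+ j.+1 * `|h|) `^ s * (2 `^ s * dwt s j.+1 x)))); last by ring.
rewrite -!(mulrA B) -(mulrA (2 ^+ j * _)) ler_wpM2l//; apply: ler_pM => //.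
- by rewrite mulr_ge0 ?dwt_ge0.
- apply: ler_pM; rewrite ?dwt_ge0//; last exact: dwt_dil_le. by apply: powR_le => //; rewrite ?lerD2l// addr_ge0.
Qed.

(** The three properties of a frequency piece that the upper bound uses: continuity, polynomial
growth and the reproducing identity. *)
Definition banded j (f : E -> C) :=
  [/\ ccont f,
     exists A (k : nat), 0 <= A /\ forall x, normc (f x) <= A * (1 + `|x|) ^+ k &
     forall x, cintble (fun z => KL j.+1 (x - z) * f z) /\
       f x = cint (fun z => KL j.+1 (x - z) * f z)].

Lemma lp_piece_banded u j : tempered u -> banded j (lp_piece phi0 u j).
Proof.
move=> ut; split; first exact: lp_piece_ccont.
  exact: lp_piece_growth.
by move=> x; exact: lp_reproduce.
Qed.

Definition Hm p s j (f : E -> C) x : R := rint (fun y => dwt s j (x - y) * normc (f y) `^ p).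

Variable p : R.
Hypothesis p01 : 0 < p <= 1.
Let p0 : 0 < p. Proof. by case/andP: p01. Qed.

Section one_function.
Variables (j : nat) (f : E -> C).
Hypothesis fb : banded j f.
Hypothesis fp : L1p (fun x => normc (f x) `^ p).
Let cf : ccont f. Proof. by case: fb. Qed.
Let mf : cmeas f. Proof. exact: ccont_cmeas. Qed.

Lemma Hm_L1p s x : 0 <= s ->
  L1p (fun y => dwt s j (x - y) * normc (f y) `^ p) /\
  Hm p s j f x <= 2 ^+ (j * d) * rint (fun x => normc (f x) `^ p).
Proof.
move=> s0; apply: (L1p_bounded (g := fun y => dwt s j (x - y)) fp).
- by apply: measurable_dwt; side.
- by move=> y; rewrite dwt_ge0 dwt_le.
Qed.

Lemma Hm_ge0 s x : 0 <= Hm p s j f x.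
Proof. by apply: rint_ge0 => y; rewrite mulr_ge0 ?dwt_ge0 ?powR_ge0. Qed.

Lemma L1p_Hm s : (2 * d)%:R <= s -> L1p (Hm p s j f) /\
  rint (Hm p s j f) <= pi ^+ d * rint (fun x => normc (f x) `^ p).
Proof. by move=> ds; have [_ h1 h2] := L1p_dwt_conv j ds fp. Qed.

Lemma Hm_slow s x y : 0 <= s -> Hm p s j f y * wt s (2 ^+ j *: (y - x)) <= Hm p s j f x.
Proof.
move=> s0; have [L1 _] := Hm_L1p y s0; have [L2 _] := Hm_L1p x s0.
have [L3 e] := L1pZ (wt_ge0 s (2 ^+ j *: (y - x))) L1.
rewrite mulrC -e; apply: rint_le => // z.
rewrite mulrA ler_wpM2r/1/ !dwtE mulrCA ler_wpM2l//.
by rewrite mulrC !scalerBr; exact: wt_submul2.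
Qed.

End one_function.

(** Peetre maximal estimate under an a priori bound M0. In the reproducing identity one writes
|f| = |f|^p |f|^(1-p), bounds the second factor by M0^(1-p) and absorbs it by [powR_root]; the
constant does not depend on M0. *)
Lemma peetre_core (t : R) : 0 <= t -> exists2 B, 0 <= B & forall j f x M0,
  banded j f -> L1p (fun x => normc (f x) `^ p) ->
  (forall z, normc (f z) * wt t (2 ^+ j *: (z - x)) <= M0) ->
  forall y, normc (f y) `^ p * wt (t * p) (2 ^+ j *: (y - x)) <= B * Hm p (t * p) j f x.
Proof.
move=> t0; have [B B0 hB] := KL_bounds t0.
have q0 : 0 <= 2 `^ t :> R := powR_ge0 _ _.
exists (2 * (B * 2 ^+ d)) => /1/.
move=> j f x M0 fb fp hM y.
pose a z := normc (f z) * wt t (2 ^+ j *: (z - x)).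
have a0 z : 0 <= a z => /1/.
pose m := sup (range a).
have hs : has_sup (range a).
  by split; [exists (a 0), 0|exists M0 => _ [z _ <-]; exact: hM].
have am z : a z <= m by apply: (ub_le_sup hs.2) => /1/.
have m0 := le_trans (a0 0) (am 0).
set H := Hm _ _ _ _ _; have H0 : 0 <= H by exact: Hm_ge0.
have key z : a z <= 2 * (B * 2 ^+ d) * H * m `^ (1 - p).
  have [cf _ /(_ z)[fi fe]] := fb. have [L1 L2] := @Hm_L1p j f fp (t * p) x (mulr_ge0 t0 (ltW p0)).
  have c0 : 0 <= B * 2 ^+ d * m `^ (1 - p) => /1/. have [L3 L4] := L1pZ c0 L1.
  have -> : a z = normc (cint (fun w => (wt t (2 ^+ j *: (z - x)))%:C * (KL j.+1 (z - w) * f w))).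
    by rewrite cintZ// -fe normcM normcr ger0_norm/1/ mulrC.
  rewrite [leRHS](_ : _ = 2 * (B * 2 ^+ d * m `^ (1 - p) * H)); last by ring.
  rewrite -L4; apply: normc_cint_rint => //.
    side.
  move=> w; rewrite !normcM normcr ger0_norm/1/. have k1 : normc (KL j.+1 (z - w)) <= B * 2 ^+ d * dwt t j (z - w).
    apply: le_trans ((hB j.+1).1 _) _; rewrite -mulrA ler_wpM2l//.
    rewrite !dwtE mulSn exprD -mulrA; apply: ler_wpM2l; first side. apply: ler_wpM2l; first side.
    apply: wt_norm_le => //; rewrite !normrZ !ger0_norm// ler_wpM2r//. by rewrite ler_eXn2l// ltr1n.
  have wpos v : 0 < wt t v => /1/.
  have k2 : normc (f w) * wt t (2 ^+ j *: (w - x)) <= normc (f w) `^ p * wt (t * p) (2 ^+ j *: (w - x)) * m `^ (1 - p).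
    apply: le_trans (powR_interp p01 (a0 w) (am w)) _. by rewrite ler_wpM2r/1/ powRM/1/ wt_powR.
  have k3 : wt t (2 ^+ j *: (z - x)) * dwt t j (z - w) <= 2 ^+ (j * d) * wt t (2 ^+ j *: (w - x)).
    rewrite !dwtE mulrCA ler_wpM2l// !scalerBr. by exact: wt_submul2.
  via (wt t (2 ^+ j *: (z - x)) * (B * 2 ^+ d * dwt t j (z - w) * normc (f w))).
    by rewrite ler_wpM2l/1/ ler_wpM2r/1/.
  have BB : 0 <= B * 2 ^+ d * normc (f w) => /1/. have := ler_wpM2l BB k3.
  rewrite [leLHS](_ : _ = wt t (2 ^+ j *: (z - x)) * (B * 2 ^+ d * dwt t j (z - w) * normc (f w))); last by ring.
  move=> k4; apply: le_trans k4 _. have BD : 0 <= B * 2 ^+ d * 2 ^+ (j * d) => /1/. have := ler_wpM2l BD k2.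
  rewrite [leLHS](_ : _ = B * 2 ^+ d * normc (f w) * (2 ^+ (j * d) * wt t (2 ^+ j *: (w - x)))); last by ring.
  move=> k5; apply: le_trans k5 _. rewrite !dwtE -[x - w]opprB scalerN wtN; le_ring.
have mm : m <= 2 * (B * 2 ^+ d) * H * m `^ (1 - p).
  by apply: sup_le_ub; [exists (a 0), 0|move=> _ [z _ <-]].
have B2 : 0 <= 2 * (B * 2 ^+ d) * H => /1/.
apply: le_trans (powR_root p01 m0 B2 mm).
rewrite -wt_powR -powRM/1/.
by apply: powR_le (am y) => /1/.
Qed.

(** Apply the core estimate with a weight beating the polynomial growth. The constant depends on
f, which does no harm since only the existence of a bound is asserted. *)
Lemma banded_bounded j f : banded j f -> L1p (fun x => normc (f x) `^ p) ->
  exists M, forall x, normc (f x) <= M.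
Proof.
move=> fb fp; have [cf [A [k [A0 hA]]] _] := fb.
have [B B0 hB] := peetre_core (ler0n R k).
exists ((B * (2 ^+ (j * d) * rint (fun x => normc (f x) `^ p))) `^ p^-1) => x.
have h0 z : normc (f z) * wt k%:R (2 ^+ j *: (z - x)) <= A * (1 + `|x|) ^+ k.
  rewrite wtX; apply: le_trans (ler_wpM2r _ (hA z)) _ => /1/. rewrite -mulrA ler_wpM2l// ler_pdivrMr//.
  have := base_mul_le x (z - x) k; rewrite (_ : x + (z - x) = z); last by vring. move=> hz; apply: le_trans hz _.
  rewrite ler_wpM2l// lerXn2r/1/. rewrite lerD2l normrZ ger0_norm// ler_peMl//. by apply: exprn_ege1; rewrite ler1n.
have h := hB j f x (A * (1 + `|x|) ^+ k) fb fp h0.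
apply: powR_leV => /1/.
  by rewrite !mulr_ge0// rint_ge0// => z/1/.
have := h x; rewrite subrr scaler0 wt0 mulr1 => h'; apply: le_trans h' _.
by rewrite ler_wpM2l//; apply: (@Hm_L1p j f fp _ x _).2 => /1/.
Qed.

(** Boundedness makes the a priori bound of the core estimate available for every weight. *)
Lemma peetre (s : R) : 0 <= s -> exists2 B, 0 <= B & forall j f,
  banded j f -> L1p (fun x => normc (f x) `^ p) ->
  forall x y, normc (f y) `^ p * wt s (2 ^+ j *: (y - x)) <= B * Hm p s j f x.
Proof.
move=> s0; have t0 : 0 <= s / p by rewrite divr_ge0// ltW.
have [B B0 hB] := peetre_core t0; rewrite divfK/1/ in hB.
exists B => // j f fb fp x y; have [M hM] := banded_bounded fb fp.
apply: (hB j f x M) => // z; apply: le_trans (hM z); rewrite ler_piMr/1/.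
exact: wt_le1.
Qed.

Lemma peetre_diff (s : R) : 0 <= s -> exists2 B, 0 <= B & forall j f,
  banded j f -> L1p (fun x => normc (f x) `^ p) ->
  forall x y, normc (f y - f x) `^ p <=
    B * ((2 ^+ j * `|y - x|) `^ p * (1 + 2 ^+ j * `|y - x|) `^ (s + (2 * d)%:R * p)) * Hm p s j f x.
Proof.
move=> s0; have [B1 B10 hB1] := peetre s0.
have pV : p / p = 1 by rewrite mulfV// gt_eqF.
pose L := s / p + (2 * d)%:R.
have sp0 : 0 <= s / p => /1/.
have L0 : 0 <= L => /1/.
have [B B0 hB] := KL_bounds L0.
pose D := 2 * (B * 2 * 2 `^ L * 2 ^+ d * pi ^+ d).
have D0 : 0 <= D => /1/.
exists (D `^ p * B1) => /1/.
move=> j f fb fp x y.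
set H := Hm p s j f x; have H0 : 0 <= H by exact: Hm_ge0.
pose G := (B1 * H) `^ p^-1; have G0 : 0 <= G by side.
have fG z : normc (f z) * wt (s / p) (2 ^+ j *: (z - x)) <= G.
  apply: powR_leV => /1/. by rewrite powRM/1/ wt_powR divfK/1/; exact: hB1.
set h := y - x.
have [a aE] : exists a, a = 2 ^+ j * `|h| by eexists.
rewrite -aE; have a0 : 0 <= a by rewrite aE mulr_ge0.
have main : normc (f y - f x) <= D * (a * (1 + a) `^ L) * G.
  have [cf _ hf] := fb. have [i1 e1] := hf y; have [i2 e2] := hf x. rewrite e1 e2 -cintB//.
  have [L1 L2] := @L1p_dwt R d (2 * d)%:R j x (lexx _).
  have c0 : 0 <= B * 2 * 2 `^ L * 2 ^+ d * (a * (1 + a) `^ L) * G.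
    side.
  have [L3 L4] := L1pZ c0 L1. via (2 * (B * 2 * 2 `^ L * 2 ^+ d * (a * (1 + a) `^ L) * G * pi ^+ d)); last first.
    rewrite /D; le_ring.
  via (2 * rint (fun z => B * 2 * 2 `^ L * 2 ^+ d * (a * (1 + a) `^ L) * G * dwt (2 * d)%:R j (x - z))); last first.
    by rewrite L4 ler_wpM2l// ler_wpM2l.
  apply: normc_cint_rint => //; first exact: (cintbleB i1 i2).1. move=> z; rewrite -mulrBl normcM.
  have -> : y - z = x - z + h by rewrite /h; vring. have k1 := (hB j.+1).2 (x - z) h.
  have aS : 2 ^+ j.+1 * `|h| = 2 * a by rewrite aE exprS -mulrA. rewrite aS in k1.
  have k2 : (1 + 2 * a) `^ L <= 2 `^ L * (1 + a) `^ L.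
    rewrite -powRM/1/; apply: powR_le => /1/. by rewrite mulrDr mulr1 lerD2r ler1n.
  have k3 : dwt L j.+1 (x - z) <= 2 ^+ d * (dwt (2 * d)%:R j (x - z) * wt (s / p) (2 ^+ j *: (z - x))).
    rewrite !dwtE mulSn exprD -[z - x]opprB scalerN wtN. rewrite -(mulrA (2 ^+ d)); apply: ler_wpM2l; first side.
    rewrite -(mulrA (2 ^+ (j * d))); mull. rewrite mulrC -wtD.
    apply: wt_norm_le => //; rewrite !normrZ !ger0_norm// ler_wpM2r//. by rewrite ler_eXn2l// ltr1n.
  have k4 : normc (KL j.+1 (x - z + h) - KL j.+1 (x - z)) <=
      B * (2 * a) * (2 `^ L * (1 + a) `^ L) * (2 ^+ d * (dwt (2 * d)%:R j (x - z) * wt (s / p) (2 ^+ j *: (z - x)))).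
    apply: le_trans k1 _; apply: ler_pM => //; rewrite ?dwt_ge0/1/. by rewrite ler_wpM2l// !mulr_ge0.
  apply: le_trans (ler_wpM2r (normc_ge0 _) k4) _.
  have c1 : 0 <= B * (2 * a) * (2 `^ L * (1 + a) `^ L) * (2 ^+ d * dwt (2 * d)%:R j (x - z)).
    by rewrite !mulr_ge0 ?powR_ge0 ?dwt_ge0.
  have := ler_wpM2l c1 (fG z). move=> k5; apply: le_trans (le_trans _ k5) _; le_ring.
have := powR_le (ltW p0) (normc_ge0 _) main.
move=> h1; apply: le_trans h1 _.
have A0 : 0 <= a * (1 + a) `^ L => /1/.
rewrite (powRM p (mulr_ge0 D0 A0) G0) (powRM p D0 A0) (powRM p a0 (powR_ge0 _ _)).
have -> : G `^ p = B1 * H by rewrite /G powRV/1/.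
have -> : ((1 + a) `^ L) `^ p = (1 + a) `^ (s + (2 * d)%:R * p).
  by rewrite -powRrM /L mulrDl divfK// gt_eqF.
move: (D `^ p) ((1 + a) `^ _) => X Y; le_ring.
Qed.

End kernel_bounds.

(** * Dyadic averages *)

Section dyadic_averages.
Variables (R : realType) (d : nat).
Local Notation E := 'rV[R]_d.
Local Notation C := R[i].
Local Notation mu := (@leb R d).
Implicit Types (x y z h : E) (N M : nat) (G S W : E -> R) (f : E -> C).

Lemma L1p_meas G : L1p G -> meas G. Proof. by case. Qed.

Lemma dyfloor_close N x y : dyfloor N x = dyfloor N y -> `|x - y| <= 2 ^- N.
Proof.
move=> xy; have p0 := two_gt0 R N.
apply: norm_rV_le => /1/.
move=> i; have := congr1 (fun m : 'rV[int]_d => m 0 i) xy; rewrite !mxE => e.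
have /andP[h1 h2] := floor_itv (2 ^+ N * x 0 i).
have /andP[h3 h4] := floor_itv (2 ^+ N * y 0 i).
rewrite e in h1 h2; rewrite intrD in h2 h4.
have : `|2 ^+ N * x 0 i - 2 ^+ N * y 0 i| <= 1 by rewrite ler_norml; apply/andP; split; lra.
rewrite -mulrBr normrM ger0_norm// => h5.
by rewrite -[leRHS]mulr1 ler_pdivlMl.
Qed.

Lemma floor_double (a b : R) : Num.floor (2 * a) = Num.floor (2 * b) -> Num.floor a = Num.floor b.
Proof.
move=> e.
have /andP[h1 h2] := floor_itv a; have /andP[h3 h4] := floor_itv b.
have /andP[h5 h6] := floor_itv (2 * a); have /andP[h7 h8] := floor_itv (2 * b).
rewrite -e in h7 h8; move: (Num.floor (2 * a)) h5 h6 h7 h8 => m h5 h6 h7 h8.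
move: (Num.floor a) (Num.floor b) h1 h2 h3 h4 => k l h1 h2 h3 h4.
have c1 : (2 * k < m + 1)%R by rewrite -(ltr_int R) intrM; lra.
have c2 : (m < 2 * (k + 1))%R by rewrite -(ltr_int R) intrM; lra.
have c3 : (2 * l < m + 1)%R by rewrite -(ltr_int R) intrM; lra.
have c4 : (m < 2 * (l + 1))%R by rewrite -(ltr_int R) intrM; lra.
lia.
Qed.

Lemma dyfloor_coarse N M x y : (N <= M)%N -> dyfloor M x = dyfloor M y -> dyfloor N x = dyfloor N y.
Proof.
move=> /subnK <-; elim: (M - N)%N => [|k IH]/1/.
rewrite addSn => e; apply: IH; apply/rowP => i.
have := congr1 (fun m : 'rV[int]_d => m 0 i) e; rewrite !mxE exprS -!mulrA.
exact: floor_double.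
Qed.

(** The indicator function of the event that x and y lie in the same dyadic cube. Averages
become integrals against this kernel, so no sum over the lattice of cubes is ever formed. *)
Definition sq N x y : R := (dyfloor N x == dyfloor N y)%:R.

Lemma sq_ge0 N x y : 0 <= sq N x y. Proof. side. Qed.
Lemma sq_le1 N x y : sq N x y <= 1. Proof. by rewrite /sq; case: (_ == _). Qed.
Lemma sqC N x y : sq N x y = sq N y x. Proof. by rewrite /sq eq_sym. Qed.
Lemma sq_eq N x y : dyfloor N x = dyfloor N y -> sq N x y = 1.
Proof. by move=> e; rewrite /sq e eqxx. Qed.
Lemma sq_neq N x y : dyfloor N x <> dyfloor N y -> sq N x y = 0.
Proof. by move=> /eqP/negbTE e; rewrite /sq e. Qed.
Lemma sq_congr N x x' y : dyfloor N x = dyfloor N x' -> sq N x y = sq N x' y.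
Proof. by move=> e; rewrite /sq e. Qed.

Lemma measurable_sq d' (T : measurableType d') (h k : T -> E) N :
  meas h -> meas k ->
  meas (fun t => sq N (h t) (k t)).
Proof.
move=> mh mk.
rewrite (_ : (fun t => _) = \1_(\bigcup_m ((h @^-1` (dyadic_cube N m)) `&` (k @^-1` (dyadic_cube N m))))).
  apply: measurable_indic; apply: countable_bigcupT_measurable => /1/.
  move=> m; apply: measurableI; rewrite -[_ @^-1` _]setTI.
    by apply: mh => //; exact: measurable_dyadic_cube.
  by apply: mk => //; exact: measurable_dyadic_cube.
ext t; rewrite indicE.
case: (dyfloor N (h t) =P dyfloor N (k t)) => e.
  by rewrite sq_eq// mem_set//; exists (dyfloor N (h t)) => //; split; exact/dyadic_cubeE.
rewrite sq_neq// memNset// => -[m _ [/dyadic_cubeE e1 /dyadic_cubeE e2]].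
by apply: e; rewrite e1.
Qed.

Lemma L1p_indic (A : set E) (r : R) : measurable A -> mu A = r%:E ->
  L1p (fun x => \1_A x) /\ rint (fun x => \1_A x) = r.
Proof.
move=> mA muA.
have e1 : nint (fun x => \1_A x) = r%:E by rewrite /nint integral_indic// setIT.
split; last by rewrite rint_def e1.
by split; [exact: measurable_indic|move=> x; rewrite indicE ler0n|rewrite e1 ltry].
Qed.

Lemma sq_indic N x : sq N x = fun y => \1_(dyadic_cube N (dyfloor N x)) y.
Proof.
ext y; rewrite indicE.
case: (dyfloor N x =P dyfloor N y) => e; last first.
  by rewrite sq_neq// memNset// => /dyadic_cubeE e1; apply: e => /1/.
by rewrite sq_eq// mem_set//; exact/dyadic_cubeE.
Qed.

Lemma L1p_sq N x : L1p (sq N x) /\ rint (sq N x) = 2 ^- (N * d).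
Proof.
rewrite sq_indic; apply: L1p_indic; first exact: measurable_dyadic_cube.
exact: leb_dyadic_cube.
Qed.

Lemma step_preimage T N (g : E -> T) (A : set T) :
  (forall x y, dyfloor N x = dyfloor N y -> g x = g y) -> measurable (g @^-1` A).
Proof.
move=> gs.
rewrite (_ : _ @^-1` _ = \bigcup_m (if `[< exists x, dyfloor N x = m /\ A (g x) >] then dyadic_cube N m else set0)).
  apply: countable_bigcupT_measurable => /1/. by move=> m; case: ifPn => _ //; exact: measurable_dyadic_cube.
apply/seteqP; split => x /=.
  move=> Ax; exists (dyfloor N x) => //; case: asboolP; first by move=> _; exact/dyadic_cubeE. by case; exists x.
by move=> [m _]; case: asboolP => // -[y [ym Ay]] /dyadic_cubeE xm; rewrite (gs x y)// xm.
Qed.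

Lemma measurable_step N (g : E -> R) :
  (forall x y, dyfloor N x = dyfloor N y -> g x = g y) -> meas g.
Proof. by move=> gs _ A mA; rewrite setTI; exact: step_preimage gs. Qed.

Fact avg_key : unit. Proof. side. Qed.
Definition avg : nat -> (E -> R) -> E -> R := locked_with avg_key
  (fun N G x => 2 ^+ (N * d) * rint (fun y => sq N x y * G y)).
Lemma avgE N G x : avg N G x = 2 ^+ (N * d) * rint (fun y => sq N x y * G y).
Proof. by rewrite /avg unlock. Qed.

Lemma L1p_sqM N x G : L1p G -> L1p (fun y => sq N x y * G y) /\
  rint (fun y => sq N x y * G y) <= rint G.
Proof.
move=> LG; have [||h1 h2] := @L1p_bounded R d G (sq N x) 1 LG _ _.
- exact: L1p_meas (L1p_sq N x).1.
- by move=> y; rewrite sq_ge0 sq_le1.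
by split => //; rewrite -[leRHS]mul1r.
Qed.

Lemma avg_ge0 N G x : (forall y, 0 <= G y) -> 0 <= avg N G x.
Proof.
move=> G0; rewrite avgE mulr_ge0//; apply: rint_ge0 => y.
side.
Qed.

Lemma avg_step N G x y : dyfloor N x = dyfloor N y -> avg N G x = avg N G y.
Proof.
move=> e; rewrite !avgE; congr (_ * rint _); ext z; by rewrite (sq_congr _ e).
Qed.

Lemma avg_bound N G x (B : R) : L1p G -> 0 <= B ->
  (forall y, dyfloor N y = dyfloor N x -> G y <= B) -> avg N G x <= B.
Proof.
move=> LG B0 h; have [h1 h2] := L1pZ B0 (L1p_sq N x).1.
rewrite avgE; via (2 ^+ (N * d) * (B * 2 ^- (N * d))).
  mull. rewrite -(L1p_sq N x).2 -h2; apply: rint_le => //; first exact: (L1p_sqM N x LG).1.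
  move=> y; case: (dyfloor N x =P dyfloor N y) => e; last by rewrite sq_neq// mul0r mulr0.
  by rewrite sq_eq// mul1r mulr1; exact: h.
by rewrite mulrCA mulfV ?mulr1.
Qed.

Lemma avg_lower N G x (B : R) : L1p G -> 0 <= B ->
  (forall y, dyfloor N y = dyfloor N x -> B <= G y) -> B <= avg N G x.
Proof.
move=> LG B0 h; have [h1 h2] := L1pZ B0 (L1p_sq N x).1.
rewrite avgE; via (2 ^+ (N * d) * (B * 2 ^- (N * d))).
  by rewrite mulrCA mulfV ?mulr1.
mull.
rewrite -(L1p_sq N x).2 -h2; apply: rint_le => //; first exact: (L1p_sqM N x LG).1.
move=> y; case: (dyfloor N x =P dyfloor N y) => e; last by rewrite sq_neq// mul0r mulr0.
by rewrite sq_eq// mul1r mulr1; exact: h.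
Qed.

Lemma avg_mono N G G' x : L1p G -> L1p G' -> (forall y, dyfloor N y = dyfloor N x -> G y <= G' y) ->
  avg N G x <= avg N G' x.
Proof.
move=> LG LG' h; rewrite !avgE; mull.
apply: rint_le; [exact: (L1p_sqM N x LG).1|exact: (L1p_sqM N x LG').1|].
move=> y; case: (dyfloor N x =P dyfloor N y) => e; last by rewrite sq_neq// !mul0r.
by rewrite sq_eq// !mul1r; exact: h.
Qed.

Lemma avgD N G G' x : L1p G -> L1p G' -> avg N (fun y => G y + G' y) x = avg N G x + avg N G' x.
Proof.
move=> LG LG'; rewrite !avgE -mulrDr; congr (_ * _).
have [_ <-] := L1pD (L1p_sqM N x LG).1 (L1p_sqM N x LG').1.
by congr rint; ext y; rewrite mulrDr.
Qed.

Lemma avgZ N (c : R) G x : 0 <= c -> L1p G -> avg N (fun y => c * G y) x = c * avg N G x.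
Proof.
move=> c0 LG; rewrite !avgE mulrCA; congr (_ * _).
have [_ <-] := L1pZ c0 (L1p_sqM N x LG).1.
by congr rint; ext y; rewrite mulrCA.
Qed.

Lemma avg_sum N (I : Type) (r : seq I) (F : I -> E -> R) x : (forall i, L1p (F i)) ->
  avg N (fun y => \sum_(i <- r) F i y) x = \sum_(i <- r) avg N (F i) x.
Proof.
move=> LF; rewrite avgE; under [RHS]eq_bigr do rewrite avgE; rewrite -mulr_sumr; congr (_ * _).
have [_ <-] := L1p_sum r (fun i => (L1p_sqM N x (LF i)).1).
by congr rint; ext y; rewrite mulr_sumr.
Qed.

Lemma measurable_sqM N G : meas G ->
  meas (fun z : E * E => sq N z.1 z.2 * G z.2).
Proof.
move=> mG; apply: measurable_funM; last exact: (measurableT_comp mG measurable_snd).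
by apply: measurable_sq => /1/.
Qed.

Lemma avg_int N G : L1p G -> L1p (avg N G) /\ rint (avg N G) = rint G.
Proof.
move=> LG; have [mG G0 _] := LG.
pose F y x := sq N x y * G y.
have mF : meas (fun z : E * E => F z.1 z.2).
  exact: (@measurable_exch _ _ (fun x y => sq N x y * G y) (measurable_sqM N mG)).
have F0 x y : 0 <= F x y => /1/.
have hF y : L1p (F y) /\ rint (F y) = 2 ^- (N * d) * G y.
  have [h1 h2] := L1pZ (G0 y) (L1p_sq N y).1. have -> : F y = fun x => G y * sq N y x by ext x; rewrite /F sqC mulrC.
  by split => //; rewrite h2 (L1p_sq N y).2 mulrC.
have p0 : 0 <= 2 ^- (N * d) :> R by [].
have [h3 h4] := L1pZ p0 LG.
have e : (fun y => rint (F y)) = (fun y => 2 ^- (N * d) * G y).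
  by ext y; exact: (hF y).2.
have [|||h5 h6] := rint_tonelli mF F0.
- by move=> y; exact: (hF y).1.
- by move=> x; exact: (L1p_sqM N x LG).1.
- by rewrite e.
have [h7 h8] := L1pZ (two_ge0 R (N * d)) h5.
have e2 : avg N G = fun x => 2 ^+ (N * d) * rint (F^~ x).
  by ext x; rewrite avgE.
rewrite e2; split => //; rewrite h8 h6 e h4 mulrA mulfV//.
by rewrite mul1r.
Qed.

Lemma avg_le_rint N G x : L1p G -> avg N G x <= 2 ^+ (N * d) * rint G.
Proof.
move=> LG; rewrite avgE; mull.
exact: (L1p_sqM N x LG).2.
Qed.

(** The inequality (sum a_Q)^p <= sum a_Q^p over dyadic cubes Q, in integrated form: with a_Q =
int_Q G the factor (2^{Nd})^{1-p} comes from |Q|^p against |Q|. *)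
Lemma rint_powR_sub p N G W : 0 < p <= 1 -> L1p G -> L1p W ->
  (forall x, avg N G x `^ p <= W x) ->
  rint G `^ p <= (2 ^+ (N * d)) `^ (1 - p) * rint W.
Proof.
move=> pp LG LW h; have [mG G0 _] := LG.
have T0 : 0 <= rint G => /1/.
have W0 : 0 <= rint W by apply: rint_ge0 => /1/.
have [L1 e1] := avg_int N LG.
pose c := (2 ^+ (N * d) * rint G) `^ (1 - p).
have c0 : 0 <= c => /1/.
have [L2 e2] := L1pZ c0 LW.
apply: powR_root => /1/.
rewrite -e1; via (rint (fun x => c * W x)).
  apply: rint_le => // x. apply: le_trans (powR_interp pp (avg_ge0 N x G0) (avg_le_rint N x LG)) _.
  by rewrite mulrC; apply: ler_wpM2l.
by rewrite e2 /c powRM// e1; le_ring.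
Qed.

Definition cavg : nat -> (E -> C) -> E -> C := locked_with avg_key
  (fun N f x => (2 ^+ (N * d))%:C * cint (fun y => (sq N x y)%:C * f y)).
Lemma cavgE N f x : cavg N f x = (2 ^+ (N * d))%:C * cint (fun y => (sq N x y)%:C * f y).
Proof. by rewrite /cavg unlock. Qed.

Lemma cintegral_cube N x f :
  cintegral (dyadic_cube N (dyfloor N x)) f = cint (fun y => (sq N x y)%:C * f y).
Proof.
have h (g : E -> R) (g' : E -> R) : (forall y, g' y = sq N x y * g y) ->
  (\int[mu]_(y in dyadic_cube N (dyfloor N x)) g y = \int[mu]_y g' y)%R.
  move=> e; rewrite Rintegral_mkcond; congr Rintegral; ext y.
  rewrite e sq_indic indicE patchE; case: (_ \in _); by rewrite ?mul1r ?mul0r.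
rewrite /cint /cintegral; congr Complex; apply: h => y.
  by rewrite ReM mul0r subr0.
by rewrite ImM mul0r addr0.
Qed.

Lemma dyadic_avgE N f : dyadic_avg N f = cavg N f.
Proof.
ext x; rewrite /dyadic_avg cavgE -cintegral_cube.
rewrite -(@fsbig_widen _ _ _ _ [set dyfloor N x])//; last first.
  move=> m [_ /= hm]; rewrite indicE memNset; first by rewrite mul0r. by move=> /dyadic_cubeE e; apply: hm.
rewrite fsbig_set1 indicE mem_set; first by rewrite mul1r.
exact/dyadic_cubeE.
Qed.

Lemma cavg_step N f x y : dyfloor N x = dyfloor N y -> cavg N f x = cavg N f y.
Proof.
move=> e; rewrite !cavgE; congr (_ * cint _); ext z; by rewrite (sq_congr _ e).
Qed.

Lemma cmeas_cavg N f : cmeas (cavg N f).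
Proof. by split; apply: (@measurable_step N) => x y e /=; rewrite (cavg_step f e). Qed.

Lemma cmeas_sqM N x f : cmeas f -> cmeas (fun y => (sq N x y)%:C * f y).
Proof.
by move=> mf; apply: cmeasM => //; apply: cmeas_real; exact: L1p_meas (L1p_sq N x).1.
Qed.

Lemma cintble_sqM N x f : cintble f -> cintble (fun y => (sq N x y)%:C * f y).
Proof.
move=> /cintble_L1p[mf Lf]; apply/cintble_L1p; split; first exact: cmeas_sqM.
have -> : (fun y => normc ((sq N x y)%:C * f y)) = fun y => sq N x y * normc (f y).
  by ext y; rewrite normcM normcr ger0_norm.
exact: (L1p_sqM N x Lf).1.
Qed.

Lemma normc_cavg N f x : cintble f -> normc (cavg N f x) <= 2 * avg N (fun y => normc (f y)) x.
Proof.
move=> /cintble_L1p[mf Lf]; rewrite cavgE normcM normcr ger0_norm// avgE mulrCA.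
mull.
apply: normc_cint_rint; first exact: cmeas_sqM.
  exact: (L1p_sqM N x Lf).1.
by move=> y; rewrite normcM normcr ger0_norm.
Qed.

Lemma cintble_cavg N f : cintble f -> cintble (cavg N f) /\
  rint (fun x => normc (cavg N f x)) <= 2 * rint (fun x => normc (f x)).
Proof.
move=> fi; have /cintble_L1p[mf Lf] := fi.
have [h1 h2] := avg_int N Lf; have [h3 h4] := L1pZ (ler0n R 2) h1.
have [|||h5 h6] := L1p_le h3 (_ : meas (fun x => normc (cavg N f x))).
- by apply: cmeas_normc; exact: cmeas_cavg.
- side.
- by move=> x; exact: normc_cavg.
split; first by apply/cintble_L1p; split => //; exact: cmeas_cavg.
by rewrite -h2 -h4.
Qed.

Lemma cavg_const N f x (a : C) : cintble f ->
  cavg N f x - a = (2 ^+ (N * d))%:C * cint (fun y => (sq N x y)%:C * (f y - a)).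
Proof.
move=> fi; rewrite cavgE.
have [Ls es] := L1p_sq N x.
have si : cintble (fun y => (sq N x y)%:C).
  apply/cintble_L1p; split; first by apply: cmeas_real; case: Ls.
  by have -> : (fun y => normc (sq N x y)%:C) = sq N x by ext y; rewrite normcr ger0_norm.
have se : cint (fun y => (sq N x y)%:C) = (2 ^- (N * d))%:C.
  rewrite sq_indic; apply: (cint_indic _ (leb_dyadic_cube _ _ _)).2. exact: measurable_dyadic_cube.
have -> : (fun y => (sq N x y)%:C * (f y - a)) = (fun y => (sq N x y)%:C * f y - a * (sq N x y)%:C).
  by ext y; rewrite mulrBr; congr (_ - _); rewrite mulrC.
rewrite cintB; [|exact: cintble_sqM|side].
rewrite cintZ// se mulrBr; congr (_ - _).
by rewrite mulrCA -rmorphM mulfV// mulr1.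
Qed.

Lemma bernoulli (t : R) n : 0 <= t <= 1 -> 1 - n%:R * t <= (1 - t) ^+ n.
Proof.
move=> /andP[t0 t1]; elim: n => [|n IH]; first by rewrite mul0r subr0 expr0.
rewrite exprS; have h : (1 - t) * (1 - n%:R * t) <= (1 - t) * (1 - t) ^+ n.
  by rewrite ler_wpM2l// subr_ge0.
apply: le_trans h; rewrite -natr1.
have n0 : 0 <= n%:R * t * t => /1/.
lra.
Qed.

(** The points of a cube that leave it under translation by h: a product of d one-dimensional
overlaps, bounded from below by the Bernoulli inequality. *)
Lemma boundary_measure N y h :
  L1p (fun x => sq N y x * (1 - sq N (x + h) x)) /\
  rint (fun x => sq N y x * (1 - sq N (x + h) x)) <=
    2 ^- (N * d) * ((2 * d.+1)%:R * (2 ^+ N * `|h|)).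
Proof.
have [Ls es] := L1p_sq N y.
have m1 : meas (fun x => 1 - sq N (x + h) x).
  apply: measurable_funB => //; apply: measurable_sq => /1/.
have [|L1 e1] := @L1p_bounded R d (sq N y) (fun x => 1 - sq N (x + h) x) 1 Ls m1.
  by move=> x; rewrite subr_ge0 sq_le1 lerBlDr lerDl sq_ge0.
have E1 : (fun x => sq N y x * (1 - sq N (x + h) x)) = (fun x => (1 - sq N (x + h) x) * sq N y x).
  by ext x; rewrite mulrC.
rewrite E1; split => //.
have p0 := two_gt0 R N; have h0 := normr_ge0 h.
have D : (2 : R) ^- (N * d) = (2 ^- N) ^+ d by rewrite exprM exprVn.
set t := 2 * (2 ^+ N * `|h|).
have t0 : 0 <= t => /1/.
have [t1|t1] := leP 1 t.
  apply: le_trans e1 _; rewrite mul1r es ler_peMr//.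
  apply: le_trans t1 _; rewrite /t natrM -mulrA ler_wpM2l// ler_peMl ?ler1n//.
pose a i := 2 ^- N * (dyfloor N y 0 i)%:~R + `|h|.
pose b i := 2 ^- N * ((dyfloor N y 0 i)%:~R + 1) - `|h|.
have ab i : b i - a i = 2 ^- N * (1 - t).
  rewrite /a /b /t !mulrBr !mulrDr mulr1 (mulrCA 2) (mulrA (2 ^- N)) mulVf; lra.
have ab0 i : a i <= b i.
  by rewrite -subr_ge0 ab mulr_ge0// subr_ge0 ltW.
pose B := [set x : E | forall i, x 0 i \in `[a i, b i[].
have mB : measurable B by apply: (@measurable_box R d (fun i => [set` `[a i, b i[])).
have muB : mu B = ((2 ^- N * (1 - t)) ^+ d)%:E.
  rewrite leb_box//; under eq_bigr do rewrite ab. by rewrite prodr_const card_ord.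
have [LB eB] := L1p_indic mB muB.
have [L3 e3] := L1pD L1 LB.
have : rint (fun x => (1 - sq N (x + h) x) * sq N y x + \1_B x) <= rint (sq N y).
  apply: rint_le => // x. rewrite indicE; case: (boolP (x \in B)) => xB; last first.
    by rewrite addr0 ler_piMl// lerBlDr lerDl sq_ge0.
  move: xB; rewrite inE /B/= => xB. have hi i : `|h 0 i| <= `|h| := coord_le_norm h i.
  have cx (w : E) : (forall i, 2 ^- N * (dyfloor N y 0 i)%:~R <= w 0 i < 2 ^- N * ((dyfloor N y 0 i)%:~R + 1)) -> dyfloor N w = dyfloor N y.
    by move=> hw; apply/dyadic_cubeE => i; rewrite -invr_expz -exprnP/1/.
  have x1 : dyfloor N x = dyfloor N y.
    apply: cx => i; have := xB i; rewrite in_itv/= => /andP[c1 c2]; rewrite /a /b in c1 c2. by apply/andP; split; lra.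
  have x2 : dyfloor N (x + h) = dyfloor N y.
    apply: cx => i; have := xB i; rewrite in_itv/= [(x + h) 0 i]mxE => /andP[c1 c2]; rewrite /a /b in c1 c2.
    have := hi i; rewrite ler_norml => /andP[c3 c4]; by apply/andP; split; lra.
  by rewrite (@sq_eq N (x + h) x) ?x2// (@sq_eq N y x)// subrr mul0r add0r.
rewrite e3 eB es -lerBrDr => h1; apply: le_trans h1 _.
have bern := @bernoulli t d _.
rewrite exprMn D -{1}[_ ^+ d]mulr1 -mulrBr; apply: ler_wpM2l.
  side.
have /bern : 0 <= t <= 1 by rewrite t0 ltW.
have -> : (2 * d.+1)%:R * (2 ^+ N * `|h|) = d.+1%:R * t by rewrite /t natrM; ring.
rewrite -natr1; lra.
Qed.

Lemma step_shift N S h : L1p S -> (forall x y, dyfloor N x = dyfloor N y -> S x = S y) ->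
  L1p (fun x => S x * (1 - sq N (x + h) x)) /\
  rint (fun x => S x * (1 - sq N (x + h) x)) <= (2 * d.+1)%:R * (2 ^+ N * `|h|) * rint S.
Proof.
move=> LS Ss; have [mS S0 _] := LS.
have m1 : meas (fun x => 1 - sq N (x + h) x).
  apply: measurable_funB => //; apply: measurable_sq => /1/.
pose F x y := 2 ^+ (N * d) * (sq N x y * S y) * (1 - sq N (x + h) x).
have b0 x : 0 <= 1 - sq N (x + h) x by rewrite subr_ge0 sq_le1.
have mF : meas (fun z : E * E => F z.1 z.2).
  apply: measurable_funM.
    by apply: measurable_funM => //; exact: measurable_sqM.
  exact: (measurableT_comp m1 measurable_fst).
have F0 x y : 0 <= F x y by rewrite !mulr_ge0.
have F1 x : L1p (F x) /\ rint (F x) = S x * (1 - sq N (x + h) x).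
  have [h1 _] := L1p_sqM N x LS. have [h2 h3] := L1pZ (two_ge0 R (N * d)) h1. have [h4 h5] := L1pZ (b0 x) h2.
  have -> : F x = fun y => (1 - sq N (x + h) x) * (2 ^+ (N * d) * (sq N x y * S y)).
    by ext y; rewrite /F mulrC.
  split => //; rewrite h5 h3 -avgE mulrC; congr (_ * _).
  by apply/eqP; rewrite eq_le avg_bound ?avg_lower// => y /Ss ->.
pose c := (2 * d.+1)%:R * (2 ^+ N * `|h|).
have F2 y : L1p (F^~ y) /\ rint (F^~ y) <= c * S y.
  have [h1 h2] := boundary_measure N y h. have c0 : 0 <= 2 ^+ (N * d) * S y => /1/. have [h3 h4] := L1pZ c0 h1.
  have -> : F^~ y = fun x => 2 ^+ (N * d) * S y * (sq N y x * (1 - sq N (x + h) x)).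
    by ext x; rewrite /F sqC; ring.
  split => //; rewrite h4; apply: le_trans (ler_wpM2l c0 h2) _. rewrite mulrACA mulfV// mul1r mulrC/1/.
have c0 : 0 <= c => /1/.
have [h1 h2] := L1pZ c0 LS.
have [|||h3 h4] := @L1p_le R d (fun y => rint (F^~ y)) _ h1.
- by apply: (@measurable_rint _ _ (fun y x => F x y)) => //; exact: measurable_exch.
- side.
- by move=> y; exact: (F2 y).2.
have [|||h5 h6] := @rint_tonelli _ _ (fun y x => F x y) (measurable_exch mF) (fun y x => F0 x y).
- by move=> y; exact: (F2 y).1.
- by move=> x; exact: (F1 x).1.
- side.
have e : (fun x => S x * (1 - sq N (x + h) x)) = (fun x => rint (F x)).
  by ext x; rewrite (F1 x).2.
rewrite e; split => /1/.
rewrite [leLHS](_ : _ = rint (fun y => rint (F^~ y))); last by [].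
by apply: le_trans h4 _; rewrite h2.
Qed.

End dyadic_averages.

Lemma powR_ge1 (R : realType) (a t : R) : 1 <= a -> 0 <= t -> 1 <= a `^ t.
Proof. by move=> a1 t0; rewrite -[leLHS](powRr0 a); apply: ler_powR. Qed.

(** * Convergence of series in L^1 *)

Section series.
Variables (R : realType) (d : nat).
Local Notation E := 'rV[R]_d.
Local Notation C := R[i].
Local Notation mu := (@leb R d).

(** The sum of a series of integrable functions is finite almost everywhere only; replacing it
by 0 on the exceptional set gives a function defined everywhere. *)
Lemma L1p_series (g : nat -> E -> R) (e : nat -> R) : (forall j, L1p (g j)) ->
  (forall J M, \sum_(j < M) rint (g (j + J)%N) <= e J) ->
  exists2 G, L1p G & forall J,
    L1p (fun x => `|G x - \sum_(j < J) g j x|) /\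
    rint (fun x => `|G x - \sum_(j < J) g j x|) <= e J.
Proof.
move=> Lg he.
have g0 j x : 0 <= g j x by case: (Lg j).
have mg j : meas (fun x => (g j x)%:E) by apply/measurable_EFinP; exact: L1p_meas.
pose P J x : \bar R := (\sum_(j <oo) (g (j + J)%N x)%:E)%E.
have P0 J x : (0 <= P J x)%E by apply: nneseries_ge0 => j _ _; rewrite lee_fin.
have mP J : meas (P J).
  by apply: (@ge0_emeasurable_sum _ _ _ setT (fun j x => (g (j + J)%N x)%:E) predT) => [j x _ _|j _]; rewrite ?lee_fin.
have iP J : (\int[mu]_x P J x <= (e J)%:E)%E.
  rewrite /P integral_nneseries//; last by move=> n x _; rewrite lee_fin.
  apply: lime_le; first by apply: is_cvg_nneseries => n _ _; apply: nint_ge0 => x/1/.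
  apply: nearW => M; rewrite big_mkord. rewrite [leLHS](_ : _ = (\sum_(j < M) rint (g (j + J)%N))%:E) ?lee_fin//.
  by rewrite -sumEFin; apply: eq_bigr => i _; rewrite -rintE.
have split J x : P 0%N x = ((\sum_(j < J) g j x)%:E + P J x)%E.
  rewrite /P (eq_eseriesr (g := fun j => (g j x)%:E)); last by move=> i _; rewrite addn0.
  rewrite (@nneseries_split _ (fun j => (g j x)%:E) 0 J); last by move=> k _; rewrite lee_fin.
  rewrite add0n big_mkord sumEFin; congr (_ + _)%E.
  by rewrite -(@nneseries_addn _ (fun j => (g j x)%:E) J)// => i; rewrite lee_fin.
pose G x := fine (P 0%N x).
have mG : meas G := (measurableT_comp (fine_measurable measurableT) (mP 0%N)).
have G0 x : 0 <= G x by exact: fine_ge0.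
have aeP : {ae mu, forall x, setT x -> P 0%N x \is a fin_num}.
  apply: integrable_ae => //; apply/integrableP; split => //. under eq_integral do rewrite gee0_abs//.
  exact: le_lt_trans (iP 0%N) (ltry _).
have key J : nint (fun x => `|G x - \sum_(j < J) g j x|) = (\int[mu]_x P J x)%E.
  rewrite /nint; apply: ae_eq_integral => //.
    apply/measurable_EFinP; apply: measurableT_comp => //; apply: measurable_funB => //.
    by apply: measurable_sum => j; exact: L1p_meas.
  move: aeP; apply: filterS => x h _; have /(_ I) fx := h. move: (fx); rewrite (split J) fin_numD /= => fJ.
  rewrite /G (split J) fineD// addrAC subrr add0r ger0_norm ?fine_ge0// fineK//.
have LG : L1p G.
  split => //; have := key 0%N. rewrite (_ : (fun x => _) = G); last by ext x; rewrite big_ord0 subr0 ger0_norm.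
  by move=> ->; exact: le_lt_trans (iP 0%N) (ltry _).
exists G => // J.
have L : L1p (fun x => `|G x - \sum_(j < J) g j x|).
  split => //.
    apply: measurableT_comp => //; apply: measurable_funB => //. by apply: measurable_sum => j; exact: L1p_meas.
  by rewrite key; exact: le_lt_trans (iP J) (ltry _).
by split => //; rewrite -lee_fin -rintE// key.
Qed.

Lemma rint_triangle (f g h : E -> R) : L1p g -> L1p h -> meas f -> (forall x, 0 <= f x) ->
  (forall x, f x <= g x + h x) -> L1p f /\ rint f <= rint g + rint h.
Proof.
move=> Lg Lh mf f0 fgh; have [L1 e1] := L1pD Lg Lh.
by have [h1 h2] := L1p_le L1 mf f0 fgh => /1/; rewrite -e1.
Qed.

Lemma real_series (g : nat -> E -> R) (F : nat -> E -> R) (e : nat -> R) :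
  (forall j, meas (g j)) -> (forall j, L1p (F j)) -> (forall j x, `|g j x| <= F j x) ->
  (forall J M, \sum_(j < M) rint (F (j + J)%N) <= e J) ->
  exists2 G : E -> R, meas G & forall J,
    L1p (fun x => `|G x - \sum_(j < J) g j x|) /\
    rint (fun x => `|G x - \sum_(j < J) g j x|) <= 2 * e J.
Proof.
move=> mg LF gF he.
pose gp j x := Num.max (g j x) 0; pose gn j x := Num.max (- g j x) 0.
have Lp j : L1p (gp j) /\ rint (gp j) <= rint (F j).
  apply: L1p_le => //; first exact: measurable_maxr.
    by move=> x; rewrite le_max lexx orbT.
  move=> x; rewrite ge_max (le_trans _ (gF j x)) ?ler_norm//=. by case: (LF j) => _ ->.
have Ln j : L1p (gn j) /\ rint (gn j) <= rint (F j).
  apply: L1p_le => //; first by apply: measurable_maxr => //; exact: measurableT_comp.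
    by move=> x; rewrite le_max lexx orbT.
  move=> x; rewrite ge_max; apply/andP; split; last by case: (LF j) => _ ->.
  by apply: le_trans (gF j x); rewrite -normrN; exact: ler_norm.
have [|Gp LGp hp] := @L1p_series gp e (fun j => (Lp j).1).
  by move=> J M; apply: le_trans (he J M); apply: ler_sum => j _; exact: (Lp _).2.
have [|Gn LGn hn] := @L1p_series gn e (fun j => (Ln j).1).
  by move=> J M; apply: le_trans (he J M); apply: ler_sum => j _; exact: (Ln _).2.
exists (fun x => Gp x - Gn x).
  by apply: measurable_funB; side.
move=> J; have [L1 e1] := hp J; have [L2 e2] := hn J.
have [|||L3 e3] := rint_triangle (f := fun x => `|Gp x - Gn x - \sum_(j < J) g j x|) L1 L2.
- apply: measurableT_comp => //; apply: measurable_funB; last exact: measurable_sum. by apply: measurable_funB; side.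
- side.
- move=> x; have -> : \sum_(j < J) g j x = \sum_(j < J) gp j x - \sum_(j < J) gn j x.
    rewrite -sumrB; apply: eq_bigr => j _; rewrite /gp /gn.
    by case: (leP (g j x) 0) => h; case: (leP (- g j x) 0) => h'; lra.
  have -> : Gp x - Gn x - (\sum_(j < J) gp j x - \sum_(j < J) gn j x) =
    (Gp x - \sum_(j < J) gp j x) - (Gn x - \sum_(j < J) gn j x) by ring.
  exact: ler_normB.
by split => //; apply: le_trans e3 _; rewrite mulr2n mulrDl mul1r; exact: lerD.
Qed.

Lemma Re_sum (I : Type) (r : seq I) (F : I -> C) : Re (\sum_(i <- r) F i) = \sum_(i <- r) Re (F i).
Proof. by elim/big_rec2: _ => // i x y _ <-; rewrite ReD. Qed.
Lemma Im_sum (I : Type) (r : seq I) (F : I -> C) : Im (\sum_(i <- r) F i) = \sum_(i <- r) Im (F i).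
Proof. by elim/big_rec2: _ => // i x y _ <-; rewrite ImD. Qed.

Lemma complex_series (g : nat -> E -> C) (e : nat -> R) :
  (forall j, cintble (g j)) ->
  (forall J M, \sum_(j < M) rint (fun x => normc (g (j + J)%N x)) <= e J) ->
  exists2 G, cintble G & forall J,
    L1p (fun x => normc (G x - \sum_(j < J) g j x)) /\
    rint (fun x => normc (G x - \sum_(j < J) g j x)) <= 4 * e J.
Proof.
move=> gi he.
have LF j : L1p (fun x => normc (g j x)) by case/cintble_L1p: (gi j).
have [||G1 m1 h1] := @real_series (fun j x => Re (g j x)) (fun j x => normc (g j x)) e _ LF _ he.
- by move=> j; case: (gi j) => -[].
- by move=> j x; exact: Re_le_normc.
have [||G2 m2 h2] := @real_series (fun j x => Im (g j x)) (fun j x => normc (g j x)) e _ LF _ he.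
- by move=> j; case: (gi j) => -[].
- by move=> j x; exact: Im_le_normc.
pose G x := Complex (G1 x) (G2 x).
have mG : cmeas G by [].
have main J : L1p (fun x => normc (G x - \sum_(j < J) g j x)) /\
    rint (fun x => normc (G x - \sum_(j < J) g j x)) <= 4 * e J.
  have [L1 e1] := h1 J; have [L2 e2] := h2 J.
  have [|||L3 e3] := rint_triangle (f := fun x => normc (G x - \sum_(j < J) g j x)) L1 L2.
  - apply: cmeas_normc; apply: cmeasB => //.
    by apply: (cintble_sum (F := fun j : 'I_J => g j) (index_enum _) (fun j => gi j)).1.
  - side.
  - move=> x; apply: le_trans (normc_le_ReIm _) _. by rewrite ReD ReN ImD ImN Re_sum Im_sum.
  split => //; apply: le_trans e3 _; apply: le_trans (lerD e1 e2) _; le_ring.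
exists G => //; apply/cintble_L1p; split => //.
have [L1 _] := main 0%N; move: L1; congr L1p; ext x.
by rewrite big_ord0 subr0.
Qed.

End series.

Section geometric.
Variable R : realType.

Lemma geo_sum_le (r : R) n : 0 <= r < 1 -> \sum_(m < n) r ^+ m <= (1 - r)^-1.
Proof.
move=> /andP[r0 r1]; have h : 0 < 1 - r by rewrite subr_gt0.
rewrite -[leRHS]mul1r ler_pdivlMr//.
rewrite mulrC -opprB mulNr -subrX1 opprB; by rewrite lerBlDr lerDl exprn_ge0.
Qed.

Lemma pow2_powR n (a : R) : (2 ^+ n) `^ a = (2 `^ a) ^+ n.
Proof.
have h2 : 0 <= 2 :> R by [].
by rewrite -(powR_mulrn n h2) -(powR_mulrn n (powR_ge0 2 a)) -!powRrM mulrC.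
Qed.

Lemma cvg_geo_bound (F : nat -> R) (l K r : R) : 0 <= r < 1 ->
  (forall J, `|F J - l| <= K * r ^+ J) -> F J @[J --> \oo] --> l.
Proof.
move=> /andP[r0 r1] h.
have h0 : K * r ^+ J @[J --> \oo] --> (0 : R).
  by apply: (@cvg_geometric _ K r); rewrite ger0_norm.
have h1 : F J - l @[J --> \oo] --> (0 : R).
  apply/norm_cvg0P; apply: cvg0_squeeze h0 => //.
have h2 : (F J - l + l) @[J --> \oo] --> 0 + l by apply: cvgD => //; exact: cvg_cst.
rewrite add0r in h2; suff e : (fun J => F J - l + l) = F by rewrite -e.
by ext J; rewrite subrK.
Qed.

Lemma powR_dist (p a b : R) : 0 < p <= 1 -> 0 <= a -> 0 <= b -> `|a `^ p - b `^ p| <= `|a - b| `^ p.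
Proof.
move=> pp; have p0 : 0 <= p by case/andP: pp => /ltW.
wlog ab : a b / b <= a.
  move=> H a0 b0; case: (leP b a) => h; first exact: H. by rewrite distrC (distrC a); apply: H => //; exact: ltW.
move=> a0 b0; have h := powR_le p0 b0 ab.
rewrite !ger0_norm ?subr_ge0// lerBlDr -{1}(subrK b a).
by apply: powR_subadd => //; rewrite subr_ge0.
Qed.

End geometric.

Section trigonometry.
Variable R : realType.

Lemma sin_le_id (x : R) : 0 < x -> sin x <= x.
Proof.
move=> x0.
have [|z _] := @MVT_segment R sin cos 0 x (ltW x0) (fun y _ => is_derive_sin y).
  by apply: continuous_subspaceT => y; exact: continuous_sin.
rewrite sin0 !subr0 => ->; rewrite -[leRHS]mul1r; mulr.
Qed.

Lemma pi_ge3 : 3 <= pi :> R.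
Proof.
have p0 := pi_gt0 R; set x := pi / 6 : R.
have c0 : 0 < cos x by apply: cos_gt0_pihalf; rewrite /x; apply/andP; split; lra.
have s2 : sin (x + x) = cos x.
  by rewrite -(cosBpihalf (x + x)) (_ : x + x - pi / 2 = - x) ?cosN /x; field.
have s1 : sin x = 1 / 2.
  move: s2; rewrite sinD => h; apply: (mulIf (lt0r_neq0 c0)) => /1/; lra.
have x0 : 0 < x => /1/.
have := sin_le_id x0; rewrite s1 /x; lra.
Qed.

Lemma cis_2pi_int (m : int) : cis (2 * pi * m%:~R) = 1 :> R[i].
Proof.
have nat n : cis (2 * pi * n%:R) = 1 :> R[i].
  elim: n => [|n IH]; first by rewrite mulr0 cis0.
  rewrite (_ : 2 * pi * n.+1%:R = 2 * pi * n%:R + pi *+ 2); last by rewrite -natr1 mulr2n; ring.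
  by rewrite cisD IH mul1r /cis cos2pi sin2pi.
case: m => n; first exact: nat.
have h := nat n.+1; have := cisD (2 * pi * n.+1%:R) (2 * pi * (Negz n)%:~R : R).
by rewrite h mul1r NegzE mulrNz -mulrDr addrN mulr0 cis0 => <-.
Qed.

Lemma cis_quarter (t : R) : 0 <= t <= pi / 2 -> 1 <= cos t + sin t.
Proof.
move=> /andP[t0 t1]; have p0 := pi_gt0 R.
have c0 : 0 <= cos t by apply: cos_ge0_pihalf; apply/andP; split; lra.
have s0 : 0 <= sin t by apply: sin_ge0_pi; apply/andP; split; lra.
have := cos2Dsin2 t => /1/; nra.
Qed.

End trigonometry.

Lemma count_margin (R : realType) (c t n N B : R) : 0 < c -> 0 <= B -> n <= 2 * t -> 8 * B <= c * n -> N <= 2 * n ->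
  c / 8 * N <= t * c - B.
Proof.
move=> c0 B0 nt nB Nn; have := ler_wpM2l (ltW c0) nt; have := ler_wpM2l (ltW c0) Nn; lra.
Qed.

(** * Oscillation of band-limited functions on dyadic cubes *)

Section besov_estimates.
Variables (R : realType) (d : nat).
Local Notation E := 'rV[R]_d.
Local Notation C := R[i].
Local Notation mu := (@leb R d).
Local Notation ift := (@inverse_fourier R d).
Variable phi0 : E -> C.
Hypothesis phi0P : lp_cutoff phi0.
Variable p : R.
Hypothesis p01 : 0 < p <= 1.
Let p0 : 0 < p. Proof. by case/andP: p01. Qed.
Let p1 : p <= 1. Proof. by case/andP: p01. Qed.
Implicit Types (x y z h : E) (j k n m N J : nat) (f g : E -> C) (S : E -> R).
Implicit Types (u v : raw_distribution R d) (q : \bar R).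
Local Notation KL := (KL phi0).
Local Notation Kd := (Kd phi0).
Local Notation banded := (banded phi0).
Local Notation lp_piece := (lp_piece phi0).
Local Notation pw f := (fun x => normc (f x) `^ p).

Definition osc : nat -> (E -> C) -> E -> R := locked_with (avg_key)
  (fun N f x => 2 ^+ (N * d) * rint (fun y => sq N x y * normc (f y - f x))).

Lemma oscE N f x : osc N f x = 2 ^+ (N * d) * rint (fun y => sq N x y * normc (f y - f x)).
Proof. by rewrite /osc unlock. Qed.

Lemma cintble_normc f : cintble f -> L1p (fun x => normc (f x)).
Proof. by move/cintble_L1p => []. Qed.

Lemma osc_slice N f x : cintble f -> L1p (fun y => sq N x y * normc (f y - f x)) /\
  osc N f x <= avg N (fun y => normc (f y)) x + normc (f x).
Proof.
move=> fi; have Lf := cintble_normc fi.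
have [L1 _] := L1p_sqM N x Lf; have [L2 e2] := L1p_sq N x.
have [L3 e3] := L1pZ (normc_ge0 (f x)) L2.
have [L4 e4] := L1pD L1 L3.
have [|||L5 e5] := L1p_le L4 (_ : meas (fun y => sq N x y * normc (f y - f x))).
- apply: measurable_funM; first exact: L1p_meas L2. side.
- side.
- move=> y; rewrite [normc (f x) * _]mulrC -mulrDr; mull. exact: normc_triangleB.
split => //; rewrite oscE avgE.
apply: le_trans (ler_wpM2l (two_ge0 R (N * d)) e5) _.
by rewrite e4 e3 e2 mulrDr (mulrCA _ (normc _)) mulfV// mulr1.
Qed.

Lemma osc_ge0 N f x : 0 <= osc N f x.
Proof.
rewrite oscE mulr_ge0//; apply: rint_ge0 => y/1/.
Qed.

Lemma osc_bound N f x (M : R) : cintble f -> 0 <= M ->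
  (forall y, dyfloor N y = dyfloor N x -> normc (f y - f x) <= M) -> osc N f x <= M.
Proof.
move=> fi M0 h; have [L1 _] := osc_slice N x fi; have [L2 e2] := L1p_sq N x.
have [L3 e3] := L1pZ M0 L2.
rewrite oscE; via (2 ^+ (N * d) * (M * 2 ^- (N * d))).
  mull. rewrite -e2 -e3; apply: rint_le => // y.
  case: (dyfloor N x =P dyfloor N y) => e; last by rewrite sq_neq// mul0r mulr0.
  by rewrite sq_eq// mul1r mulr1; exact: h.
by rewrite mulrCA mulfV ?mulr1.
Qed.

Lemma L1p_osc N f : cintble f -> L1p (osc N f).
Proof.
move=> fi; have Lf := cintble_normc fi.
have [L1 e1] := L1pD (avg_int N Lf).1 Lf.
have [|||//] := L1p_le L1 (_ : meas (osc N f)).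
- rewrite (_ : osc N f = fun x => 2 ^+ (N * d) * rint (fun y => sq N x y * normc (f y - f x))); last first.
    by ext x; rewrite oscE.
  apply: measurable_funM => //. apply: (@measurable_rint _ _ (fun x y => sq N x y * normc (f y - f x))).
    apply: measurable_funM.
      by apply: measurable_sq => /1/.
    apply: cmeas_normc; apply: cmeasB.
      exact: (cmeas_comp fi.1 measurable_snd).
    exact: (cmeas_comp fi.1 measurable_fst).
  side.
- by move=> x; exact: osc_ge0.
- by move=> x; exact: (osc_slice N x fi).2.
Qed.

Lemma cavg_dist N f x (a : C) (M : R) : cintble f -> 0 <= M ->
  (forall y, dyfloor N y = dyfloor N x -> normc (f y - a) <= M) ->
  normc (cavg N f x - a) <= 2 * M.
Proof.
move=> fi M0 h; rewrite cavg_const// normcM normcr ger0_norm//.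
have [L2 e2] := L1p_sq N x; have [L3 e3] := L1pZ M0 L2.
via (2 ^+ (N * d) * (2 * rint (fun y => M * sq N x y))).
  mull. apply: normc_cint_rint => //.
    by apply: cmeas_sqM; side.
  move=> y; rewrite normcM normcr ger0_norm//.
  case: (dyfloor N x =P dyfloor N y) => e; last by rewrite sq_neq// mul0r mulr0.
  by rewrite sq_eq// mul1r mulr1; exact: h.
by rewrite e3 e2 mulrCA (mulrCA _ M) mulfV// mulr1.
Qed.

Definition step_fun N S := forall x y, dyfloor N x = dyfloor N y -> S x = S y.

(** One step function S dominating, in p-th power, both the mean oscillation of f at scale N and
the increments of its average; the latter with a polynomial loss in the distance. *)
Definition controls N (tau : R) f S :=
  [/\ L1p S, step_fun N S, (forall x, avg N (osc N f) x `^ p <= S x) &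
    forall x h, normc (cavg N f (x + h) - cavg N f x) `^ p <=
      (1 + 2 ^+ N * `|h|) `^ tau * (S x + S (x + h))].

Lemma wt_near (s : R) j x y : 0 <= s -> `|x - y| <= 2 ^- j -> 2 `^ (- s) <= wt s (2 ^+ j *: (x - y)).
Proof.
move=> s0 xy; have h : `|2 ^+ j *: (x - y)| <= 1.
  rewrite normrZ ger0_norm//; have := ler_wpM2l (two_ge0 R j) xy. by rewrite mulfV.
rewrite /wt !powRN lef_pV2 ?posrE//.
by apply: powR_le; rewrite// -[2]/(1 + 1) lerD2l.
Qed.

Lemma powR2N_le (s a b : R) : a * 2 `^ (- s) <= b -> a <= 2 `^ s * b.
Proof.
move=> h; have p2 : 0 < 2 `^ s :> R by rewrite powR_gt0.
by rewrite -[2 `^ s]invrK -powRN ler_pdivlMl// mulrC.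
Qed.

Lemma twoV_mono N M : (N <= M)%N -> 2 ^- M <= 2 ^- N :> R.
Proof. by move=> NM; rewrite lef_pV2/1/ ler_eXn2l// ltr1n. Qed.

Section oscillation_control.
Let s : R := (2 * d)%:R.
Let s0 : 0 <= s. Proof. side. Qed.

(** Below the scale N the mean value form of the Peetre estimate gains the factor 2^{j-N}. *)
Lemma controls_fine : exists2 B, 0 <= B & exists2 tau, 0 <= tau & forall j N f, (j <= N)%N ->
  banded j f -> L1p (pw f) -> cintble f ->
  exists2 S, controls N tau f S &
    rint S <= B * (2 ^+ j / 2 ^+ N) `^ p * rint (pw f).
Proof.
have [B1 B10 hB1] := peetre_diff phi0P p01 s0.
pose sg := s + (2 * d)%:R * p; have sg0 : 0 <= sg by rewrite addr_ge0// mulr_ge0// ltW.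
pose K := B1 * 2 `^ sg; have K0 : 0 <= K by rewrite mulr_ge0.
pose D := 4 `^ p * K * 2 `^ s * 2 `^ s.
have D0 : 0 <= D => /1/.
exists (D * pi ^+ d) => /1/.
exists (p + sg) => /1/.
move=> j N f jN fb fp fi.
pose H := Hm p s j f.
have [LH eH] := @L1p_Hm _ _ p j f fp s (lexx s).
have H0 x : 0 <= H x by exact: Hm_ge0.
have [q qE] : exists q : R, q = 2 ^+ j / 2 ^+ N by eexists.
rewrite -qE; have q0 : 0 <= q by rewrite qE divr_ge0.
pose c := D * q `^ p; have c0 : 0 <= c by rewrite mulr_ge0/1/.
have [LA eA] := avg_int N LH.
have [LS eS] := L1pZ c0 LA.
have jN2 : 2 ^- N <= 2 ^- j :> R by exact: twoV_mono.
have Hslow x y : dyfloor N x = dyfloor N y -> H y <= 2 `^ s * H x.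
  move=> e; apply: powR2N_le; refine (le_trans _ (@Hm_slow _ _ p j f fp s x y s0)).
  apply: ler_wpM2l => //; apply: wt_near => //; apply: le_trans jN2. by apply: dyfloor_close => /1/.
have HA x : H x <= 2 `^ s * avg N H x.
  apply: powR2N_le; apply: avg_lower => //; first by rewrite mulr_ge0.
  move=> y e; rewrite powRN ler_pdivrMr// mulrC; exact: Hslow.
have diff x y h : `|y - x| <= `|h| + 2 ^- N ->
    normc (f y - f x) `^ p <= K * q `^ p * (1 + 2 ^+ N * `|h|) `^ (p + sg) * H x.
  move=> yx; apply: le_trans (hB1 j f fb fp x y) _; rewrite -/s -/sg -/H.
  apply: ler_wpM2r => //; rewrite /K -!mulrA; apply: ler_wpM2l => //.
  set r := 1 + 2 ^+ N * `|h|; have r1 : 1 <= r by rewrite lerDl mulr_ge0. have r0 : 0 <= r => /1/.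
  have u1 : 2 ^+ j * `|y - x| <= q * r.
    apply: le_trans (ler_wpM2l (two_ge0 R j) yx) _. rewrite qE -mulrA; mull.
    by rewrite /r mulrDr mulr1 mulrA mulVf// mul1r addrC.
  have q1 : q <= 1 by rewrite qE ler_pdivrMr// mul1r ler_eXn2l// ltr1n. have u2 : 1 + 2 ^+ j * `|y - x| <= 2 * r.
    rewrite mulr2n mulrDl mul1r; apply: lerD => //; apply: le_trans u1 _. by rewrite ler_piMl.
  have u0 : 0 <= 2 ^+ j * `|y - x| by []. via ((q * r) `^ p * (2 * r) `^ sg).
    apply: ler_pM => /1/; apply: powR_le => /1/.
  rewrite !powRM// powRD; last by rewrite (gt_eqF (lt_le_trans ltr01 r1)) implybT. le_ring.
pose M x h := (K * q `^ p * (1 + 2 ^+ N * `|h|) `^ (p + sg) * H x) `^ p^-1.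
have M0 x h : 0 <= M x h => /1/.
have KH x h : 0 <= K * q `^ p * (1 + 2 ^+ N * `|h|) `^ (p + sg) * H x.
  by rewrite !mulr_ge0/1/.
have Mp x h : M x h `^ p = K * q `^ p * (1 + 2 ^+ N * `|h|) `^ (p + sg) * H x by rewrite powRV.
have near x y h : dyfloor N y = dyfloor N (x + h) -> normc (f y - f x) <= M x h.
  move=> e; apply: powR_leV => /1/; apply: diff. rewrite (_ : y - x = h + (y - (x + h))); last by vring.
  apply: le_trans (ler_normD _ _) _; rewrite lerD2l; exact: dyfloor_close.
exists (fun x => c * avg N H x); last first.
  rewrite eS eA; apply: le_trans (ler_wpM2l c0 eH) _; rewrite /c; le_ring.
split => //.
- by move=> x y e; rewrite (avg_step _ e).
- move=> x. pose Q := (K * q `^ p * (2 `^ s * H x)) `^ p^-1.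
  have Q0 : 0 <= K * q `^ p * (2 `^ s * H x) by rewrite !mulr_ge0/1/. have h1 : avg N (osc N f) x <= Q.
    apply: avg_bound; [exact: L1p_osc|side|move=> y e]. apply: osc_bound => /1/.
    move=> z ez; apply: le_trans (near y z 0 _) _; first by rewrite addr0.
    rewrite /M normr0 mulr0 addr0 powR1 mulr1; apply: powR_le => /1/.
      by rewrite !mulr_ge0/1/.
    mull. by apply: Hslow.
  via (Q `^ p).
    by apply: powR_le => /1/; apply: avg_ge0 => y; exact: osc_ge0.
  rewrite /Q powRV//; via (K * q `^ p * (2 `^ s * (2 `^ s * avg N H x))).
    mull. by mull.
  rewrite /c /D [leRHS](_ : _ = 4 `^ p * (K * q `^ p * (2 `^ s * (2 `^ s * avg N H x)))); last by ring.
  rewrite ler_peMl/1/. by apply: powR_ge1; rewrite ?ler1n// ltW.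
- move=> x h. have k1 : normc (cavg N f (x + h) - f x) <= 2 * M x h by apply: cavg_dist => // y; exact: near.
  have k2 : normc (cavg N f x - f x) <= 2 * M x h.
    apply: cavg_dist => // y e; apply: le_trans (near x y 0 _) _; first by rewrite addr0. apply: powR_le => /1/.
    apply: ler_wpM2r => //; mull. rewrite normr0 mulr0 addr0 powR1; apply: powR_ge1.
      by rewrite lerDl mulr_ge0.
    side.
  have k3 : normc (cavg N f (x + h) - cavg N f x) <= 4 * M x h.
    have -> : cavg N f (x + h) - cavg N f x = (cavg N f (x + h) - f x) - (cavg N f x - f x) by ring.
    apply: le_trans (normc_triangleB _ _) _; apply: le_trans (lerD k1 k2) _. by le_ring.
  via ((4 * M x h) `^ p); first by apply: powR_le; rewrite/1/ ltW. rewrite powRM// Mp.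
  set r := (1 + 2 ^+ N * `|h|) `^ (p + sg); have r0 : 0 <= r by side. via (r * (c * avg N H x)); last first.
    apply: ler_wpM2l => //; rewrite lerDl mulr_ge0// avg_ge0//.
  rewrite [leLHS](_ : _ = r * (4 `^ p * K * q `^ p * H x)); last by ring. apply: ler_wpM2l => //; rewrite /c /D.
  rewrite [leRHS](_ : _ = 4 `^ p * K * q `^ p * (2 `^ s * (2 `^ s * avg N H x))); last by ring.
  apply: ler_wpM2l; first side. apply: le_trans (HA x) _; rewrite ler_peMl/1/. by apply: powR_ge1; rewrite ?ler1n.
Qed.

(** Above the scale N only the size of f enters; (1/|Q|) int_Q |f| to the power p is bounded by
the sum over the smaller cubes of side 2^-j, which costs the stated volume factor to the power 1
- p. *)
Lemma controls_coarse : exists2 B, 0 <= B & forall tau j N f, 0 <= tau -> (N <= j)%N ->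
  banded j f -> L1p (pw f) -> cintble f ->
  exists2 S, controls N tau f S &
    rint S <= B * (2 ^+ (j * d) / 2 ^+ (N * d)) `^ (1 - p) * rint (pw f).
Proof.
have [B1 B10 hB1] := peetre phi0P p01 s0.
pose K := 2 `^ s * B1; have K0 : 0 <= K by rewrite mulr_ge0.
exists (2 * K * pi ^+ d) => /1/.
move=> tau j N f tau0 Nj fb fp fi.
pose H := Hm p s j f.
have [LH eH] := @L1p_Hm _ _ p j f fp s (lexx s).
have H0 x : 0 <= H x by exact: Hm_ge0.
have Lf := cintble_normc fi.
have [q qE] : exists q : R, q = (2 ^+ (j * d) / 2 ^+ (N * d)) `^ (1 - p) by eexists.
rewrite -qE; have q0 : 0 <= q by rewrite qE powR_ge0.
have [LA eA] := avg_int N LH.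
have main x : avg N (fun y => normc (f y)) x `^ p <= K * q * avg N H x.
  pose G y := sq N x y * normc (f y). have [LG _] := L1p_sqM N x Lf; rewrite -/G in LG. have [LW _] := L1p_sqM N x LH.
  have [LW2 eW2] := L1pZ K0 LW. have h : forall z, avg j G z `^ p <= K * (sq N x z * H z).
    move=> z; have [e|e] := pselect (dyfloor N x = dyfloor N z); last first.
      suff -> : avg j G z = 0 by rewrite powR0/1/ !mulr_ge0// sq_ge0. apply/eqP; rewrite eq_le avg_ge0 ?andbT/1/.
      apply: avg_bound => // y yz; rewrite /G sq_neq ?mul0r// => e2; apply: e.
      by rewrite e2; exact: (dyfloor_coarse Nj).
    rewrite sq_eq// mul1r; have KH : 0 <= K * H z by rewrite mulr_ge0.
    rewrite -[leRHS](powRV p0 KH); apply: powR_le => /1/.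
      by apply: avg_ge0 => y/1/.
    apply: avg_bound => /1/. move=> y yz; via (normc (f y)).
      by rewrite ler_piMl ?normc_ge0 ?sq_le1.
    apply: powR_leV; rewrite/1/ /K -mulrA; apply: powR2N_le. apply: le_trans (hB1 j f fb fp z y); mull.
    by apply: wt_near => //; exact: dyfloor_close.
  have := rint_powR_sub p01 LG LW2 h; rewrite eW2 => h2. have X0 := two_gt0 R (N * d).
  rewrite !avgE powRM ?rint_ge0/1/. apply: le_trans (ler_wpM2l (powR_ge0 _ _) h2) _. rewrite qE powRM//.
  have -> : (2 ^+ (N * d))^-1 `^ (1 - p) = (2 ^+ (N * d)) `^ p / 2 ^+ (N * d) :> R.
    rewrite -[X in X `^ _ = _]powR_inv1// -powRrM mulN1r opprB powRB ?powRr1//. by rewrite (gt_eqF X0) implybT.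
  rewrite [leRHS](_ : _ = (2 ^+ (N * d)) `^ p * ((2 ^+ (j * d)) `^ (1 - p) * (K * rint (fun y => sq N x y * H y))) * ((2 ^+ (N * d))^-1 * 2 ^+ (N * d))); last by ring.
  by rewrite mulVf// mulr1.
pose c := 2 * (K * q); have c0 : 0 <= c by rewrite !mulr_ge0.
have [LS eS] := L1pZ c0 LA.
have h2 (a b : R) : 0 <= a -> a `^ p <= b -> (2 * a) `^ p <= 2 * b.
  move=> a0 ab; rewrite powRM//; apply: ler_pM => /1/. by rewrite -[leRHS]powRr1//; apply: ler_powR; rewrite ?ler1n.
have avf0 x : 0 <= avg N (fun y => normc (f y)) x by apply: avg_ge0 => y/1/.
exists (fun x => c * avg N H x); last first.
  rewrite eS eA /c; apply: le_trans (ler_wpM2l c0 eH) _; rewrite /c; le_ring.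
split => //.
- by move=> x y e; rewrite (avg_step _ e).
- move=> x; rewrite /c -mulrA; via ((2 * avg N (fun y => normc (f y)) x) `^ p).
    apply: powR_le; [side|by apply: avg_ge0 => y; exact: osc_ge0|]. have La := (avg_int N Lf).1.
    via (avg N (fun y => avg N (fun y => normc (f y)) y + normc (f y)) x).
      apply: avg_mono; [exact: L1p_osc|exact: (L1pD La Lf).1|]. by move=> y _; exact: (osc_slice N y fi).2.
    rewrite avgD// mulr2n mulrDl mul1r lerD2r; apply: avg_bound => // y e. by rewrite (avg_step _ e).
  exact: h2.
- move=> x h. have t1 : 1 <= (1 + 2 ^+ N * `|h|) `^ tau.
    by apply: powR_ge1 => //; rewrite lerDl mulr_ge0.
  via (c * avg N H x + c * avg N H (x + h)); last first.
    by rewrite ler_peMl// addr_ge0// mulr_ge0// avg_ge0.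
  via ((2 * avg N (fun y => normc (f y)) (x + h) + 2 * avg N (fun y => normc (f y)) x) `^ p).
    apply: powR_le => /1/. apply: le_trans (normc_triangleB _ _) _; apply: lerD; exact: normc_cavg.
  apply: le_trans (powR_subadd p01 _ _) _ => /1/. rewrite addrC; apply: lerD; rewrite /c -mulrA; exact: h2.
Qed.

End oscillation_control.

(** * Frequency pieces of averages *)

Definition cnv k g x : C := cint (fun y => Kd k (x - y) * g y).

Lemma cmeas_Kd k x : cmeas (fun y => Kd k (x - y)).
Proof.
apply: (cmeas_comp (ccont_cmeas (schwartz_ccont [::] (schwartz_Kd phi0P k)))).
side.
Qed.

Lemma cintble_cnv k g x : cintble g -> cintble (fun y => Kd k (x - y) * g y).
Proof.
move=> gi; have [B B0 hB] := schwartz_bounded [::] (schwartz_Kd phi0P k).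
have -> : (fun y => Kd k (x - y) * g y) = fun y => g y * Kd k (x - y).
  by ext y; rewrite mulrC.
by apply: (cintble_mul_bounded gi (cmeas_Kd k x) (B := B)) => y; exact: hB.
Qed.

Lemma cmeas_cnv k g : cintble g -> cmeas (cnv k g).
Proof.
move=> gi; have [h _] := conv_smooth (-1) gi (schwartz_Kd phi0P k).
have -> : cnv k g = fun x => cint (fun y => g y * Kd k (x + -1 *: y)).
  by ext x; congr cint; ext y; rewrite mulrC scaleN1r.
by apply: ccont_cmeas; exact: (smooth_ccont [::] h).
Qed.

Lemma cnvB k g g' x : cintble g -> cintble g' -> cnv k (fun y => g y - g' y) x = cnv k g x - cnv k g' x.
Proof.
move=> gi gi'; rewrite /cnv -cintB; [|exact: cintble_cnv|exact: cintble_cnv].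
by congr cint; ext y; rewrite mulrBr.
Qed.

Lemma lp_piece_cnv u g k : (forall psi, schwartz psi -> u psi = cint (fun x => g x * psi x)) ->
  lp_piece u k = cnv k g.
Proof.
move=> ug; ext x; rewrite lp_pieceE /tconv ug; last exact: schwartz_refl (schwartz_Kd phi0P k).
by congr cint; ext y; rewrite mulrC.
Qed.

Lemma dwt_near s k x y z : 0 <= s -> `|y - z| <= 2 ^- k -> dwt s k (x - y) <= 2 `^ s * dwt s k (x - z).
Proof.
move=> s0 yz; rewrite !dwtE [leRHS]mulrCA; mull.
have -> : 2 ^+ k *: (x - y) = 2 ^+ k *: (x - z) + 2 ^+ k *: (z - y) by vring.
apply: le_trans (wt_shift_le _ _ s0) _; mulr.
apply: powR_le; rewrite// -[2 in leRHS]/(1 + 1) lerD2l normrZ ger0_norm//.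
by have := ler_wpM2l (two_ge0 R k) yz; rewrite mulfV// distrC.
Qed.

Lemma dwt_powR s k x : dwt s k x `^ p = (2 ^+ (k * d)) `^ (p - 1) * dwt (s * p) k x.
Proof.
have X0 := two_gt0 R (k * d).
rewrite !dwtE powRM/1/ wt_powR mulrA; congr (_ * _).
rewrite -[X in _ * X]powRr1// -powRD ?subrK//.
by rewrite (gt_eqF X0) implybT.
Qed.

Lemma powR_cancel (X q : R) : 0 < X -> X `^ (1 - q) * X `^ (q - 1) = 1.
Proof.
move=> X0; rewrite -powRD; last by rewrite (gt_eqF X0) implybT.
by rewrite addrA subrK subrr powRr0.
Qed.

Section high.
Variable tau : R.
Hypothesis tau0 : 0 <= tau.

(** The kernel at scale 2^-k moves points by about 2^-k, and [step_shift] says that only a fraction 2^{N-k} of each cube notices. *)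
Lemma shift_integral k N S : L1p S -> step_fun N S ->
  let Phi x h := dwt (2 * d).+1%:R k h * ((S x + S (x + h)) * (1 - sq N (x + h) x)) in
  [/\ forall x, L1p (Phi x), L1p (fun x => rint (Phi x)) &
     rint (fun x => rint (Phi x)) <= 2 * (2 * d.+1)%:R * pi ^+ d * (2 ^+ N / 2 ^+ k) * rint S].
Proof.
move=> LS Ss Phi; have [mS S0 _] := LS.
pose F h x := Phi x h.
have b0 x h : 0 <= 1 - sq N (x + h) x by rewrite subr_ge0 sq_le1.
have b1 x h : 1 - sq N (x + h) x <= 1 by rewrite lerBlDr lerDl sq_ge0.
have F0 h x : 0 <= F h x by rewrite !mulr_ge0 ?dwt_ge0// addr_ge0.
have mh : meas (fun z : E * E => z.2 + z.1).
  side.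
have mF : meas (fun z : E * E => F z.1 z.2).
  apply: measurable_funM; first by apply: measurable_dwt; side. apply: measurable_funM.
    apply: measurable_funD; first exact: (measurableT_comp mS measurable_snd). exact: (measurableT_comp mS mh).
  by apply: measurable_funB => //; apply: measurable_sq => /1/.
have Fh h : L1p (F h) /\ rint (F h) <= 2 * (2 * d.+1)%:R * (2 ^+ N / 2 ^+ k) * rint S * dwt (2 * d)%:R k (0 - h).
  have [L1 e1] := step_shift h LS Ss. have [L2 e2] := step_shift (- h) LS Ss. have [L3 e3] := L1p_shift h L2.
  have [L4 e4] := L1pD L1 L3. have [L5 e5] := L1pZ (dwt_ge0 (2 * d).+1%:R k h) L4.
  have -> : F h = fun x => dwt (2 * d).+1%:R k h * (S x * (1 - sq N (x + h) x) +
      S (x + h) * (1 - sq N (x + h - h) (x + h))).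
    ext x; rewrite /F /Phi addrK [sq N x _]sqC/1/; ring.
  split => //; rewrite e5 e4 e3 sub0r dwtN. rewrite normrN in e2.
  via (dwt (2 * d).+1%:R k h * (2 * ((2 * d.+1)%:R * (2 ^+ N * `|h|) * rint S))).
    apply: ler_wpM2l; first exact: dwt_ge0. by rewrite mulr2n mulrDl mul1r; exact: lerD.
  have k1 : dwt (2 * d).+1%:R k h * (2 ^+ k * `|h|) <= dwt (2 * d)%:R k h.
    have e1d : (2 * d).+1%:R = (2 * d)%:R + 1%:R :> R by rewrite -natrD addn1. rewrite e1d !dwtE wtD -!mulrA; mull.
    rewrite -[leRHS]mulr1; mull. rewrite (wtX 1) expr1 mulrC ler_pdivrMr// mul1r. by rewrite normrZ ger0_norm// lerDr.
  have c0 : 0 <= 2 * (2 * d.+1)%:R * (2 ^+ N / 2 ^+ k) * rint S.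
    side.
  apply: le_trans (ler_wpM2l c0 k1).
  rewrite [leRHS](_ : _ = 2 * (2 * d.+1)%:R * (2 ^+ N * ((2 ^+ k)^-1 * 2 ^+ k)) * rint S * (dwt (2 * d).+1%:R k h * `|h|)); last by ring.
  rewrite mulVf// mulr1; le_ring.
have c0 : 0 <= 2 * (2 * d.+1)%:R * (2 ^+ N / 2 ^+ k) * rint S.
  side.
have [L1 e1] := @L1p_dwt R d (2 * d)%:R k 0 (lexx _).
have [L2 e2] := L1pZ c0 L1.
have [|||L3 e3] := @L1p_le R d (fun h => rint (F h)) _ L2.
- exact: measurable_rint.
- side.
- by move=> h; exact: (Fh h).2.
have Px x : L1p (Phi x).
  have [Ld _] := @L1p_dwt R d (2 * d)%:R k 0 (lexx _). have [L4 _] := L1p_shift x LS. have [L5 _] := L1pZ (S0 x) Ld.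
  have [L6 _] := L1pZ (two_ge0 R (k * d)) L4. have [L7 _] := L1pD L5 L6. have [|||//] := L1p_le L7 (_ : meas (Phi x)).
  - exact: (measurable_slice2 x mF).
  - by move=> h; exact: F0.
  - move=> h; rewrite /Phi sub0r dwtN.
    have h1 : dwt (2 * d).+1%:R k h <= dwt (2 * d)%:R k h by apply: dwt_mono; rewrite ler_nat.
    have h2 := @dwt_le R d (2 * d).+1%:R k h (ler0n _ _). via (dwt (2 * d).+1%:R k h * (S x + S (x + h))).
      apply: ler_wpM2l; first exact: dwt_ge0. by rewrite ler_piMr// addr_ge0.
    rewrite mulrDr; apply: lerD.
      by rewrite mulrC; apply: ler_wpM2l.
    by rewrite (addrC h x); apply: ler_wpM2r.
have [||h10 h11] := rint_tonelli mF F0 _ _ L3.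
- by move=> h; exact: (Fh h).1.
- by [].
split => /1/.
rewrite [leLHS](_ : _ = rint (fun h => rint (F h))); last by [].
apply: le_trans e3 _; rewrite e2.
apply: le_trans (ler_wpM2l c0 e1) _; le_ring.
Qed.

(** K_k has mean zero, so K_k * E_N f(x) only sees the increments of E_N f. The p-th power
passes inside the integral over cubes of side 2^-k by [rint_powR_sub]. *)
Lemma cnv_high : exists2 B, 0 <= B & forall k N f S, (N < k)%N -> cintble f ->
  controls N tau f S ->
  L1p (pw (cnv k (cavg N f))) /\
  rint (pw (cnv k (cavg N f))) <= B * (2 ^+ N / 2 ^+ k) * rint S.
Proof.
pose L := ((2 * d).+1%:R + tau) / p.
have Lp : L * p = (2 * d).+1%:R + tau by rewrite /L divfK/1/.
have L0 : 0 <= L => /1/.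
have Ld : (2 * d)%:R <= L.
  rewrite ler_pdivlMr//; apply: (@le_trans _ _ (2 * d)%:R); first by rewrite ler_piMr.
  by apply: (@le_trans _ _ (2 * d).+1%:R); rewrite ?ler_nat// lerDl.
have [B B0 hB] := Kd_bounds phi0P L0.
pose D := (2 * B) `^ p * (2 `^ L) `^ p; have D0 : 0 <= D by rewrite mulr_ge0/1/.
exists (D * (2 * (2 * d.+1)%:R * pi ^+ d)).
  side.
move=> k N f S Nk fi [LS Ss _ hS].
have [mS S0 _] := LS.
have [gi _] := cintble_cavg N fi.
set g := cavg N f in gi hS *.
pose Phi x h := dwt (2 * d).+1%:R k h * ((S x + S (x + h)) * (1 - sq N (x + h) x)).
have [LP LPP eP] : [/\ forall x, L1p (Phi x), L1p (fun x => rint (Phi x)) &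
     rint (fun x => rint (Phi x)) <= 2 * (2 * d.+1)%:R * pi ^+ d * (2 ^+ N / 2 ^+ k) * rint S].
  exact: (shift_integral k LS Ss).
have X0 := two_gt0 R (k * d).
have main x : normc (cnv k g x) `^ p <= D * rint (Phi x).
  pose G y := dwt L k (x - y) * normc (g y - g x). have Lg := cintble_normc gi. have [Lk _] := L1p_dwt k x Ld.
  have LG : L1p G.
    have [L1 _] := L1pZ (two_ge0 R (k * d)) Lg. have [L2 _] := L1pZ (normc_ge0 (g x)) Lk. have [L3 _] := L1pD L1 L2.
    have [|||//] := L1p_le L3 (_ : meas G).
    - apply: measurable_funM; first side. by apply: cmeas_normc; side.
    - by move=> y; rewrite mulr_ge0 ?dwt_ge0 ?normc_ge0.
    - move=> y; apply: le_trans (ler_wpM2l (dwt_ge0 _ _ _) (normc_triangleB _ _)) _.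
      rewrite mulrDr; apply: lerD; last by rewrite mulrC. by mulr; exact: dwt_le.
  have v1 : normc (cnv k g x) <= 2 * B * rint G.
    have e : cnv k g x = cint (fun y => Kd k (x - y) * (g y - g x)).
      case: k Nk {LP LPP eP Phi X0 G Lk LG} => // k' _. have Ki := schwartz_cintble [::] (schwartz_Kd phi0P k'.+1).
      have Ki2 := cintble_refl x Ki. have -> : (fun y => Kd k'.+1 (x - y) * (g y - g x)) =
          (fun y => Kd k'.+1 (x - y) * g y - g x * Kd k'.+1 (x - y)).
        by ext y; ring.
      rewrite cintB; [|exact: cintble_cnv|side].
      by rewrite (cintZ _ Ki2) (cint_refl x Ki) (cint_Kd phi0P) mulr0 subr0.
    have [LBG eBG] := L1pZ B0 LG. rewrite e -mulrA -eBG; apply: normc_cint_rint => //.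
      by apply: cmeasM; [exact: cmeas_Kd|apply: cmeasB; [side|side]].
    move=> y; rewrite normcM mulrA; mulr. exact: (hB k).1.
  have [LPs ePs] := L1p_shift (- x) (LP x). have c0 : 0 <= (2 `^ L) `^ p * (2 ^+ (k * d)) `^ (p - 1) :> R by [].
  have [LW eW] := L1pZ c0 LPs. have v2 := rint_powR_sub p01 LG LW. have RG0 : 0 <= rint G by apply: rint_ge0 => /1/.
  apply: le_trans (powR_le (ltW p0) (normc_ge0 _) v1) _. rewrite powRM/1/ /D -mulrA; mull.
  apply: le_trans (v2 k _) _; last first.
    rewrite eW ePs (mulrC ((2 `^ L) `^ p)) -mulrA mulrA powR_cancel// mul1r/1/.
  move=> z; pose Bz := 2 `^ L * dwt L k (x - z) * normc (g z - g x).
  have Bz0 : 0 <= Bz by rewrite !mulr_ge0 ?dwt_ge0 ?normc_ge0. have h1 : avg k G z <= Bz.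
    apply: avg_bound => // y e; rewrite /G /g (cavg_step f (dyfloor_coarse (ltnW Nk) e)). mulr.
    by apply: dwt_near => //; exact: dyfloor_close.
  apply: le_trans (powR_le (ltW p0) _ h1) _; first by apply: avg_ge0; case: LG.
  rewrite /Bz powRM ?mulr_ge0 ?dwt_ge0/1/ powRM ?dwt_ge0//. rewrite dwt_powR Lp -!mulrA; mull. mull. rewrite /Phi.
  have zx : x + (z - x) = z by vring. have [e|e] := pselect (dyfloor N z = dyfloor N x).
    rewrite /g (cavg_step f e) subrr normc0 powR0/1/ mulr0.
    by apply: mulr_ge0; [exact: dwt_ge0|apply: mulr_ge0; [side|by rewrite subr_ge0 sq_le1]].
  rewrite zx (sq_neq e) subr0 mulr1. have := hS x (z - x); rewrite zx => h2.
  apply: le_trans (ler_wpM2l (dwt_ge0 _ _ _) h2) _. rewrite mulrA; mulr. rewrite !dwtE -mulrA; mull.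
  rewrite wtD -[x - z]opprB scalerN !wtN -mulrA ler_piMr/1/. rewrite /wt powRN mulrC ler_pdivrMr// mul1r.
  apply: powR_le => //. rewrite lerD2l normrZ (ger0_norm (two_ge0 R k)); apply: ler_wpM2r => //.
  by rewrite ler_eXn2l ?ltr1n// ltnW.
have [LD eD] := L1pZ D0 LPP.
have [|||h1 h2] := L1p_le LD (_ : meas (pw (cnv k g))).
- by apply: measurable_powR_fun; apply: cmeas_normc; exact: cmeas_cnv.
- side.
- side.
split => //; apply: le_trans h2 _; rewrite eD.
apply: le_trans (ler_wpM2l D0 eP) _; le_ring.
Qed.

End high.

Lemma twoVC n : (2 ^- n)%:C * (2 ^+ n)%:C = 1 :> C.
Proof. by rewrite -rmorphM mulVf// two_neq0. Qed.

Lemma normc_cavg_sub N f y : cintble f -> normc (cavg N f y - f y) <= 2 * osc N f y.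
Proof.
move=> fi; rewrite cavg_const// normcM normcr ger0_norm// oscE mulrCA.
mull.
apply: normc_cint_rint; last by move=> z; rewrite normcM normcr ger0_norm.
  by apply: cmeas_sqM; side.
exact: (osc_slice N y fi).1.
Qed.

(** Dyadic averaging is self-adjoint and leaves step functions unchanged. *)
Lemma cavg_orth N (a f : E -> C) (A : R) : cintble f ->
  (forall x y, dyfloor N x = dyfloor N y -> a x = a y) -> (forall x, normc (a x) <= A) ->
  cint (fun y => a y * cavg N f y) = cint (fun y => a y * f y).
Proof.
move=> fi as_ aA; have Lf := cintble_normc fi.
have A0 := le_trans (normc_ge0 _) (aA 0).
have ma : cmeas a by split; apply: (@measurable_step R d N) => x y e /=; rewrite (as_ x y).
pose F y z := a y * ((sq N y z)%:C * f z).
have mF : cmeas (fun z : E * E => F z.1 z.2).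
  apply: cmeasM; first exact: (cmeas_comp ma measurable_fst).
  apply: cmeasM; last exact: (cmeas_comp fi.1 measurable_snd). by apply: cmeas_real; apply: measurable_sq => /1/.
have Fn y z : normc (F y z) = normc (a y) * (sq N y z * normc (f z)).
  by rewrite !normcM normcr ger0_norm.
have Fs y : L1p (fun z => normc (F y z)) /\ rint (fun z => normc (F y z)) <= A * 2 ^- (N * d) * avg N (fun z => normc (f z)) y.
  have [u1 _] := L1p_sqM N y Lf. have [u2 u3] := L1pZ (normc_ge0 (a y)) u1.
  rewrite (_ : (fun z => normc (F y z)) = fun z => normc (a y) * (sq N y z * normc (f z))); last first.
    by apply/funext => z/1/.
  split => //; rewrite u3 avgE -!mulrA (mulrA (2 ^- _)) mulVf// mul1r.
  by apply: ler_wpM2r => //; apply: rint_ge0 => /1/.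
have Fint : L1p (fun y => rint (fun z => normc (F y z))).
  have [u1 _] := L1pZ (mulr_ge0 A0 (ltW (twoV_gt0 R (N * d)))) (avg_int N Lf).1.
  have [|||//] := L1p_le u1 (_ : meas (fun y => rint (fun z => normc (F y z)))).
  - apply: (@measurable_rint _ _ (fun y z => normc (F y z))); first side. side.
  - by move=> y; apply: rint_ge0 => z/1/.
  - by move=> y; exact: (Fs y).2.
have Ffub : (\int[@leb R d]_y \int[@leb R d]_z (normc (F y z))%:E < +oo)%E.
  case: Fint => _ _; rewrite /nint => h; apply: le_lt_trans h.
  rewrite le_eqVlt; apply/orP; left; apply/eqP; apply: eq_integral => y _. by rewrite -rintE; [|exact: (Fs y).1].
have sw := cfubini mF Ffub.
have si z : cintble (fun y => (sq N z y)%:C).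
  have [Ls _] := L1p_sq N z; apply/cintble_L1p; split; first by apply: cmeas_real; exact: L1p_meas Ls.
  by have -> : (fun y => normc (sq N z y)%:C) = sq N z by ext y; rewrite normcr ger0_norm.
have se z : cint (fun y => (sq N z y)%:C) = (2 ^- (N * d))%:C.
  rewrite sq_indic; apply: (cint_indic _ (leb_dyadic_cube _ _ _)).2. exact: measurable_dyadic_cube.
have e1 y : cint (F y) = (2 ^- (N * d))%:C * (a y * cavg N f y).
  rewrite cintZ; last exact: cintble_sqM. rewrite cavgE [RHS]mulrCA; congr (_ * _). by rewrite mulrA twoVC mul1r.
have e2 z : cint (F^~ z) = (2 ^- (N * d))%:C * (a z * f z).
  have -> : F^~ z = fun y => a z * f z * (sq N z y)%:C.
    ext y; rewrite /F [sq N y z]sqC. case: (dyfloor N z =P dyfloor N y) => e.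
      by rewrite (as_ _ _ e) -mulrA [f z * _]mulrC.
    have -> : (sq N z y)%:C = 0 :> C by rewrite (sq_neq e). by rewrite mul0r mulr0 [RHS]mulr0.
  by rewrite (cintZ _ (si z)) se mulrC.
have n0 : (2 ^- (N * d))%:C != 0 :> C.
  by rewrite eqE negb_and gt_eqF.
have aci g : cintble g -> cintble (fun y => a y * g y).
  move=> gi; have -> : (fun y => a y * g y) = fun y => g y * a y by ext y; rewrite mulrC.
  exact: (cintble_mul_bounded gi ma aA).
apply: (mulfI n0); rewrite -!cintZ; [|exact: aci|by apply: aci; exact: (cintble_cavg N fi).1].
have -> : (fun x => (2 ^- (N * d))%:C * (a x * cavg N f x)) = (fun y => cint (F y)).
  by apply/funext => y/1/.
have -> : (fun x => (2 ^- (N * d))%:C * (a x * f x)) = (fun z => cint (F^~ z)).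
  by apply/funext => y/1/.
side.
Qed.

(** E_N f - f has mean zero on each N-cube, so K_k may be replaced by its deviation from its
average over the cube, smaller by the factor 2^{k-N}. *)
Lemma cnv_low : exists2 B, 0 <= B & forall tau k N f S, (k <= N)%N -> cintble f ->
  controls N tau f S ->
  L1p (pw (cnv k (fun y => cavg N f y - f y))) /\
  rint (pw (cnv k (fun y => cavg N f y - f y))) <=
    B * ((2 ^+ k / 2 ^+ N) `^ p * (2 ^+ (N * d) / 2 ^+ (k * d)) `^ (1 - p)) * rint S.
Proof.
pose L : R := (2 * d)%:R / p.
have Lp : L * p = (2 * d)%:R by rewrite /L divfK/1/.
have L0 : 0 <= L => /1/.
have [B B0 hB] := Kd_bounds phi0P L0.
pose D := (2 * (4 * (B * 2 `^ L))) `^ p * (2 `^ L) `^ p.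
have D0 : 0 <= D => /1/.
exists (D * pi ^+ d) => /1/.
move=> tau k N f S kN fi [LS Ss hS _].
have [mS S0 _] := LS.
have [gi _] := cintble_cavg N fi.
have ri : cintble (fun y => cavg N f y - f y) => /1/.
have [q qE] : exists q : R, q = 2 ^+ k / 2 ^+ N by eexists.
rewrite -qE; have q0 : 0 <= q by rewrite qE divr_ge0.
have kN2 : 2 ^- N <= 2 ^- k :> R by exact: twoV_mono.
have [LV LVV eV] := L1p_dwt_conv k (lexx (2 * d)%:R) LS.
have Lf := cintble_normc fi.
have X0 := two_gt0 R (k * d); have Y0 := two_gt0 R (N * d).
pose c := (2 ^+ (N * d) / 2 ^+ (k * d)) `^ (1 - p) : R.
have main x : normc (cnv k (fun y => cavg N f y - f y) x) `^ p <=
    D * q `^ p * c * rint (fun y => dwt (2 * d)%:R k (x - y) * S y).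
  pose G y := dwt L k (x - y) * osc N f y. have LG : L1p G.
    apply: (L1p_bounded (B := 2 ^+ (k * d)) (L1p_osc N fi) _ _).1.
      by apply: measurable_dwt; side.
    by move=> y; rewrite dwt_ge0 dwt_le.
  have Kx : cintble (fun y => Kd k (x - y)) by apply: cintble_refl; exact: schwartz_cintble [::] (schwartz_Kd phi0P k).
  have [BK BK0 hBK] := schwartz_bounded [::] (schwartz_Kd phi0P k). pose a := cavg N (fun y => Kd k (x - y)).
  have aB y : normc (a y) <= 2 * BK.
    apply: le_trans (normc_cavg _ _ Kx) _; apply: ler_wpM2l => //.
    by apply: avg_bound; [exact: cintble_normc|side|move=> z _; exact: hBK].
  have ma : cmeas a by exact: cmeas_cavg. have aci g : cintble g -> cintble (fun y => a y * g y).
    move=> g_i; have -> : (fun y => a y * g y) = fun y => g y * a y by ext y; rewrite mulrC.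
    exact: (cintble_mul_bounded g_i ma aB).
  have v1 : normc (cnv k (fun y => cavg N f y - f y) x) <= 2 * (4 * (B * 2 `^ L) * q * rint G).
    have e : cnv k (fun y => cavg N f y - f y) x = cint (fun y => (Kd k (x - y) - a y) * (cavg N f y - f y)).
      have -> : (fun y => (Kd k (x - y) - a y) * (cavg N f y - f y)) =
          (fun y => Kd k (x - y) * (cavg N f y - f y) - (a y * cavg N f y - a y * f y)).
        by ext y; ring.
      rewrite cintB; [|exact: cintble_cnv|by apply: cintbleB; exact: aci]. rewrite cintB; [|exact: aci|exact: aci].
      rewrite (@cavg_orth N a f _ fi _ aB) ?subrr ?subr0// => y z. exact: cavg_step.
    have c1 : 0 <= 4 * (B * 2 `^ L) * q => /1/. have [LcG ecG] := L1pZ c1 LG.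
    rewrite e -ecG; apply: normc_cint_rint => //.
      by apply: cmeasM; [apply: cmeasB => //; side|side].
    move=> y; rewrite normcM. have M0 : 0 <= B * 2 `^ L * q * dwt L k (x - y) by rewrite !mulr_ge0 ?dwt_ge0.
    have k1 : normc (Kd k (x - y) - a y) <= 2 * (B * 2 `^ L * q * dwt L k (x - y)).
      rewrite normc_distC; apply: cavg_dist => // z ez. have -> : x - z = x - y + (y - z) by vring.
      apply: le_trans ((hB k).2 _ _) _; apply: ler_wpM2r; first exact: dwt_ge0. have yz : 2 ^+ k * `|y - z| <= q.
        rewrite qE; mull. by apply: dyfloor_close => /1/.
      have q1 : q <= 1 by rewrite qE ler_pdivrMr// mul1r ler_eXn2l// ltr1n.
      rewrite -(mulrA B) -(mulrA B); apply: ler_wpM2l => //; rewrite mulrC; apply: ler_pM => /1/.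
      apply: powR_le => //. by rewrite -[2 in leRHS]/(1 + 1) lerD2l; exact: le_trans q1.
    apply: le_trans (ler_pM (normc_ge0 _) (normc_ge0 _) k1 (normc_cavg_sub N y fi)) _. rewrite /G; le_ring.
  have [LVx eVx] := L1pZ (powR_ge0 (2 ^+ (k * d)) (p - 1)) (LV x). have [LW eW] := L1pZ (powR_ge0 (2 `^ L) p) LVx.
  have RG0 : 0 <= rint G by apply: rint_ge0 => /1/. have c1 : 0 <= 4 * (B * 2 `^ L) => /1/.
  have v2 := rint_powR_sub p01 LG LW. have D10 : 0 <= 2 * (4 * (B * 2 `^ L)) => /1/.
  have v1' : normc (cnv k (fun y => cavg N f y - f y) x) <= 2 * (4 * (B * 2 `^ L)) * (q * rint G).
    by apply: le_trans v1 _; le_ring.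
  apply: le_trans (powR_le (ltW p0) (normc_ge0 _) v1') _. have qG0 : 0 <= q * rint G => /1/.
  rewrite (powRM p D10 qG0) (powRM p q0 RG0) /D -!(mulrA ((2 * _) `^ p)); mull. rewrite -!mulrA [leRHS]mulrCA; mull.
  apply: le_trans (v2 N _) _; last first.
    rewrite eW eVx /c powRM//. have -> : (2 ^+ (k * d))^-1 `^ (1 - p) = (2 ^+ (k * d)) `^ (p - 1) :> R.
      by rewrite -[X in X `^ _ = _]powR_inv1// -powRrM mulN1r opprB.
    le_ring.
  move=> z; pose Bz := 2 `^ L * dwt L k (x - z). have Bz0 : 0 <= Bz by rewrite !mulr_ge0 ?dwt_ge0.
  have Lo := L1p_osc N fi. have o0 : 0 <= avg N (osc N f) z by apply: avg_ge0 => y/1/.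
  have h1 : avg N G z <= Bz * avg N (osc N f) z.
    rewrite -avgZ//; apply: avg_mono => //; first exact: (L1pZ Bz0 Lo).1. move=> y e; mulr.
    apply: dwt_near => //; apply: le_trans kN2; exact: dyfloor_close.
  apply: le_trans (powR_le (ltW p0) _ h1) _; first by apply: avg_ge0; case: LG.
  rewrite powRM// /Bz powRM ?dwt_ge0// dwt_powR Lp -!mulrA. mull. mull. by apply: ler_wpM2l => //; exact: dwt_ge0.
have c0 : 0 <= D * q `^ p * c => /1/.
have [LD eD] := L1pZ c0 LVV.
have [|||h1 h2] := L1p_le LD (_ : meas (pw (cnv k (fun y => cavg N f y - f y)))).
- by apply: measurable_powR_fun; apply: cmeas_normc; exact: cmeas_cnv.
- side.
- side.
split => //; apply: le_trans h2 _; rewrite eD.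
apply: le_trans (ler_wpM2l c0 eV) _; rewrite -/c; le_ring.
Qed.

Ltac side_dyadic ::= match goal with
  | |- is_true (0 <= _)%R => first [ exact: dwt_ge0 | exact: sq_ge0 | exact: osc_ge0 | apply: avg_ge0 ]
  | |- measurable_fun _ _ => first [ apply: measurable_dwt | apply: measurable_sq ]
  | |- cmeas _ => first [ exact: cmeas_cavg | apply: cmeas_Kd | apply: cmeas_cnv ]
  | |- cintble _ => first
    [ exact: (proj1 (cintble_cavg _ _)) | apply: cintble_cnv | apply: cintble_refl | apply: cintble_shift ]
  | |- schwartz _ => exact: schwartz_Kd
  end.

Definition gam : R := p - d%:R * (1 - p).
Hypothesis gam0 : 0 < gam.

(** * Distributions with bounded densities *)

Lemma cavg_sum N (r : seq nat) (F : nat -> E -> C) x : (forall i, cintble (F i)) ->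
  cavg N (fun y => \sum_(i <- r) F i y) x = \sum_(i <- r) cavg N (F i) x.
Proof.
move=> Fi; rewrite cavgE; under [RHS]eq_bigr do rewrite cavgE; rewrite -mulr_sumr; congr (_ * _).
rewrite -(cint_sum r (fun i => cintble_sqM N x (Fi i))).
by congr cint; ext y; rewrite mulr_sumr.
Qed.

Lemma controls_sum N tau J (F : nat -> E -> C) (S : nat -> E -> R) :
  (forall j, cintble (F j)) -> (forall j, controls N tau (F j) (S j)) ->
  controls N tau (fun x => \sum_(j < J) F j x) (fun x => \sum_(j < J) S j x).
Proof.
move=> Fi hS.
have LS j : L1p (S j) by case: (hS j).
have S0 j x : 0 <= S j x by case: (LS j).
have Fs : cintble (fun x => \sum_(j < J) F j x) by exact: (cintble_sum _ (fun j : 'I_J => Fi j)).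
split.
- by apply: (L1p_sum _ (fun j : 'I_J => LS j)).1.
- by move=> x y e; apply: eq_bigr => j _; case: (hS j) => _ h _ _; exact: h.
- move=> x; have Lo j : L1p (osc N (F j)) by exact: L1p_osc. have o0 j y : 0 <= osc N (F j) y => /1/.
  have h1 : avg N (osc N (fun x => \sum_(j < J) F j x)) x <= \sum_(j < J) avg N (osc N (F j)) x.
    rewrite -(avg_sum N (index_enum _) x (fun j : 'I_J => Lo j)).
    apply: avg_mono; [exact: L1p_osc|exact: (L1p_sum _ (fun j : 'I_J => Lo j)).1|]. move=> y _; rewrite oscE.
    have -> : \sum_(i < J) osc N (F i) y = 2 ^+ (N * d) * \sum_(i < J) rint (fun z => sq N y z * normc (F i z - F i y)).
      by rewrite mulr_sumr; apply: eq_bigr => i _; rewrite oscE.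
    mull. have Ls (j : 'I_J) : L1p (fun z => sq N y z * normc (F j z - F j y)) by apply: (osc_slice N y (Fi j)).1.
    have [L1 <-] := L1p_sum (index_enum _) Ls. apply: rint_le => //; first exact: (osc_slice N y Fs).1.
    move=> z; rewrite -mulr_sumr; mull. by rewrite -sumrB; exact: normc_sum.
  apply: le_trans (powR_le (ltW p0) _ h1) _; first by apply: avg_ge0 => y; side.
  apply: le_trans (powR_sum_le _ p01 _) _ => /1/. by apply: ler_sum => j _; case: (hS j) => _ _ h _/1/.
- move=> x h. have e y : cavg N (fun x => \sum_(j < J) F j x) y = \sum_(j < J) cavg N (F j) y.
    rewrite -(big_mkord xpredT (fun j => cavg N (F j) y)) -cavg_sum//.
    by congr (cavg N _ y); ext z; rewrite big_mkord.
  rewrite !e -sumrB. apply: le_trans (powR_le (ltW p0) (normc_ge0 _) (normc_sum _ _ _)) _.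
  apply: le_trans (powR_sum_le _ p01 _) _ => /1/. rewrite -big_split/= mulr_sumr; apply: ler_sum => j _.
  by case: (hS j) => _ _ _ h'/1/.
Qed.

Definition beta : R := 2 `^ (- (gam / p)).

Lemma beta01 : 0 <= beta < 1.
Proof.
rewrite powR_ge0/= /beta powRN invf_lt1//.
have h : 0 < gam / p => /1/.
by rewrite -[ltLHS](powRr0 2) /powR ifF ?ifF ?ltr_expR ?ltr_pM2r ?ln_gt0 ?ltr1n/1/.
Qed.

(** Bernstein inequality: a band-limited piece in L^p lies in L^1, and with the normalization
2^{jp} ||f||_p^p <= 1 the L^1 norms decay geometrically at rate gamma/p. *)
Lemma piece_L1 : exists2 B, 0 <= B & forall j f, banded j f ->
  L1p (pw f) -> (2 ^+ j) `^ p * rint (pw f) <= 1 ->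
  cintble f /\ rint (fun x => normc (f x)) <= B * beta ^+ j.
Proof.
have [B1 B10 hB1] := peetre phi0P p01 (lexx 0).
exists (B1 `^ (p^-1 * (1 - p))) => /1/.
move=> j f fb fp fA; set a := rint _ in fA.
have a0 : 0 <= a by apply: rint_ge0 => x/1/.
have X0 := two_gt0 R j; have Xn0 : (2 ^+ j : R) != 0 by rewrite gt_eqF.
have aX : a <= (2 ^+ j) `^ (- p).
  by rewrite powRN -[leRHS]mulr1 ler_pdivlMl.
pose W : R := B1 * (2 ^+ (j * d) * (2 ^+ j) `^ (- p)).
have W0 : 0 <= W => /1/.
have fm y : normc (f y) <= W `^ p^-1.
  apply: powR_leV => /1/. have := hB1 j f fb fp y y; rewrite subrr scaler0 wt0 mulr1 => h1; apply: le_trans h1 _.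
  apply: ler_wpM2l => //; apply: le_trans (Hm_L1p j fp y (lexx 0)).2 _. by mull.
have mf : cmeas f by case: fb => cf _ _; exact: ccont_cmeas.
have c0 : 0 <= W `^ (p^-1 * (1 - p)) => /1/.
have [L1 e1] := L1pZ c0 fp.
have [|||L2 e2] := L1p_le L1 (_ : meas (fun x => normc (f x))).
- side.
- side.
- move=> x; rewrite mulrC powRrM; apply: powR_interp => /1/.
split; first exact/cintble_L1p.
apply: le_trans e2 _; rewrite e1.
apply: le_trans (ler_wpM2l c0 aX) _.
rewrite /W powRM// -mulrA; mull.
rewrite exprM -powR_mulrn// -powRD ?Xn0 ?implybT// -powRrM -powRD ?Xn0 ?implybT//.
rewrite /beta -pow2_powR; rewrite (_ : _ + _ = - (gam / p))//.
have pn0 : p != 0 => /1/.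
by rewrite /gam; field.
Qed.

Definition rho : R := Num.max (2 `^ (p - 1)) (2 `^ (- (p + gam))).

Lemma rho_ge0 : 0 <= rho. Proof. by rewrite /rho le_max powR_ge0. Qed.

Lemma rho_le1 : rho <= 1.
Proof.
have h a : a <= 0 -> 2 `^ a <= 1 :> R.
  by move=> a0; rewrite -[leRHS](powRr0 2); apply: ler_powR; rewrite ?ler1n.
by rewrite /rho ge_max !h ?subr_le0// oppr_le0 addr_ge0/1/.
Qed.

(** The p-th power of the j-th term of the Besov sequence, written A_j in the introduction. *)
Definition dens u j : R := (2 ^+ j) `^ p * rint (pw (lp_piece u j)).

Lemma dens_ge0 u j : 0 <= dens u j.
Proof. by rewrite /dens mulr_ge0// rint_ge0// => x/1/. Qed.

(** The pieces are summable in L^1 by [piece_L1], and their sum represents u by [lp_converge].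
*)
Lemma represent : exists2 B, 0 <= B & forall u, tempered u ->
  (forall j, L1p (pw (lp_piece u j))) -> (forall j, dens u j <= 1) ->
  (forall j, cintble (lp_piece u j)) /\
  exists2 f, cintble f & (forall psi, schwartz psi -> u psi = cint (fun x => f x * psi x)) /\
    forall J, L1p (fun x => normc (f x - \sum_(j < J) lp_piece u j x)) /\
      rint (fun x => normc (f x - \sum_(j < J) lp_piece u j x)) <= B * beta ^+ J.
Proof.
have [B B0 hB] := piece_L1; have /andP[b0 b1] := beta01.
exists (4 * (B * (1 - beta)^-1)); first by rewrite !mulr_ge0// invr_ge0 subr_ge0 ltW.
move=> u ut fp fA.
have h j := hB j _ (lp_piece_banded phi0P j ut) (fp j) (fA j).
have ci j : cintble (lp_piece u j) := (h j).1.
split => //.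
have [|f fi hf] := @complex_series R d (lp_piece u) (fun J => B * (1 - beta)^-1 * beta ^+ J) ci.
  move=> J M; via (\sum_(j < M) B * beta ^+ J * beta ^+ j).
    by apply: ler_sum => j _; rewrite -mulrA -exprD addnC; exact: (h _).2.
  rewrite -mulr_sumr [leRHS]mulrAC; mull. exact: (geo_sum_le M beta01).
exists f => //; split => /1/; last by move=> J; have := hf J; rewrite -!mulrA.
move=> psi ps.
have [P P0 hP] := schwartz_bounded [::] ps.
have mp : cmeas psi := ccont_cmeas (schwartz_ccont [::] ps).
have fpi : cintble (fun x => f x * psi x) by exact: (cintble_mul_bounded fi mp hP).
apply/eqP; rewrite eq_sym -subr_eq0; apply/eqP/eq0_normc/le_anti; rewrite normc_ge0 andbT.
apply/ler_addgt0Pr => e e0; rewrite add0r.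
have c1 := lp_converge phi0P ut ps.
have e2 : 0 < e / 2 => /1/.
have [N1 hN1] := (cvg0_nnegP (fun n => normc_ge0 _)).1 c1 (e / 2) e2.
have c2 : 2 * (P * (4 * (B * (1 - beta)^-1))) * beta ^+ J @[J --> \oo] --> (0:R).
  apply: (@cvg_geo_bound _ _ _ (2 * (P * (4 * (B * (1 - beta)^-1)))) beta beta01) => J.
  rewrite subr0 ger0_norm// !mulr_ge0 ?invr_ge0 ?subr_ge0 ?(ltW b1)// exprn_ge0//.
have nn J : 0 <= 2 * (P * (4 * (B * (1 - beta)^-1))) * beta ^+ J.
  by rewrite !mulr_ge0 ?invr_ge0 ?subr_ge0 ?(ltW b1)// exprn_ge0.
have [N2 hN2] := (cvg0_nnegP nn).1 c2 (e / 2) e2.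
pose J := (maxn N1 N2); have := hN1 J (leq_maxl _ _); have := hN2 J.+1 (leqW (leq_maxr _ _)).
set s := cint (fun x => psi x * _) => h2 h1.
have -> : cint (fun x => f x * psi x) - u psi = (cint (fun x => f x * psi x) - s) + (s - u psi) by ring.
apply: le_trans (normc_triangle _ _) _.
rewrite [leRHS]splitr; apply: lerD; last exact: ltW.
apply: le_trans _ (ltW h2).
have si : cintble (fun x => psi x * \sum_(j < J.+1) lp_piece u j x).
  have ss : cintble (fun x => \sum_(j < J.+1) lp_piece u j x).
    by exact: (cintble_sum _ (fun j : 'I_(J.+1) => ci j)).
  rewrite (_ : (fun x => _) = fun x => (\sum_(j < J.+1) lp_piece u j x) * psi x).
    exact: (cintble_mul_bounded ss mp hP).
  by ext x; rewrite mulrC.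
have [L1 e1] := hf J.+1; have [L2 e2'] := L1pZ P0 L1.
rewrite /s -cintB//; via (2 * (P * rint (fun x => normc (f x - \sum_(j < J.+1) lp_piece u j x)))).
  rewrite -e2'; apply: normc_cint_rint => //; first exact: (cintbleB fpi si).1.
  move=> x; rewrite [f x * _]mulrC -mulrBr normcM; apply: ler_wpM2r; first side. side.
rewrite -(mulrA 2) -(mulrA P) -(mulrA 4); apply: ler_wpM2l => //; mull.
Qed.

(** * The density recursion for the average *)

Definition theta N j : R := (2 `^ (- gam)) ^+ (j - N).

Lemma theta01 : 0 <= 2 `^ (- gam) < (1 : R).
Proof.
rewrite powR_ge0/= powRN invf_lt1//.
by have := gt0_ltr_powR gam0 ler01 (ler0n R 2) (ltr1n R 2); rewrite powR1.
Qed.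

(** The two regimes j <= N and j > N in a common normalization; the exponents combine to gamma.
*)
Lemma controls_piece : exists2 B, 0 <= B & exists2 tau, 0 <= tau & forall u N j, tempered u ->
  L1p (pw (lp_piece u j)) -> cintble (lp_piece u j) -> dens u j <= 1 ->
  exists2 S, controls N tau (lp_piece u j) S &
    rint S <= B * (2 ^+ N) `^ (- p) * (if (j <= N)%N then dens u j else theta N j).
Proof.
have [B1 B10 [tau tau0 h1]] := controls_fine.
have [B2 B20 h2] := controls_coarse.
exists (B1 + B2) => /1/.
exists tau => // u N j ut fp fi fA.
have fb := lp_piece_banded phi0P j ut.
have q0 : 0 <= (2 ^+ N) `^ (- p) :> R by [].
have r0 : 0 <= rint (pw (lp_piece u j)) by apply: rint_ge0 => x/1/.
have X0 := two_gt0 R N.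
case: leqP => jN.
  have [S hS eS] := h1 j N _ jN fb fp fi; exists S => //; apply: le_trans eS _. rewrite powRM// /dens.
  have -> : (2 ^+ N)^-1 `^ p = (2 ^+ N) `^ (- p) :> R.
    by rewrite -[X in X `^ _ = _]powR_inv1// -powRrM mulN1r.
  rewrite (_ : B1 * _ * _ = B1 * (2 ^+ N) `^ (- p) * ((2 ^+ j) `^ p * rint (pw (lp_piece u j)))); last by ring. mulr.
  by apply: ler_wpM2r => //; rewrite lerDl.
have [S hS eS] := h2 tau j N _ tau0 (ltnW jN) fb fp fi; exists S => //; apply: le_trans eS _.
have aX : rint (pw (lp_piece u j)) <= (2 ^+ j) `^ (- p).
  by rewrite powRN -[leRHS]mulr1 ler_pdivlMl.
via (B2 * (2 ^+ (j * d) / 2 ^+ (N * d)) `^ (1 - p) * (2 ^+ j) `^ (- p)).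
  by mull.
rewrite -!mulrA; apply: ler_pM => //; rewrite ?lerDr//.
rewrite /theta; move: (subnK (ltnW jN)); move: (j - N)%N => m <-.
have Y0 := two_gt0 R m; have Yn0 : (2 ^+ m : R) != 0 by rewrite gt_eqF.
have -> : 2 ^+ ((m + N) * d) / 2 ^+ (N * d) = (2 ^+ m) `^ d%:R :> R.
  by rewrite mulnDl exprD mulfK// exprM powR_mulrn.
rewrite exprD (powRM _ (two_ge0 R m) (two_ge0 R N)) -powRrM mulrA -powRD ?Yn0 ?implybT//.
rewrite -pow2_powR mulrC (_ : d%:R * (1 - p) + - p = - gam)//.
by rewrite /gam; ring.
Qed.

Lemma theta_sum N J (A : nat -> R) : (forall j, 0 <= A j) ->
  \sum_(j < J) (if (j <= N)%N then A j else theta N j) <=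
  \sum_(j < N.+1) A j + (1 - 2 `^ (- gam))^-1.
Proof.
move=> A0; have /andP[t0 t1] := theta01.
set t := fun j : nat => (if (j <= N)%N then A j else theta N j).
have tt0 j : 0 <= t j by rewrite /t; case: ifP =>  _/1/.
via (\sum_(j < N.+1 + J) t j).
  rewrite -(big_mkord xpredT t) -(big_mkord xpredT t) (@big_cat_nat _ _ _ J 0 (N.+1 + J)) ?leq_addl//=.
  by rewrite lerDl sumr_ge0.
rewrite big_split_ord/=; apply: lerD.
  by apply: ler_sum => j _; rewrite /t -ltnS ltn_ord.
apply: le_trans (geo_sum_le J theta01); apply: ler_sum => j _.
rewrite /t ifF; last by rewrite leqNgt ltnS leq_addr.
rewrite /theta addSn -addnS addKn; apply: ler_wiXn2l => //; exact: ltW.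
Qed.

(** Convergence in L^1 gives pointwise convergence after convolution with K_k, so Fatou
transfers bounds on finite sums of pieces to f. *)
Lemma cnv_fatou k (F : nat -> E -> C) f (K r M : R) : 0 <= r < 1 -> (forall J, cintble (F J)) -> cintble f ->
  (forall J, L1p (fun x => normc (F J x - f x)) /\ rint (fun x => normc (F J x - f x)) <= K * r ^+ J) ->
  (forall J, L1p (pw (cnv k (F J))) /\ rint (pw (cnv k (F J))) <= M) ->
  L1p (pw (cnv k f)) /\ rint (pw (cnv k f)) <= M.
Proof.
move=> r01 Fi fi h FM; apply: (nint_fatou (fun J => (FM J).1)) => [x||x|J]; [side|side| |exact: (FM J).2].
have /andP[r0 r1] := r01.
have [B B0 hB] := schwartz_bounded [::] (schwartz_Kd phi0P k).
have rp : 0 <= r `^ p < 1.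
  rewrite powR_ge0/=. by have := gt0_ltr_powR p0 r0 ler01 r1; rewrite powR1.
have K0 : 0 <= K.
  have := (h 0%N).2; rewrite expr0 mulr1; apply: le_trans; apply: rint_ge0 => y/1/.
apply: (@cvg_geo_bound R _ _ ((2 * (B * K)) `^ p) (r `^ p)) => // J.
apply: le_trans (powR_dist p01 (normc_ge0 _) (normc_ge0 _)) _.
have -> : (2 * (B * K)) `^ p * r `^ p ^+ J = (2 * (B * (K * r ^+ J))) `^ p.
  have -> : 2 * (B * (K * r ^+ J)) = 2 * (B * K) * r ^+ J by ring.
  rewrite (powRM p _ (exprn_ge0 J r0))/1/; congr (_ * _).
  by rewrite -(powR_mulrn J r0) -(powR_mulrn J (powR_ge0 r p)) -!powRrM mulrC.
apply: powR_le => /1/.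
via (normc (cnv k (F J) x - cnv k f x)).
  rewrite ler_norml; apply/andP; split.
    by rewrite lerNl opprB normc_distC; exact: normc_dist_ge.
  exact: normc_dist_ge.
rewrite -cnvB//; have [L1 e1] := h J; have [L2 e2] := L1pZ B0 L1.
via (2 * (B * rint (fun x => normc (F J x - f x)))); last first.
  by apply: ler_wpM2l => //; apply: ler_wpM2l.
rewrite -e2; apply: normc_cint_rint => //.
  by apply: cmeasM; [side|apply: cmeasB; [exact: (Fi J).1|side]].
by move=> y; rewrite normcM; mulr; exact: hB.
Qed.

Lemma cavgB N f g x : cintble f -> cintble g -> cavg N (fun y => f y - g y) x = cavg N f x - cavg N g x.
Proof.
move=> fi gi; rewrite !cavgE -mulrBr -cintB; [|exact: cintble_sqM|exact: cintble_sqM].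
by congr (_ * cint _); ext y; rewrite mulrBr.
Qed.

(** The bound is proved for finite sums of pieces and passes to the limit by Fatou. The constant
1 accounts for the pieces above N, whose densities are at most 1. *)
Lemma upper_density : exists2 B, 0 <= B & forall u, tempered u ->
  (forall j, L1p (pw (lp_piece u j))) -> (forall j, dens u j <= 1) ->
  exists2 f, cintble f & (forall psi, schwartz psi -> u psi = cint (fun x => f x * psi x)) /\
    forall N k, L1p (pw (cnv k (cavg N f))) /\
      (2 ^+ k) `^ p * rint (pw (cnv k (cavg N f))) <=
       (if (k <= N)%N then dens u k else 0) +
        B * (\sum_(j < N.+1) dens u j + 1) * rho ^+ (if (k <= N)%N then N - k else k - N)%N.
Proof.
have [B1 B10 [tau tau0 hS]] := controls_piece.
have [B2 B20 hhi] := cnv_high tau0.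
have [B3 B30 hlo] := cnv_low.
have [B4 B40 hrep] := represent.
have /andP[t0 t1] := theta01; pose T := (1 - 2 `^ (- gam))^-1.
have T0 : 0 <= T by rewrite invr_ge0 subr_ge0 ltW.
have b01 := beta01; have /andP[b0 b1] := b01.
pose B := (B2 + B3) * (B1 * (1 + T)).
have BB0 : 0 <= B => /1/.
exists B => // u ut fp fA.
have [ci [f fi [fu hf]]] := hrep u ut fp fA; exists f => //; split => // N k.
pose fJ J x := \sum_(j < J) lp_piece u j x.
have fJi J : cintble (fJ J) by exact: (cintble_sum _ (fun j : 'I_J => ci j)).
have /choice[S hSS] : forall j, exists S, controls N tau (lp_piece u j) S /\
    rint S <= B1 * (2 ^+ N) `^ (- p) * (if (j <= N)%N then dens u j else theta N j).
  by move=> j; have [S h1 h2] := hS u N j ut (fp j) (ci j) (fA j); exists S.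
pose SJ J x := \sum_(j < J) S j x.
have cJ J : controls N tau (fJ J) (SJ J) by exact: (controls_sum J ci (fun j => (hSS j).1)).
pose A := \sum_(j < N.+1) dens u j.
have A0 : 0 <= A by apply: sumr_ge0 => j _; exact: dens_ge0.
have q0 : 0 <= (2 ^+ N) `^ (- p) :> R by [].
have SJb J : rint (SJ J) <= B1 * (1 + T) * (2 ^+ N) `^ (- p) * (A + 1).
  have LS (j : 'I_J) : L1p (S j) by case: (hSS j).1. have [_ ->] := L1p_sum (index_enum _) LS.
  via (B1 * (2 ^+ N) `^ (- p) * (A + T)).
    apply: le_trans (ler_wpM2l _ (theta_sum N J (dens_ge0 u))) => /1/.
    by rewrite mulr_sumr; apply: ler_sum => j _; exact: (hSS j).2.
  rewrite -!mulrA; apply: ler_wpM2l => //; rewrite [leRHS]mulrCA; apply: ler_wpM2l => //. have := mulr_ge0 T0 A0; lra.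
have BAr n : 0 <= B * (A + 1) * rho ^+ n by rewrite !mulr_ge0 ?addr_ge0 ?exprn_ge0 ?rho_ge0.
have X0 := two_gt0 R N.
have dJ J : L1p (fun x => normc (fJ J x - f x)) /\ rint (fun x => normc (fJ J x - f x)) <= B4 * beta ^+ J.
  have := hf J; rewrite (_ : (fun x => normc (f x - \sum_(j < J) lp_piece u j x)) = fun x => normc (fJ J x - f x))//.
  by ext x; rewrite normc_distC.
have gJ J : L1p (fun x => normc (cavg N (fJ J) x - cavg N f x)) /\
    rint (fun x => normc (cavg N (fJ J) x - cavg N f x)) <= 2 * B4 * beta ^+ J.
  have di : cintble (fun x => fJ J x - f x) by side. have [h1 h2] := cintble_cavg N di.
  rewrite (_ : (fun x => _) = fun x => normc (cavg N (fun y => fJ J y - f y) x)); last first.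
    by ext x; rewrite cavgB.
  split; first exact: cintble_normc. apply: le_trans h2 _; rewrite -mulrA; apply: ler_wpM2l => //; exact: (dJ J).2.
have kp : 0 < (2 ^+ k) `^ p :> R by [].
(* the common step of both cases: X is the gain of the estimate and n the distance from k to N *)
have bound (Bi X w : R) n J : 0 <= Bi <= B2 + B3 -> 0 <= X -> (2 ^+ k) `^ p * X * (2 ^+ N) `^ (- p) <= rho ^+ n ->
    w <= Bi * X * rint (SJ J) -> w <= ((2 ^+ k) `^ p)^-1 * (B * (A + 1) * rho ^+ n).
  move=> /andP[Bi0 BiB] X0' hX hy; rewrite ler_pdivlMl//.
  via ((2 ^+ k) `^ p * (Bi * X * (B1 * (1 + T) * (2 ^+ N) `^ (- p) * (A + 1)))).
    mull. apply: le_trans hy _; apply: ler_wpM2l => //. side.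
  rewrite (_ : _ * (Bi * X * _) = Bi * (B1 * (1 + T)) * (A + 1) * ((2 ^+ k) `^ p * X * (2 ^+ N) `^ (- p))); last by ring.
  by apply: ler_pM => //; [side|side|mulr; rewrite /B; mulr].
have gi := (cintble_cavg N fi).1.
case: leqP => kN.
  pose rJ J y := cavg N (fJ J) y - fJ J y; pose r y := cavg N f y - f y. have rJi J : cintble (rJ J) by side.
  have ri : cintble r by side. have hJ J := hlo tau k N (fJ J) (SJ J) kN (fJi J) (cJ J).
  have pwr : (2 ^+ k) `^ p * ((2 ^+ k / 2 ^+ N) `^ p * (2 ^+ (N * d) / 2 ^+ (k * d)) `^ (1 - p)) * (2 ^+ N) `^ (- p) <= rho ^+ (N - k).
    rewrite -{1 2 3}(subnK kN); move: (N - k)%N => m.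
    have Y0 := two_gt0 R m; have Yn0 : (2 ^+ m : R) != 0 by rewrite gt_eqF.
    have Z0 := two_gt0 R k; have Zn0 : (2 ^+ k : R) != 0 by rewrite gt_eqF.
    have -> : 2 ^+ ((m + k) * d) / 2 ^+ (k * d) = (2 ^+ m) `^ d%:R :> R.
      by rewrite mulnDl exprD mulfK// exprM powR_mulrn.
    have -> : 2 ^+ k / 2 ^+ (m + k) = (2 ^+ m) `^ (-1) :> R.
      rewrite exprD powR_inv1// invfM mulrCA mulfV// mulr1//.
    rewrite exprD (powRM _ (two_ge0 R m) (two_ge0 R k)) -!powRrM.
    rewrite (_ : (2 ^+ k) `^ p * _ * _ = ((2 ^+ k) `^ p * (2 ^+ k) `^ (- p)) *
       ((2 ^+ m) `^ (-1 * p) * (2 ^+ m) `^ (d%:R * (1 - p)) * (2 ^+ m) `^ (- p))); last by ring.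
    rewrite -!powRD ?Yn0 ?Zn0 ?implybT// subrr powRr0 mul1r pow2_powR.
    apply: lerXn2r; rewrite ?nnegrE ?rho_ge0// /rho le_max; apply/orP; right.
    by rewrite (_ : -1 * p + _ + _ = - (p + gam))// /gam; ring.
  have rd J : L1p (fun x => normc (rJ J x - r x)) /\ rint (fun x => normc (rJ J x - r x)) <= 3 * B4 * beta ^+ J.
    have [L1 e1] := dJ J; have [L2 e2] := gJ J.
    have [|||L3 e3] := rint_triangle (f := fun x => normc (rJ J x - r x)) L2 L1.
    - by apply: cmeas_normc; apply: cmeasB; [exact: (rJi J).1|side].
    - side.
    - move=> x; rewrite /rJ /r.
      have -> : cavg N (fJ J) x - fJ J x - (cavg N f x - f x) = (cavg N (fJ J) x - cavg N f x) - (fJ J x - f x) by ring.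
      exact: normc_triangleB.
    split => //; apply: le_trans e3 _; apply: le_trans (lerD e2 e1) _; le_ring.
  have FM J : L1p (pw (cnv k (rJ J))) /\ rint (pw (cnv k (rJ J))) <= ((2 ^+ k) `^ p)^-1 * (B * (A + 1) * rho ^+ (N - k)).
    split; first exact: (hJ J).1. by apply: bound (hJ J).2 => //; rewrite B30 lerDr.
  have [L1 e1] := cnv_fatou b01 rJi ri rd FM.
  have [|||L2 e2] := rint_triangle (f := fun x => normc (cnv k (cavg N f) x) `^ p) (fp k) L1.
  - by apply: measurable_powR_fun; side; side.
  - side.
  - move=> x; rewrite (lp_piece_cnv k fu).
    have -> : cnv k (cavg N f) x = cnv k f x + cnv k r x by rewrite /r cnvB// addrC subrK.
    apply: le_trans (powR_le (ltW p0) (normc_ge0 _) (normc_triangle _ _)) _. by apply: powR_subadd => /1/.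
  split => //; apply: le_trans (ler_wpM2l (ltW kp) e2) _. rewrite mulrDr; apply: lerD => /1/. by rewrite -ler_pdivlMl.
have hJ J := hhi k N (fJ J) (SJ J) kN (fJi J) (cJ J).
have pwr : (2 ^+ k) `^ p * (2 ^+ N / 2 ^+ k) * (2 ^+ N) `^ (- p) <= rho ^+ (k - N).
  rewrite -{1 2}(subnK (ltnW kN)); move: (k - N)%N => m.
  have Y0 := two_gt0 R m; have Yn0 : (2 ^+ m : R) != 0 by rewrite gt_eqF.
  have Z0 := two_gt0 R N; have Zn0 : (2 ^+ N : R) != 0 by rewrite gt_eqF.
  have -> : 2 ^+ N / 2 ^+ (m + N) = (2 ^+ m) `^ (-1) :> R.
    rewrite exprD powR_inv1// invfM mulrCA mulfV// mulr1//.
  rewrite exprD (powRM _ (two_ge0 R m) (two_ge0 R N)).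
  rewrite (_ : (2 ^+ m) `^ p * _ * _ * _ = ((2 ^+ N) `^ p * (2 ^+ N) `^ (- p)) *
     ((2 ^+ m) `^ p * (2 ^+ m) `^ (-1))); last by ring.
  rewrite -!powRD ?Yn0 ?Zn0 ?implybT// subrr powRr0 mul1r pow2_powR.
  apply: lerXn2r; rewrite ?nnegrE ?rho_ge0// /rho le_max; apply/orP; left. side.
have gJi J : cintble (cavg N (fJ J)) by side.
have FM J : L1p (pw (cnv k (cavg N (fJ J)))) /\
    rint (pw (cnv k (cavg N (fJ J)))) <= ((2 ^+ k) `^ p)^-1 * (B * (A + 1) * rho ^+ (k - N)).
  split; first exact: (hJ J).1. by apply: bound (hJ J).2 => //; rewrite B20 lerDl.
have [L1 e1] := cnv_fatou b01 gJi gi gJ FM.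
by split => //; rewrite add0r -ler_pdivlMl.
Qed.

(** * Besov norms as sequence norms *)

Section sequence_norm.
Implicit Types (b : nat -> \bar R) (M : R).

Definition seq_le q b M := match q with
  | r%:E => forall J, (\sum_(j < J) (b j `^ r)%E <= (M `^ r)%:E)%E
  | _ => forall j, (b j <= M%:E)%E end.

Lemma counting_ae (P : nat -> Prop) : (\forall k \ae (@counting nat R), P k) -> forall k, P k.
Proof.
move=> [A [mA A0 PA]] x; apply: contrapT => nPx.
have xA : [set x] `<=` A by move=> y ->; exact: PA.
have h := le_measure (@counting nat R) (mem_set (I : measurable [set x])) (mem_set mA) xA.
have : (@counting nat R [set x] <= 0)%E.
  by apply: (le_trans h); rewrite le_eqVlt; apply/orP; left; apply/eqP; side.
rewrite /counting ifT/1/; last by apply/asboolP.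
by rewrite fset_set1 finmap.cardfs1 lee_fin ler10.
Qed.

Lemma counting_setT_gt0 : (0 < @counting nat R setT)%E.
Proof. by rewrite /counting ifF//; apply/asboolP; exact: infinite_nat. Qed.

Lemma Lnorm_counting_le q b M : (0 < q)%E -> 0 <= M -> (forall j, 0 <= b j)%E ->
  (Lnorm counting q b <= M%:E)%E <-> seq_le q b M.
Proof.
move=> q0 M0 b0; case: q q0 => [r|_|//].
  rewrite lte_fin => r0; rewrite Lnorm_counting// /seq_le. have aE : (fun k => `|b k| `^ r)%E = (fun k => b k `^ r)%E.
    by ext k; rewrite gee0_abs.
  rewrite [X in (limn X `^ _)%E](_ : _ = fun n => \sum_(0 <= k < n) b k `^ r)%E; last first.
    by ext n; apply: eq_bigr => k _; rewrite gee0_abs.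
  set S := (limn _)%E; have S0 : (0 <= S)%E by apply: nneseries_ge0 => n _ _; exact: poweR_ge0.
  have SE : (S `^ r^-1 <= M%:E)%E <-> (S <= (M `^ r)%:E)%E.
    split => h.
      have := gt0_ler_poweR (ltW r0) _ _ h; rewrite -poweRrM mulVf/1/ poweRe1// poweR_EFin.
      by apply; rewrite in_itv/= ?poweR_ge0 ?leey ?lee_fin ?M0.
    have := gt0_ler_poweR (_ : 0 <= r^-1) _ _ h; rewrite poweR_EFin -powRrM mulfV/1/ powRr1//.
    by apply; rewrite/1/ in_itv/= ?S0 ?leey ?lee_fin ?powR_ge0.
  apply: (iff_trans SE); split=> h.
    move=> J; apply: le_trans h; rewrite -(big_mkord xpredT (fun j => b j `^ r)%E).
    by apply: nneseries_lim_ge => n _ _; exact: poweR_ge0.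
  apply: lime_le; first by apply: is_cvg_nneseries => n _ _; exact: poweR_ge0.
  by apply: nearW => J; rewrite big_mkord/1/.
rewrite unlock counting_setT_gt0 /seq_le; split => [h j|h].
  by have := counting_ae (ess_supP h) j => /=; rewrite gee0_abs.
by apply/ess_supP; apply: nearW => j /=; rewrite gee0_abs.
Qed.

End sequence_norm.

Lemma Lnorm_rint f : L1p (pw f) ->
  Lnorm (lebesgue_rV R d) p%:E (fun x => (normc (f x))%:E) = (rint (pw f) `^ p^-1)%:E.
Proof.
move=> h; rewrite unlock; rewrite (_ : (\int[_]_x _)%E = nint (pw f)).
  by rewrite rintE// poweR_EFin.
by apply: eq_integral => x _ /=; rewrite ger0_norm/1/.
Qed.

Lemma Lnorm_fin f : cmeas f -> (Lnorm (lebesgue_rV R d) p%:E (fun x => (normc (f x))%:E) < +oo)%E ->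
  L1p (pw f).
Proof.
move=> mf h; split => /1/.
move: h; rewrite unlock; rewrite (_ : (\int[_]_x _)%E = nint (pw f)).
  by apply: lty_poweRy => /1/.
by apply: eq_integral => x _ /=; rewrite ger0_norm/1/.
Qed.

Definition density_le q (D : nat -> R) (M : R) := match q with
  | r%:E => forall J, \sum_(j < J) D j `^ (r / p) <= M `^ r
  | _ => forall j, D j <= M `^ p end.

Lemma powR_root_le (a M : R) : 0 <= a -> 0 <= M -> (a `^ p^-1 <= M) = (a <= M `^ p).
Proof.
move=> a0 M0; apply/idP/idP => h.
  by have := powR_le (ltW p0) (powR_ge0 _ _) h; rewrite powRV.
have := powR_le (_ : 0 <= p^-1) a0 h; rewrite -powRrM mulfV/1/ powRr1//.
by apply => /1/.
Qed.

(** Everything after this point uses the norm only through this equivalence. *)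
Lemma besov_le q u (M : R) : (0 < q)%E -> 0 <= M -> tempered u ->
  (besov_norm phi0 1 p%:E q u <= M%:E)%E <->
  (forall j, L1p (pw (lp_piece u j))) /\ density_le q (dens u) M.
Proof.
move=> q0 M0 ut; rewrite /besov_norm.
set b := fun j : nat => _.
have b0 j : (0 <= b j)%E by rewrite mule_ge0 ?Lnorm_ge0.
have bE j : L1p (pw (lp_piece u j)) -> b j = (dens u j `^ p^-1)%:E.
  move=> h; have -> : b j = ((2 `^ (j%:R * 1))%:E * (rint (pw (lp_piece u j)) `^ p^-1)%:E)%E.
    by rewrite /b; congr (_ * _)%E; exact: Lnorm_rint.
  rewrite -EFinM mulr1 powR_mulrn// /dens powRM//; last first.
    by apply: rint_ge0 => x/1/.
  by rewrite -powRrM mulfV/1/ powRr1// two_ge0.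
have Lb j : (b j < +oo)%E -> L1p (pw (lp_piece u j)).
  move=> h; apply: Lnorm_fin; first exact: (ccont_cmeas (lp_piece_ccont phi0P j ut)).
  rewrite ltey; apply/eqP => e; move: h; rewrite /b e gt0_muley// lte_fin/1/.
apply: (iff_trans (Lnorm_counting_le q0 M0 b0)).
have D0 j : 0 <= dens u j by exact: dens_ge0.
case: q q0 => [r|_|//].
  rewrite lte_fin => r0; split => [h|[h1 h2] J].
    have Lj j : L1p (pw (lp_piece u j)).
      apply: Lb; apply: (@lty_poweRy _ _ r) => /1/. apply: le_lt_trans (ltry (M `^ r)); apply: le_trans (h j.+1).
      by rewrite big_ord_recr leeDr// sume_ge0// => i _; exact: poweR_ge0.
    split => // J; rewrite -lee_fin; apply: le_trans (h J); rewrite -sumEFin.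
    by apply: lee_sum => j _; rewrite bE// poweR_EFin -powRrM mulrC.
  rewrite -[leRHS]/((M `^ r)%:E); have := h2 J; rewrite -lee_fin; apply: le_trans.
  by rewrite -sumEFin; apply: lee_sum => j _; rewrite bE// poweR_EFin -powRrM mulrC.
split => [h|[h1 h2] j].
  have Lj j : L1p (pw (lp_piece u j)).
    by apply: Lb; exact: le_lt_trans (h j) (ltry M).
  by split =>  j; have := h j; rewrite bE// lee_fin powR_root_le.
by rewrite bE// lee_fin powR_root_le.
Qed.

Lemma density_term q (D : nat -> R) (M : R) k : (0 < q)%E -> 0 <= M -> (forall j, 0 <= D j) ->
  density_le q D M -> D k <= M `^ p.
Proof.
move=> q0 M0 D0; case: q q0 => [r r0 h|_ h|]/1/.
rewrite lte_fin in r0.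
have rp : 0 < r / p => /1/.
have : D k `^ (r / p) <= M `^ r.
  by apply: le_trans (h k.+1); rewrite big_ord_recr lerDr sumr_ge0// => i _/1/.
move=> h1; have := powR_le (_ : 0 <= (r / p)^-1) (powR_ge0 _ _) h1.
rewrite -!powRrM mulfV/1/ powRr1// invf_div mulrCA mulfV/1/ mulr1.
by apply => /1/.
Qed.

(** * Distributions given by integrable functions *)

Section integrable_distribution.
Implicit Types (psi : E -> C) (s : seq 'I_d).

Lemma iter_vanish f s (M : R) : smooth f -> (forall x, M < `|x| -> f x = 0) ->
  forall x, M < `|x| -> iter_partial s f x = 0.
Proof.
move=> fs f0; elim: s => // i s IH; exact: (cder_vanish (smooth_cder s i fs) IH).
Qed.

Lemma compact_norm_ball (M : R) : compact [set x : E | `|x| <= M].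
Proof.
apply: bounded_closed_compact.
  by exists M; split; rewrite ?num_real// => r Mr x /le_trans; apply; exact: ltW.
rewrite (_ : [set x | _] = (fun x : E => `|x|) @^-1` [set r | r <= M])//.
by apply: closed_comp => [x _|]/1/; exact: norm_continuous.
Qed.

Lemma ccont_bounded f (M : R) : ccont f -> exists2 B, 0 <= B & forall x, `|x| <= M -> normc (f x) <= B.
Proof.
move=> [c1 c2]; pose K := [set x : E | `|x| <= M].
have cK : compact K by exact: compact_norm_ball.
have bnd (h : E -> R) : continuous h -> exists2 B, 0 <= B & forall x, K x -> `|h x| <= B.
  move=> ch; have : compact (h @` K) by apply: continuous_compact => //; exact: continuous_subspaceT.
  move=> /compact_bounded[B [_ hB]]; exists (Num.max 0 (B + 1)); first by rewrite le_max lexx.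
  move=> x Kx; rewrite le_max; apply/orP; right. by apply: (hB (B + 1)) => /1/; rewrite ltrDl.
have [B1 B10 h1] := bnd _ c1; have [B2 B20 h2] := bnd _ c2.
exists (B1 + B2) => /1/.
move=> x Kx; apply: le_trans (normc_le_ReIm _) _; apply: lerD; [exact: h1|exact: h2].
Qed.

Lemma schwartz_of_bounded_support f (M : R) : smooth f -> (forall x, M < `|x| -> f x = 0) -> schwartz f.
Proof.
move=> fs f0; apply/schwartzP; split => // k s.
have [B B0 hB] := ccont_bounded M (smooth_ccont s fs).
exists ((1 + `|M|) ^+ k * B) => x; case: (leP `|x| M) => xM.
  apply: ler_pM => /1/; last exact: hB. apply: lerXn2r; rewrite/1/ lerD2l; apply: le_trans xM (ler_norm _).
by rewrite (iter_vanish s fs f0 xM) normc0 mulr0 mulr_ge0// exprn_ge0 addr_ge0.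
Qed.

Lemma test_function_schwartz f U : test_function U f -> schwartz f.
Proof.
move=> [fs /compact_bounded[B [_ hB]] _].
apply: (@schwartz_of_bounded_support f (B + 1)) => // x xB; apply/eqP; apply: contrapT => /negP fx.
have BB : B < B + 1 by rewrite ltrDl.
by have /= := hB (B + 1) BB x (@subset_closure _ [set x | f x != 0] x fx); rewrite leNgt xB.
Qed.

Lemma tempered_of_cintble g : cintble g -> tempered (fun psi => cint (fun x => g x * psi x)).
Proof.
move=> gi; have [gm gl] := proj1 (cintble_L1p g) gi.
have ci psi : schwartz psi -> cintble (fun x => g x * psi x).
  move=> ps; have [B B0 hB] := schwartz_bounded [::] ps. by apply: (cintble_mul_bounded gi _ hB); side; side.
split.
  move=> a phi psi hphi hpsi; rewrite -cintZ; last exact: ci.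
  rewrite -cintD; [|by apply: cintbleZ; exact: ci|exact: ci]. by congr cint; ext x; ring.
exists (2 * rint (fun x => normc (g x))), 0%N => psi ps.
have r0 : 0 <= rint (fun x => normc (g x)) by apply: rint_ge0 => x/1/.
have [B B0 hB] := schwartz_bounded [::] ps.
have sm0 k s : (0 <= schwartz_seminorm k s psi)%E.
  apply: (@le_trans _ _ ((1 + eucl_norm (0 : E)) ^+ k * normc (iter_partial s psi 0))%:E).
    by rewrite lee_fin mulr_ge0/1/ exprn_ge0// addr_ge0// sqrtr_ge0.
  by apply: ereal_sup_ubound => /1/.
have fin : (schwartz_seminorm 0 [::] psi < +oo)%E by exact: ps.2.
have := sm0 0%N [::]; case bE : (schwartz_seminorm 0 [::] psi) fin => [b||]// _; rewrite lee_fin => b0.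
apply: (@le_trans _ _ (2 * rint (fun x => normc (g x)) * b)%:E).
  rewrite lee_fin -mulrA; have [L e] := L1pZ b0 gl; rewrite (mulrC (rint _)) -e. apply: normc_cint_rint => /1/.
  move=> x; rewrite normcM mulrC; mulr. rewrite -lee_fin -bE; apply: ereal_sup_ubound; exists x => //.
  by rewrite expr0 mul1r.
rewrite EFinM; apply: lee_wpmul2l; first by rewrite lee_fin mulr_ge0.
rewrite big_ord1 (bigD1 [tuple])// bE leeDl// sume_ge0// => s _/1/.
Qed.

Lemma locally_L1_cintble g : cintble g -> locally_L1 g.
Proof.
move=> [[m1 m2] gi]; split => // K cK; apply: le_lt_trans gi.
apply: ge0_subset_integral => //.
- by rewrite -(setCK K); apply: measurableC; apply: measurable_open; apply: closed_openC; exact: compact_closed.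
- by apply/measurable_EFinP; side.
- by move=> x _; rewrite lee_fin normc_ge0.
Qed.

Lemma represents_cintble g u : cintble g -> (forall psi, schwartz psi -> u psi = cint (fun x => g x * psi x)) ->
  represents g u.
Proof.
move=> gi gu; split; first exact: locally_L1_cintble.
by move=> phi hphi; rewrite gu//; exact: test_function_schwartz hphi.
Qed.

End integrable_distribution.

(** * The upper bound *)

Section density_sequences.
Implicit Types (a b t r : R) (A D : nat -> R).

Lemma powR_add2 a b t : 0 <= a -> 0 <= b -> 0 <= t -> (a + b) `^ t <= 2 `^ t * (a `^ t + b `^ t).
Proof.
move=> a0 b0 t0; have [ab|ab] := leP a b.
  via ((2 * b) `^ t).
    by apply: powR_le => /1/; lra.
  by rewrite powRM//; mull; rewrite lerDr powR_ge0.
via ((2 * a) `^ t).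
  by apply: powR_le => /1/; lra.
by rewrite powRM//; mull; rewrite lerDl powR_ge0.
Qed.

Lemma le_powRD1 a t : 0 <= a -> 1 <= t -> a <= a `^ t + 1.
Proof.
move=> a0 t1; have [a1|a1] := leP a 1.
  by rewrite (le_trans a1)// lerDr powR_ge0.
have := ler_powR (ltW a1) t1; rewrite powRr1// => h/1/; lra.
Qed.

Lemma two_sided_geo (r : R) N J : 0 <= r < 1 ->
  \sum_(k < J) r ^+ (if (k <= N)%N then N - k else k - N)%N <= 2 * (1 - r)^-1.
Proof.
move=> r01; have /andP[r0 r1] := r01.
pose t k := r ^+ (if (k <= N)%N then N - k else k - N)%N.
have t0 k : 0 <= t k => /1/.
via (\sum_(k < N.+1 + J) t k).
  rewrite -[leLHS]/(\sum_(k < J) t k) -[leLHS](big_mkord xpredT t) -[leRHS](big_mkord xpredT t) (@big_cat_nat _ _ _ J 0 (N.+1 + J)) ?leq_addl//=.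
  by rewrite lerDl sumr_ge0.
rewrite big_split_ord/= mulrDl mul1r; apply: lerD.
  rewrite (reindex_inj rev_ord_inj)/=; apply: le_trans (geo_sum_le N.+1 r01).
  apply: ler_sum => j _; rewrite /t subSS leq_subr subKn//; by rewrite -ltnS.
apply: le_trans (geo_sum_le J r01); apply: ler_sum => j _.
rewrite /t ifF; last by rewrite leqNgt ltnS leq_addr.
rewrite addSn -addnS addKn; apply: ler_wiXn2l => //; exact: ltW.
Qed.

Lemma powR_rate (n : R) s : (n `^ s) `^ p = n `^ (s * p).
Proof. by rewrite -powRrM. Qed.

(** Hoelder on N + 1 terms, by [le_powRD1] after rescaling the terms. *)
Lemma density_sum_le q A N : (p%:E <= q)%E -> (0 < N)%N -> (forall j, 0 <= A j) -> density_le q A 1 ->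
  \sum_(j < N.+1) A j + 1 <= 4 * (N%:R `^ (p^-1 - fine q^-1%E)) `^ p.
Proof.
move=> pq N0 A0; have N1 : 1 <= N%:R :> R by rewrite ler1n.
case: q pq => [r|_|//]; last first.
  rewrite /density_le powR1 => h; rewrite powR_rate invey subr0 mulVf/1/ powRr1//. via (\sum_(j < N.+1) 1 + 1).
    by rewrite lerD2r; apply: ler_sum => j _/1/.
  by rewrite sumr_const card_ord -[N.+1]addn1 natrD; lra.
rewrite lee_fin => pr; have r0 : 0 < r by exact: lt_le_trans pr.
rewrite /density_le powR1 => h; set t := r / p; have t1 : 1 <= t by rewrite /t ler_pdivlMr// mul1r.
have t0 : 0 < t => /1/.
rewrite powR_rate inver gt_eqF//= mulrBl mulVf/1/.
have -> : r^-1 * p = t^-1 by rewrite /t invf_div mulrC.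
have Nn : (N%:R : R) != 0 by rewrite gt_eqF// (lt_le_trans _ N1).
have NV : N%:R `^ (- t^-1) * N%:R `^ t^-1 = 1 :> R.
  by rewrite -powRD ?Nn ?implybT// addNr powRr0.
have -> : N%:R `^ (1 - t^-1) = N%:R * N%:R `^ (- t^-1) :> R.
  by rewrite powRD ?Nn ?implybT// powRr1.
have X0 : 0 <= N%:R `^ (- t^-1) :> R by [].
have a1 j : A j <= N%:R `^ (- t^-1) * (A j `^ t * N%:R + 1).
  have e : A j = N%:R `^ (- t^-1) * (N%:R `^ t^-1 * A j) by rewrite mulrA NV mul1r.
  rewrite [leLHS]e; apply: ler_wpM2l => //. apply: le_trans (le_powRD1 _ t1) _ => /1/.
  rewrite lerD2r powRM// -powRrM mulVf/1/ powRr1// mulrC/1/.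
have s1 : \sum_(j < N.+1) A j <= N%:R `^ (- t^-1) * (N%:R + N.+1%:R).
  via (\sum_(j < N.+1) N%:R `^ (- t^-1) * (A j `^ t * N%:R + 1)).
    by apply: ler_sum.
  rewrite -mulr_sumr; apply: ler_wpM2l => //; rewrite big_split/= sumr_const card_ord lerD2r -mulr_suml.
  by rewrite ler_piMl//; exact: h.
have s2 : 1 <= N%:R * N%:R `^ (- t^-1) :> R.
  have -> : N%:R * N%:R `^ (- t^-1) = N%:R `^ (1 - t^-1) :> R by rewrite powRD ?Nn ?implybT// powRr1.
  by apply: powR_ge1 => //; rewrite subr_ge0 invf_le1.
have s3 : N%:R `^ (- t^-1) <= N%:R * N%:R `^ (- t^-1) :> R by rewrite ler_peMl.
move: s1; rewrite -[N.+1]addn1 natrD; move: s2 s3; set X := N%:R * _.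
rewrite !mulrDr mulr1 mulrC -/X; lra.
Qed.

(** The l^q norm of the right-hand side: the diagonal part is bounded by the norm of A, the
geometric part by its peak at k = N. *)
Lemma density_recursion q (B rho : R) : (p%:E <= q)%E -> 0 <= B -> 0 <= rho <= 1 -> (q != +oo%E -> rho < 1) ->
  exists2 K, 0 < K & forall A D N, (0 < N)%N -> (forall j, 0 <= A j) -> (forall j, 0 <= D j) ->
  density_le q A 1 ->
  (forall k, D k <= (if (k <= N)%N then A k else 0) +
     B * (\sum_(j < N.+1) A j + 1) * rho ^+ (if (k <= N)%N then N - k else k - N)%N) ->
  density_le q D (K * N%:R `^ (p^-1 - fine q^-1%E)).
Proof.
move=> pq B0 /andP[r0 r1] rq.
have rate1 N : (0 < N)%N -> 1 <= N%:R `^ (p^-1 - fine q^-1%E) :> R.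
  move=> N0; apply: powR_ge1; first by rewrite ler1n.
  case: q pq {rq} => [r|_|//]; last by rewrite invey subr0 invr_ge0 ltW.
  rewrite lee_fin => pr; have r0' : 0 < r by exact: lt_le_trans pr. by rewrite inver gt_eqF// subr_ge0 lef_pV2.
have main A D N : (0 < N)%N -> (forall j, 0 <= A j) -> density_le q A 1 ->
  (forall k, D k <= (if (k <= N)%N then A k else 0) +
     B * (\sum_(j < N.+1) A j + 1) * rho ^+ (if (k <= N)%N then N - k else k - N)%N) ->
  forall k, D k <= A k + 4 * B * (N%:R `^ (p^-1 - fine q^-1%E)) `^ p * rho ^+ (if (k <= N)%N then N - k else k - N)%N.
  move=> N0 A0 h1 h2 k; apply: le_trans (h2 k) _; apply: lerD; first by case: ifP. mulr.
  rewrite (mulrC 4) -mulrA; apply: ler_wpM2l => //; exact: density_sum_le.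
case: q pq rq rate1 main => [r|_ _|//]; last first.
  move=> rate1 main; exists ((1 + 4 * B) `^ p^-1) => /1/.
  move=> A D N N0 A0 D0 h1 h2 /= j; apply: le_trans (main A D N N0 A0 h1 h2 j) _.
  have := rate1 N N0; set X := _ `^ (p^-1 - _) => X1. have Xp : 1 <= X `^ p by apply: powR_ge1 => /1/.
  rewrite powRM/1/. rewrite powRV/1/. rewrite [leRHS](_ : _ = X `^ p + 4 * B * X `^ p); last by ring. apply: lerD.
    by apply: le_trans Xp; have := h1 j; rewrite powR1.
  rewrite ler_piMr/1/. exact: exprn_ile1.
rewrite lee_fin => pr /(_ isT) r1' rate1 main.
have rr0 : 0 < r by exact: lt_le_trans pr.
set t := r / p; have t1 : 1 <= t by rewrite /t ler_pdivlMr// mul1r.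
have t0 : 0 < t => /1/.
have rt : 0 <= rho `^ t < 1.
  rewrite powR_ge0; by have := gt0_ltr_powR t0 r0 ler01 r1'; rewrite powR1.
pose L := 2 `^ t * (1 + (4 * B) `^ t * (2 * (1 - rho `^ t)^-1)).
have L0 : 0 < L.
  rewrite mulr_gt0// ltr_pwDl// !mulr_ge0/1/ invr_ge0 subr_ge0 ltW; by case/andP: rt.
exists (L `^ r^-1) => /1/.
move=> A D N N0 A0 D0 h1 h2 J; have hm := main A D N N0 A0 h1 h2.
move: hm (rate1 N N0); move: (N%:R `^ (p^-1 - _)) => X hm X1.
have X0 : 0 <= X by exact: le_trans X1.
rewrite powRM/1/ powRV/1/.
have Xr : (X `^ p) `^ t = X `^ r by rewrite -powRrM /t mulrCA mulfV/1/ mulr1.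
have Xr1 : 1 <= X `^ r by exact: (powR_ge1 X1 (ltW rr0)).
pose e k := (if (k <= N)%N then N - k else k - N)%N.
via (\sum_(k < J) 2 `^ t * (A k `^ t + (4 * B) `^ t * X `^ r * (rho `^ t) ^+ e k)).
  apply: ler_sum => k _; apply: le_trans (powR_le (ltW t0) (D0 k) (hm k)) _.
  apply: le_trans (powR_add2 _ _ (ltW t0)) _ => //.
    side.
  mull. rewrite lerD2l -/(e k) -/X [leLHS]powRM/1/. rewrite [X in X * _ <= _]powRM/1/ Xr.
  by rewrite -(powR_mulrn _ r0) -(powR_mulrn _ (powR_ge0 rho t)) -!powRrM (mulrC t) lexx.
rewrite -mulr_sumr big_split/= /L -mulrA; mull.
rewrite [leRHS](_ : _ = X `^ r + (4 * B) `^ t * X `^ r * (2 / (1 - rho `^ t))); last by ring.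
apply: lerD.
  by apply: le_trans Xr1; have := h1 J; rewrite powR1.
rewrite -mulr_sumr; mull.
exact: two_sided_geo.
Qed.

End density_sequences.

Section upper_bound.
Variable q : \bar R.
Hypothesis pq : (p%:E <= q)%E.
Hypothesis p1q : (q = +oo)%E \/ p < 1.

Lemma Op_le_operator_norm (T : operator R d) nrm Q : (Op T nrm Q <= operator_norm T nrm)%E.
Proof.
apply: ereal_sup_le => _ [u [u1 u2 _] <-]; by exists u.
Qed.

Lemma operator_norm_upper : exists2 K, 0 < K & forall N, (0 < N)%N ->
  (operator_norm (avg_operator N) (besov_norm phi0 1 p%:E q) <= (K * N%:R `^ (p^-1 - fine q^-1%E))%:E)%E.
Proof.
have q0 : (0 < q)%E by apply: lt_le_trans pq => /1/.
have [B B0 hB] := upper_density.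
have rho1 : q != +oo%E -> rho < 1.
  move=> qoo; case: p1q => [qE|pl]; first by rewrite qE in qoo. rewrite /rho gt_max; apply/andP; split.
    rewrite -opprB powRN invf_lt1//.
    by have := gt0_ltr_powR (_ : 0 < 1 - p) ler01 (ler0n R 2) (ltr1n R 2); rewrite powR1 subr_gt0; apply.
  rewrite powRN invf_lt1//.
  by have := gt0_ltr_powR (_ : 0 < p + gam) ler01 (ler0n R 2) (ltr1n R 2); rewrite powR1; apply => /1/.
have r01 : 0 <= rho <= 1 by rewrite rho_ge0 rho_le1.
have [K K0 hK] := density_recursion pq B0 r01 rho1.
exists K => // N N0; apply: ge_ereal_sup => _ [u [ut un] <-].
have [Lu Du] := (besov_le q0 ler01 ut).1 un.
have Du1 j : dens u j <= 1.
  have := density_term j q0 ler01 (dens_ge0 u) Du; by rewrite powR1.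
have [f fi [fu hf]] := hB u ut Lu Du1.
have gi := (cintble_cavg N fi).1.
pose v : raw_distribution R d := fun psi => cint (fun x => cavg N f x * psi x).
have vt : tempered v by exact: tempered_of_cintble.
have vE k : lp_piece v k = cnv k (cavg N f) by exact: lp_piece_cnv.
via (besov_norm phi0 1 p%:E q v).
  apply: ereal_inf_lbound; exists v => //; split => //; exists f; split.
    exact: represents_cintble.
  by rewrite dyadic_avgE; exact: represents_cintble.
apply/(besov_le q0 _ vt).
  side.
split; first by move=> k; rewrite vE; exact: (hf N k).1.
apply: (hK (dens u) (dens v) N N0 (dens_ge0 u) (dens_ge0 v) Du) => k.
by rewrite {1}/dens vE; exact: (hf N k).2.
Qed.

End upper_bound.

(** * Representing functions *)

Section density.
Implicit Types (w : E) (psi : E -> C).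

Lemma test_function_of_bounded_support f (M : R) : smooth f -> (forall x, M < `|x| -> f x = 0) -> test_function setT f.
Proof.
move=> fs f0; have cK : compact [set x : E | `|x| <= M] by exact: compact_norm_ball.
split => //; apply: (subclosed_compact _ cK); first exact: closed_closure.
have clK : closed [set x : E | `|x| <= M] by exact: compact_closed.
rewrite closureE; apply: smallest_sub => // y /= fy; rewrite leNgt; apply/negP => My; by move: fy; rewrite f0// eqxx.
Qed.

Lemma phi0_support x : 3 / 2 <= `|x| -> phi0 x = 0.
Proof. by move=> h; case: phi0P => _ _; apply; apply: le_trans h (eucl_norm_ge x). Qed.

Lemma phi0_cutoff n x : 3 / 2 * 2 ^+ n < `|x| -> phi0 (2 ^- n *: x) = 0.
Proof.
move=> h; apply: phi0_support; rewrite normrZ ger0_norm//.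
by rewrite [leRHS]mulrC ler_pdivlMr// ltW.
Qed.

(** The cutoff is 1 on a ball of radius 2^n, outside of which one power of decay gives 2^-n. *)
Lemma cutoff_seminorm psi (k : nat) : schwartz psi -> exists2 B, 0 <= B & forall n s, (size s <= k)%N ->
  sbd k s (fun x => psi x - phi0 (2 ^- n *: x) * psi x) (B * 2 ^- n).
Proof.
move=> ps; have phs := phi0_schwartz phi0P.
have [A A0 hA] := schwartz_bd_le k.+1 k ps.
have [B B0 hB] := schwartz_decay k 0 phs.
have [L L0 hL] := schwartz_lip 0 (lexx 0) phs.
exists (2 ^+ k * (A * (L + B))) => /1/.
move=> n s sk x; set T := 2 ^- n; have T0 : 0 <= T by rewrite invr_ge0 two_ge0.
have T1 : T <= 1 by rewrite invf_le1// exprn_ege1// ler1n.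
pose om x : C := 1 - phi0 (T *: x).
have [sp1 sp2] := smooth_affine T 0 (schwartz_smooth phs).
have afE : (fun x => phi0 (T *: x + 0)) = fun x => phi0 (T *: x) by ext y; rewrite addr0.
rewrite afE in sp1 sp2; have [c1 c2] := @smooth_cst R d 1.
have [om1 om2] := smooth_lin (-1) sp1 c1.
have omE : (fun x => -1 * phi0 (T *: x) + 1) = om by ext y; rewrite /om mulN1r addrC.
rewrite omE in om1 om2.
rewrite (_ : (fun x => psi x - _) = fun x => psi x * om x); last first.
  by ext y; rewrite /om mulrBr mulr1 mulrC.
have x1 : 1 <= 1 + `|x| by rewrite lerDl.
have xk := base_ge0 x.
have b1 t : (size t <= size s)%N -> normc (iter_partial t psi x) <= A / (1 + `|x|) ^+ k.+1.
  by move=> ts; rewrite ler_pdivlMr// mulrC; apply: hA; exact: leq_trans sk.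
have b2 t : (size t <= size s)%N -> normc (iter_partial t om x) <= (L + B) * (T * (1 + `|x|)).
  move=> ts; rewrite om2 c2 sp2. have TX : 0 <= T * (1 + `|x|) => /1/. case: t ts => [|i t] ts.
    have := hL [::] (leq0n _) 0 (T *: x); rewrite add0r /wt normr0 !addr0 oppr0 !powRr0 !mulr1.
    rewrite -[iter_partial [::] phi0]/phi0.
    have -> : phi0 0 = 1 by case: phi0P => _ h _; apply: h; rewrite /eucl_norm /dotp big1 ?sqrtr0// => i _; rewrite mxE mul0r.
    rewrite -[size [::]]/0%N expr0 rmorph1 mul1r mulN1r [X in _ -> normc X <= _]addrC normc_distC normrZ (ger0_norm T0) => h.
    apply: le_trans h _; rewrite mulrDl -[leLHS]addr0; apply: lerD => /1/.
    by apply: ler_wpM2l => //; apply: ler_wpM2l => //; rewrite lerDr.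
  rewrite addr0 mulN1r normc_opp addr0 normcM normcr ger0_norm/1/ mulrDl -[leLHS]add0r. apply: lerD => /1/.
  rewrite mulrC; apply: ler_pM => /1/.
    have := hB (i :: t) (leq_trans ts sk) (T *: x); rewrite /wt oppr0 powRr0 mulr1/1/.
  apply: (@le_trans _ _ T); last by rewrite ler_peMr. by rewrite -[size _]/((size t).+1) exprS ler_piMr// exprn_ile1.
have := smoothM_bound (schwartz_smooth ps) om1 b1 b2.
have s2 : 2 ^+ size s <= 2 ^+ k :> R by rewrite ler_weXn2l// ler1n.
move=> h; via ((1 + `|x|) ^+ k * (2 ^+ k * (A / (1 + `|x|) ^+ k.+1 * ((L + B) * (T * (1 + `|x|)))))).
  mull. apply: le_trans h _; apply: ler_wpM2r => //. side.
have xn : 1 + `|x| != 0 by [].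
rewrite exprS invfM le_eqVlt; apply/orP; left; apply/eqP; field.
by rewrite xn expf_neq0.
Qed.

Lemma cutoff_test psi n : schwartz psi -> test_function setT (fun x => phi0 (2 ^- n *: x) * psi x).
Proof.
move=> ps; apply: (@test_function_of_bounded_support _ (3 / 2 * 2 ^+ n)).
  have [sp1 _] := smooth_affine (2 ^- n) 0 (schwartz_smooth (phi0_schwartz phi0P)).
  have afE : (fun x => phi0 (2 ^- n *: x + 0)) = fun x => phi0 (2 ^- n *: x) by ext y; rewrite addr0.
  by rewrite afE in sp1; exact: (smoothM sp1 (schwartz_smooth ps)).1.
by move=> x h; rewrite phi0_cutoff// mul0r.
Qed.

(** Test functions are dense in the Schwartz space, by cutoffs. *)
Lemma tempered_determined u v psi : tempered u -> tempered v ->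
  (forall phi, test_function setT phi -> u phi = v phi) -> schwartz psi -> u psi = v psi.
Proof.
move=> ut vt uv ps.
have cut (w : raw_distribution R d) : tempered w -> exists2 B, 0 <= B & forall n, normc (w psi - w (fun x => phi0 (2 ^- n *: x) * psi x)) <= B * 2 ^- n.
  move=> wT; have [M [k [M0 hM]]] := tempered_bound wT; have [B B0 hB] := cutoff_seminorm k ps. exists (M * B) => /1/.
  move=> n; have ts := test_function_schwartz (cutoff_test n ps).
  by rewrite -temperedB// -mulrA; apply: hM; [exact: schwartzB|move=> s sk; exact: hB].
have [B B0 hB] := cut u ut; have [B' B'0 hB'] := cut v vt.
apply/eqP; rewrite -subr_eq0; apply/eqP; apply: eq0_normc; apply/eqP; rewrite eq_le normc_ge0 andbT.
have b n : normc (u psi - v psi) <= (B + B') * 2 ^- n.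
  have -> : u psi - v psi = (u psi - u (fun x => phi0 (2 ^- n *: x) * psi x)) - (v psi - v (fun x => phi0 (2 ^- n *: x) * psi x)).
    by rewrite (uv _ (cutoff_test n ps)); ring.
  by apply: le_trans (normc_triangleB _ _) _; rewrite mulrDl; exact: lerD.
have c : (B + B') * 2 ^- n @[n --> \oo] --> (B + B') * 0 by apply: cvgMr; exact: cvg_half.
rewrite mulr0 in c; apply: (ler_cvg_to (@cvg_cst _ (normc (u psi - v psi)) _ \oo _) c).
exact: nearW.
Qed.

Lemma represents_unique g v : cintble g -> tempered v -> represents g v ->
  forall psi, schwartz psi -> v psi = cint (fun x => g x * psi x).
Proof.
move=> gi vt [_ gv] psi ps.
exact: (tempered_determined vt (tempered_of_cintble gi) gv ps).
Qed.

(** A translate and modulation of phi0: the modulation makes its integral nonzero, as the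
transform of phi0 cannot vanish identically; hence the mollifier is complex valued. *)
Lemma orthant_mollifier : exists2 rho : E -> C, schwartz rho & cint rho = 1 /\
  forall z, rho z != 0 -> forall i, -4 <= z 0 i < 0.
Proof.
have phs := phi0_schwartz phi0P.
have [x0 hx0] : exists x0, ift phi0 x0 != 0.
  apply: contrapT => h. have z x : ift phi0 x = 0 by apply/eqP; apply: contrapT => /negP hx; apply: h; exists x.
  have := cint_K0 phi0P; rewrite (_ : ift phi0 = fun=> 0); last by apply/funext.
  by rewrite cint0 => /eqP; rewrite eq_sym oner_eq0.
pose one : E := \row_i 2.
pose psi z := phi0 z * chi x0 z.
have pss : schwartz psi by exact: schwartz_mulchi.
pose a := cint psi.
have a0 : a != 0.
  by apply: contra hx0 => /eqP aE; rewrite iftE -/psi -/a aE mulr0.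
have s1 : schwartz (fun z => psi (1 *: z + one)) by apply: schwartz_affine => /1/.
have E1 : (fun z => psi (1 *: z + one)) = fun z => psi (z + one) by ext z; rewrite scale1r.
rewrite E1 in s1; have psi_i := schwartz_cintble [::] pss.
exists (fun z => a^-1 * psi (z + one)); first exact: schwartzZ.
split; first by rewrite cintZ ?cint_shift ?mulVf; side.
move=> z hz i; have : `|z + one| < 3 / 2.
  rewrite ltNge; apply/negP => h; move: hz; by rewrite /psi phi0_support// mul0r mulr0 eqxx.
move=> h; have := le_lt_trans (coord_le_norm (z + one) i) h; rewrite !mxE ltr_norml => /andP[h1 h2].
by apply/andP; split; lra.
Qed.

Lemma dyfloor_right N x : exists2 e : R, 0 < e & forall h : E, (forall i, 0 <= h 0 i < e) ->
  dyfloor N (x + h) = dyfloor N x.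
Proof.
have X0 := two_gt0 R N.
have nr : \forall e \near 0^'+, forall i, 2 ^+ N * e <= (Num.floor (2 ^+ N * x 0 i) + 1)%:~R - 2 ^+ N * x 0 i.
  apply: filter_forall => i; set s := _ - _. have s0 : 0 < s by rewrite subr_gt0 floorD1_gt.
  near=> e; rewrite mulrC -ler_pdivlMr//; near: e; apply: nbhs_right_le; side.
have [e e0 he] : exists2 e : R, 0 < e & forall i, 2 ^+ N * e <= (Num.floor (2 ^+ N * x 0 i) + 1)%:~R - 2 ^+ N * x 0 i.
  near (0:R)^'+ => e; exists e; near: e => //; exact: nbhs_right_gt.
exists e => // h hh; apply/rowP => i; rewrite !mxE.
have /andP[h0 h1] := hh i; have xe := he i.
have le1 := floor_le_tmp (2 ^+ N * x 0 i).
have a1 : 2 ^+ N * h 0 i < 2 ^+ N * e by rewrite ltr_pM2l.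
have a0 : 0 <= 2 ^+ N * h 0 i => /1/.
apply: floor_def; rewrite mulrDr; apply/andP; split.
  by apply: le_trans le1 _; rewrite lerDl.
by apply: lt_le_trans (_ : 2 ^+ N * x 0 i + 2 ^+ N * e <= _); [rewrite ltrD2l|rewrite addrC -lerBrDr].
Unshelve. all: by end_near.
Qed.

Lemma locally_L1_cutoff g (M : R) : locally_L1 g ->
  (nint (fun x => \1_[set x : E | `|x| <= M] x * normc (g x))%R < +oo)%E.
Proof.
move=> [_ _ /(_ _ (@compact_norm_ball M))]; apply: le_lt_trans.
rewrite integral_mkcond le_eqVlt; apply/orP; left; apply/eqP; apply: eq_integral => x _.
by rewrite patchE indicE; case: (_ \in _); rewrite ?mul1r ?mul0r.
Qed.

(** Convolving the indicator function of a cube with a mollifier living in one orthant gives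
convergence at every point, boundary included. *)
Lemma cube_test_functions N x0 : exists (F : nat -> E -> C) (B M : R), [/\ 0 <= B,
  forall n, test_function setT (F n),
  forall n x, normc (F n x) <= B * \1_[set x : E | `|x| <= M] x &
  forall x, normc (F n x - (sq N x0 x)%:C) @[n --> \oo] --> (0:R)].
Proof.
have [rho rs [r1 rsupp]] := orthant_mollifier.
have ri := schwartz_cintble [::] rs.
have [mr lr] := (cintble_L1p rho).1 ri.
pose Hn n (v : E) := (2 ^+ (n * d))%:C * rho (2 ^+ n *: v + 0).
have Hs n : schwartz (Hn n) by apply: schwartzZ; apply: schwartz_affine => /1/.
have sqi : cintble (fun w => (sq N x0 w)%:C).
  apply/cintble_L1p; split; first by apply: cmeas_real; exact: L1p_meas (L1p_sq N x0).1.
  rewrite (_ : (fun x => _) = sq N x0); first exact: (L1p_sq N x0).1. by ext w; rewrite normcr ger0_norm.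
pose F n y := cint (fun w => (sq N x0 w)%:C * Hn n (y + (-1) *: w)).
have FE n y : F n y = cint (fun z => rho z * (sq N x0 (y - 2 ^- n *: z))%:C).
  have Gi : cintble (fun w => (sq N x0 w)%:C * Hn n (y + (-1) *: w)).
    have [B B0 hB] := schwartz_bounded [::] (Hs n).
    apply: (cintble_mul_bounded sqi _ (B := B)); last by move=> x; exact: hB.
    apply: (cmeas_comp (ccont_cmeas (schwartz_ccont [::] (Hs n)))). side.
  have Tn : - 2 ^- n != 0 :> R by []. have := cint_affine y Tn Gi; rewrite normrN ger0_norm// exprVn invrK -exprM.
  rewrite -/(F n y) => h.
  have Y0 : (2 ^+ (n * d))%:C != 0 :> C by rewrite -(rmorph0 (real_complex R)) (inj_eq (@complexI R)) two_neq0.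
  apply: (mulfI Y0); rewrite -h -cintZ; last first.
    apply: (cintble_mul_bounded ri _ (B := 1)).
      apply: cmeas_real; apply: measurable_sq => //. side.
    by move=> x; rewrite normcr ger0_norm// sq_le1.
  congr cint; ext z; rewrite /Hn. have -> : - 2 ^- n *: z + y = y - 2 ^- n *: z by rewrite scaleNr addrC.
  have -> : 2 ^+ n *: (y + -1 *: (y - 2 ^- n *: z)) + 0 = z.
    rewrite addr0 scaleN1r opprB addrC subrK scalerA mulfV// scale1r//.
  by rewrite mulrC -mulrA/1/.
pose A := rint (fun z => normc (rho z)).
have A0 : 0 <= A by apply: rint_ge0 => z/1/.
have rz z : rho z != 0 -> `|z| <= 4.
  by move=> hz; apply: norm_rV_le => // i; have /andP[h1 h2] := rsupp z hz i; rewrite ler_norml; apply/andP; split; lra.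
have u01 n : 0 <= (2 ^- n : R) <= 1.
  by rewrite invr_ge0 two_ge0 invf_le1// exprn_ege1// ler1n.
have Fz n y : `|x0| + 5 < `|y| -> F n y = 0.
  move=> hy; rewrite FE (_ : (fun z => _) = fun=> 0) ?cint0//; ext z.
  have [->|rz0] := eqVneq (rho z) 0; first by rewrite mul0r.
  rewrite sq_neq ?mulr0// => e; have := dyfloor_close e; rewrite leNgt => /negP; apply.
  have /andP[n0 n1] := u01 n; have /andP[N0 N1] := u01 N. have h1 : `|2 ^- n *: z| <= 4.
    by rewrite normrZ ger0_norm// -[leRHS]mul1r; apply: ler_pM => //; exact: rz.
  have h2 : `|y| <= `|x0| + `|x0 - (y - 2 ^- n *: z)| + `|2 ^- n *: z|.
    have {1}-> : y = x0 - (x0 - (y - 2 ^- n *: z)) + 2 ^- n *: z by rewrite opprB addrCA subrr addr0 subrK.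
    apply: le_trans (ler_normD _ _) _; rewrite lerD2r; exact: ler_normB.
  apply: le_lt_trans N1 _; lra.
exists F, (2 * A), (`|x0| + 5); split => /1/.
- move=> n; apply: (@test_function_of_bounded_support _ (`|x0| + 5)); last exact: Fz.
  exact: (conv_smooth (-1) sqi (Hs n)).1.
- move=> n y; rewrite indicE; case: (leP `|y| (`|x0| + 5)) => hy; last first.
    by rewrite Fz// normc0 memNset/1/= => h; have := le_lt_trans h hy; rewrite ltxx.
  rewrite mem_set// mulr1 FE; apply: normc_cint_rint => //.
    apply: cmeasM => //; apply: cmeas_real; apply: measurable_sq => //. side.
  by move=> z; rewrite normcM normcr ger0_norm// ler_piMr ?sq_le1// normc_ge0.
- move=> y; have [e e0 he] := dyfloor_right N y. apply/cvg0_nnegP => [n|eps eps0]/1/.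
  have [n0 _ hn] : \forall n \near \oo, 2 ^- n < e / 4 :> R.
    by apply: (cvgr_lt (0:R)) => /1/; exact: cvg_half.
  exists n0 => n nn; have ne := hn n nn. rewrite FE (_ : (fun z => _) = fun z => (sq N x0 y)%:C * rho z).
    by rewrite cintZ// r1 mulr1 subrr normc0.
  ext z; have [->|rz0] := eqVneq (rho z) 0; first by rewrite mul0r mulr0.
  rewrite mulrC; congr (_ * _); congr (_%:C); rewrite sqC [in RHS]sqC; apply: sq_congr.
  apply: he => i; rewrite !mxE; have /andP[h1 h2] := rsupp z rz0 i.
  have /andP[n1 n2] := u01 n; have q0 := twoV_gt0 R n; apply/andP; split.
    by rewrite oppr_ge0 mulr_ge0_le0// ltW.
  apply: (@le_lt_trans _ _ (2 ^- n * 4)); last by rewrite -ltr_pdivlMr.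
  by rewrite -mulrN; apply: ler_wpM2l => //; lra.
Qed.

Lemma cmeas_locally_L1 g : locally_L1 g -> cmeas g.
Proof. by case. Qed.

(** Two representatives have the same integral against test functions, hence over cubes by
dominated convergence. *)
Lemma averages_determined g g' u N : represents g u -> represents g' u -> dyadic_avg N g = dyadic_avg N g'.
Proof.
move=> [Lg gu] [Lg' gu']; rewrite !dyadic_avgE; ext x0; rewrite !cavgE; congr (_ * _).
have [F [B [M [B0 Ft Fb Fc]]]] := cube_test_functions N x0.
have lim f : locally_L1 f -> normc (cint (fun x => f x * F n x) - cint (fun x => (sq N x0 x)%:C * f x)) @[n --> \oo] --> (0:R).
  move=> Lf; have mf := cmeas_locally_L1 Lf. have mi : meas (fun x => \1_[set x : E | `|x| <= M] x : R).
    by apply: measurable_indic; rewrite -(setCK [set x : E | _]); apply: measurableC; apply: measurable_open; apply: closed_openC; apply: compact_closed => //; exact: compact_norm_ball.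
  have mb : meas (fun x => \1_[set x : E | `|x| <= M] x * normc (f x)).
    side.
  apply: (cint_dct (g := fun x => B * (\1_[set x : E | `|x| <= M] x * normc (f x)))).
  - by move=> n; apply: cmeasM => //; apply: ccont_cmeas; exact: (schwartz_ccont [::] (test_function_schwartz (Ft n))).
  - by apply: cmeasM => //; apply: cmeas_real; exact: L1p_meas (L1p_sq N x0).1.
  - side.
  - rewrite nintZ/1/. have := locally_L1_cutoff M Lf; set T := nint _ => Ty.
    have T0 : (0 <= T)%E by apply: nint_ge0 => x/1/. by move: T Ty T0 => [t||]// _ _; rewrite -EFinM ltry.
  - by move=> n x; rewrite normcM mulrA mulrC; mulr.
  - move=> x; have c : normc (f x) * normc (F n x - (sq N x0 x)%:C) @[n --> \oo] --> normc (f x) * 0 by apply: cvgMr; side.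
    rewrite mulr0 in c; apply: cvg_trans c. apply: near_eq_cvg; near=> n; rewrite -normcM; congr normc; ring.
apply/eqP; rewrite -subr_eq0; apply/eqP; apply: eq0_normc; apply/eqP; rewrite eq_le normc_ge0 andbT.
have c : normc (cint (fun x => g x * F n x) - cint (fun x => (sq N x0 x)%:C * g x)) +
    normc (cint (fun x => g' x * F n x) - cint (fun x => (sq N x0 x)%:C * g' x)) @[n --> \oo] --> (0 + 0 : R).
  by apply: cvgD; exact: lim.
rewrite addr0 in c; set b := normc _.
apply: (ler_cvg_to (@cvg_cst _ b _ \oo _) c); apply: nearW => n; rewrite {}/b.
have -> : cint (fun x => g x * F n x) = cint (fun x => g' x * F n x).
  by rewrite -[LHS](gu _ (Ft n)) gu'.
set a := cint _; set b := cint _; set e := cint _.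
have -> : a - b = (e - b) - (e - a) by ring.
by rewrite [leRHS]addrC; exact: normc_triangleB.
Unshelve. all: by end_near.
Qed.

End density.

(** * Bumps and their frequency pieces *)

(** Mean value inequality for f minus its linear part, whose gradient is an increment of the
gradient of f. *)
Lemma schwartz_taylor2 f (s : R) : 0 <= s -> schwartz f -> exists2 B, 0 <= B & forall x h,
  normc (f (x + h) - f x - \sum_i (h 0 i)%:C * partial i f x) <= B * (`|h| ^+ 2 * (1 + `|h|) `^ s * wt s x).
Proof.
move=> s0 fs; have [L L0 hL] := schwartz_lip 1 s0 fs.
exists (2 * d%:R * L) => /1/.
move=> x h; pose a i := partial i f x.
pose g t := f (1 *: t + x) + (-1) * \sum_i xc i t * a i.
have gd i : cder g i (fun t => (1%:C) * partial i f (1 *: t + x) + (0 * \sum_k xc k t * a k + (-1) * \sum_k ((k == i)%:R * a k + xc k t * 0))).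
  apply: cderD; first by apply: cder_affine; exact: (smooth_cder [::] i (schwartz_smooth fs)).
  apply: cderM; first exact: cder_cst. by apply: cder_sum => k; apply: cderM; [exact: cder_xc|exact: cder_cst].
have gE t : g t = f (x + t) - \sum_i (t 0 i)%:C * a i by rewrite /g scale1r mulN1r (addrC t).
have sumE i t : \sum_k ((k == i)%:R * a k + xc k t * 0) = a i.
  rewrite (bigD1 i)//= eqxx mul1r mulr0 addr0 big1 ?addr0// => k ki. by rewrite (negbTE ki) mul0r mulr0 addr0.
have := cder_lip (x := 0) (h := h) (M := L * `|h| * (1 + `|h|) `^ s * wt s x) gd.
have -> : g (0 + h) - g 0 = f (x + h) - f x - \sum_i (h 0 i)%:C * a i.
  rewrite add0r !gE addr0 [X in _ - (_ - X)]big1; last by move=> i _; rewrite mxE mul0r. by rewrite subr0; ring.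
move=> H; apply: le_trans (H _) _; last by le_ring.
move=> i z zh; rewrite add0r mul0r add0r sumE mulN1r scale1r rmorph1 mul1r (addrC z).
apply: le_trans (hL [:: i] isT x z) _.
apply: ler_wpM2r; first side.
apply: ler_pM => /1/; first by apply: ler_wpM2l.
by apply: powR_le; rewrite// lerD2l.
Qed.

Variable i0 : 'I_d.

Fact eta_key : unit. Proof. side. Qed.

(** Linear near the origin, where phi0 is 1. *)
Definition eta : E -> C := locked_with eta_key (fun x => phi0 x * xc i0 x).

Lemma etaE x : eta x = phi0 x * xc i0 x.
Proof. by rewrite /eta unlock. Qed.

Lemma schwartz_eta : schwartz eta.
Proof.
rewrite (_ : eta = fun x => phi0 x * xc i0 x); last by ext x; rewrite etaE.
by apply: schwartz_mulxc; exact: phi0_schwartz.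
Qed.

Fact bump_key : unit. Proof. side. Qed.

(** The amplitude 2^{-j+jd/p} makes the Besov contribution of each bump of order one. *)
Definition amp : nat -> R := locked_with bump_key (fun j => (2 ^+ j) `^ (d%:R / p) / 2 ^+ j).

Lemma ampE j : amp j = (2 ^+ j) `^ (d%:R / p) / 2 ^+ j.
Proof. by rewrite /amp unlock. Qed.

Lemma amp_gt0 j : 0 < amp j.
Proof. by rewrite ampE divr_gt0// powR_gt0. Qed.

Lemma amp_powR j : amp j `^ p = 2 ^+ (j * d) * (2 ^+ j) `^ (- p).
Proof.
rewrite ampE powRM// -powRrM mulfVK/1/ powR_mulrn// -exprM.
by congr (_ * _); rewrite -[X in X `^ _ = _]powR_inv1// -powRrM mulN1r.
Qed.

Definition bump : E -> nat -> E -> C :=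
  locked_with bump_key (fun z j x => (amp j)%:C * eta (2 ^+ j *: (x - z))).

Lemma bumpE z j x : bump z j x = (amp j)%:C * eta (2 ^+ j *: (x - z)).
Proof. by rewrite /bump unlock. Qed.

Lemma bump_affine z j : bump z j = fun x => (amp j)%:C * eta (2 ^+ j *: x + - (2 ^+ j *: z)).
Proof. by ext x; rewrite bumpE scalerBr. Qed.

Lemma schwartz_bump z j : schwartz (bump z j).
Proof.
rewrite bump_affine; apply: schwartzZ; apply: schwartz_affine => /1/.
exact: schwartz_eta.
Qed.

Lemma cintble_bump z j : cintble (bump z j).
Proof. exact: (schwartz_cintble [::] (schwartz_bump z j)). Qed.

Lemma dwt_moment (s t : R) k y : 0 <= s -> dwt (t + s) k y * (1 + 2 ^+ k * `|y|) `^ s = dwt t k y.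
Proof.
move=> s0; have b0 : 0 < 1 + 2 ^+ k * `|y| by rewrite ltr_pwDl// mulr_ge0.
rewrite !dwtE wtD -!mulrA; congr (_ * _); rewrite -[RHS]mulr1; congr (_ * _).
rewrite /wt normrZ ger0_norm// -powRD; last by rewrite (gt_eqF b0) implybT.
by rewrite addNr powRr0.
Qed.

(** Two vanishing moments of the kernel gain (2^{j-k})^2 through the Taylor expansion. *)
Lemma cnv_bump_high (s : R) : 0 <= s -> exists2 B, 0 <= B & forall z k j x, (j <= k.+1)%N ->
  normc (cnv k.+1 (bump z j) x) <= B * (amp j * (2 ^+ j / 2 ^+ k.+1) ^+ 2 * wt s (2 ^+ j *: (x - z))).
Proof.
move=> s0; have [B1 B10 h1] := schwartz_taylor2 s0 schwartz_eta.
have t0 : 0 <= (2 * d)%:R + (2 + s) => /1/.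
have [B2 B20 h2] := Kd_bounds phi0P t0.
exists (2 * (B1 * B2 * pi ^+ d)) => /1/.
move=> z k j x jk; have [X XE] : exists X, X = 2 ^+ j *: (x - z) by eexists.
rewrite -XE.
have Ki := schwartz_cintble [::] (schwartz_Kd phi0P k.+1).
pose T y := eta (X + - (2 ^+ j *: y)) - eta X - \sum_i ((- (2 ^+ j *: y)) 0 i)%:C * partial i eta X.
have refl : cnv k.+1 (bump z j) x = cint (fun y => Kd k.+1 y * bump z j (x - y)).
  have := cint_refl x (cintble_cnv k.+1 x (cintble_bump z j)); rewrite -/(cnv _ _ _) => <-.
  by congr cint; ext y; rewrite opprB addrC subrK.
have bi (y : E) : bump z j (x - y) = (amp j)%:C * eta (X + - (2 ^+ j *: y)).
  by rewrite bumpE XE; congr (_ * eta _) => /1/; vring.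
have Kyi i : cintble (fun y => Kd k.+1 y * xc i y).
  exact: (schwartz_cintble [::] (schwartz_mulxc i (schwartz_Kd phi0P k.+1))).
have Kbi : cintble (fun y => Kd k.+1 y * bump z j (x - y)).
  have := cintble_refl x (cintble_cnv k.+1 x (cintble_bump z j)); congr cintble. by ext y; rewrite opprB addrC subrK.
have TE : cnv k.+1 (bump z j) x = cint (fun y => (amp j)%:C * (Kd k.+1 y * T y)).
  rewrite refl. have -> : (fun y => (amp j)%:C * (Kd k.+1 y * T y)) = fun y =>
      (Kd k.+1 y * bump z j (x - y) - ((amp j)%:C * eta X) * Kd k.+1 y) +
      \sum_i ((amp j)%:C * ((2 ^+ j)%:C * partial i eta X)) * (Kd k.+1 y * xc i y).
    ext y; rewrite bi /T !mulrBr.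
    rewrite (mulrCA (amp j)%:C) (mulrC (_ * eta X) (Kd _ _)) (mulrCA _ (Kd k.+1 y) (eta X)) -!addrA; congr (_ + _); congr (_ + _).
    rewrite !mulr_sumr -sumrN; apply: eq_bigr => i _. by rewrite !mxE rmorphN rmorphM /xc; ring.
  have s1 : cintble (fun y => ((amp j)%:C * eta X) * Kd k.+1 y) by side.
  rewrite cintD; [|side|by apply: cintble_sum => i; exact: cintbleZ].
  rewrite (cintB Kbi s1) (cintZ _ Ki) (cint_Kd phi0P) mulr0 subr0 cint_sum; last by move=> i; exact: cintbleZ.
  rewrite big1 ?addr0/1/; move=> i _; rewrite (cintZ _ (Kyi i)) (_ : (fun y => Kd k.+1 y * xc i y) = fun y => (y 0 i)%:C * Kd k.+1 y).
    by rewrite (Kd_moment phi0P) mulr0.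
  by ext y; rewrite mulrC.
rewrite TE; pose G y := amp j * (B1 * B2 * (2 ^+ j / 2 ^+ k.+1) ^+ 2 * wt s X) * dwt (2 * d)%:R k.+1 (0 - y).
have a0 := amp_gt0 j; have c0 : 0 <= amp j * (B1 * B2 * (2 ^+ j / 2 ^+ k.+1) ^+ 2 * wt s X).
  side.
have [L1 e1] := @L1p_dwt R d (2 * d)%:R k.+1 0 (lexx _).
have [L2 e2] := L1pZ c0 L1.
via (2 * rint G); last first.
  rewrite /G e2; via (2 * (amp j * (B1 * B2 * (2 ^+ j / 2 ^+ k.+1) ^+ 2 * wt s X) * pi ^+ d)); last by le_ring.
  by apply: ler_wpM2l => //; apply: ler_wpM2l.
apply: normc_cint_rint => //.
  have mT : cmeas T.
    apply: cmeasB; first apply: cmeasB.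
    - apply: (cmeas_comp (ccont_cmeas (schwartz_ccont [::] schwartz_eta))). side.
    - side.
    - apply: ccont_cmeas; apply: ccont_sum => i; apply: ccontM; last exact: ccont_cst.
      rewrite (_ : (fun x0 => _) = fun y => (- (2 ^+ j)%:C) * xc i y); last first.
        by ext y; rewrite !mxE rmorphN rmorphM mulNr.
      by apply: ccontM; [exact: ccont_cst|exact: ccont_xc].
  side.
move=> y; rewrite !normcM normcr (ger0_norm (ltW a0)) /G -[leRHS]mulrA; mull.
rewrite sub0r dwtN.
via ((B2 * dwt ((2 * d)%:R + (2 + s)) k.+1 y) * (B1 * (`|2 ^+ j *: y| ^+ 2 * (1 + `|2 ^+ j *: y|) `^ s * wt s X))).
  apply: ler_pM => /1/; first exact: (h2 k.+1).1. by have := h1 X (- (2 ^+ j *: y)); rewrite normrN.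
have Y0 := two_gt0 R k.+1.
have e3 : `|2 ^+ j *: y| = (2 ^+ j / 2 ^+ k.+1) * (2 ^+ k.+1 * `|y|).
  by rewrite normrZ ger0_norm// mulrA divfK// gt_eqF.
have jk1 : 2 ^+ j / 2 ^+ k.+1 <= 1 :> R by rewrite ler_pdivrMr// mul1r ler_weXn2l// ler1n.
have q0 : 0 <= 2 ^+ j / 2 ^+ k.+1 :> R by [].
set Z := 2 ^+ k.+1 * `|y|; have Z0 : 0 <= Z by rewrite mulr_ge0.
have e4 : `|2 ^+ j *: y| ^+ 2 * (1 + `|2 ^+ j *: y|) `^ s <= (2 ^+ j / 2 ^+ k.+1) ^+ 2 * (1 + Z) `^ (2 + s).
  have nz : 1 + Z != 0 => /1/. rewrite powRD ?nz ?implybT// (powR_mulrn 2)/1/ mulrA -exprMn; apply: ler_pM => /1/.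
    apply: lerXn2r; rewrite/1/ e3 -/Z; apply: ler_wpM2l => //; by rewrite lerDr.
  apply: powR_le; rewrite// lerD2l e3 -/Z ler_piMl//.
via ((B2 * dwt ((2 * d)%:R + (2 + s)) k.+1 y) * (B1 * ((2 ^+ j / 2 ^+ k.+1) ^+ 2 * (1 + Z) `^ (2 + s) * wt s X))).
  mull. by apply: ler_wpM2l => //; mulr.
have s2 : 0 <= 2 + s => /1/.
rewrite -(@dwt_moment (2 + s) (2 * d)%:R k.+1 y s2) -/Z; le_ring.
Qed.

Lemma cnv_bump_low (s : R) : 0 <= s -> exists2 B, 0 <= B & forall z k j x, (k <= j)%N ->
  normc (cnv k (bump z j) x) <= B * (amp j * (2 ^+ (k * d) / 2 ^+ (j * d)) * wt s (2 ^+ k *: (x - z))).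
Proof.
move=> s0; have [B1 B10 h1] := schwartz_decay 0 ((2 * d)%:R + s) schwartz_eta.
have [B2 B20 h2] := Kd_bounds phi0P s0.
exists (2 * (B1 * B2 * pi ^+ d)) => /1/.
move=> z k j x kj; have a0 := amp_gt0 j.
pose c := amp j * (B1 * B2 * (2 ^+ (k * d) / 2 ^+ (j * d)) * wt s (2 ^+ k *: (x - z))).
have c0 : 0 <= c => /1/.
have [L1 e1] := @L1p_dwt R d (2 * d)%:R j z (lexx _).
have [L2 e2] := L1pZ c0 L1.
via (2 * rint (fun y => c * dwt (2 * d)%:R j (z - y))); last first.
  rewrite e2; via (2 * (c * pi ^+ d)); last by rewrite /c; le_ring. by apply: ler_wpM2l => //; apply: ler_wpM2l.
apply: normc_cint_rint => //; first exact: (cintble_cnv k x (cintble_bump z j)).1.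
move=> y; rewrite normcM.
have b1 : normc (bump z j y) <= amp j * (B1 * wt ((2 * d)%:R + s) (2 ^+ j *: (y - z))).
  rewrite bumpE normcM normcr (ger0_norm (ltW a0)); mull. exact: (h1 [::] (leq0n _)).
have b2 : normc (Kd k (x - y)) <= B2 * (2 ^+ (k * d) * ((1 + `|2 ^+ j *: (y - z)|) `^ s * wt s (2 ^+ k *: (x - z)))).
  apply: le_trans ((h2 k).1 _) _; apply: (ler_wpM2l B20); rewrite dwtE; apply: (ler_wpM2l (two_ge0 R _)).
  have -> : 2 ^+ k *: (x - y) = 2 ^+ k *: (x - z) + 2 ^+ k *: (z - y) by vring.
  apply: le_trans (wt_shift_le _ _ s0) _; apply: ler_wpM2r; first side.
  apply: powR_le; rewrite// lerD2l !normrZ !ger0_norm// distrC; apply: (ler_wpM2r (normr_ge0 _)).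
  by rewrite ler_weXn2l// ler1n.
apply: le_trans (ler_pM (normc_ge0 _) (normc_ge0 _) b2 b1) _.
rewrite /c -dwtN opprB -(@dwt_moment s (2 * d)%:R j (y - z) s0) dwtE normrZ (ger0_norm (two_ge0 R j)).
have reorder (a b c' e f g w X : R) : X != 0 -> b * (c' * (e * f)) * (a * (g * w)) = a * (g * b * (c' / X) * f) * (X * w * e).
  by move=> X0; field.
by rewrite (reorder _ _ _ _ _ _ _ _ (two_neq0 R (j * d))) lexx.
Qed.

Definition sig : R := Num.max (2 `^ (- p)) (2 `^ (- gam)).

Lemma sig01 : 0 <= sig < 1.
Proof.
rewrite /sig le_max powR_ge0/= gt_max !powRN !invf_lt1//.
by apply/andP; split; [have := gt0_ltr_powR p0 ler01 (ler0n R 2) (ltr1n R 2)|have := gt0_ltr_powR gam0 ler01 (ler0n R 2) (ltr1n R 2)]; rewrite powR1.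
Qed.

(** Above the diagonal the second-order gain 2^{-2p} per step is paid by the weight 2^p, leaving
2^-p; below it the exponents combine to 2^-gamma. *)
Lemma cnv_bump : exists2 B, 0 <= B & forall z k j, (0 < j)%N ->
  L1p (pw (cnv k (bump z j))) /\
  (2 ^+ k) `^ p * rint (pw (cnv k (bump z j))) <=
    B * sig ^+ (if (j <= k)%N then k - j else j - k)%N.
Proof.
pose s : R := (2 * d)%:R / p; have s0 : 0 <= s by rewrite divr_ge0// ltW.
have [B1 B10 h1] := cnv_bump_high s0; have [B2 B20 h2] := cnv_bump_low s0.
pose B := (B1 `^ p + B2 `^ p) * pi ^+ d.
have pd : 0 <= pi ^+ d :> R => /1/.
have BB0 : 0 <= B => /1/.
exists B => // z k j j0; have a0 := amp_gt0 j.
have [/andP[_ sg1] sg0] : (0 <= sig < 1) /\ 0 <= sig by split; [exact: sig01|case/andP: sig01].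
have Lw n : L1p (fun x => wt (2 * d)%:R (2 ^+ n *: (x - z))) /\ rint (fun x => wt (2 * d)%:R (2 ^+ n *: (x - z))) <= pi ^+ d / 2 ^+ (n * d).
  have [L1 e1] := @L1p_wt R d (2 * d)%:R (lexx _). have [L2 e2] := L1p_affine (- (2 ^+ n *: z)) (two_neq0 R n) L1.
  have E1 : (fun x => wt (2 * d)%:R (2 ^+ n *: x + - (2 ^+ n *: z))) = fun x => wt (2 * d)%:R (2 ^+ n *: (x - z)).
    by ext x; rewrite scalerBr.
  rewrite E1 in L2 e2; split; first side. rewrite e2 ger0_norm// mulrC -exprM. by mulr.
have gen (c : R) n : 0 <= c -> (forall x, normc (cnv k (bump z j) x) <= c * wt s (2 ^+ n *: (x - z))) ->
    L1p (pw (cnv k (bump z j))) /\ rint (pw (cnv k (bump z j))) <= c `^ p * (pi ^+ d / 2 ^+ (n * d)).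
  move=> c0 hc; have [L1 e1] := Lw n; have [L2 e2] := L1pZ (powR_ge0 c p) L1.
  have [|||L3 e3] := L1p_le (f := fun x => normc (cnv k (bump z j) x) `^ p) L2.
  - by apply: measurable_powR_fun; apply: cmeas_normc; apply: cmeas_cnv => //; exact: cintble_bump.
  - side.
  - move=> x; apply: le_trans (powR_le (ltW p0) (normc_ge0 _) (hc x)) _. by rewrite powRM/1/ wt_powR /s divfK/1/ lexx.
  split => //; apply: le_trans e3 _; rewrite e2; mull.
have kp : 0 <= (2 ^+ k) `^ p :> R by [].
case: leqP => jk.
  case: k jk gen kp => [|k] jk gen kp; first by move: (leq_ltn_trans jk j0); rewrite ltnn.
  pose c := B1 * (amp j * (2 ^+ j / 2 ^+ k.+1) ^+ 2). have c0 : 0 <= c => /1/.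
  have [L1 e1] := gen c j c0 (fun x => ltac:(rewrite /c -mulrA; exact: h1)).
  split => //; apply: le_trans (ler_wpM2l kp e1) _. have q0 : 0 <= 2 ^+ j / 2 ^+ k.+1 :> R by [].
  rewrite /c (powRM p B10 (mulr_ge0 (ltW a0) (exprn_ge0 2 q0))) (powRM p (ltW a0) (exprn_ge0 2 q0)). rewrite amp_powR.
  move: (subnK jk); move: (k.+1 - j)%N => m <-.
  have Y0 := two_gt0 R m; have Yn0 : (2 ^+ m : R) != 0 by rewrite gt_eqF.
  have Z0 := two_gt0 R j; have Zn0 : (2 ^+ j : R) != 0 by rewrite gt_eqF.
  have -> : 2 ^+ j / 2 ^+ (m + j) = (2 ^+ m)^-1 :> R by rewrite exprD invfM mulrCA mulfV// mulr1.
  have -> : ((2 ^+ m)^-1 ^+ 2) `^ p = (2 ^+ m) `^ (- (2 * p)) :> R.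
    rewrite -(powR_inv1 (two_ge0 R m)) -(powR_mulrn 2 (powR_ge0 _ _)) -!powRrM. by rewrite mulN1r.
  rewrite [in X in X * _ <= _]exprD (powRM _ (two_ge0 R m) (two_ge0 R j)).
  have -> : (2 ^+ m) `^ p * (2 ^+ j) `^ p * (B1 `^ p * (2 ^+ (j * d) * (2 ^+ j) `^ (- p) * (2 ^+ m) `^ (- (2 * p))) * (pi ^+ d / 2 ^+ (j * d))) =
    B1 `^ p * pi ^+ d * (((2 ^+ m) `^ p * (2 ^+ m) `^ (- (2 * p))) * ((2 ^+ j) `^ p * (2 ^+ j) `^ (- p))).
    by field; side.
  rewrite -!powRD ?Yn0 ?Zn0 ?implybT// subrr powRr0 mulr1 pow2_powR. apply: ler_pM => /1/.
    by rewrite /B; apply: ler_wpM2r => //; rewrite lerDl powR_ge0.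
  apply: lerXn2r; rewrite/1/ /sig le_max; apply/orP; left. by rewrite (_ : p - 2 * p = - p)//; ring.
pose c := B2 * (amp j * (2 ^+ (k * d) / 2 ^+ (j * d))).
have c0 : 0 <= c => /1/.
have [L1 e1] := gen c k c0 (fun x => ltac:(rewrite /c -mulrA; exact: (h2 z k j x (ltnW jk)))).
split => //; apply: le_trans (ler_wpM2l kp e1) _.
have q0 : 0 <= 2 ^+ (k * d) / 2 ^+ (j * d) :> R by [].
rewrite /c (powRM p B20 (mulr_ge0 (ltW a0) q0)) (powRM p (ltW a0) q0).
rewrite amp_powR.
move: (subnK (ltnW jk)); move: (j - k)%N => m <-.
have Y0 := two_gt0 R m; have Yn0 : (2 ^+ m : R) != 0 by rewrite gt_eqF.
have Z0 := two_gt0 R k; have Zn0 : (2 ^+ k : R) != 0 by rewrite gt_eqF.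
have -> : 2 ^+ ((m + k) * d) = (2 ^+ m) `^ d%:R * 2 ^+ (k * d) :> R.
  by rewrite mulnDl exprD/1/; rewrite exprM powR_mulrn.
have M0 : 0 < (2 ^+ m) `^ d%:R :> R by [].
have -> : 2 ^+ (k * d) / ((2 ^+ m) `^ d%:R * 2 ^+ (k * d)) = (2 ^+ m) `^ (- d%:R) :> R.
  by rewrite powRN invfM mulrCA mulfV// mulr1.
rewrite exprD (powRM _ (two_ge0 R m) (two_ge0 R k)) -powRrM.
have -> : (2 ^+ k) `^ p * (B2 `^ p * ((2 ^+ m) `^ d%:R * 2 ^+ (k * d) * ((2 ^+ m) `^ (- p) * (2 ^+ k) `^ (- p)) * (2 ^+ m) `^ (- d%:R * p)) * (pi ^+ d / 2 ^+ (k * d))) =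
  B2 `^ p * pi ^+ d * (((2 ^+ m) `^ d%:R * (2 ^+ m) `^ (- p) * (2 ^+ m) `^ (- d%:R * p)) * ((2 ^+ k) `^ p * (2 ^+ k) `^ (- p))).
  by field; side.
rewrite -!powRD ?Yn0 ?Zn0 ?implybT// subrr powRr0 mulr1 pow2_powR.
apply: ler_pM => /1/.
  by rewrite /B; apply: ler_wpM2r => //; rewrite lerDr powR_ge0.
apply: lerXn2r; rewrite/1/ /sig le_max; apply/orP; right.
rewrite le_eqVlt; apply/orP; left; apply/eqP; congr (_ `^ _); rewrite /gam; ring.
Qed.

(** * The ladder of bumps *)

(** A sequence bounded on its first N terms and decaying geometrically afterwards has l^q norm
of order N^{1/q}. *)
Lemma density_block q (B r : R) : (p%:E <= q)%E -> 0 <= B -> 0 <= r < 1 ->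
  exists2 K, 0 < K & forall (D : nat -> R) N, (0 < N)%N -> (forall k, 0 <= D k <= B * r ^+ (k - N)) ->
    density_le q D (K * N%:R `^ (fine q^-1%E)).
Proof.
move=> pq B0 /andP[r0 r1]; case: q pq => [s|_|//]; last first.
  exists ((1 + B) `^ p^-1) => /1/. move=> D N N0 h j; rewrite invey powRr0 mulr1 powRV/1/.
  have /andP[_ h1] := h j; apply: le_trans h1 _; apply: (@le_trans _ _ B); last by rewrite lerDr.
  by rewrite ler_piMr// exprn_ile1// ltW.
rewrite lee_fin => ps; have s0 : 0 < s by exact: lt_le_trans ps.
set t := s / p; have t0 : 0 < t by rewrite divr_gt0.
have rt : 0 <= r `^ t < 1.
  by rewrite powR_ge0; have := gt0_ltr_powR t0 r0 ler01 r1; rewrite powR1.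
pose T := (1 - r `^ t)^-1; have T0 : 0 <= T by rewrite invr_ge0 subr_ge0 ltW; case/andP: rt.
pose L := (1 + B) `^ t * (2 + T).
have L0 : 0 < L => /1/.
exists (L `^ s^-1) => /1/.
move=> D N N0 h J; have N1 : 1 <= N%:R :> R by rewrite ler1n.
rewrite inver gt_eqF// powRM/1/ powRV/1/ powRV//.
have g k : D k `^ t <= (1 + B) `^ t * (r `^ t) ^+ (k - N).
  have /andP[h0 h1] := h k; apply: le_trans (powR_le (ltW t0) h0 h1) _. rewrite powRM/1/; apply: ler_pM => /1/.
    by apply: powR_le; rewrite/1/ lerDr.
  by rewrite -(powR_mulrn _ r0) -(powR_mulrn _ (powR_ge0 r t)) -!powRrM (mulrC t) lexx.
via (\sum_(k < J) (1 + B) `^ t * (r `^ t) ^+ (k - N)); first by apply: ler_sum => k _; side.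
rewrite -mulr_sumr /L -mulrA; mull.
pose w k := (r `^ t) ^+ (k - N).
have w0 k : 0 <= w k => /1/.
via (\sum_(k < N.+1 + J) w k).
  rewrite -[leLHS]/(\sum_(k < J) w k) -[leLHS](big_mkord xpredT w) -[leRHS](big_mkord xpredT w) (@big_cat_nat _ _ _ J 0 (N.+1 + J)) ?leq_addl//=.
  by rewrite lerDl sumr_ge0.
rewrite big_split_ord/=.
have s1 : \sum_(i < N.+1) w i <= N%:R + 1.
  via (\sum_(i < N.+1) 1); last by rewrite sumr_const card_ord -[N.+1]addn1 natrD lexx.
  by apply: ler_sum => i _; rewrite /w exprn_ile1/1/ ltW; case/andP: rt.
have s2 : \sum_(i < J) w (N.+1 + i)%N <= T.
  apply: le_trans (geo_sum_le J rt); apply: ler_sum => i _; rewrite /w addSn -addnS addKn.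
  by apply: ler_wiXn2l => /1/; rewrite ltW; case/andP: rt.
have s3 : T <= T * N%:R by rewrite ler_peMr.
rewrite mulrDl; lra.
Qed.

Lemma density_leZ q (D : nat -> R) (M : R) : (0 < q)%E -> 0 < M -> (forall j, 0 <= D j) ->
  density_le q D M -> density_le q (fun j => M^-1 `^ p * D j) 1.
Proof.
move=> q0 M0 D0; have Mi : 0 <= M^-1 by rewrite invr_ge0 ltW.
have inv (t : R) : M^-1 `^ t * M `^ t = 1 by rewrite -powRM/1/ mulVf/1/ powR1.
case: q q0 => [r r0 h J|_ h j|//].
  rewrite powR1 -(inv r); apply: le_trans (ler_wpM2l (powR_ge0 _ _) (h J)); rewrite mulr_sumr.
  apply: ler_sum => j _; rewrite powRM/1/ -powRrM mulrCA mulfV/1/ mulr1/1/.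
by rewrite powR1 -(inv p); mull.
Qed.

(** The bumps start at j = 5 so that the support lies in the ball of radius 1/8 around z. *)
Definition ladder : E -> nat -> E -> C := locked_with bump_key (fun z n x => \sum_(i < n) bump z (i + 5) x).

Lemma ladderE z n x : ladder z n x = \sum_(i < n) bump z (i + 5) x.
Proof. by rewrite /ladder unlock. Qed.

Lemma ladder_fun z n : ladder z n = fun x => \sum_(i < n) bump z (i + 5) x.
Proof. by ext x; exact: ladderE. Qed.

Lemma cintble_ladder z n : cintble (ladder z n).
Proof. by rewrite ladder_fun; apply: cintble_sum => i; exact: cintble_bump. Qed.

Lemma cnv_ladder : exists2 B, 0 <= B & forall z n k,
  L1p (pw (cnv k (ladder z n))) /\
  (2 ^+ k) `^ p * rint (pw (cnv k (ladder z n))) <= B * sig ^+ (k - (n + 4)).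
Proof.
have [B B0 hB] := cnv_bump.
have s01 := sig01; have /andP[s0 s1] := s01.
exists (B * (2 * (1 - sig)^-1)); first by rewrite !mulr_ge0// invr_ge0 subr_ge0 ltW.
move=> z n k; have kp : 0 <= (2 ^+ k) `^ p :> R by side.
have bi j : cintble (bump z j) by exact: cintble_bump.
have Li (i : 'I_n) : L1p (pw (cnv k (bump z (i + 5)))) by apply: (hB z k (i + 5)%N _).1; rewrite addnS.
have [L1 e1] := L1p_sum (index_enum _) Li.
have [|||L2 e2] := L1p_le (f := fun x => normc (cnv k (ladder z n) x) `^ p) L1.
- by apply: measurable_powR_fun; apply: cmeas_normc; apply: cmeas_cnv => //; exact: cintble_ladder.
- side.
- move=> x; have -> : cnv k (ladder z n) x = \sum_(i < n) cnv k (bump z (i + 5)) x.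
    rewrite /cnv -cint_sum; last side. by congr cint; ext y; rewrite ladderE mulr_sumr.
  apply: le_trans (powR_sum_le _ p01 _) => /1/. by apply: powR_le => /1/; exact: normc_sum.
split => //; apply: le_trans (ler_wpM2l kp e2) _; rewrite e1 mulr_sumr.
pose m := minn k (n + 4).
via (\sum_(i < n) B * (sig ^+ (k - (n + 4)) * sig ^+ (if (i + 5 <= m)%N then m - (i + 5) else i + 5 - m)%N)).
  apply: ler_sum => i _; have i5 : (0 < i + 5)%N by rewrite addnS.
  apply: le_trans (hB z k (i + 5)%N i5).2 _; apply: ler_wpM2l => //; rewrite -exprD.
  rewrite le_eqVlt; apply/orP; left; apply/eqP; congr (_ ^+ _).
  have := ltn_ord i => /1/; clear; case: ifP; case: ifP; lia.
rewrite -mulr_sumr -mulr_sumr [leRHS](_ : _ = B * (sig ^+ (k - (n + 4)) * (2 * (1 - sig)^-1))); last by ring.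
apply: ler_wpM2l => //; mull.
pose w j := sig ^+ (if (j <= m)%N then m - j else j - m)%N.
have w0 j : 0 <= w j => /1/.
apply: le_trans (two_sided_geo m (5 + n) s01).
rewrite -[leRHS]/(\sum_(j < 5 + n) w j) big_split_ord/=.
rewrite (_ : \sum_(i < n) w (5 + i)%N = \sum_(i < n) w (i + 5)%N); last by apply: eq_bigr => i _; rewrite addnC.
by rewrite lerDr sumr_ge0.
Qed.

Lemma bump_support z j x : (3 / 2) * 2 ^- j <= `|x - z| -> bump z j x = 0.
Proof.
move=> h; rewrite bumpE etaE (phi0_support) ?mul0r ?mulr0// normrZ ger0_norm//.
by rewrite -ler_pdivrMl// mulrC.
Qed.

Lemma ladder_support z n x : 8^-1 <= `|x - z| -> ladder z n x = 0.
Proof.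
move=> h; rewrite ladderE big1// => i _; apply: bump_support; apply: le_trans h.
via (3 / 2 * 2 ^- 5); last by rewrite !exprS expr0; lra.
by apply: ler_wpM2l; [lra|apply: twoV_mono; rewrite addnC leq_addr].
Qed.

(** * The sawtooth and its first Fourier mode *)

Section cells.
Implicit Types (M : nat) (G : E -> C) (b : E -> R).

Definition half_step M : E := 2 ^- M.+1 *: ev R i0.

(** The indicator function of the first halves of the cells of side 2^-M in the direction i0. *)
Definition first_half M y : R :=
  (Num.floor (2 ^+ M.+1 * y 0 i0) == 2 * Num.floor (2 ^+ M * y 0 i0))%R%:R.

Lemma half_stepE M y i : (y + half_step M) 0 i = y 0 i + (if i == i0 then 2 ^- M.+1 else 0).
Proof. by rewrite !mxE eqxx; case: (i == i0); rewrite ?mulr1 ?mulr0. Qed.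

Lemma floor_dichotomy (t : R) : Num.floor (2 * t) = 2 * Num.floor t \/ Num.floor (2 * t) = 2 * Num.floor t + 1.
Proof.
have /andP[h1 h2] := floor_itv t; set m := Num.floor t in h1 h2 *.
have [h|h] := ltP (2 * t) ((2 * m + 1)%:~R).
  left; apply: floor_def => /1/; lra.
right; apply: floor_def => /1/; lra.
Qed.

Lemma first_half01 M y : first_half M y = 0 \/ first_half M y = 1.
Proof. by rewrite /first_half; case: (_ == _); [right|left]. Qed.

Lemma first_half_dichotomy M y :
  (first_half M y = 1 /\ Num.floor (2 ^+ M.+1 * y 0 i0) = 2 * Num.floor (2 ^+ M * y 0 i0)) \/
  (first_half M y = 0 /\ Num.floor (2 ^+ M.+1 * y 0 i0) = 2 * Num.floor (2 ^+ M * y 0 i0) + 1).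
Proof.
rewrite /first_half exprS -mulrA; case: (floor_dichotomy (2 ^+ M * y 0 i0)) => ->.
  by left; rewrite eqxx.
right => /1/; rewrite (_ : _ == _ = false)//; apply/negbTE/eqP => /eqP.
by rewrite -subr_eq0 addrC addrA addNr add0r.
Qed.

Lemma floor_half_step M y : Num.floor (2 ^+ M.+1 * (y + half_step M) 0 i0) = Num.floor (2 ^+ M.+1 * y 0 i0) + 1.
Proof. by rewrite half_stepE eqxx mulrDr mulfV// floorDrz ?floor1// int_num1. Qed.

Lemma half_floor M y : Num.floor (2 ^+ M * y 0 i0) = divz (Num.floor (2 ^+ M.+1 * y 0 i0)) 2.
Proof.
case: (first_half_dichotomy M y) => -[_ ->]; first by rewrite mulKz.
by rewrite [2 * _]mulrC divzMDl// divz_small ?addr0.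
Qed.

Lemma half_stepP M y : first_half M y = 1 ->
  dyfloor M (y + half_step M) = dyfloor M y /\ first_half M (y + half_step M) = 0.
Proof.
move=> h; have [[_ e]|[]] := first_half_dichotomy M y; last by rewrite h => /eqP; rewrite oner_eq0.
have f0 : Num.floor (2 ^+ M * (y + half_step M) 0 i0) = Num.floor (2 ^+ M * y 0 i0).
  by rewrite (half_floor M (y + half_step M)) (floor_half_step M y) e [2 * _]mulrC divzMDl// divz_small ?addr0.
split.
  apply/rowP => i; rewrite ![dyfloor _ _ _ _]mxE; have [->//|ni] := eqVneq i i0.
  by rewrite half_stepE (negbTE ni) addr0.
have [[_]|[]//] := first_half_dichotomy M (y + half_step M).
rewrite floor_half_step f0 e => /eqP; by rewrite -subr_eq0 addrC addrA addNr add0r.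
Qed.

Lemma half_stepN M y : first_half M y = 0 -> first_half M (y - half_step M) = 1.
Proof.
move=> h; have [[]|[_ e]] := first_half_dichotomy M y; first by rewrite h => /esym/eqP; rewrite oner_eq0.
have [[]//|[_ e']] := first_half_dichotomy M (y - half_step M).
have := floor_half_step M (y - half_step M); rewrite subrK e e'.
set a := Num.floor _; set b := Num.floor _ => ab; exfalso; lia.
Qed.

Lemma first_half_shift M y : first_half M (y - half_step M) = 1 - first_half M y.
Proof.
have [h|h] := first_half01 M y; first by rewrite (half_stepN h) h subr0.
rewrite h subrr; have [//|h'] := first_half01 M (y - half_step M).
by have := (half_stepP h').2; rewrite subrK h => /eqP; rewrite oner_eq0.
Qed.

Lemma first_half_congr M y y' : dyfloor M.+1 y = dyfloor M.+1 y' -> first_half M y = first_half M y'.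
Proof.
move=> e; have e' := dyfloor_coarse (leqnSn M) e.
have := congr1 (fun v : 'rV[int]_d => v 0 i0) e; have := congr1 (fun v : 'rV[int]_d => v 0 i0) e'.
by rewrite !mxE /first_half => -> ->.
Qed.

Lemma measurable_first_half M : meas (first_half M).
Proof. by apply: (@measurable_step _ _ M.+1) => x y; exact: first_half_congr. Qed.

(** Pairing each point of the first half of a cell with its translate in the second half; every
integral over cells below is evaluated this way, without a primitive. *)
Lemma halving M b G : (forall y, first_half M y = 1 -> b (y + half_step M) = b y) ->
  cintble (fun y => (b y)%:C * G y) ->
  cintble (fun y => (b y * first_half M y)%:C * (G y + G (y + half_step M))) /\
  cint (fun y => (b y)%:C * G y) = cint (fun y => (b y * first_half M y)%:C * (G y + G (y + half_step M))).
Proof.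
move=> hb bi; have mh := measurable_first_half M.
have i1 : cintble (fun y => (b y)%:C * G y * (first_half M y)%:C).
  apply: (cintble_mul_bounded bi _ (B := 1)) => /1/.
  by move=> y; rewrite normcr; case: (first_half01 M y) => ->; rewrite ?normr0 ?normr1.
have i2 : cintble (fun y => (b y)%:C * G y * (1 - first_half M y)%:C).
  apply: (cintble_mul_bounded bi _ (B := 1)); first by apply: cmeas_real; exact: measurable_funB.
  by move=> y; rewrite normcr; case: (first_half01 M y) => ->; rewrite ?subr0 ?subrr ?normr0 ?normr1.
have shiftE : (fun y => (b (y + half_step M))%:C * G (y + half_step M) * (1 - first_half M (y + half_step M))%:C) =
    fun y => (b y * first_half M y)%:C * G (y + half_step M).
  ext y; have := first_half_shift M (y + half_step M); rewrite addrK => <-.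
  case: (first_half01 M y) => h; rewrite h; first by rewrite !mulr0 mul0r. by rewrite !mulr1 (hb y h).
have i3 := cintble_shift (half_step M) i2; rewrite shiftE in i3.
have E1 : (fun y => (b y)%:C * G y * (first_half M y)%:C) = fun y => (b y * first_half M y)%:C * G y.
  by apply/funext => y/1/; ring.
have E2 : (fun y => (b y * first_half M y)%:C * (G y + G (y + half_step M))) =
   fun y => (b y * first_half M y)%:C * G y + (b y * first_half M y)%:C * G (y + half_step M).
  by ext y; rewrite mulrDr.
rewrite E1 in i1; rewrite E2; split; first exact: cintbleD.
rewrite cintD// -{1}shiftE (cint_shift _ i2) -E1 -cintD//; last by rewrite E1.
by congr cint; ext y; rewrite -mulrDr -rmorphD addrC subrK mulr1.
Qed.

(** The plane wave of period 2^-N in the direction i0. *)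
Definition wave N : E -> C := chi (- ((2 * pi * 2 ^+ N) *: ev R i0)).

Lemma waveE N y : wave N y = cis (- (2 * pi * (2 ^+ N * y 0 i0))).
Proof. by rewrite /wave /chi dotpNl dotpZl dotpC dotp_ev mulrA. Qed.

Lemma wave_half N y : wave N (y + half_step N) = - wave N y.
Proof.
rewrite !waveE half_stepE eqxx (_ : - _ = - (2 * pi * (2 ^+ N * y 0 i0)) + - pi).
  rewrite cisD (_ : cis (- pi) = -1) ?mulrN1//. by rewrite /cis cosN cospi sinN sinpi/1/.
by rewrite exprS; have := two_neq0 R N; move: (2 ^+ N) => X X0; field.
Qed.

Lemma wave_quarter N y : wave N (y + half_step N.+1) = - ii R * wave N y.
Proof.
rewrite !waveE half_stepE eqxx (_ : - _ = - (2 * pi * (2 ^+ N * y 0 i0)) + - (pi / 2)).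
  rewrite cisD mulrC (_ : cis (- (pi / 2)) = - ii R)//.
  by rewrite /cis cosN cos_pihalf sinN sin_pihalf /ii; apply: complexP => /=; rewrite ?oppr0.
by rewrite !exprS; have := two_neq0 R N; move: (2 ^+ N) => X X0; field.
Qed.

Lemma normc_wave N y : normc (wave N y) = 1.
Proof. exact: normc_chi. Qed.

Lemma cmeas_wave N : cmeas (wave N).
Proof. exact: (cmeas_chi (measurable_cst _) (@measurable_id _ _ setT)). Qed.

(** On the first quarter of the period the phase stays within a quarter turn, where cos + sin >=
1. *)
Lemma wave_quarter_cell N y : first_half N y = 1 -> first_half N.+1 y = 1 ->
  1 <= Re ((1 + ii R) * wave N y).
Proof.
move=> h1 h2.
have [[_ e1]|[]] := first_half_dichotomy N y; last by rewrite h1 => /eqP; rewrite oner_eq0.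
have [[_ e2]|[]] := first_half_dichotomy N.+1 y; last by rewrite h2 => /eqP; rewrite oner_eq0.
rewrite e1 in e2; set m := Num.floor (2 ^+ N * y 0 i0) in e1 e2.
have f1 := floor_itv (2 ^+ N * y 0 i0); have f2 := floor_itv (2 ^+ N.+2 * y 0 i0).
rewrite e2 -/m in f2; rewrite -/m in f1; rewrite waveE.
set t := 2 ^+ N * y 0 i0 in f1 *.
have tE : 2 ^+ N.+2 * y 0 i0 = 4 * t by rewrite /t !exprS; ring.
rewrite tE in f2; have -> : - (2 * pi * t) = - (2 * pi * (t - m%:~R)) + 2 * pi * (- m)%:~R.
  by rewrite mulrNz; ring.
rewrite cisD cis_2pi_int mulr1 ReM /ii /= cosN sinN.
have /andP[g1 g2] := f1; have /andP[g3 g4] := f2; have pi0 := pi_gt0 R.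
have := @cis_quarter R (2 * pi * (t - m%:~R)).
rewrite addr0 add0r !mul1r opprK; apply; apply/andP; split.
  by rewrite !mulr_ge0 ?subr_ge0// ltW.
rewrite (_ : pi / 2 = 2 * pi * 4^-1); last by field.
mull.
move: g4 => /1/; lra.
Qed.

Lemma Re_cint_ge (f : E -> C) (g : E -> R) : cintble f -> L1p g -> (forall x, g x <= Re (f x)) ->
  rint g <= Re (cint f).
Proof.
move=> fi [mg g0 gi] h; rewrite rint_def /cint /=.
apply: le_Rintegral => //; last exact: cintble_Re fi.
apply/integrable_nint => //; apply: le_lt_trans gi; apply: nint_le => //.
- exact: measurableT_comp.
- by move=> x; rewrite ger0_norm.
Qed.

Section over_cell.
Variables (N J : nat).
Hypothesis JN : (J <= N)%N.
Variable b : E -> R.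
Hypothesis b01 : forall y, b y = 0 \/ b y = 1.
Hypothesis bN : forall y y', dyfloor N y = dyfloor N y' -> b y = b y'.
Hypothesis Lb : L1p b.

Let b_inv y : first_half N y = 1 -> b (y + half_step N) = b y.
Proof. by move=> h; apply: bN; exact: (half_stepP h).1. Qed.

Let bh_inv y : first_half N.+1 y = 1 -> b (y + half_step N.+1) * first_half N (y + half_step N.+1) = b y * first_half N y.
Proof.
move=> h; have e := (half_stepP h).1; congr (_ * _); last exact: first_half_congr.
by apply: bN; exact: (dyfloor_coarse (leqnSn N)).
Qed.

Lemma cintble_cell G : cmeas G -> (exists B, forall y, b y = 1 -> normc (G y) <= B) ->
  cintble (fun y => (b y)%:C * G y).
Proof.
move=> mG [B hB]; have B0 : 0 <= `|B| by [].
have [L e] := L1pZ B0 Lb; apply: (@cintble_dom _ _ _ (fun y => `|B| * b y)).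
- side.
- side.
- move=> y; rewrite normcM normcr; case: (b01 y) => h; rewrite h; first by rewrite normr0 mul0r mulr0.
  by rewrite normr1 mul1r mulr1; apply: le_trans (hB y h) (ler_norm B).
- by case: L.
Qed.

Lemma cell_wave0 : cint (fun y => (b y)%:C * wave N y) = 0.
Proof.
have ci : cintble (fun y => (b y)%:C * wave N y).
  by apply: cintble_cell; [exact: cmeas_wave|exists 1 => y _; rewrite normc_wave].
rewrite (halving b_inv ci).2 -[RHS](@cint0 R d); congr cint; ext y.
by rewrite wave_half addrN mulr0.
Qed.

Lemma cell_quarter : rint (fun y => b y * first_half N y * first_half N.+1 y) = rint b / 4.
Proof.
have m1 := measurable_first_half N; have m2 := measurable_first_half N.+1.
have half M (c : E -> R) : (forall y, c y = 0 \/ c y = 1) -> L1p c -> (forall y, first_half M y = 1 -> c (y + half_step M) = c y) ->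
    L1p (fun y => c y * first_half M y) /\ rint c = 2 * rint (fun y => c y * first_half M y).
  move=> c01 Lc ci; have mM := measurable_first_half M; have mc := L1p_meas Lc. have c0 y : 0 <= c y => /1/.
  have h0 y : 0 <= first_half M y by []. have L1 : L1p (fun y => c y * first_half M y).
    apply: (L1p_le Lc _ _ _).1; first side.
      side.
    by move=> y; rewrite ler_piMr//; case: (first_half01 M y) => ->.
  split => //. have L2 : L1p (fun y => c y * (1 - first_half M y)).
    apply: (L1p_le Lc _ _ _).1; first by apply: measurable_funM => //; exact: measurable_funB.
      by move=> y; rewrite mulr_ge0// subr_ge0; case: (first_half01 M y) => ->.
    by move=> y; rewrite ler_piMr//; case: (first_half01 M y) => -> /1/.
  have e2 : rint (fun y => c y * (1 - first_half M y)) = rint (fun y => c y * first_half M y).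
    have [_ <-] := L1p_shift (half_step M) L2; congr rint; ext y.
    have := first_half_shift M (y + half_step M); rewrite addrK => <-.
    by case: (first_half01 M y) => h; rewrite h ?mulr0// !mulr1 ci.
  have [_ e3] := L1pD L1 L2. have -> : rint c = rint (fun y => c y * first_half M y + c y * (1 - first_half M y)).
    by congr rint; ext y; rewrite -mulrDr addrC subrK mulr1.
  by rewrite e3 e2; ring.
have [L1 e1] := half N b b01 Lb b_inv.
have c01 y : b y * first_half N y = 0 \/ b y * first_half N y = 1.
  by case: (b01 y) => ->; case: (first_half01 N y) => ->; rewrite ?mulr0 ?mulr1; [left|left|left|right].
have [L2 e2] := half N.+1 _ c01 L1 bh_inv.
by rewrite e1 e2; field.
Qed.

(** Halving twice: pairing points at distance half a period leaves the constant slope times the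
wave on the first halves, and pairing again at a quarter period leaves (1 + i) times the wave on
the first quarters, whose real part is bounded below. *)
Lemma cell_sawtooth z : (exists B, forall y, b y = 1 -> `|(y - z) 0 i0| <= B) ->
  rint b * (2 ^- N / 16) <= normc (cint (fun y => (b y)%:C * (xc i0 (y - z) * wave N y))).
Proof.
move=> [B hB].
have mG : cmeas (fun y => xc i0 (y - z) * wave N y).
  apply: cmeasM; last exact: cmeas_wave.
  by apply: cmeas_real; apply: (measurable_rV_comp (h := fun y => y - z)); side.
have ci : cintble (fun y => (b y)%:C * (xc i0 (y - z) * wave N y)).
  by apply: cintble_cell => //; exists B => y h; rewrite normcM normc_wave mulr1 normcr; exact: hB.
have [_ ->] := halving b_inv ci.
have ch : cintble (fun y => (b y * first_half N y)%:C * wave N y).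
  rewrite (_ : (fun y => _) = fun y => (b y)%:C * ((first_half N y)%:C * wave N y)); last first.
    by ext y; rewrite rmorphM mulrA.
  apply: cintble_cell.
    by apply: cmeasM; [apply: cmeas_real; exact: measurable_first_half|exact: cmeas_wave].
  by exists 1 => y _; rewrite normcM normc_wave mulr1 normcr; case: (first_half01 N y) => ->; rewrite ?normr0 ?normr1.
have -> : (fun y => (b y * first_half N y)%:C * (xc i0 (y - z) * wave N y + xc i0 (y + half_step N - z) * wave N (y + half_step N))) =
    fun y => - (2 ^- N.+1)%:C * ((b y * first_half N y)%:C * wave N y).
  ext y; rewrite wave_half. have -> : xc i0 (y + half_step N - z) = xc i0 (y - z) + (2 ^- N.+1)%:C.
    by rewrite /xc addrAC half_stepE eqxx rmorphD.
  ring.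
rewrite cintZ// (halving bh_inv ch).2.
set g := fun y => b y * first_half N y * first_half N.+1 y.
have -> : (fun y => (b y * first_half N y * first_half N.+1 y)%:C * (wave N y + wave N (y + half_step N.+1))) =
   fun y => (1 - ii R) * ((g y)%:C * wave N y).
  by ext y; rewrite wave_quarter /g; ring.
have Lg : L1p g.
  have m1 := measurable_first_half N; have m2 := measurable_first_half N.+1. apply: (L1p_le Lb _ _ _).1.
  - side.
  - side.
  - by move=> y; rewrite /g; case: (b01 y) => ->; case: (first_half01 N y) => ->; case: (first_half01 N.+1 y) => -> /1/.
have cg : cintble (fun y => (g y)%:C * wave N y).
  apply: (@cintble_dom _ _ _ g) => //.
  - by apply: cmeasM; [side; side|exact: cmeas_wave].
  - side.
  - by move=> y; rewrite normcM normc_wave mulr1 normcr ger0_norm/1/.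
  - by case: Lg.
rewrite cintZ// mulrA !normcM normc_opp normcr ger0_norm//.
have n1 : 1 <= normc (1 - ii R).
  by apply: le_trans (Re_le_normc _); rewrite /ii /= subr0 normr1.
have n2 : normc (1 + ii R) <= 2.
  by apply: le_trans (normc_triangle _ _) _; rewrite normc_ii normc1/1/.
have c1 : rint g <= 2 * normc (cint (fun y => (g y)%:C * wave N y)).
  have cg' : cintble (fun y => (1 + ii R) * ((g y)%:C * wave N y)) by exact: cintbleZ.
  via (Re (cint (fun y => (1 + ii R) * ((g y)%:C * wave N y)))).
    apply: Re_cint_ge => // y; rewrite mulrCA ReM /= mul0r subr0.
    rewrite /g; case: (b01 y) => ->; case: (first_half01 N y) => h1; case: (first_half01 N.+1 y) => h2; rewrite h1 h2 ?mulr0 ?mulr1 ?mul1r//.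
    exact: wave_quarter_cell.
  rewrite cintZ//; apply: le_trans (ler_norm _) _; apply: le_trans (Re_le_normc _) _. by rewrite normcM; mulr.
move: c1; rewrite cell_quarter exprS invfM => c1.
have X0 := twoV_gt0 R N; move: (2 ^- N) X0 => X X0.
set W := normc _ in c1 *; set a := normc _ in n1 *.
have W0 : 0 <= W => /1/.
via (2^-1 * X * 1 * W); last by apply: ler_wpM2r => //; mull.
have := ler_wpM2l (ltW X0) c1; lra.
Qed.

End over_cell.

End cells.

(** * The ladder on boxes *)

Definition ratio : R := 2 `^ (d%:R / p).
Local Notation a := ratio.

Lemma ratioX j : (2 ^+ j) `^ (d%:R / p) = a ^+ j.
Proof. exact: pow2_powR. Qed.

Lemma ratio_ge2 : 2 <= a.
Proof.
have d1 : 1 <= d%:R :> R by rewrite ler1n (leq_ltn_trans _ (ltn_ord i0)).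
rewrite /a -[leLHS]powRr1//; apply: ler_powR; first by rewrite ler1n.
by rewrite ler_pdivlMr// mul1r (le_trans p1).
Qed.

Lemma ratio_gt0 : 0 < a. Proof. side. Qed.

Lemma ratioX_ge0 j : 0 <= a ^+ j. Proof. side. Qed.

Lemma ratio_sum m : \sum_(i < m) a ^+ i <= a ^+ m.
Proof.
elim: m => [|m IH]; first by rewrite big_ord0 exprn_ge0// ltW// ratio_gt0.
rewrite big_ord_recr exprS; via (2 * a ^+ m); first by rewrite mulr_natl mulr2n lerD2r.
by mulr; exact: ratio_ge2.
Qed.

Lemma bump_lip : exists2 L, 0 <= L & forall z j x y, normc (bump z j x - bump z j y) <= L * a ^+ j * `|x - y|.
Proof.
have [L L0 hL] := schwartz_lip 0 (lexx 0) (schwartz_eta).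
exists L => // z j x y; rewrite !bumpE -mulrBr normcM normcr ger0_norm ?(ltW (amp_gt0 j))//.
have -> : 2 ^+ j *: (x - z) = 2 ^+ j *: (y - z) + 2 ^+ j *: (x - y) by vring.
via (amp j * (L * (2 ^+ j * `|x - y|))).
  apply: ler_wpM2l; first exact: ltW (amp_gt0 j). apply: le_trans (hL [::] (leqnn _) _ _) _.
  rewrite powRr0 /wt oppr0 powRr0 !mulr1 normrZ ger0_norm//.
rewrite ampE ratioX le_eqVlt; apply/orP; left; apply/eqP.
by have := two_neq0 R j; move: (2 ^+ j) => X X0; field.
Qed.

Lemma partial_ratio_sum n m : \sum_(i < n) (if (i + 5 < m)%N then a ^+ (i + 5) else 0) <= a ^+ m.
Proof.
pose w j := if (j < m)%N then a ^+ j else 0.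
have w0 j : 0 <= w j by rewrite /w; case: ifP =>  _/1/.
via (\sum_(j < m + (5 + n)) w j).
  rewrite big_split_ord [X in _ <= _ + X]big_split_ord/=.
  have -> : \sum_(i < n) (if (i + 5 < m)%N then a ^+ (i + 5) else 0) = \sum_(i < n) w (i + 5)%N by [].
  via (\sum_(j < 5 + n) w j).
    rewrite big_split_ord/= (_ : \sum_(i < n) w (5 + i)%N = \sum_(i < n) w (i + 5)%N); last by apply: eq_bigr => i _; rewrite addnC.
    by rewrite lerDr sumr_ge0.
  have -> : \sum_(i < 5) w (m + i)%N + \sum_(i < n) w (m + (5 + i))%N = 0.
    by rewrite !big1 ?addr0// => i _; rewrite /w ifF//; apply/negbTE; rewrite -leqNgt leq_addr.
  rewrite addr0 -(big_mkord xpredT w) -[leRHS](big_mkord xpredT w). have [h|h] := leqP (5 + n) m.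
    by rewrite [leRHS](@big_cat_nat _ _ _ (5 + n))// lerDl sumr_ge0.
  rewrite (@big_cat_nat _ _ _ m) ?(ltnW h)//= [X in _ + X]big_nat_cond [X in _ + X]big1 ?addr0//.
  by move=> i /andP[/andP[mi _] _]; rewrite /w ltnNge mi.
rewrite big_split_ord/= [X in _ + X]big1 ?addr0; last first.
  by move=> i _; rewrite /w ifF//; apply/negbTE; rewrite -leqNgt leq_addr.
apply: le_trans (ratio_sum m); apply: ler_sum => i _; rewrite /w ltn_ord lexx//.
Qed.

(** The finest bump of a ladder with n terms has index n + 4, which is also the scale N of the
averages. *)
Definition remainder z n y : C := cavg (n + 4) (ladder z n) y - ladder z n y.

(** At distance 2^-j from z only the bumps of index at most j are felt, with total Lipschitz
constant comparable to ratio^j; nearer to z the loss is paid by the distance factor. *)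
Lemma remainder_bound : exists2 B, 0 <= B & forall z n j x y, (j + 2 <= n + 4)%N ->
  3 / 4 * 2 ^- j <= `|x - z| ->
  normc (remainder z n y) <= B * (2 ^- (n + 4) * a ^+ j) * (1 + 2 ^+ (n + 4) * `|x - y|) `^ (d%:R / p).
Proof.
have [L L0 hL] := bump_lip.
have a0 := ratio_gt0; have dp0 : 0 <= d%:R / p by rewrite divr_ge0// ltW.
have lad z n m x y : (forall j, (j < n + 5)%N -> (m <= j)%N -> bump z j x = 0 /\ bump z j y = 0) ->
    normc (ladder z n x - ladder z n y) <= L * a ^+ m * `|x - y|.
  move=> h; rewrite !ladderE -sumrB; apply: le_trans (normc_sum _ _ _) _.
  via (\sum_(i < n) L * `|x - y| * (if (i + 5 < m)%N then a ^+ (i + 5) else 0)).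
    apply: ler_sum => i _; case: ltnP => mi; first by apply: le_trans (hL _ _ _ _) _; le_ring.
    have [|-> ->] := h (i + 5)%N _ mi; first by rewrite ltn_add2r. by rewrite subrr normc0 mulr0.
  rewrite -mulr_sumr; via (L * `|x - y| * a ^+ m); last by le_ring. by mull; exact: partial_ratio_sum.
have rem z n m y : (forall y', dyfloor (n + 4) y' = dyfloor (n + 4) y -> forall j, (j < n + 5)%N -> (m <= j)%N -> bump z j y' = 0 /\ bump z j y = 0) ->
    normc (remainder z n y) <= 2 * (L * a ^+ m * 2 ^- (n + 4)).
  move=> h; apply: cavg_dist.
  - exact: cintble_ladder.
  - side.
  move=> y' yy; apply: le_trans (lad z n m y' y (h y' yy)) _; mull. exact: dyfloor_close.
have q0 : 0 <= 4 `^ (d%:R / p) :> R by [].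
exists (2 * (L * (a ^+ 3 + a * 4 `^ (d%:R / p)))).
  by rewrite !mulr_ge0// addr_ge0 ?ratioX_ge0// mulr_ge0// ltW.
move=> z n j x y jn xz; set N := (n + 4)%N; set W := (1 + 2 ^+ N * `|x - y|) `^ (d%:R / p).
have N0 := twoV_gt0 R N; have j0 := twoV_gt0 R j.
have W1 : 1 <= W by apply: powR_ge1 => //; rewrite lerDl mulr_ge0// two_ge0.
have aj := ratioX_ge0 j.
have [near|far] := leP `|x - y| (2 ^- j / 4).
  have yz : 2 ^- j / 2 <= `|y - z|.
    have : `|x - z| <= `|x - y| + `|y - z| by rewrite -[x - z](subrKA y) ler_normD. lra.
  via (2 * (L * a ^+ (j + 3) * 2 ^- N)).
    apply: rem => y' /dyfloor_close yy j' _ j3. have j'0 : 3 / 2 * 2 ^- j' <= 2 ^- j / 4 :> R.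
      have h1 : 2 ^- j' <= 2 ^- (j + 3) :> R by exact: twoV_mono.
      have h2 : 2 ^- (j + 3) = 2 ^- j / 8 :> R by rewrite exprD invfM/1/; field. lra.
    have N4 : 2 ^- N <= 2 ^- j / 4 :> R.
      have h1 : 2 ^- N <= 2 ^- (j + 2) :> R by exact: twoV_mono.
      have h2 : 2 ^- (j + 2) = 2 ^- j / 4 :> R by rewrite exprD invfM/1/; field. lra.
    split; apply: bump_support => //; last lra. have : `|y - z| <= `|y' - y| + `|y' - z|.
      by rewrite -[y - z](subrKA y') distrC -(opprB y' y) normrN; apply: le_trans (ler_normD _ _) _; rewrite normrN.
    lra.
  via (2 * (L * (a ^+ 3 + a * 4 `^ (d%:R / p))) * (2 ^- N * a ^+ j) * 1); last first.
    by apply: ler_wpM2l => //; rewrite !mulr_ge0 ?addr_ge0 ?mulr_ge0 ?(ltW a0).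
  rewrite mulr1 exprD. have t0 : 0 <= 2 * L * (a * 4 `^ (d%:R / p)) * (2 ^- N * a ^+ j) by rewrite !mulr_ge0/1/. lra.
via (2 * (L * a ^+ (n + 5) * 2 ^- N)).
  by apply: rem => y' _ j' h1 h2; move: (leq_ltn_trans h2 h1); rewrite ltnn.
have aN : a ^+ (N - j) <= 4 `^ (d%:R / p) * W.
  rewrite -ratioX /W -powRM//. apply: (powR_le dp0 (two_ge0 R _)). have -> : 2 ^+ (N - j) = 2 ^+ N * 2 ^- j :> R.
    have jN : (j <= N)%N by apply: leq_trans jn; rewrite leq_addr. by rewrite -{2}(subnK jN) exprD mulfK// two_neq0.
  have X0 := two_gt0 R N; have := ltW far; rewrite -(ler_pM2l X0); set u := 2 ^+ N * `|x - y| => h.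
  have u0 : 0 <= u => /1/. lra.
have -> : a ^+ (n + 5) = a * a ^+ j * a ^+ (N - j).
  by rewrite -exprS -exprD; congr (_ ^+ _); move: jn => /1/; clear; lia.
have t1 : 2 * L * 2 ^- N * a * a ^+ j * a ^+ (N - j) <= 2 * L * 2 ^- N * a * a ^+ j * (4 `^ (d%:R / p) * W).
  by mull.
have t2 : 0 <= 2 * (L * a ^+ 3) * (2 ^- N * a ^+ j) * W.
  have W0 : 0 <= W by side. apply: (mulr_ge0 _ W0); apply: mulr_ge0; apply: mulr_ge0.
  - side.
  - apply: mulr_ge0; [side|side].
  - side.
  - side.
lra.
Qed.

Definition box_center z j : E := z + (7 / 8 * 2 ^- j) *: ev R i0.
(** A dyadic cube of side 2^{-(j+d+4)}: small enough, in all dimensions, to lie in the annulus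
where the bumps of index at most j are linear and the others vanish. *)
Definition box z j : E -> R := sq (j + (d + 4)) (box_center z j).

Lemma box01 z j y : box z j y = 0 \/ box z j y = 1.
Proof. by rewrite /box /sq; case: (_ == _); [right|left]. Qed.

Lemma box_position z j y : box z j y = 1 -> eucl_norm (y - z) <= 2 ^- j /\ 3 / 4 * 2 ^- j <= (y - z) 0 i0.
Proof.
move=> h; have e : dyfloor (j + (d + 4)) (box_center z j) = dyfloor (j + (d + 4)) y.
  by move: h; rewrite /box /sq; case: eqP => // _ /esym/eqP; rewrite oner_eq0.
have cl := dyfloor_close e; set T := 2 ^- j : R; have T0 : 0 < T by side.
set u := 2 ^- (d + 4) : R; have u0 : 0 < u by side.
have clT : `|box_center z j - y| <= T * u by rewrite /T /u -invfM -exprD.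
have u1 : u <= 16^-1.
  have : u <= 2 ^- 4 by apply: twoV_mono; rewrite leq_addl. by rewrite !exprS expr0 /u; lra.
have du : d%:R * u <= 16^-1.
  rewrite /u exprD invfM mulrA (_ : 2 ^- 4 = 16^-1 :> R)/1/; last by rewrite !exprS expr0; lra.
  rewrite -[leRHS]mul1r; mulr. by rewrite ler_pdivrMr// mul1r -natrX ler_nat ltnW// ltn_expl.
have co i : (y - z) 0 i = (if i == i0 then 7 / 8 * T else 0) - (box_center z j - y) 0 i.
  by rewrite !mxE eqxx -/T; case: (i == i0); rewrite /=; ring.
have wi i : `|(box_center z j - y) 0 i| <= T * u by apply: le_trans (coord_le_norm _ _) clT.
have Tu : T * u <= T * 16^-1 by mull.
split; last by rewrite co eqxx; have := wi i0; rewrite ler_norml => /andP[_ h2]; lra.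
rewrite /eucl_norm -[X in _ <= X](@ger0_norm _ T)/1/ -sqrtr_sqr; apply: ler_wsqrtr.
rewrite /dotp (bigD1 i0)//=.
have t1 : (y - z) 0 i0 * (y - z) 0 i0 <= (15 / 16 * T) ^+ 2.
  rewrite -expr2 -real_normK ?num_real//; apply: lerXn2r => /1/.
  rewrite co eqxx; have := wi i0; rewrite !ler_norml => /andP[h1 h2]; apply/andP; split; lra.
have t2 : \sum_(i < d | i != i0) (y - z) 0 i * (y - z) 0 i <= T ^+ 2 * (16^-1 * 16^-1).
  via (\sum_(i < d) (T * u) ^+ 2).
    rewrite [leRHS](bigD1 i0)//= -[leLHS]add0r; apply: lerD => /1/.
    apply: ler_sum => i /negbTE ni; rewrite -expr2 -real_normK ?num_real//; apply: lerXn2r => /1/.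
    by rewrite co ni sub0r normrN.
  rewrite sumr_const card_ord -[leLHS]mulr_natl exprMn mulrCA; mull. by rewrite expr2 mulrA; apply: ler_pM => /1/.
have T2 : 0 <= T ^+ 2 => /1/.
move: t1 => /1/; lra.
Qed.

(** On the box j the coordinate i0 of y - z lies between 3/4 and 1 times 2^-j. *)
Lemma box_disjoint z i j y : (i < j)%N -> box z i y = 1 -> box z j y = 1 -> False.
Proof.
move=> ij /box_position[_ h1] /box_position[h2 _].
have h3 : (y - z) 0 i0 <= eucl_norm (y - z).
  by apply: le_trans (ler_norm _) _; apply: le_trans (coord_le_norm _ _) (eucl_norm_ge _).
have h4 : 2 ^- j <= 2 ^- i.+1 :> R by exact: twoV_mono.
have h5 : 2 ^- i.+1 = 2 ^- i / 2 :> R by rewrite exprS invfM mulrC.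
have := twoV_gt0 R i; lra.
Qed.

Lemma box_norm z j y : box z j y = 1 -> 3 / 4 * 2 ^- j <= `|y - z|.
Proof.
move=> /box_position[_ h]; apply: le_trans h _; apply: le_trans (ler_norm _) _; exact: coord_le_norm.
Qed.

Lemma L1p_box z j : L1p (box z j) /\ rint (box z j) = 2 ^- ((j + (d + 4)) * d).
Proof. exact: L1p_sq. Qed.

Lemma box_congr N z j y y' : (j + (d + 4) <= N)%N -> dyfloor N y = dyfloor N y' -> box z j y = box z j y'.
Proof.
move=> h e; rewrite /box sqC [RHS]sqC; apply: sq_congr; exact: (dyfloor_coarse h).
Qed.

Lemma ladder_box z n j : (5 <= j)%N -> (j < n + 5)%N -> exists2 s, a ^+ j <= s &
  forall y, box z j y = 1 -> ladder z n y = s%:C * xc i0 (y - z).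
Proof.
move=> j5 jn; exists (\sum_(i < n) (if (i + 5 <= j)%N then a ^+ (i + 5) else 0)).
  have jl : (j - 5 < n)%N by rewrite ltn_subLR// addnC.
  rewrite (bigD1 (Ordinal jl))//= subnK// leqnn lerDl sumr_ge0// => i _. by case: ifP =>  _/1/.
move=> y yB; have [h1 h2] := box_position yB; rewrite ladderE rmorph_sum mulr_suml.
apply: eq_bigr => i _; rewrite bumpE etaE; case: leqP => ij.
  have -> : phi0 (2 ^+ (i + 5) *: (y - z)) = 1.
    case: phi0P => _ h _; apply: h; rewrite eucl_normZ//.
    have := twoV_mono ij; rewrite -[X in _ -> _ <= X](@mulfV _ (2 ^+ (i + 5) : R))// => h3.
    by mull; apply: le_trans h1 h3.
  rewrite mul1r /xc mxE rmorphM mulrA -rmorphM ampE ratioX mulfVK//.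
rewrite (phi0_support) ?mul0r ?mulr0//.
rewrite normrZ ger0_norm//.
have h3 : 2 ^+ j.+1 <= 2 ^+ (i + 5) :> R by rewrite ler_weXn2l// ler1n.
have h4 := box_norm yB; have h5 : 2 ^+ j.+1 * (3 / 4 * 2 ^- j) = 3 / 2 :> R.
  by rewrite exprS; have := two_neq0 R j; move: (2 ^+ j) => X X0; field.
by rewrite -h5; apply: ler_pM => /1/.
Qed.

Lemma cmeas_ladder z n : cmeas (ladder z n).
Proof. by case: (cintble_ladder z n). Qed.

Lemma cmeas_remainder z n : cmeas (remainder z n).
Proof. by apply: cmeasB => /1/; exact: cmeas_ladder. Qed.

Lemma cintble_remainder z n : cintble (remainder z n).
Proof. by apply: cintbleB; [exact: (cintble_cavg _ (cintble_ladder z n)).1|exact: cintble_ladder]. Qed.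

(** Averaging kills the wave, so the coefficient of E_N f - f is that of the linear function -f.
*)
Lemma box_coefficient z n j : (5 <= j)%N -> (j + (d + 4) <= n + 4)%N ->
  a ^+ j * (2 ^- (n + 4) / 16) * 2 ^- ((j + (d + 4)) * d) <=
    normc (cint (fun y => (box z j y)%:C * (wave (n + 4) y * remainder z n y))).
Proof.
move=> j5 jn; set N := (n + 4)%N; set B := box z j.
have [LB eB] := L1p_box z j; have fi := cintble_ladder z n.
have gi := (cintble_cavg N fi).1.
have bN y y' : dyfloor N y = dyfloor N y' -> B y = B y' by exact: box_congr.
have bw y : normc ((B y)%:C * wave N y) <= 1.
  by rewrite normcM normc_wave mulr1 normcr; rewrite /B; case: (box01 z j y) => ->; rewrite ?normr0 ?normr1.
have mw : cmeas (fun y => (B y)%:C * wave N y).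
  by apply: cmeasM; [apply: cmeas_real; exact: L1p_meas LB|exact: cmeas_wave].
have wi : cintble (fun y => (B y)%:C * wave N y).
  by apply: (cintble_cell (box01 z j) LB); [exact: cmeas_wave|exists 1 => y _; rewrite normc_wave].
have zero : cint (fun y => cavg N (ladder z n) y * ((B y)%:C * wave N y)) = 0.
  have [A hA] : exists A, forall x, normc (cavg N (ladder z n) x) <= A.
    exists (2 * (2 ^+ (N * d) * rint (fun y => normc (ladder z n y)))) => x.
    apply: le_trans (normc_cavg _ _ fi) _; apply: ler_wpM2l => //; apply: avg_le_rint; exact: cintble_normc.
  rewrite -(cavg_orth wi (fun x y => @cavg_step _ _ N _ x y) hA) -[RHS](@cint0 R d); congr cint; ext x.
  rewrite [X in _ * X]cavgE.
  have -> : (fun y => (sq N x y)%:C * ((B y)%:C * wave N y)) = fun y => (sq N x y * B y)%:C * wave N y.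
    by ext y; rewrite rmorphM mulrA.
  rewrite (@cell_wave0 N (fun y => sq N x y * B y)) ?mulr0//.
  - by move=> y; rewrite /sq; case: (_ == _); rewrite ?mul1r ?mul0r; [exact: box01|left].
  - by move=> y y' e; rewrite (bN _ _ e) sqC [in RHS]sqC (sq_congr _ e).
  - exact: (L1p_sqM N x LB).1.
have jn5 : (j < n + 5)%N by move: jn; clear; lia.
have [s sj hs] := ladder_box z j5 jn5.
have s0 : 0 <= s by apply: le_trans sj; side.
have bdd : exists M, forall y, B y = 1 -> `|(y - z) 0 i0| <= M.
  exists (2 ^- j) => y h; apply: le_trans (box_position h).1. exact: le_trans (coord_le_norm _ _) (eucl_norm_ge _).
have cs : cintble (fun y => (B y)%:C * (xc i0 (y - z) * wave N y)).
  apply: (cintble_cell (box01 z j) LB).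
    apply: cmeasM; last exact: cmeas_wave.
    by apply: cmeas_real; apply: (measurable_rV_comp (h := fun y => y - z)); side.
  have [M hM] := bdd; exists M => y h; rewrite normcM normc_wave mulr1 normcr; exact: hM.
have fE : (fun y => ladder z n y * ((B y)%:C * wave N y)) = fun y => s%:C * ((B y)%:C * (xc i0 (y - z) * wave N y)).
  ext y; case: (box01 z j y) => h; rewrite /B h; first by rewrite mul0r !mulr0 mul0r mulr0. by rewrite (hs y h); ring.
have -> : (fun y => (B y)%:C * (wave N y * remainder z n y)) =
    fun y => cavg N (ladder z n) y * ((B y)%:C * wave N y) - ladder z n y * ((B y)%:C * wave N y).
  by ext y; rewrite /remainder; ring.
rewrite cintB; [|exact: (cintble_mul_bounded gi mw bw)|exact: (cintble_mul_bounded fi mw bw)].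
rewrite zero sub0r normc_opp fE (cintZ _ cs) normcM normcr ger0_norm//.
have := cell_sawtooth (box01 z j) bN LB bdd; rewrite eB => h.
via (a ^+ j * (2 ^- ((j + (d + 4)) * d) * (2 ^- N / 16))); first by le_ring.
apply: ler_pM => /1/.
Qed.

(** * The mass of the high-frequency piece on a box *)

Lemma eucl_norm_ev : eucl_norm (ev R i0) = 1.
Proof. by rewrite /eucl_norm dotp_ev !mxE !eqxx sqrtr1. Qed.

(** The frequency 2 pi 2^N satisfies 3/2 2^{N+2} <= 2 pi 2^N <= 2^{N+3}, so the low-pass symbols
N + 3 and N + 2 take the values 1 and 0 there. *)
Lemma symbol_wave N : cint (fun h => Kd N.+3 h * wave N h) = 1.
Proof.
have p3 := pi_ge3 R; have p4 := @pihalf_lt2 R; have N0 := two_neq0 R N.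
rewrite Kd_def fourier_inversion; last exact: schwartz_res.
have e c : eucl_norm (2 ^- c *: ((2 * pi * 2 ^+ N) *: ev R i0)) = 2 * pi * 2 ^+ N / 2 ^+ c.
  by rewrite scalerA eucl_normZ ?eucl_norm_ev ?mulr1 1?mulrC// !mulr_ge0/1/.
rewrite /lp_resolution; case: phi0P => _ h1 h2.
rewrite h1; last first.
  rewrite e !exprS (_ : _ / _ = pi / 4); first by lra. by move: (2 ^+ N) N0 => X X0; field.
rewrite h2 ?subr0// e !exprS (_ : 2 * pi * 2 ^+ N / _ = pi / 2); first by lra.
by move: (2 ^+ N) N0 => X X0; field.
Qed.

Lemma box_shift z j h : L1p (fun y => `|box z j (y + h) - box z j y|) /\
  rint (fun y => `|box z j (y + h) - box z j y|) <=
    2 * (2 ^- ((j + (d + 4)) * d) * ((2 * d.+1)%:R * (2 ^+ (j + (d + 4)) * `|h|))).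
Proof.
set J := (j + (d + 4))%N; pose c := box_center z j.
have bE y : box z j y = sq J c y by [].
have key x (k : E) : box z j x * (1 - box z j (x + k)) = sq J c x * (1 - sq J (x + k) x).
  rewrite !bE; case: (eqVneq (dyfloor J c) (dyfloor J x)) => e; last by rewrite (sq_neq (elimN eqP e)) !mul0r.
  by rewrite (@sq_congr _ _ J c x (x + k) e) (sqC J x (x + k)).
have [L1 e1] := boundary_measure J c h.
have [L2 e2] := boundary_measure J c (- h).
have [L3 e3] := L1p_shift h L2; rewrite normrN in e2.
have [L4 e4] := L1pD L1 L3.
have -> : (fun y => `|box z j (y + h) - box z j y|) = fun y => sq J c y * (1 - sq J (y + h) y) + sq J c (y + h) * (1 - sq J (y + h - h) (y + h)).
  ext y; rewrite -key -key addrK.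
  by case: (box01 z j y) => ->; case: (box01 z j (y + h)) => ->; rewrite ?subrr ?subr0 ?mulr0 ?mulr1 ?addr0 ?add0r ?normrN ?normr0 ?normr1.
split => //; rewrite e4 e3 mulr_natl mulr2n; exact: lerD.
Qed.

Lemma schwartz_ladder z n : schwartz (ladder z n).
Proof. by rewrite ladder_fun; apply: schwartz_sum => i; exact: schwartz_bump. Qed.

Lemma remainder_bounded z n : exists2 A, 0 <= A & forall y, normc (remainder z n y) <= A.
Proof.
have fi := cintble_ladder z n.
have [B B0 hB] := schwartz_bounded [::] (schwartz_ladder z n).
have r0 : 0 <= rint (fun y => normc (ladder z n y)) by apply: rint_ge0 => y/1/.
exists (2 * (2 ^+ ((n + 4) * d) * rint (fun y => normc (ladder z n y))) + B).
  side.
move=> y; apply: le_trans (normc_triangleB _ _) _; apply: lerD; last exact: hB.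
apply: le_trans (normc_cavg _ _ fi) _; apply: ler_wpM2l => //; apply: avg_le_rint; exact: cintble_normc.
Qed.

Fact window_key : unit. Proof. side. Qed.

(** The Fourier coefficient over the box translated by h, the inner integral after exchanging
the order of integration in the coefficient of K_{N+3} * (E_N f - f). *)
Definition window : E -> nat -> nat -> E -> C := locked_with window_key
  (fun z n j h => cint (fun y => (box z j (y + h))%:C * (wave (n + 4) y * remainder z n y))).

Lemma windowE z n j h :
  window z n j h = cint (fun y => (box z j (y + h))%:C * (wave (n + 4) y * remainder z n y)).
Proof. by rewrite /window unlock. Qed.

Lemma cmeas_wave_remainder z n : cmeas (fun y => wave (n + 4) y * remainder z n y).
Proof. by apply: cmeasM; [exact: cmeas_wave|exact: cmeas_remainder]. Qed.

Lemma cmeas_box_shift z j h : cmeas (fun y => (box z j (y + h))%:C).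
Proof.
have [L _] := L1p_box z j; have [L' _] := L1p_shift h L.
by apply: cmeas_real; exact: L1p_meas L'.
Qed.

Lemma cintble_window z n j h : cintble (fun y => (box z j (y + h))%:C * (wave (n + 4) y * remainder z n y)).
Proof.
have [A A0 hA] := remainder_bounded z n.
have [L _] := L1p_box z j; have [L' _] := L1p_shift h L; have [L2 _] := L1pZ A0 L'.
apply: (@cintble_dom _ _ _ (fun y => A * box z j (y + h))).
- by apply: cmeasM; [exact: cmeas_box_shift|exact: cmeas_wave_remainder].
- side.
- move=> y; rewrite !normcM normc_wave mul1r normcr ger0_norm/1/. by rewrite mulrC; mulr.
- by case: L2.
Qed.

Lemma window_diff z n j h (k : E) (A : R) : 0 <= A ->
  (forall y, box z j (y + h) <> box z j (y + k) -> normc (remainder z n y) <= A) ->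
  normc (window z n j h - window z n j k) <=
    2 * (A * (2 * (2 ^- ((j + (d + 4)) * d) * ((2 * d.+1)%:R * (2 ^+ (j + (d + 4)) * `|h - k|))))).
Proof.
move=> A0 hA; rewrite !windowE -cintB; [|exact: cintble_window|exact: cintble_window].
have [L e] := box_shift z j (h - k); have [L1 e1] := L1p_shift k L; have [L2 e2] := L1pZ A0 L1.
via (2 * rint (fun y => A * `|box z j (y + k + (h - k)) - box z j (y + k)|)); last first.
  by rewrite e2; apply: ler_wpM2l => //; apply: ler_wpM2l => //; rewrite e1.
apply: normc_cint_rint => //.
  apply: cmeasB; apply: cmeasM; [exact: cmeas_box_shift|exact: cmeas_wave_remainder|exact: cmeas_box_shift|exact: cmeas_wave_remainder].
move=> y; rewrite -mulrBl -rmorphB !normcM normc_wave mul1r normcr (_ : y + k + (h - k) = y + h) 1?[leLHS]mulrC; last by vring.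
case: (pselect (box z j (y + h) = box z j (y + k))) => [->|ne]; first by rewrite subrr normr0 !mulr0.
by apply: ler_wpM2r => //; exact: hA.
Qed.

Lemma cmeas_window z n j : cmeas (window z n j).
Proof.
have [A A0 hA] := remainder_bounded z n; apply: ccont_cmeas; apply: loc_lip_ccont => x.
exists (2 * (A * (2 * (2 ^- ((j + (d + 4)) * d) * ((2 * d.+1)%:R * 2 ^+ (j + (d + 4))))))) => h _.
apply: le_trans (window_diff (A := A) _ _) _ => //.
rewrite (_ : x + h - x = h); last by vring.
le_ring.
Qed.

Lemma cnv_refl k g x : cintble g -> cintble (fun h => Kd k h * g (x - h)) /\ cnv k g x = cint (fun h => Kd k h * g (x - h)).
Proof.
move=> gi; have ci := cintble_cnv k x gi.
have E1 : (fun h => Kd k h * g (x - h)) = fun h => Kd k (x - (x - h)) * g (x - h).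
  by ext h; rewrite (_ : x - (x - h) = h)//; vring.
by rewrite E1; split; [exact: cintble_refl ci|rewrite (cint_refl x ci)].
Qed.

(** The coefficient of a convolution is an average of translated coefficients, with total weight
1 by [symbol_wave]. *)
Lemma window_fubini z n j :
  cint (fun x => (box z j x)%:C * (wave (n + 4) x * cnv (n + 4).+3 (remainder z n) x)) =
  cint (fun h => (Kd (n + 4).+3 h * wave (n + 4) h) * window z n j h).
Proof.
set N := (n + 4)%N; set r := remainder z n; have ri : cintble r by exact: cintble_remainder.
have [A A0 hA] := remainder_bounded z n.
have [LB _] := L1p_box z j.
have Ks := schwartz_Kd phi0P N.+3; have [mK LK] := (cintble_L1p _).1 (schwartz_cintble [::] Ks).
pose F x h := (box z j x)%:C * (wave N x * (Kd N.+3 h * r (x - h))).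
have mr : cmeas r => /1/.
have -> : (fun x => (box z j x)%:C * (wave N x * cnv N.+3 r x)) = fun x => cint (F x).
  ext x; have [ci ->] := cnv_refl N.+3 x ri.
  have -> : F x = fun h => ((box z j x)%:C * wave N x) * (Kd N.+3 h * r (x - h)).
    by ext h; rewrite /F mulrA.
  by rewrite cintZ// mulrA.
have [LBA _] := L1pZ A0 LB.
rewrite (@cfubini_dom _ _ F (fun x => A * box z j x) (fun h => normc (Kd N.+3 h))).
- congr cint; ext h. have ci : cintble (fun y => (box z j (y + h))%:C * (wave N y * r y)) by exact: cintble_window.
  rewrite windowE -cintZ//.
  have ci2 : cintble (fun y => Kd N.+3 h * wave N h * ((box z j (y + h))%:C * (wave N y * r y))) by exact: cintbleZ.
  rewrite -(cint_shift (- h) ci2); congr cint; ext x; rewrite /F subrK.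
  have -> : wave N x = wave N (x - h) * wave N h by rewrite /wave -chiD subrK. ring.
- apply: cmeasM; first exact: (cmeas_comp (cmeas_real (L1p_meas LB)) measurable_fst).
  apply: cmeasM; first exact: (cmeas_chi (measurable_cst _) measurable_fst).
  apply: cmeasM; first exact: (cmeas_comp mK measurable_snd). by apply: (cmeas_comp mr); side.
- side.
- side.
- side.
- side.
- by case: LBA.
- by case: LK.
- move=> x h; rewrite /F !normcM normc_wave mul1r normcr.
  case: (box01 z j x) => ->; first by rewrite normr0 !(mul0r, mulr0). by rewrite normr1 mul1r mulr1 mulrC; mulr.
Qed.

Lemma moment_le (s : R) N h : 0 <= s -> (1 + 2 ^+ N * `|h|) `^ s <= (1 + 2 ^+ N.+3 * `|h|) `^ s.
Proof.
move=> s0; apply: powR_le => //.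
by rewrite lerD2l; apply: ler_wpM2r => //; rewrite ler_weXn2l ?ler1n// -addn3 leq_addr.
Qed.

Lemma cnv_remainder_box : exists2 B, 0 < B & forall z n j x, (j + (d + 4) <= n + 4)%N -> box z j x = 1 ->
  normc (cnv (n + 4).+3 (remainder z n) x) <= B * (2 ^- (n + 4) * a ^+ j).
Proof.
have dp0 : 0 <= d%:R / p => /1/.
have [B1 B10 h1] := remainder_bound.
have t0 : 0 <= (2 * d)%:R + d%:R / p => /1/.
have [B2 B20 h2] := Kd_bounds phi0P t0.
have pd : 0 <= pi ^+ d :> R => /1/.
exists (2 * (B2 * B1 * pi ^+ d) + 1); first by rewrite ltr_wpDl// !mulr_ge0.
move=> z n j x jn xB; set N := (n + 4)%N; have [s sE] : exists s, s = 2 ^- N * a ^+ j by eexists.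
have s0 : 0 <= s by rewrite sE mulr_ge0// ratioX_ge0.
rewrite -sE.
have j2 : (j + 2 <= N)%N by apply: leq_trans jn; rewrite leq_add2l addnS addnS ltnS ltnS.
have c0 : 0 <= B2 * B1 * s => /1/.
have [L1 e1] := @L1p_dwt R d (2 * d)%:R N.+3 x (lexx _); have [L2 e2] := L1pZ c0 L1.
via (2 * (B2 * B1 * s * pi ^+ d)); last first.
  via (2 * (B2 * B1 * pi ^+ d) * s); first by le_ring. by apply: ler_wpM2r => //; rewrite lerDl.
via (2 * rint (fun y => B2 * B1 * s * dwt (2 * d)%:R N.+3 (x - y))); last first.
  by apply: ler_wpM2l => //; rewrite e2; apply: ler_wpM2l.
apply: normc_cint_rint => //.
  by apply: cmeasM; [side|exact: cmeas_remainder].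
move=> y; rewrite normcM.
via (B2 * dwt ((2 * d)%:R + d%:R / p) N.+3 (x - y) * (B1 * s * (1 + 2 ^+ N.+3 * `|x - y|) `^ (d%:R / p))).
  apply: ler_pM; [side|side|exact: (h2 N.+3).1|].
  apply: le_trans (h1 z n j x y j2 (box_norm xB)) _; rewrite -sE; mull. exact: moment_le.
rewrite -(dwt_moment (2 * d)%:R N.+3 (x - y) dp0); le_ring.
Qed.

(** The average of the windows differs from the unshifted one by at most C 2^{j-N} times its size, hence by at most half of it when j + m <= N. *)
Lemma box_integral : exists m, forall z n j, (5 <= j)%N -> (j + (d + 4) + m <= n + 4)%N ->
  (2 ^- (n + 4) * a ^+ j) * 2 ^- ((j + (d + 4)) * d) / 32 <=
  normc (cint (fun x => (box z j x)%:C * (wave (n + 4) x * cnv (n + 4).+3 (remainder z n) x))).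
Proof.
have dp0 : 0 <= d%:R / p => /1/.
have dp1 : 0 <= d%:R / p + 1 => /1/.
have [B1 B10 h1] := remainder_bound.
have t0 : 0 <= (2 * d)%:R + (d%:R / p + 1) => /1/.
have [B2 B20 h2] := Kd_bounds phi0P t0.
have pd : 0 <= pi ^+ d :> R => /1/.
pose Q := 2 * (B2 * (2 * (B1 * (2 * (2 * d.+1)%:R)))) * pi ^+ d.
have Q0 : 0 <= Q => /1/.
have [m hm] : exists m, Q * 2 ^- m <= 1 / 32.
  have c : Q * 2 ^- n @[n --> \oo] --> Q * 0 by apply: cvgMr; exact: cvg_half.
  rewrite mulr0 in c; have [m _ hm] : \forall n \near \oo, Q * 2 ^- n < 1 / 32 by apply: (cvgr_lt (0:R)) => /1/.
  by exists m; apply: ltW; exact: (hm m (leqnn m)).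
exists m => z n j j5 jm; have jn : (j + (d + 4) <= n + 4)%N by exact: leq_trans (leq_addr _ _) jm.
have j2 : (j + 2 <= n + 4)%N by apply: leq_trans jn; rewrite leq_add2l addnS addnS ltnS ltnS.
rewrite window_fubini; set N := (n + 4)%N in jm jn j2 *; set J := (j + (d + 4))%N in jm jn *.
have [s sE] : exists s, s = 2 ^- N * a ^+ j by eexists.
have s0 : 0 <= s by rewrite sE mulr_ge0// ratioX_ge0.
have [V VE] : exists V, V = 2 ^- (J * d) :> R by eexists.
have V0 : 0 <= V by rewrite VE invr_ge0 two_ge0.
rewrite -VE -sE; have [W WE] : exists W, W = window z n j by eexists.
rewrite -WE.
have Wd h : normc (W h - W 0) <= 2 * (B1 * s * (1 + 2 ^+ N * `|h|) `^ (d%:R / p) * (2 * (V * ((2 * d.+1)%:R * (2 ^+ J * `|h|))))).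
  have := @window_diff z n j h 0 (B1 * s * (1 + 2 ^+ N * `|h|) `^ (d%:R / p)); rewrite subr0 -VE -WE; apply.
    side.
  move=> y; rewrite addr0 => hne. case: (box01 z j y) => hy; last first.
    apply: le_trans (h1 z n j y y j2 (box_norm hy)) _; rewrite subrr normr0 mulr0 addr0 powR1 mulr1 -sE.
    by rewrite ler_peMr/1/ powR_ge1// lerDl mulr_ge0// two_ge0.
  case: (box01 z j (y + h)) => hyh; first by rewrite hy hyh in hne.
  have := h1 z n j (y + h) y j2 (box_norm hyh); rewrite (_ : y + h - y = h) -?sE//; vring.
have Ks := schwartz_Kd phi0P N.+3; have [mK LK] := (cintble_L1p _).1 (schwartz_cintble [::] Ks).
have kw : cintble (fun h => Kd N.+3 h * wave N h).
  apply: (@cintble_mul_bounded _ _ _ _ 1); [side|exact: cmeas_wave|by move=> h; rewrite normc_wave].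
have c0 : 0 <= B2 * (2 * (B1 * s * (2 * (V * ((2 * d.+1)%:R * (2 ^+ J / 2 ^+ N)))))).
  by rewrite !mulr_ge0.
have [L1 e1] := @L1p_dwt R d (2 * d)%:R N.+3 0 (lexx _); have [L2 e2] := L1pZ c0 L1.
have pw h : normc (Kd N.+3 h * wave N h * (W h - W 0)) <=
    B2 * (2 * (B1 * s * (2 * (V * ((2 * d.+1)%:R * (2 ^+ J / 2 ^+ N)))))) * dwt (2 * d)%:R N.+3 (0 - h).
  rewrite !normcM normc_wave mulr1 sub0r dwtN.
  apply: le_trans (ler_pM (normc_ge0 _) (normc_ge0 _) ((h2 N.+3).1 h) (Wd h)) _. set u := 1 + 2 ^+ N.+3 * `|h|.
  have u0 : 0 < u by rewrite ltr_pwDl// mulr_ge0 two_ge0. have hu : 2 ^+ N * `|h| <= u.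
    via (2 ^+ N.+3 * `|h|); last by rewrite lerDr.
    by apply: ler_wpM2r => //; rewrite ler_weXn2l ?ler1n// -addn3 leq_addr.
  have key : (1 + 2 ^+ N * `|h|) `^ (d%:R / p) * (2 ^+ J * `|h|) <= 2 ^+ J / 2 ^+ N * u `^ (d%:R / p + 1).
    rewrite powRD; last by rewrite (gt_eqF u0) implybT. rewrite powRr1/1/.
    via (u `^ (d%:R / p) * (2 ^+ J / 2 ^+ N * u)); last by le_ring. apply: ler_pM => /1/; first exact: moment_le.
    have -> : 2 ^+ J * `|h| = 2 ^+ J / 2 ^+ N * (2 ^+ N * `|h|) by rewrite mulrA divfK. by mull.
  rewrite -(dwt_moment (2 * d)%:R N.+3 h dp1) -/u. set D := dwt _ _ _; have D0 : 0 <= D by side.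
  have m0 : 0 <= B2 * D * (2 * (B1 * s * (2 * (V * (2 * d.+1)%:R)))) => /1/.
  have := ler_wpM2l m0 key; set P := (1 + _) `^ _; set P' := u `^ _; move=> hk.
  apply: le_trans (_ : _ <= B2 * D * (2 * (B1 * s * (2 * (V * (2 * d.+1)%:R)))) * (P * (2 ^+ J * `|h|))) _; first by le_ring.
  apply: le_trans hk _; le_ring.
have mWd : cmeas (fun h => Kd N.+3 h * wave N h * (W h - W 0)).
  by apply: cmeasM; [side|apply: cmeasB; [rewrite WE; exact: cmeas_window|side]].
have wi : cintble (fun h => Kd N.+3 h * wave N h * (W h - W 0)).
  by apply: (cintble_dom mWd (L1p_meas L2) pw); case: L2.
have split_ : cint (fun h => Kd N.+3 h * wave N h * W h) = cint (fun h => Kd N.+3 h * wave N h * (W h - W 0)) + W 0.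
  have -> : (fun h => Kd N.+3 h * wave N h * W h) = fun h => Kd N.+3 h * wave N h * (W h - W 0) + W 0 * (Kd N.+3 h * wave N h).
    by ext h; ring.
  by rewrite cintD ?cintZ ?symbol_wave ?mulr1/1/.
rewrite split_; have := normc_cint_rint mWd L2 pw; rewrite e2; set e := cint _ => he.
have W0 := box_coefficient z j5 jn.
have W0E : W 0 = cint (fun y => (box z j y)%:C * (wave N y * remainder z n y)).
  by rewrite WE windowE; congr cint; ext y; rewrite addr0.
rewrite -W0E -/J -VE in W0.
have he' : normc e <= s * V / 32.
  apply: le_trans he _.
  apply: (@le_trans _ _ (2 * (B2 * (2 * (B1 * s * (2 * (V * ((2 * d.+1)%:R * (2 ^+ J / 2 ^+ N)))))) * pi ^+ d))).
    by apply: ler_wpM2l => //; apply: ler_wpM2l.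
  have JN : 2 ^+ J / 2 ^+ N <= 2 ^- m :> R.
    rewrite ler_pdivrMr// mulrC ler_pdivlMr// -exprD ler_weXn2l ?ler1n//.
  via (s * V * (Q * (2 ^+ J / 2 ^+ N))); first by rewrite /Q; le_ring. mull.
  apply: le_trans (ler_wpM2l Q0 JN) _ => /1/; lra.
have := normc_dist_ge (W 0) (- e); rewrite opprK normc_opp (addrC (W 0) e) => hd.
apply: (le_trans _ hd); move: he' W0; rewrite (_ : a ^+ j * (2 ^- N / 16) * V = s * V / 16); last by rewrite sE; ring.
move: (s * V) (normc e) (normc (W 0)) => u v w; lra.
Qed.

(** Interpolation |g| <= |g|^p M^{1-p} with the upper bound M of [cnv_remainder_box] turns the
lower bound on the integral of |g| into one on that of |g|^p. *)
Lemma box_mass : exists c m, 0 < c /\ forall z n j, (5 <= j)%N -> (j + (d + 4) + m <= n + 4)%N ->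
  L1p (fun x => box z j x * normc (cnv (n + 4).+3 (remainder z n) x) `^ p) /\
  c * (2 ^+ (n + 4)) `^ (- p) <= rint (fun x => box z j x * normc (cnv (n + 4).+3 (remainder z n) x) `^ p).
Proof.
have [B B0 hB] := cnv_remainder_box; have [m hm] := box_integral.
exists (B `^ (p - 1) / 64 * 2 ^- ((d + 4) * d)), m; split.
  side.
move=> z n j j5 jm; have jn : (j + (d + 4) <= n + 4)%N by exact: leq_trans (leq_addr _ _) jm.
have := hm z n j j5 jm; set N := (n + 4)%N; set s := 2 ^- N * a ^+ j; set J := (j + (d + 4))%N => hI.
have s0 : 0 < s => /1/.
pose v x := normc (cnv N.+3 (remainder z n) x).
have v0 x : 0 <= v x by side.
have vB x : box z j x = 1 -> v x <= B * s by exact: hB.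
have mv : meas v by apply: cmeas_normc; apply: cmeas_cnv => //; exact: cintble_remainder.
have [LB eB] := L1p_box z j; have mB := L1p_meas LB.
have Bs0 : 0 < B * s => /1/.
have b0 x : 0 <= box z j x by [].
have [L1 _] := L1pZ (powR_ge0 (B * s) p) LB.
have Lp : L1p (fun x => box z j x * v x `^ p).
  apply: (L1p_le L1 _ _ _).1.
  - side.
  - side.
  - move=> x; case: (box01 z j x) => h; rewrite h; first by rewrite mul0r mulr0.
    by rewrite mul1r mulr1; apply: powR_le (ltW p0) (v0 x) (vB x h).
split => //.
have [L2 e2] := L1pZ (powR_ge0 (B * s) (1 - p)) Lp.
have h1 : normc (cint (fun x => (box z j x)%:C * (wave N x * cnv N.+3 (remainder z n) x))) <=
    2 * rint (fun x => (B * s) `^ (1 - p) * (box z j x * v x `^ p)).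
  apply: normc_cint_rint => //.
    apply: cmeasM; first side. by apply: cmeasM; [exact: cmeas_wave|apply: cmeas_cnv => //; exact: cintble_remainder].
  move=> x; rewrite !normcM normc_wave mul1r normcr ger0_norm//.
  case: (box01 z j x) => h; rewrite h; first by rewrite !mul0r mulr0.
  by have := powR_interp p01 (v0 x) (vB x h); rewrite !mul1r [X in _ <= X -> _]mulrC.
rewrite e2 in h1; have := le_trans hI h1; set I := rint _ => h2.
have X0 : 0 < (B * s) `^ (1 - p) => /1/.
have h3 : s * 2 ^- (J * d) / 64 / (B * s) `^ (1 - p) <= I.
  rewrite ler_pdivrMr// [I * _]mulrC/1/; lra.
apply: le_trans h3; rewrite le_eqVlt; apply/orP; left; apply/eqP.
have -> : ((B * s) `^ (1 - p))^-1 = B `^ (p - 1) * s `^ (p - 1).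
  by rewrite -powRN opprB powRM// ltW.
have ss : s * s `^ (p - 1) = s `^ p.
  rewrite -{1}[s]powRr1/1/ -powRD; last by rewrite (gt_eqF s0) implybT. by rewrite addrC subrK.
have sp : s `^ p = (2 ^+ N) `^ (- p) * 2 ^+ (j * d).
  rewrite /s powRM/1/ -ratioX -powRrM mulfVK/1/ powR_mulrn// -exprM.
  by congr (_ * _); rewrite -(powR_inv1 (two_ge0 R N)) -powRrM mulN1r.
have JE : 2 ^- (J * d) = 2 ^- (j * d) * 2 ^- ((d + 4) * d) :> R by rewrite /J mulnDl exprD invfM.
rewrite (_ : s * 2 ^- (J * d) / 64 * _ = B `^ (p - 1) / 64 * 2 ^- (J * d) * (s * s `^ (p - 1))); last by ring.
rewrite ss sp JE; have := two_neq0 R (j * d); move: (2 ^+ (j * d)) => X Xn0.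
have := two_neq0 R ((d + 4) * d); move: (2 ^+ ((d + 4) * d)) => Y Yn0.
by field; rewrite Xn0 Yn0.
Qed.

(** * The lower bound and the theorem *)

(** Summing over the disjoint boxes; the piece N + 3 of the ladder itself is bounded and is
subtracted. *)
Lemma averaged_ladder : exists c n0, 0 < c /\ forall z n, (n0 <= n)%N ->
  L1p (pw (cnv (n + 4).+3 (cavg (n + 4) (ladder z n)))) ->
  c * (n + 4)%:R <= (2 ^+ (n + 4).+3) `^ p * rint (pw (cnv (n + 4).+3 (cavg (n + 4) (ladder z n)))).
Proof.
have [c [m [c0 hc]]] := box_mass.
have [B B0 hB] := cnv_ladder.
have [n1 hn1] : exists n1 : nat, 8 * B / c <= n1%:R.
  exists (Num.truncn (8 * B / c)).+1; apply: ltW; exact: truncnS_gt.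
exists (c / 8), (n1 + (2 * (d + m + 5) + 4))%N; split => /1/.
move=> z n hn Lg; set N := (n + 4)%N; set k := N.+3.
pose f := ladder z n; have fi : cintble f by exact: cintble_ladder.
pose v x := normc (cnv k (remainder z n) x).
have v0 x : 0 <= v x => /1/.
have ri : cintble (remainder z n) => /1/.
have gi := (cintble_cavg N fi).1.
have [Lf ef] := hB z n k; rewrite -/f in Lf ef.
have mv : meas (fun x => v x `^ p).
  by apply: measurable_powR_fun; side; side.
have [|||Lv ev] := rint_triangle (f := fun x => v x `^ p) Lg Lf.
- side.
- side.
- move=> x; rewrite /v (_ : cnv k (remainder z n) x = cnv k (cavg N f) x - cnv k f x); last by rewrite -cnvB.
  apply: le_trans (powR_le (ltW p0) (normc_ge0 _) (normc_triangleB _ _)) _. by apply: powR_subadd => /1/.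
pose t := (n - (d + m + 5))%N.
have hj (i : 'I_t) : (5 <= i + 5)%N /\ (i + 5 + (d + 4) + m <= N)%N.
  by have := ltn_ord i => /1/; clear; lia.
have mass : t%:R * (c * (2 ^+ N) `^ (- p)) <= rint (fun x => v x `^ p).
  have Li (i : 'I_t) : L1p (fun x => box z (i + 5) x * v x `^ p) by exact: (hc z n (i + 5)%N (hj i).1 (hj i).2).1.
  have [L1 e1] := L1p_sum (index_enum _) Li. via (\sum_(i < t) rint (fun x => box z (i + 5) x * v x `^ p)).
    rewrite (_ : t%:R * _ = \sum_(i < t) c * (2 ^+ N) `^ (- p)); last by rewrite sumr_const card_ord mulr_natl.
    by apply: ler_sum => i _; exact: (hc z n (i + 5)%N (hj i).1 (hj i).2).2.
  rewrite -e1; apply: rint_le => // x; rewrite -mulr_suml ler_piMl/1/.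
  have [[i hi]|none] := pselect (exists i : 'I_t, box z (i + 5) x = 1).
    rewrite (bigD1 i)//= hi big1// => i' ii'. case: (box01 z (i' + 5) x) => // hi'; exfalso.
    have : (i < i')%N || (i' < i)%N by rewrite -neq_ltn eq_sym.
    case/orP => lt; [apply: (box_disjoint (i := (i + 5)%N) (j := (i' + 5)%N) _ hi hi')|apply: (box_disjoint (i := (i' + 5)%N) (j := (i + 5)%N) _ hi' hi)]; by rewrite ltn_add2r.
  rewrite big1 // => i _; case: (box01 z (i + 5) x) => // h; case: none; by exists i.
have kp : 0 < (2 ^+ k) `^ p :> R by [].
have kN : 1 <= (2 ^+ k) `^ p * (2 ^+ N) `^ (- p) :> R.
  rewrite powRN ler_pdivlMr// mul1r; apply: powR_le => /1/. by rewrite ler_weXn2l ?ler1n// /k -addn3 leq_addr.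
have t2 : n%:R <= 2 * t%:R :> R.
  by rewrite -natrM ler_nat /t; move: hn; clear; lia.
have nN : N%:R <= 2 * n%:R :> R.
  by rewrite -natrM ler_nat /N; move: hn; clear; lia.
have nB : 8 * B <= c * n%:R.
  move: hn1; rewrite ler_pdivrMr// => h; apply: (le_trans h); rewrite mulrC; mull.
  by rewrite ler_nat; apply: leq_trans hn; rewrite leq_addr.
have fB : (2 ^+ k) `^ p * rint (pw (cnv k f)) <= B.
  apply: le_trans ef _; rewrite ler_piMr// exprn_ile1//; [by case/andP: (sig01)|by rewrite ltW; case/andP: (sig01)].
have h1 := ler_wpM2l (ltW kp) mass; have h2 := ler_wpM2l (ltW kp) ev.
have h3 : t%:R * c <= (2 ^+ k) `^ p * (t%:R * (c * (2 ^+ N) `^ (- p))).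
  rewrite (_ : _ * (t%:R * _) = t%:R * c * ((2 ^+ k) `^ p * (2 ^+ N) `^ (- p))); last by ring.
  by rewrite ler_peMr// mulr_ge0// ltW.
have h6 := le_trans (le_trans h3 h1) h2; rewrite mulrDr in h6.
via (t%:R * c - B); first exact: (count_margin c0 B0 t2 nB nN).
by rewrite lerBlDr; apply: (le_trans h6); rewrite lerD2l.
Qed.

Lemma cube_center (k : int) (m : 'rV[int]_d) : 1 / 2 <= 2 ^ (- k) :> R ->
  exists z : E, forall x, `|x - z| < 4^-1 -> open_dyadic_cube k m x.
Proof.
move=> hk; exists (\row_i (2 ^ (- k) * ((m 0 i)%:~R + 1 / 2))) => x hx i.
have := le_lt_trans (coord_le_norm _ i) hx; rewrite !mxE ltr_norml => /andP[h1 h2].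
move: h1 h2 hk; set t := 2 ^ (- k) => h1 h2 hk; rewrite !mulrDr mulr1.
rewrite mulrDr in h1 h2; apply/andP; split; lra.
Qed.

Variable q : \bar R.
Hypothesis pq : (p%:E <= q)%E.

(** The test distribution is the ladder divided by its norm. *)
Lemma Op_lower : exists c N0, 0 < c /\ forall N, (N0 <= N)%N -> forall (k : int) (m : 'rV[int]_d),
  1 / 2 <= 2 ^ (- k) :> R ->
  ((c * N%:R `^ (p^-1 - fine q^-1%E))%:E <= Op (avg_operator N) (besov_norm phi0 1 p%:E q) (open_dyadic_cube k m))%E.
Proof.
have q0 : (0 < q)%E by apply: lt_le_trans pq => /1/.
have [c [n0 [c0 hc]]] := averaged_ladder.
have [B B0 hB] := cnv_ladder.
have s01 := sig01.
have [K K0 hK] := density_block pq B0 s01.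
exists (K^-1 * c `^ p^-1), (n0 + 5)%N; split => /1/.
move=> N hN k m hk; have [z hz] := cube_center m hk.
have [n nE] : exists n, N = (n + 4)%N by exists (N - 4)%N; move: hN; clear; lia.
have nn0 : (n0 <= n)%N by move: hN; rewrite nE; clear; lia.
have N0 : (0 < N)%N by move: hN; clear; lia.
have Nn : N%:R != 0 :> R by rewrite pnatr_eq0 -lt0n.
pose f := ladder z n; have fi : cintble f by exact: cintble_ladder.
pose D j := (2 ^+ j) `^ p * rint (pw (cnv j f)).
have rint0 (g : E -> R) : 0 <= rint (fun x => g x `^ p) by apply: rint_ge0 => x/1/.
have D0 j : 0 <= D j by rewrite mulr_ge0.
have [M [M0 ME]] : exists M, 0 < M /\ M = K * N%:R `^ (fine q^-1%E).
  by eexists; split; last reflexivity; rewrite mulr_gt0// powR_gt0// ltr0n.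
have DM : density_le q D M.
  by rewrite ME; apply: hK => // j; rewrite D0 nE; exact: (hB z n j).2.
have D1 := density_leZ q0 M0 D0 DM.
have Mi : 0 <= M^-1 => /1/.
pose f' x : C := (M^-1)%:C * f x; have f'i : cintble f' by side.
pose u : raw_distribution R d := fun psi => cint (fun x => f' x * psi x).
have ut : tempered u by exact: tempered_of_cintble.
have scale (g : E -> C) j x : cintble g -> normc (cnv j (fun y => (M^-1)%:C * g y) x) `^ p = M^-1 `^ p * normc (cnv j g x) `^ p.
  move=> gi; rewrite /cnv (_ : (fun y => Kd j (x - y) * _) = fun y => (M^-1)%:C * (Kd j (x - y) * g y)); last first.
    by ext y; ring.
  by rewrite cintZ; [rewrite normcM normcr ger0_norm// powRM// normc_ge0|side].
have uE j : lp_piece u j = cnv j f' by exact: lp_piece_cnv.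
have Mp0 : 0 <= M^-1 `^ p => /1/.
have uL j : L1p (pw (lp_piece u j)) /\ dens u j = M^-1 `^ p * D j.
  have [L e] := L1pZ Mp0 (hB z n j).1. have E1 : (pw (lp_piece u j)) = fun x => M^-1 `^ p * normc (cnv j f x) `^ p.
    by ext x; rewrite uE scale.
  by rewrite /dens E1; split => //; rewrite e /D; ring.
have un : (besov_norm phi0 1 p%:E q u <= 1)%E.
  apply/(besov_le q0 ler01 ut); split; first by move=> j; exact: (uL j).1.
  by rewrite (_ : dens u = fun j => M^-1 `^ p * D j)//; ext j; exact: (uL j).2.
have us : supp u `<=` open_dyadic_cube k m.
  move=> x xu; apply: contrapT => xQ; apply: xu.
  have xz : 8^-1 < `|x - z| by rewrite ltNge; apply/negP => h; apply: xQ; apply: hz; lra.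
  exists [set y | 8^-1 < `|y - z|] => //; split.
    rewrite (_ : [set y | _] = (fun y => `|y - z|) @^-1` [set r | 8^-1 < r])//. apply: open_comp => /1/.
    move=> y _; apply: continuous_comp; last exact: norm_continuous. exact: continuous_shiftr.
  move=> psi [_ _ psiU]; rewrite /u -[RHS](@cint0 R d); congr cint; ext y.
  have [->|py] := eqVneq (psi y) 0; first by rewrite mulr0. rewrite /f' /f ladder_support ?mulr0 ?mul0r//; apply: ltW.
  by have := psiU y (@subset_closure _ [set x | psi x != 0] y py).
via (op_value (besov_norm phi0 1 p%:E q) (avg_operator N) u); last first.
  by apply: ereal_sup_ubound; exists u.
apply: le_ereal_inf_tmp => _ [v [vt [g [gu gv]]] <-].
have f'u : represents f' u by exact: represents_cintble.
have gE : dyadic_avg N g = cavg N f' by rewrite (averages_determined N gu f'u) dyadic_avgE.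
rewrite gE in gv; have g'i := (cintble_cavg N f'i).1.
have vE j := lp_piece_cnv j (represents_unique g'i vt gv).
have bv0 : (0 <= besov_norm phi0 1 p%:E q v)%E by rewrite /besov_norm Lnorm_ge0.
case bE : (besov_norm phi0 1 p%:E q v) bv0 => [M1| |]; [|by move=> _; exact: leey|by []].
rewrite lee_fin => M10; rewrite lee_fin.
have [vL vD] := (besov_le q0 M10 vt).1 (ltac:(by rewrite bE)).
have h1 := density_term N.+3 q0 M10 (dens_ge0 v) vD.
have fi2 := (cintble_cavg N fi).1.
have gS : cavg N f' = fun y => (M^-1)%:C * cavg N f y.
  ext y; rewrite !cavgE mulrCA; congr (_ * _).
  rewrite (_ : (fun y0 => _) = fun y0 => (M^-1)%:C * ((sq N y y0)%:C * f y0)); last by ext w; rewrite /f'; ring.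
  by rewrite cintZ//; exact: cintble_sqM.
have vS x : normc (lp_piece v N.+3 x) `^ p = M^-1 `^ p * normc (cnv N.+3 (cavg N f) x) `^ p.
  by rewrite vE gS (scale _ N.+3 x fi2).
have MpP : 0 < M^-1 `^ p => /1/.
have Lc : L1p (pw (cnv N.+3 (cavg N f))).
  have [L _] := L1pZ (ltW (ltac:(side) : 0 < (M^-1 `^ p)^-1)) (vL N.+3).
  congr L1p: L; ext x; by rewrite vS mulKf// gt_eqF.
have := hc z n nn0; rewrite -nE -/f => /(_ Lc) h2.
have h3 : M^-1 `^ p * (c * N%:R) <= M1 `^ p.
  apply: le_trans h1; rewrite /dens (_ : (fun x => _) = fun x => M^-1 `^ p * normc (cnv N.+3 (cavg N f) x) `^ p); last first.
    by apply/funext => x/1/.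
  rewrite (L1pZ (ltW MpP) Lc).2 [leRHS]mulrCA; mull.
have cN0 : 0 <= c * N%:R => /1/.
have := powR_root_le (mulr_ge0 (ltW MpP) cN0) M10; rewrite h3 powRM// -powRrM mulfV/1/ powRr1// => h4.
apply: le_trans h4; rewrite ME powRM/1/ powRD ?Nn ?implybT// powRN invfM.
by rewrite le_eqVlt; apply/orP; left; apply/eqP; ring.
Qed.

End besov_estimates.

Theorem theorem6p1 (R : realType) (d : nat) (d_ge1 : (1 <= d)%N)
    (phi0 : 'rV[R]_d -> R[i]) (phi0P : lp_cutoff phi0)
    (p : R) (q : \bar R)
    (pq : (d%:R / (d%:R + 1) < p /\ p < 1 /\ (p%:E <= q)%E) \/
          (p = 1 /\ q = +oo%E)) :
  exists (c C : R) (N0 : nat), 0 < c /\ 0 < C /\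
    forall N : nat, (N0 <= N)%N ->
      let rate := N%:R `^ (p^-1 - fine q^-1%E) in
      let B1pq := besov_norm phi0 1 p%:E q in
      ((c * rate)%:E <= operator_norm (avg_operator N) B1pq <=
         (C * rate)%:E)%E /\
      forall (k : int) (m : 'rV[int]_d), 1 / 2 <= 2 ^ (- k) :> R ->
        ((c * rate)%:E <= Op (avg_operator N) B1pq (open_dyadic_cube k m) <=
           (C * rate)%:E)%E.
Proof.
have d0 : 0 <= d%:R :> R by [].
have p01 : 0 < p <= 1.
  case: pq => [[h1 [h2 _]]|[-> _]]; last by rewrite ltr01 lexx.
  by rewrite (ltW h2) andbT; apply: le_lt_trans h1 => /1/.
have gam0 : 0 < gam d p.
  case: pq => [[h1 _]|[-> _]]/1/. rewrite (_ : gam d p = p * (d%:R + 1) - d%:R); last by rewrite /gam; ring.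
  by rewrite subr_gt0 -ltr_pdivrMr// ltr_wpDl.
have pq' : (p%:E <= q)%E by case: pq => [[_ [_ h]]|[_ ->]] //; exact: leey.
have p1q : (q = +oo)%E \/ p < 1 by case: pq => [[_ [h _]]|[_ ->]]; [right|left].
have [C C0 upper] := operator_norm_upper phi0P p01 gam0 pq' p1q.
have [c [N0 [c0 lower]]] := Op_lower phi0P p01 gam0 (Ordinal d_ge1) pq'.
exists c, C, N0.+1; split => //; split => // N hN rate B1pq.
have N1 : (0 < N)%N by exact: leq_trans hN.
have up := upper N N1; have lo := lower N (ltnW hN).
have Q0 : 1 / 2 <= 2 ^ (- (0 : int)) :> R by rewrite oppr0 expr0z; lra.
split; first by rewrite up andbT; apply: le_trans (lo 0 0 Q0) _; exact: Op_le_operator_norm.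
move=> k m hk; rewrite lo//; apply: le_trans up; exact: Op_le_operator_norm.
Qed.
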